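(* Let $\Bbbk$ be an algebraically closed field of characteristic $p\ge 0$, let $r,s,m,n\in\mathbb{N}$, let $V$ be a super vector space over $\Bbbk$ with $\dim V=(m|n)$, and let $W=V^\ast$ and $\delta=m-n\in\Bbbk$. Assume $p\notin\{2,3,\dots,\max(r,s)\}$, $m\ge r+s$ and $n\ge\max(r,s)$. Then $T^{r,s}=\bigoplus_{j=0}^{\min(r,s)}V^{\otimes(r-j)}\otimes W^{\otimes(s-j)}$ is a complete tilting module of the quasi-hereditary algebra $\mathcal{B}^{\mathbf c}_{r,s}(\delta)$. A Ringel dual of $\mathcal{B}^{\mathbf c}_{r,s}(\delta)$ is thus given by $\mathcal{S}^g_{r,s}(V):=\underline{\mathrm{End}}_{\mathcal{B}_{r,s}(\delta)}(V^{\otimes r}\otimes W^{\otimes s})$.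
   Context: Super spaces: $\mathbb{Z}_2$-graded vector spaces with braiding $\gamma(v\otimes w)=(-1)^{|v||w|}w\otimes v$; $\dim V=(m|n)$ means $\dim V_{\bar 0}=m$, $\dim V_{\bar 1}=n$. $\underline{\mathrm{End}}$ denotes all (not necessarily grading preserving) linear endomorphisms. Oriented Brauer category $\mathcal{OB}(\delta)$: objects are finite words in $\{\vee,\wedge\}$ (with tensor product concatenation of words); morphisms from a word $a$ (lower line) to a word $b$ (upper line) have as basis the perfect pairings of all letters in which a propagating strand (joining the lower to the upper line) joins equal letters, and an arc joining two letters on the same line (cap on the lower line, cup on the upper line) joins different letters. Composition is concatenation with closed loops replaced by $\delta$. The walled Brauer algebra is $\mathcal{B}_{r,s}(\delta)=\mathrm{End}(\vee^{r}\wedge^{s})$, and $\mathcal{B}_{r,s}^{\mathbf c}(\delta)=\bigoplus_{i,j}\mathrm{Hom}(\vee^{r-i}\wedge^{s-i},\vee^{r-j}\wedge^{s-j})$, with $0\le i,j\le\min(r,s)$. The subalgebra $\mathcal{R}_{r,s}$ is spanned by the diagrams without cups. Action: there is a $\Bbbk$-linear symmetric monoidal functor from $\mathcal{OB}(\delta)$ to super vector spaces with $\vee\mapsto V$, $\wedge\mapsto W$, and with the cap $\wedge\vee\to\varnothing$ sent to $W\otimes V\to\Bbbk$, $\alpha\otimes v\mapsto\alpha(v)$. It makes $V^{\otimes r}\otimes W^{\otimes s}$ a $\mathcal{B}_{r,s}(\delta)$-module and $T^{r,s}$ a $\mathcal{B}_{r,s}^{\mathbf c}(\delta)$-module (as ordinary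 modules over ordinary algebras). Quasi-hereditary structure: let $\Lambda_{r,s}=\{(\lambda,\mu)\mid\lambda\vdash r-j,\ \mu\vdash s-j,\ 0\le j\le\min(r,s)\}$. If $p\notin\{2,\dots,\max(r,s)\}$, then $\mathcal{B}^{\mathbf c}_{r,s}(\delta)$ is quasi-hereditary with simples labelled by $\Lambda_{r,s}$, order $(\lambda,\mu)<(\lambda',\mu')$ iff $|\lambda'|<|\lambda|$, and standard modules $\mathcal{B}^{\mathbf c}_{r,s}(\delta)\otimes_{\mathcal{R}_{r,s}}(S(\lambda)\boxtimes S(\mu))$, where the product of Specht modules is a $\Bbbk(S_{r-j}\times S_{s-j})$-module extended to $\mathcal{R}_{r,s}$ by letting diagrams with caps act by zero. Tilting: for a quasi-hereditary algebra $(A,\le)$ with simples labelled by $\Lambda$, a tilting module is a finite dimensional module having both a filtration with standard quotients and a filtration with costandard quotients. Indecomposable tilting modules up to isomorphism are labelled $T(\lambda)$, $\lambda\in\Lambda$. A tilting module $T$ is complete if every $T(\lambda)$ is a direct summand of it; for complete $T$, $\mathrm{End}_A(T)^{\mathrm{op}}$ is called a Ringel dual of $A$ (well defined up to Morita equivalence). *)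

(* Defs.v *)
From HB Require Import structures.
From mathcomp Require Import all_boot all_order all_algebra all_fingroup all_field.
From mathcomp Require Import ring.

Set Implicit Arguments.
Unset Strict Implicit.
Unset Printing Implicit Defensive.

Import GRing.Theory.

Definition zigzag (Q : finType) (u t : Q -> Q) : rel Q :=
  fun x y => (y == u x) || (y == t x).

Section TwoInvolutions.

Variables (Q : finType) (u t : Q -> Q) (col : Q -> bool).
Hypotheses (uK : involutive u) (tK : involutive t).

Lemma zigzagC : connect_sym (zigzag u t).
Proof.
apply: sym_connect_sym => x y; rewrite /zigzag.
by rewrite -(can2_eq uK uK) -(can2_eq tK tK) (eq_sym (u y)) (eq_sym (t y)) !(eq_sym x).
Qed.

Lemma zigzag_u x : connect (zigzag u t) x (u x).
Proof. by apply: connect1; rewrite /zigzag eqxx. Qed.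

Lemma zigzag_t x : connect (zigzag u t) x (t x).
Proof. by apply: connect1; rewrite /zigzag eqxx orbT. Qed.

Lemma zigzag_ind (P : Q -> Prop) x :
    P x -> (forall q, P q -> P (u q)) -> (forall q, P q -> P (t q)) ->
  forall y, connect (zigzag u t) x y -> P y.
Proof.
move=> Px Pu Pt y /connectP[p]; elim: p x Px => [|z p IHp] x Px /=; first by move=> _ ->.
by case/andP=> /orP[] /eqP->; apply: IHp; auto.
Qed.

Hypothesis u_neq : forall q, u q != q.
Hypothesis col_u : forall q, col (u q) = ~~ col q.
Hypothesis col_t : forall q, t q != q -> col (t q) = ~~ col q.

Let f q := t (u q).

Let f_inj : injective f.
Proof. by move=> x y /(inv_inj tK)/(inv_inj uK). Qed.

Let connect_f k q : connect (zigzag u t) q (iter k f q).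
Proof.
elim: k => //= k IHk; apply: connect_trans IHk _.
exact: connect_trans (zigzag_u _) (zigzag_t _).
Qed.

Let iter_t k q : iter k f (t (iter k f q)) = t q.
Proof. by elim: k => //= k IHk; rewrite -iterS iterSr /f tK uK -/f. Qed.

Let iter_inj k : injective (iter k f).
Proof. by elim: k => //= k IHk x y /f_inj/IHk. Qed.

(* If u has no fixed points, a component of the graph with edges q - u q and
   q - t q which contains a fixed point of t contains exactly two of them. *)
Lemma zigzag_ends x : t x = x ->
  exists y, [/\ t y = y, y != x, connect (zigzag u t) x y, col y = ~~ col x &
    forall z, t z = z -> connect (zigzag u t) x z -> (z == x) || (z == y)].
Proof.
move=> tx; set n := fingraph.order f x.
have fn : iter n f x = x by apply: iter_order; apply: f_inj.
have fj j : j < n -> iter j f x = x -> j = 0.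
  move=> ltjn fjx; rewrite -(findex_iter ltjn) fjx.
  by rewrite -[in LHS](erefl : iter 0 f x = x) findex_iter ?fingraph.order_gt0.
have fixP k : t (iter k f x) = iter k f x <-> iter k.*2 f x = x.
  rewrite -addnn iterD; split=> [tk|fk]; first by rewrite -tk iter_t.
  by apply: (@iter_inj k); rewrite iter_t tx.
have n_even : ~~ odd n.
  apply/negP=> n_odd; have := odd_double_half n; rewrite n_odd add1n => nE.
  have := fn; rewrite -nE -addnn -addSn addnC iterD iterS.
  rewrite -[RHS]tx -(iter_t n./2 x) => /iter_inj/(inv_inj tK)/eqP.
  by rewrite (negPf (u_neq _)).
have nE : n = (n./2).*2 by rewrite even_halfK.
have n_gt0 : 0 < n by apply: fingraph.order_gt0.
have m_gt0 : 0 < n./2 by rewrite -double_gt0 -nE.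
have ltmn : n./2 < n by rewrite {2}nE -addnn -addn1 leq_add2l.
have ty : t (iter n./2 f x) = iter n./2 f x by apply/fixP; rewrite -nE.
have colk k : k < n./2 -> col (iter k f x) = col x.
  elim: k => //= k IHk ltk; rewrite col_t.
    by rewrite col_u negbK IHk // ltnW.
  apply/eqP=> tuk; have tk : t (iter k.+1 f x) = iter k.+1 f x by rewrite /= /f tK.
  have := fj k.+1.*2; rewrite nE ltn_double ltk => /(_ isT).
  by case/fixP: tk => [->] // /(_ erefl); rewrite doubleS.
exists (iter n./2 f x); split=> //.
- by apply/eqP=> fx; have := fj _ ltmn fx => m0; rewrite m0 in m_gt0.
- have [m mE] : exists m, n./2 = m.+1 by exists n./2.-1; rewrite prednK.
  have uy : u (iter m f x) = iter n./2 f x.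
    by apply: (inv_inj tK); rewrite ty mE.
  by rewrite -uy col_u colk // mE.
- move=> z tz xz.
  have fz : fconnect f x z.
    apply: (zigzag_ind (P := fun z => fconnect f x z)) xz => [|q xq|q xq] //.
      rewrite same_fconnect1_r // /f uK fconnect_sym //.
      by rewrite -[x in fconnect _ _ x]tx -(iter_t (findex f x q) x) iter_findex // fconnect_iter.
    rewrite fconnect_sym //.
    by rewrite -[x in fconnect _ _ x]tx -(iter_t (findex f x q) x) iter_findex // fconnect_iter.
  have := findex_max fz; have := iter_findex fz; rewrite -/n.
  set k := findex f x z => kz ltkn.
  have fk : iter k.*2 f x = x by apply/fixP; rewrite kz.
  have [ltk|lek] := ltnP k.*2 n.
    have /eqP := fj _ ltk fk; rewrite double_eq0 => /eqP k0.
    by rewrite -kz k0 eqxx.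
  have fk' : iter (k.*2 - n) f x = x by rewrite -[x in iter _ _ x]fn -iterD subnK.
  have lt' : k.*2 - n < n.
    by rewrite ltn_subLR // addnn ltn_double.
  have /eqP := fj _ lt' fk'; rewrite subn_eq0 => lek'.
  have kE : k = n./2.
    by apply: double_inj; rewrite -nE; apply/eqP; rewrite eqn_leq lek' lek.
  by rewrite -kE kz eqxx orbT.
Qed.

End TwoInvolutions.


Definition word := seq bool.
Definition vee := true.
Definition wedge := false.

(* The left summand is the lower line a, the right summand the upper line b. *)
Definition pt (a b : word) : finType := ('I_(size a) + 'I_(size b))%type.

Definition letter a b (x : pt a b) : bool :=
  match x with inl i => nth wedge a i | inr j => nth wedge b j end.

Definition is_lower a b (x : pt a b) : bool :=
  if x is inl _ then true else false.

Definition is_diag a b (d : {ffun pt a b -> pt a b}) : bool :=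
  [forall x, [&& d (d x) == x, d x != x &
     if is_lower x == is_lower (d x) then letter x != letter (d x)
     else letter x == letter (d x)]].

Record diag (a b : word) := Diag {
  pairing :> {ffun pt a b -> pt a b};
  diagP : is_diag pairing }.

HB.instance Definition _ a b := [isSub for @pairing a b].
HB.instance Definition _ a b := [Finite of diag a b by <:].

Definition sgn a b (x : pt a b) : bool :=
  match x with inl i => nth wedge a i | inr j => ~~ nth wedge b j end.

Lemma is_diagE a b (d : {ffun pt a b -> pt a b}) :
  is_diag d = [forall x, [&& d (d x) == x, d x != x & sgn (d x) == ~~ sgn x]].
Proof.
apply: eq_forallb => x; congr [&& _, _ & _].
by case: x => x; case: (d _) => y /=; do 2!case: (nth _ _ _).
Qed.

Section DiagTheory.
Variables (a b : word) (d : diag a b).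

Lemma diagK : involutive d.
Proof. by move=> x; have /forallP/(_ x)/and3P[/eqP] := diagP d. Qed.

Lemma diag_neq x : d x != x.
Proof. by have /forallP/(_ x)/and3P[] := diagP d. Qed.

Lemma diag_sgn x : sgn (d x) = ~~ sgn x.
Proof. by have := diagP d; rewrite is_diagE => /forallP/(_ x)/and3P[_ _ /eqP]. Qed.

End DiagTheory.

Lemma diag_ext a b (d d' : diag a b) : d =1 d' -> d = d'.
Proof. by move=> dd'; apply/val_inj/ffunP. Qed.

Lemma mk_diag_subproof a b (f : pt a b -> pt a b) :
    involutive f -> (forall x, sgn (f x) = ~~ sgn x) -> is_diag (finfun f).
Proof.
move=> fK fs; rewrite is_diagE; apply/forallP=> x; rewrite !ffunE fK eqxx fs eqxx andbT /=.
by apply/eqP=> fx; have := fs x; rewrite fx; case: (sgn x).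
Qed.

Definition mk_diag a b f fK fs : diag a b := Diag (@mk_diag_subproof a b f fK fs).

Definition swap_line a (x : pt a a) : pt a a :=
  match x with inl i => inr i | inr i => inl i end.

Lemma swap_lineK a : involutive (@swap_line a). Proof. by case. Qed.

Lemma swap_line_sgn a (x : pt a a) : sgn (swap_line x) = ~~ sgn x.
Proof. by case: x => i //=; rewrite negbK. Qed.

Definition diag1 a : diag a a := mk_diag (@swap_lineK a) (@swap_line_sgn a).

(* d : a -> b is drawn below e : b -> c, and the upper line of d is glued to
   the lower line of e.  A point of the outer lines a, c is matched with the
   other outer point on its strand; strands without outer points are loops. *)
Section Comp.

Variables (a b c : word).
Implicit Types (d : diag a b) (e : diag b c).

Definition strand d e (q : pt a b + pt b c) : pt a b + pt b c :=
  match q with inl x => inl (d x) | inr y => inr (e y) end.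

Definition glue (q : pt a b + pt b c) : pt a b + pt b c :=
  match q with
  | inl (inr j) => inr (inl j)
  | inr (inl j) => inl (inr j)
  | _ => q
  end.

Definition outer (x : pt a c) : pt a b + pt b c :=
  match x with inl i => inl (inl i) | inr j => inr (inr j) end.

Definition same_strand d e : rel (pt a b + pt b c) :=
  connect [rel q q' | (q' == strand d e q) || (q' == glue q)].

Definition comp_fun d e (x : pt a c) : pt a c :=
  odflt x [pick y | (y != x) && same_strand d e (outer x) (outer y)].

Definition loops d e : nat :=
  n_comp [rel q q' | (q' == strand d e q) || (q' == glue q)]
         [pred q | [forall x, ~~ same_strand d e q (outer x)]].

Lemma same_strandE d e : same_strand d e = connect (zigzag (strand d e) glue).
Proof. by []. Qed.

Lemma strandK d e : involutive (strand d e).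
Proof. by case=> x /=; rewrite diagK. Qed.

Lemma glueK : involutive glue. Proof. by case=> [] []. Qed.

Lemma strand_neq d e q : strand d e q != q.
Proof.
case: q => x /=; [have := diag_neq d x | have := diag_neq e x];
  by apply: contra => /eqP[->].
Qed.

Definition qsgn (q : pt a b + pt b c) : bool :=
  match q with inl x => sgn x | inr y => sgn y end.

Lemma qsgn_strand d e q : qsgn (strand d e q) = ~~ qsgn q.
Proof. by case: q => x /=; rewrite diag_sgn. Qed.

Lemma qsgn_glue q : glue q != q -> qsgn (glue q) = ~~ qsgn q.
Proof. by case: q => [] [] j //=; rewrite ?eqxx ?negbK. Qed.

Lemma glue_outer x : glue (outer x) = outer x. Proof. by case: x. Qed.

Lemma glue_fix q : glue q = q -> exists x, q = outer x.
Proof. by case: q => [] [] j //= _; [exists (inl j) | exists (inr j)]. Qed.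

Lemma outer_inj : injective outer.
Proof. by case=> i [] j //= [->]. Qed.

Lemma qsgn_outer x : qsgn (outer x) = sgn x.
Proof. by case: x. Qed.

Lemma comp_funP d e x :
  [/\ comp_fun d e x != x, same_strand d e (outer x) (outer (comp_fun d e x)),
      sgn (comp_fun d e x) = ~~ sgn x &
      forall y, same_strand d e (outer x) (outer y) -> y = x \/ y = comp_fun d e x].
Proof.
have [q [/glue_fix[y ->{q}] neq_yx xy ysgn only]] := zigzag_ends (strandK d e) glueK
  (strand_neq d e) (qsgn_strand d e) qsgn_glue (glue_outer x).
have cE : comp_fun d e x = y.
  rewrite /comp_fun; case: pickP => [z /= /andP[neq_zx xz]|/(_ y)/=].
    have /orP[/eqP/outer_inj zx|/eqP/outer_inj->//] := only _ (glue_outer z) xz.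
    by rewrite zx eqxx in neq_zx.
  by rewrite same_strandE xy andbT => /negbFE/eqP yx; rewrite yx eqxx in neq_yx.
rewrite cE; split=> //; first by apply: contra neq_yx => /eqP->.
  by rewrite !qsgn_outer in ysgn.
move=> z /(only _ (glue_outer z)) /orP[] /eqP/outer_inj; by [left | right].
Qed.

Lemma same_strandC d e q q' : same_strand d e q q' = same_strand d e q' q.
Proof. exact: (zigzagC (strandK d e) glueK). Qed.

Lemma comp_funK d e : involutive (comp_fun d e).
Proof.
move=> x; have [neq xy _ _] := comp_funP d e x.
have [_ _ _ only] := comp_funP d e (comp_fun d e x).
rewrite same_strandC in xy; case: (only _ xy) => [xE|<- //].
by rewrite -xE eqxx in neq.
Qed.

Lemma comp_fun_sgn d e x : sgn (comp_fun d e x) = ~~ sgn x.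
Proof. by have [] := comp_funP d e x. Qed.

Definition comp d e : diag a c := mk_diag (comp_funK d e) (comp_fun_sgn d e).

Lemma compE d e x : comp d e x = comp_fun d e x.
Proof. by rewrite ffunE. Qed.

Lemma comp_eq d e x y :
  y != x -> same_strand d e (outer x) (outer y) -> comp d e x = y.
Proof.
move=> neq xy; have [_ _ _ only] := comp_funP d e x.
by rewrite compE; case: (only _ xy) => // yx; rewrite yx eqxx in neq.
Qed.

Lemma comp_same d e x : same_strand d e (outer x) (outer (comp d e x)).
Proof. by rewrite compE; have [_ ss _ only] := comp_funP d e x; auto. Qed.

Lemma comp_only d e x y :
  same_strand d e (outer x) (outer y) -> y = x \/ y = comp d e x.
Proof. by rewrite compE; have [_ ss _ only] := comp_funP d e x; auto. Qed.

Lemma loops0 d e :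
  (forall q, exists x, same_strand d e q (outer x)) -> loops d e = 0.
Proof.
move=> Q; apply: eq_card0 => q; apply/negP => /andP[_] /=; rewrite inE.
by case: (Q q) => x qx /forallP/(_ x); rewrite qx.
Qed.

Lemma same_strand_s d e q : same_strand d e q (strand d e q).
Proof. exact: zigzag_u. Qed.

Lemma same_strand_g d e q : same_strand d e q (glue q).
Proof. exact: zigzag_t. Qed.

End Comp.

Lemma same_trans a b c (d : diag a b) (e : diag b c) q2 q1 q3 :
  same_strand d e q1 q2 -> same_strand d e q2 q3 -> same_strand d e q1 q3.
Proof. exact: connect_trans. Qed.

Lemma comp1d a b (d : diag a b) : comp (diag1 a) d = d.
Proof.
apply: diag_ext => x; apply: comp_eq; first exact: diag_neq.
have to_o (y : pt a b) : same_strand (diag1 a) d (inr y) (outer a y).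
  case: y => i; last exact: connect0.
  apply: same_trans (same_strand_g _ _ _) _ => /=.
  by apply: same_trans (same_strand_s _ _ _) _; rewrite /= ffunE; apply: connect0.
have := to_o (d x); apply: same_trans.
have := to_o x; rewrite same_strandC => /same_trans; apply.
exact: (same_strand_s _ _ (inr x)).
Qed.

Lemma loops1d a b (d : diag a b) : loops (diag1 a) d = 0.
Proof.
apply: loops0 => -[] [] i; first by exists (inl i); apply: connect0.
- exists (inl i); apply: same_trans (same_strand_s _ _ _) _.
  by rewrite /= ffunE; apply: connect0.
- exists (inl i); apply: same_trans (same_strand_g _ _ _) _ => /=.
  by apply: same_trans (same_strand_s _ _ _) _; rewrite /= ffunE; apply: connect0.
by exists (inr i); apply: connect0.
Qed.

Lemma compd1 a b (d : diag a b) : comp d (diag1 b) = d.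
Proof.
apply: diag_ext => x; apply: comp_eq; first exact: diag_neq.
have to_o (y : pt a b) : same_strand d (diag1 b) (inl y) (outer b y).
  case: y => i; first exact: connect0.
  apply: same_trans (same_strand_g _ _ _) _ => /=.
  by apply: same_trans (same_strand_s _ _ _) _; rewrite /= ffunE; apply: connect0.
have := to_o (d x); apply: same_trans.
have := to_o x; rewrite same_strandC => /same_trans; apply.
exact: (same_strand_s _ _ (inl x)).
Qed.

Lemma loopsd1 a b (d : diag a b) : loops d (diag1 b) = 0.
Proof.
apply: loops0 => -[] [] i; first by exists (inl i); apply: connect0.
- exists (inr i); apply: same_trans (same_strand_g _ _ _) _ => /=.
  by apply: same_trans (same_strand_s _ _ _) _; rewrite /= ffunE; apply: connect0.
- exists (inr i); apply: same_trans (same_strand_s _ _ _) _.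
  by rewrite /= ffunE; apply: connect0.
by exists (inr i); apply: connect0.
Qed.

(* S is the part of the picture Q glued by t1, P what remains of Q after this
   gluing; gluing P further gives the same strands as gluing Q by t1 and t2. *)
Section Reduce.

Variables (Q P S Y Z : finType).
Variables (u t1 t2 : Q -> Q) (uP tP : P -> P) (uS tS : S -> S) (mY : Y -> Y).
Variables (iota : P -> Q) (h : S -> Q) (outS : Y -> S) (kY : Y -> P).
Variables (isol : pred P) (oP : Z -> P).

Let zQ := relU (zigzag u t1) (zigzag u t2).
Let zP := zigzag uP tP.
Let zS := zigzag uS tS.

Hypotheses (uK : involutive u) (t1K : involutive t1) (t2K : involutive t2).
Hypotheses (uPK : involutive uP) (tPK : involutive tP).
Hypotheses (uSK : involutive uS) (tSK : involutive tS).
Hypotheses (iota_inj : injective iota) (h_inj : injective h).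
Hypotheses (h_u : forall s, h (uS s) = u (h s)) (h_t : forall s, h (tS s) = t1 (h s)).
Hypothesis iota_t : forall p, iota (tP p) = t2 (iota p).
Hypothesis P_cases : forall p, isol p \/ exists y, p = kY y.
Hypothesis Q_cases : forall q, (exists s, q = h s) \/ (exists2 p, q = iota p & isol p).
Hypothesis isol_u : forall p, isol p -> isol (uP p) && (u (iota p) == iota (uP p)).
Hypothesis isol_t : forall p, isol p -> t1 (iota p) = iota p.
Hypothesis isol_h : forall p s, isol p -> iota p <> h s.
Hypothesis iota_k : forall y, iota (kY y) = h (outS y).
Hypothesis t2_h : forall s, (exists y, s = outS y) \/ t2 (h s) = h s.
Hypothesis uP_k : forall y, uP (kY y) = kY (mY y).
Hypothesis outS_m : forall y, connect zS (outS y) (outS (mY y)).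
Hypothesis outS_only : forall y y',
  connect zS (outS y) (outS y') -> y' = y \/ y' = mY y.

Let zQC : connect_sym zQ.
Proof. by apply: relU_sym; apply: zigzagC. Qed.

Let zQ_u q : connect zQ q (u q).
Proof. by apply: connect1; rewrite /zQ /= /zigzag eqxx. Qed.
Let zQ_t1 q : connect zQ q (t1 q).
Proof. by apply: connect1; rewrite /zQ /= /zigzag eqxx orbT. Qed.
Let zQ_t2 q : connect zQ q (t2 q).
Proof. by apply: connect1; rewrite /zQ /= /zigzag eqxx !orbT. Qed.

Let zQ_ind (R : Q -> Prop) x :
    R x -> (forall q, R q -> [/\ R (u q), R (t1 q) & R (t2 q)]) ->
  forall y, connect zQ x y -> R y.
Proof.
move=> Rx Rs y /connectP[p]; elim: p x Rx => [|z p IHp] x Rx /=; first by move=> _ ->.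
have [Ru R1 R2] := Rs _ Rx.
by case/andP=> /orP[] /orP[] /eqP->; apply: IHp.
Qed.

Let h_connect s s' : connect zS s s' -> connect zQ (h s) (h s').
Proof.
apply: (zigzag_ind (P := fun s' => connect zQ (h s) (h s'))) => [|q|q].
- exact: connect0.
- by rewrite h_u => /connect_trans-> //; apply: zQ_u.
- by rewrite h_t => /connect_trans-> //; apply: zQ_t1.
Qed.

Let iota_connect p p' : connect zP p p' -> connect zQ (iota p) (iota p').
Proof.
apply: (zigzag_ind (P := fun p' => connect zQ (iota p) (iota p'))) => [|q|q].
- exact: connect0.
- move/connect_trans; apply; case: (P_cases q) => [/isol_u/andP[_ /eqP<-] //|[y ->]].
  by rewrite uP_k !iota_k; apply: h_connect.
- by rewrite iota_t => /connect_trans-> //; apply: zQ_t2.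
Qed.

Lemma reduce_connect p p' : connect zP p p' = connect zQ (iota p) (iota p').
Proof.
apply/idP/idP; first exact: iota_connect.
have sP : connect_sym zP by apply: zigzagC.
have sS : connect_sym zS by apply: zigzagC.
pose R q := (exists p1, [/\ q = iota p1, isol p1 & connect zP p p1]) \/
  (exists y s, [/\ q = h s, connect zS (outS y) s & connect zP p (kY y)]).
have RE p1 : connect zP p p1 -> R (iota p1).
  move=> pp1; case: (P_cases p1) => [p1i|[y p1E]]; first by left; exists p1.
  right; exists y, (outS y); rewrite p1E iota_k -p1E; split=> //.
have Rclosed q : R q -> [/\ R (u q), R (t1 q) & R (t2 q)].
  case=> [[p1 [-> p1i pp1]]|[y [s [-> ys py]]]]; split.
  - have /andP[_ /eqP->] := isol_u p1i.
    by apply: RE; apply: connect_trans pp1 (zigzag_u _ _ _).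
  - by rewrite isol_t //; apply: RE.
  - by rewrite -iota_t; apply: RE; apply: connect_trans pp1 (zigzag_t _ _ _).
  - right; exists y, (uS s); rewrite h_u; split=> //.
    exact: connect_trans ys (zigzag_u _ _ _).
  - right; exists y, (tS s); rewrite h_t; split=> //.
    exact: connect_trans ys (zigzag_t _ _ _).
  - case: (t2_h s) => [[y' sE]|->]; last by right; exists y, s.
    rewrite sE -iota_k -iota_t; apply: RE.
    apply: (connect_trans (y := kY y')); last exact: zigzag_t.
    rewrite sE in ys; case: (outS_only ys) => -> //.
    by apply: connect_trans py _; rewrite -uP_k; apply: zigzag_u.
move=> pp'; have : R (iota p') by apply: (zQ_ind _ Rclosed pp'); apply: RE.
case=> [[p1 [/iota_inj-> _]] //|[y [s [p'E ys py]]]].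
case: (P_cases p') => [p'i|[y' p'y]]; first by case: (isol_h p'i p'E).
move: p'E; rewrite p'y iota_k => /h_inj sE; rewrite -sE in ys.
case: (outS_only ys) => -> //.
by apply: connect_trans py _; rewrite -uP_k; apply: zigzag_u.
Qed.

Let far q := [forall p, ~~ connect zQ q (iota p)].
Let farS s := [forall y, ~~ connect zS s (outS y)].

Let farS_closed s q : farS s -> connect zQ (h s) q ->
  exists2 s', q = h s' & connect zS s s'.
Proof.
move=> fs; apply: (zQ_ind (R := fun q => exists2 s', q = h s' & connect zS s s')).
  by exists s.
move=> _ [s' -> ss']; split.
- by exists (uS s') => //; apply: connect_trans ss' (zigzag_u _ _ _).
- by exists (tS s') => //; apply: connect_trans ss' (zigzag_t _ _ _).
- exists s' => //; case: (t2_h s') => [[y s'E]|//].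
  by have /forallP/(_ y) := fs; rewrite -s'E ss'.
Qed.

Let far_h s : far (h s) = farS s.
Proof.
apply/idP/idP=> [fs|fs]; apply/forallP.
  move=> y; apply/negP=> sy; have /forallP/(_ (kY y))/negP[] := fs.
  by rewrite iota_k; apply: h_connect.
move=> p; apply/negP=> /(farS_closed fs)[s' pE ss'].
case: (P_cases p) => [p'i|[y' p'y]]; first by case: (isol_h p'i pE).
move: pE; rewrite p'y iota_k => /h_inj sE; have /forallP/(_ y') := fs.
by rewrite sE ss'.
Qed.

Lemma reduce_n_comp :
  n_comp zQ [pred q | [forall z, ~~ connect zQ q (iota (oP z))]] =
  n_comp zS [pred s | [forall y, ~~ connect zS s (outS y)]] +
  n_comp zP [pred p | [forall z, ~~ connect zP p (oP z)]].
Proof.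
have sP : connect_sym zP by apply: zigzagC.
have sS : connect_sym zS by apply: zigzagC.
have eq_far q q' : connect zQ q q' -> far q = far q'.
  by move=> qq'; apply: eq_forallb => p; rewrite (same_connect zQC qq').
set NO := [pred q | _].
have eq_NO q q' : connect zQ q q' -> (q \in NO) = (q' \in NO).
  move=> qq'; rewrite !inE; apply: eq_forallb => z.
  by rewrite (same_connect zQC qq').
have far_NO q : far q -> q \in NO.
  by move=> /forallP fq; rewrite inE; apply/forallP=> z; apply: fq.
have -> : n_comp zQ NO = n_comp zQ [pred q | far q] + n_comp zQ [pred q | (q \in NO) && ~~ far q].
  rewrite /n_comp_mem -[LHS](cardID [pred q | far q]); congr (_ + _);
    apply: eq_card => q; rewrite !inE; case fq: (far q); rewrite ?andbF ?andbT //=.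
  by have := far_NO q fq; rewrite inE => ->; rewrite andbT.
congr (_ + _).
- rewrite (adjunction_n_comp h zQC sS) => [|q q' /connect1/eq_far|]; rewrite ?inE //.
    by apply: eq_n_comp_r => s; rewrite !inE far_h.
  split=> [q|s s']; rewrite ?inE.
    move=> fq; case: (pickP (fun s => q == h s)) => [s /eqP->|noh].
      by exists s; apply: connect0.
    exfalso; case: (Q_cases q) => [[s qh]|[p qp _]]; first by move: (noh s); rewrite /= qh eqxx.
    by have /forallP/(_ p) := fq; rewrite qp connect0.
  rewrite far_h => fs; apply/idP/idP; first exact: h_connect.
  by case/(farS_closed fs)=> s1 /h_inj->.
- rewrite (adjunction_n_comp iota zQC sP) => [|q q' qq'|]; last 2 first.
  + by have := eq_NO _ _ (connect1 qq'); rewrite !inE (eq_far _ _ (connect1 qq')) => ->.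
  + split=> [q|p p']; rewrite ?inE; last by move=> _; apply: reduce_connect.
    case/andP=> _ fq; case: (pickP (fun p => connect zQ q (iota p))) => [p qp|noq].
      by exists p.
    by case/negP: fq; apply/forallP=> p; rewrite noq.
  apply: eq_n_comp_r => p; rewrite !inE.
  have -> : far (iota p) = false.
    by apply/negbTE/forallPn; exists p; rewrite negbK connect0.
  by rewrite andbT; apply: eq_forallb => z; rewrite reduce_connect.
Qed.

End Reduce.

Section Assoc.

Variables (a b c g : word) (d : diag a b) (e : diag b c) (f : diag c g).

Let Q : finType := (pt a b + (pt b c + pt c g))%type.

Let u (q : Q) : Q :=
  match q with
  | inl x => inl (d x) | inr (inl y) => inr (inl (e y)) | inr (inr z) => inr (inr (f z))
  end.

Let tb (q : Q) : Q :=
  match q with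
  | inl (inr j) => inr (inl (inl j)) | inr (inl (inl j)) => inl (inr j) | _ => q
  end.

Let tc (q : Q) : Q :=
  match q with
  | inr (inl (inr j)) => inr (inr (inl j)) | inr (inr (inl j)) => inr (inl (inr j)) | _ => q
  end.

Let uK : involutive u. Proof. by case=> [x|[x|x]] /=; rewrite diagK. Qed.
Let tbK : involutive tb. Proof. by case=> [[]|[[]|[]]]. Qed.
Let tcK : involutive tc. Proof. by case=> [[]|[[]|[]]]. Qed.

Let iotaL (p : pt a b + pt b g) : Q :=
  match p with inl x => inl x | inr y => inr (outer c y) end.
Let iotaR (p : pt a c + pt c g) : Q :=
  match p with
  | inl (inl i) => inl (inl i) | inl (inr j) => inr (inl (inr j)) | inr y => inr (inr y)
  end.
Let hR (s : pt a b + pt b c) : Q :=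
  match s with inl x => inl x | inr y => inr (inl y) end.
Let isL (p : pt a b + pt b g) := if p is inl _ then true else false.
Let isR (p : pt a c + pt c g) := if p is inr _ then true else false.

Let zL := relU (zigzag u tc) (zigzag u tb).
Let zR := relU (zigzag u tb) (zigzag u tc).

Let eqLR : connect zL =2 connect zR.
Proof. by apply: eq_connect => x y; rewrite /zL /zR /= orbC. Qed.

Let L1 := @reduce_connect Q _ _ (pt b g) u tc tb
  (strand d (comp e f)) (@glue _ _ _) (strand e f) (@glue _ _ _) (comp e f)
  iotaL inr (@outer b c g) inr isL.
Let L2 := @reduce_n_comp Q _ _ (pt b g) (pt a g) u tc tb
  (strand d (comp e f)) (@glue _ _ _) (strand e f) (@glue _ _ _) (comp e f)
  iotaL inr (@outer b c g) inr isL (@outer a b g).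
Let R1 := @reduce_connect Q _ _ (pt a c) u tb tc
  (strand (comp d e) f) (@glue _ _ _) (strand d e) (@glue _ _ _) (comp d e)
  iotaR hR (@outer a b c) inl isR.
Let R2 := @reduce_n_comp Q _ _ (pt a c) (pt a g) u tb tc
  (strand (comp d e) f) (@glue _ _ _) (strand d e) (@glue _ _ _) (comp d e)
  iotaR hR (@outer a b c) inl isR (@outer a c g).

Let factL :
  (forall p p', same_strand d (comp e f) p p' = connect zL (iotaL p) (iotaL p')) /\
  n_comp zL [pred q | [forall z : pt a g, ~~ connect zL q (iotaL (outer b z))]] =
    loops e f + loops d (comp e f).
Proof.
split; [move=> p p'; apply: L1 | apply: L2].
all: try exact: strandK. all: try exact: glueK. all: rewrite //.
all: try by case=> [x|[x|x]] [y|[y|y]] //= [->].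
all: try by move=> x y [->].
all: try by case=> [x|y]; [left | right; exists y].
all: try by case=> [x|s]; [right; exists (inl x) | left; exists s].
all: try by case=> [[x|x]|[x|x]].
all: try by case=> [x|x] //=.
all: try by case=> [[x|x]|[x|x]] /=; rewrite ?eqxx //.
all: try by case=> [[x|x]|[x|x]] /=; [left; exists (inl x) | right | right | left; exists (inr x)].
all: try by move=> y; apply: comp_same.
all: try by move=> y y'; apply: comp_only.
Qed.

Let factR :
  (forall p p', same_strand (comp d e) f p p' = connect zR (iotaR p) (iotaR p')) /\
  n_comp zR [pred q | [forall z : pt a g, ~~ connect zR q (iotaR (outer c z))]] =
    loops d e + loops (comp d e) f.
Proof.
split; [move=> p p'; apply: R1 | apply: R2].
all: try exact: strandK. all: try exact: glueK. all: rewrite //.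
all: try by case=> [[x|x]|[x|x]] [[y|y]|[y|y]] //= [->].
all: try by case=> [x|x] [y|y] //= [->].
all: try by case=> [x|y]; [right; exists x | left].
all: try by case=> [x|[x|x]]; [left; exists (inl x) | left; exists (inr x) | right; exists (inr x)].
all: try by case=> [[x|x]|[x|x]].
all: try by case=> [x|x] //=.
all: try by case=> [[x|x]|[x|x]] /=; rewrite ?eqxx //.
all: try by case=> [[x|x]|[x|x]] /=; [left; exists (inl x) | right | right | left; exists (inr x)].
all: try by move=> y; apply: comp_same.
all: try by move=> y y'; apply: comp_only.
all: try by case=> [x|x] [y|[y|y]] //= [->].
Qed.

Let iotaLR (x : pt a g) : iotaL (outer b x) = iotaR (outer c x).
Proof. by case: x. Qed.

Lemma compA : comp (comp d e) f = comp d (comp e f).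
Proof.
apply: diag_ext => x; apply: comp_eq; first exact: diag_neq.
rewrite (proj1 factR) -!iotaLR -eqLR -(proj1 factL).
exact: comp_same.
Qed.

Lemma loopsA : loops d e + loops (comp d e) f = loops e f + loops d (comp e f).
Proof.
rewrite -(proj2 factL) -(proj2 factR) (eq_n_comp eqLR).
apply: eq_n_comp_r => q; rewrite !inE; apply: eq_forallb => z.
by rewrite iotaLR eqLR.
Qed.

End Assoc.


Section Juxtapose.

Variables (a b a' b' : word).

Definition pt_split (x : pt (a ++ a') (b ++ b')) : pt a b + pt a' b' :=
  match x with
  | inl i => match split (cast_ord (size_cat a a') i) with
             | inl i1 => inl (inl i1) | inr i2 => inr (inl i2) end
  | inr j => match split (cast_ord (size_cat b b') j) with
             | inl j1 => inl (inr j1) | inr j2 => inr (inr j2) end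
  end.

Definition pt_join (x : pt a b + pt a' b') : pt (a ++ a') (b ++ b') :=
  match x with
  | inl (inl i) => inl (cast_ord (esym (size_cat a a')) (lshift _ i))
  | inl (inr j) => inr (cast_ord (esym (size_cat b b')) (lshift _ j))
  | inr (inl i) => inl (cast_ord (esym (size_cat a a')) (rshift _ i))
  | inr (inr j) => inr (cast_ord (esym (size_cat b b')) (rshift _ j))
  end.

Lemma pt_joinK : cancel pt_join pt_split.
Proof.
by case=> [] [] i /=; rewrite cast_ordKV; [rewrite (unsplitK (inl i)) |
  rewrite (unsplitK (inl i)) | rewrite (unsplitK (inr i)) | rewrite (unsplitK (inr i))].
Qed.

Lemma pt_splitK : cancel pt_split pt_join.
Proof.
case=> i /=; case: splitP => j jE /=;
  by [congr inl; apply: val_inj | congr inr; apply: val_inj].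
Qed.

Lemma sgn_join x :
  sgn (pt_join x) = match x with inl y => sgn y | inr y => sgn y end.
Proof.
by case: x => [] [] i /=; rewrite nth_cat ?ltn_ord // ltnNge leq_addr /= addKn.
Qed.

Variables (d : diag a b) (d' : diag a' b').

Definition juxt_fun (x : pt (a ++ a') (b ++ b')) : pt (a ++ a') (b ++ b') :=
  pt_join match pt_split x with inl y => inl (d y) | inr y => inr (d' y) end.

Lemma juxt_funK : involutive juxt_fun.
Proof.
move=> x; rewrite /juxt_fun pt_joinK -[RHS]pt_splitK.
by case: (pt_split x) => y; rewrite diagK.
Qed.

Lemma juxt_fun_sgn x : sgn (juxt_fun x) = ~~ sgn x.
Proof.
rewrite /juxt_fun -{2}(pt_splitK x) !sgn_join.
by case: (pt_split x) => y; rewrite diag_sgn.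
Qed.

Definition juxt : diag (a ++ a') (b ++ b') := mk_diag juxt_funK juxt_fun_sgn.

End Juxtapose.

Definition cross_fun c c' (x : pt [:: c; c'] [:: c'; c]) : pt [:: c; c'] [:: c'; c] :=
  match x with inl i => inr (rev_ord i) | inr i => inl (rev_ord i) end.

Lemma cross_funK c c' : involutive (@cross_fun c c').
Proof. by case=> i /=; rewrite rev_ordK. Qed.

Lemma cross_fun_sgn c c' (x : pt [:: c; c'] [:: c'; c]) : sgn (cross_fun x) = ~~ sgn x.
Proof. by case: x => [] [[|[|[]]] //= _]; rewrite negbK. Qed.

Definition cross c c' : diag [:: c; c'] [:: c'; c] :=
  mk_diag (@cross_funK c c') (@cross_fun_sgn c c').

Definition cap_fun (x : pt [:: wedge; vee] [::]) : pt [:: wedge; vee] [::] :=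
  match x with inl i => inl (rev_ord i) | inr i => inr i end.

Lemma cap_funK : involutive cap_fun.
Proof. by case=> i //=; rewrite rev_ordK. Qed.

Lemma cap_fun_sgn x : sgn (cap_fun x) = ~~ sgn x.
Proof. by case: x => [] [[|[|[]]] //= _]. Qed.

Definition cap : diag [:: wedge; vee] [::] := mk_diag cap_funK cap_fun_sgn.

Section PermDiagram.

Variables (c : bool) (n : nat) (sigma : 'S_n).
Let w := nseq n c.
Let sz : size w = n := size_nseq n c.

Definition perm_fun (x : pt w w) : pt w w :=
  match x with
  | inl i => inr (cast_ord (esym sz) (sigma (cast_ord sz i)))
  | inr j => inl (cast_ord (esym sz) ((sigma^-1)%g (cast_ord sz j)))
  end.

Lemma perm_funK : involutive perm_fun.
Proof. by case=> i /=; rewrite cast_ordKV ?permK ?permKV cast_ordK. Qed.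

Lemma perm_fun_sgn x : sgn (perm_fun x) = ~~ sgn x.
Proof.
have nthc (i : 'I_(size w)) : nth wedge w i = c.
  by rewrite nth_nseq; have := ltn_ord i; rewrite {2}size_nseq => ->.
by case: x => i; rewrite /sgn /perm_fun !nthc ?negbK.
Qed.

Definition perm_diag : diag w w := mk_diag perm_funK perm_fun_sgn.

End PermDiagram.

Definition has_cup a b (d : diag a b) : bool :=
  [exists x, ~~ is_lower x && ~~ is_lower (d x)].

Local Open Scope ring_scope.

(* Source and target of a diagram are recorded by the indices i, j. *)
Definition OBbasis n (w : 'I_n.+1 -> word) : finType :=
  {ij : 'I_n.+1 * 'I_n.+1 & diag (w ij.1) (w ij.2)}.

Definition obb n (w : 'I_n.+1 -> word) i j (d : diag (w i) (w j)) : OBbasis w :=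
  existT (fun ij : 'I_n.+1 * 'I_n.+1 => diag (w ij.1) (w ij.2)) (i, j) d.

(* The algebra (+)_(i, j) Hom(w i, w j), by coefficients on diagrams; the
   parameter delta only enters through the product. *)
Definition OBalg (k : fieldType) (delta : k) n (w : 'I_n.+1 -> word) : Type :=
  {ffun OBbasis w -> k^o}.

Section OBAlgebra.

Variables (k : fieldType) (delta : k) (n : nat) (w : 'I_n.+1 -> word).
Local Notation A := (OBalg delta w).

HB.instance Definition _ := Vector.on A.

Definition OBone : A := [ffun z => (z == obb (diag1 (w (tag z).1)))%:R].

(* y * x is "y after x". *)
Definition OBmul (y x : A) : A :=
  [ffun z => \sum_l \sum_(d : diag (w (tag z).1) (w l)) \sum_(e : diag (w l) (w (tag z).2))
     y (obb e) * x (obb d) * delta ^+ loops d e * (comp d e == tagged z)%:R].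

Definition OBcoef (x : A) i j (d : diag (w i) (w j)) : k := x (obb d).

Lemma obb_eq i j (d d' : diag (w i) (w j)) : (obb d == obb d') = (d == d').
Proof. exact: eq_Tagged. Qed.

Lemma OBmulE (y x : A) i j (c : diag (w i) (w j)) :
  OBmul y x (obb c) = \sum_l \sum_(d : diag (w i) (w l)) \sum_(e : diag (w l) (w j))
     y (obb e) * x (obb d) * delta ^+ loops d e * (comp d e == c)%:R.
Proof. by rewrite ffunE. Qed.

Lemma OBext (x y : A) :
  (forall i j (c : diag (w i) (w j)), x (obb c) = y (obb c)) -> x = y.
Proof. by move=> xy; apply/ffunP=> -[[i j] c]; apply: xy. Qed.

Lemma OBoneE i j (c : diag (w i) (w j)) :
  OBone (obb c) = (obb c == obb (diag1 (w i)))%:R.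
Proof. by rewrite ffunE. Qed.

Lemma OBone_neq i j (c : diag (w i) (w j)) : i != j -> OBone (obb c) = 0.
Proof.
move=> neq; rewrite OBoneE; case: eqP => // /(congr1 tag) [ij].
by rewrite ij eqxx in neq.
Qed.

Lemma OBone_diag i (c : diag (w i) (w i)) : OBone (obb c) = (c == diag1 (w i))%:R.
Proof. by rewrite OBoneE obb_eq. Qed.

Lemma sum_pick (T : finType) (c : T) (F : T -> k) :
  \sum_d F d * (c == d)%:R = F c.
Proof.
rewrite (bigD1 c) //= eqxx mulr1 big1 ?addr0 // => d /negPf dc.
by rewrite eq_sym dc mulr0.
Qed.

Lemma OBmul1l : left_id OBone OBmul.
Proof.
move=> x; apply: OBext => i j c; rewrite OBmulE (bigD1 j) //= [X in _ + X]big1 ?addr0.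
  rewrite -[RHS](sum_pick c (fun d => x (obb d))); apply: eq_bigr => d _.
  rewrite (bigD1 (diag1 (w j))) //= big1 ?addr0 => [|e /negPf ne].
    by rewrite OBone_diag eqxx mul1r loopsd1 mulr1 compd1 eq_sym.
  by rewrite OBone_diag ne !mul0r.
move=> l neq; rewrite big1 // => d _; rewrite big1 // => e _.
by rewrite OBone_neq ?mul0r.
Qed.

Lemma OBmul1r : right_id OBone OBmul.
Proof.
move=> x; apply: OBext => i j c; rewrite OBmulE (bigD1 i) //= [X in _ + X]big1 ?addr0.
  rewrite exchange_big /= -[RHS](sum_pick c (fun d => x (obb d))); apply: eq_bigr => d _.
  rewrite (bigD1 (diag1 (w i))) //= big1 ?addr0 => [|e /negPf ne].
    by rewrite OBone_diag eqxx mulr1 loops1d mulr1 comp1d eq_sym.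
  by rewrite OBone_diag ne mulr0 !mul0r.
move=> l neq; rewrite big1 // => d _; rewrite big1 // => e _.
by rewrite OBone_neq ?mulr0 ?mul0r // eq_sym.
Qed.

Lemma OBmulDl : left_distributive OBmul +%R.
Proof.
move=> x y z; apply/ffunP=> t; rewrite !ffunE -big_split; apply: eq_bigr => l _.
rewrite -big_split; apply: eq_bigr => d _; rewrite -big_split; apply: eq_bigr => e _.
by rewrite ffunE !mulrDl.
Qed.

Lemma OBmulDr : right_distributive OBmul +%R.
Proof.
move=> x y z; apply/ffunP=> t; rewrite !ffunE -big_split; apply: eq_bigr => l _.
rewrite -big_split; apply: eq_bigr => d _; rewrite -big_split; apply: eq_bigr => e _.
by rewrite ffunE mulrDr !mulrDl.
Qed.

Let shuffle1 (a b c p q r s : k) : a * (b * c * p * s) * q * r = a * b * c * (p * q) * r * s.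
Proof. by ring. Qed.

Let shuffle2 (a b c p q r s : k) : a * b * p * s * c * q * r = a * b * c * (p * q) * r * s.
Proof. by ring. Qed.

Lemma OBmulA : associative OBmul.
Proof.
move=> x y z; apply: OBext => i j c; rewrite !OBmulE.
transitivity (\sum_l \sum_m \sum_(d1 : diag (w i) (w m)) \sum_(d2 : diag (w m) (w l))
  \sum_(d3 : diag (w l) (w j)) x (obb d3) * y (obb d2) * z (obb d1) *
  delta ^+ (loops d1 d2 + loops (comp d1 d2) d3) * (comp (comp d1 d2) d3 == c)%:R).
  apply: eq_bigr => l _.
  transitivity (\sum_d \sum_(m < n.+1) \sum_(d1 : diag (w i) (w m)) \sum_(d2 : diag (w m) (w l))
    (\sum_(d3 : diag (w l) (w j)) x (obb d3) * y (obb d2) * z (obb d1) *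
    delta ^+ (loops d1 d2 + loops d d3) * (comp d d3 == c)%:R) * (comp d1 d2 == d)%:R).
    apply: eq_bigr => d _.
    under eq_bigr => e _ do rewrite OBmulE mulr_sumr !mulr_suml.
    rewrite exchange_big; apply: eq_bigr => m _.
    under eq_bigr => e _ do rewrite mulr_sumr !mulr_suml.
    rewrite exchange_big; apply: eq_bigr => d1 _.
    under eq_bigr => e _ do rewrite mulr_sumr !mulr_suml.
    rewrite exchange_big; apply: eq_bigr => d2 _.
    rewrite mulr_suml; apply: eq_bigr => e _.
    by rewrite exprD; apply: shuffle1.
  rewrite exchange_big; apply: eq_bigr => m _.
  rewrite exchange_big; apply: eq_bigr => d1 _.
  rewrite exchange_big; apply: eq_bigr => d2 _.
  exact: (sum_pick _ (fun d => \sum_d3 x (obb d3) * y (obb d2) * z (obb d1) *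
     delta ^+ (loops d1 d2 + loops d d3) * (comp d d3 == c)%:R)).
rewrite [LHS]exchange_big /=; apply: eq_bigr => m _.
rewrite [LHS]exchange_big /=; apply: eq_bigr => d1 _.
transitivity (\sum_e \sum_(l < n.+1) \sum_(d2 : diag (w m) (w l)) \sum_(d3 : diag (w l) (w j))
    (x (obb d3) * y (obb d2) * z (obb d1) *
    delta ^+ (loops d2 d3 + loops d1 e) * (comp d1 e == c)%:R) * (comp d2 d3 == e)%:R).
  rewrite [RHS]exchange_big /=; apply: eq_bigr => l _.
  rewrite [RHS]exchange_big /=; apply: eq_bigr => d2 _.
  rewrite [RHS]exchange_big /=; apply: eq_bigr => d3 _.
  by rewrite (sum_pick _ (fun e => x (obb d3) * y (obb d2) * z (obb d1) *
    delta ^+ (loops d2 d3 + loops d1 e) * (comp d1 e == c)%:R)) loopsA compA.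
apply: eq_bigr => e _; rewrite OBmulE !mulr_suml; apply: eq_bigr => l _.
rewrite !mulr_suml; apply: eq_bigr => d2 _; rewrite !mulr_suml; apply: eq_bigr => d3 _.
by rewrite exprD; apply/esym/shuffle2.
Qed.

Lemma OBone_neq0 : OBone != 0.
Proof.
apply/eqP=> /ffunP/(_ (obb (diag1 (w ord0)))); rewrite OBone_diag eqxx ffunE.
by move/eqP; apply/negP; apply: (oner_neq0 k).
Qed.

HB.instance Definition _ := GRing.Zmodule_isNzRing.Build A
  OBmulA OBmul1l OBmul1r OBmulDl OBmulDr OBone_neq0.

Lemma OBscalerAl (a : k) (x y : A) : a *: (x * y) = (a *: x) * y.
Proof.
apply/ffunP=> t; rewrite !ffunE scaler_sumr; apply: eq_bigr => l _.
rewrite scaler_sumr; apply: eq_bigr => d _; rewrite scaler_sumr; apply: eq_bigr => e _.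
by rewrite ffunE -[LHS]/(a * _) -[a *: x _]/(a * _) !mulrA.
Qed.

HB.instance Definition _ := GRing.Lmodule_isLalgebra.Build k A OBscalerAl.

Lemma OBscalerAr (a : k) (x y : A) : a *: (x * y) = x * (a *: y).
Proof.
apply/ffunP=> t; rewrite !ffunE scaler_sumr; apply: eq_bigr => l _.
rewrite scaler_sumr; apply: eq_bigr => d _; rewrite scaler_sumr; apply: eq_bigr => e _.
by rewrite ffunE -[LHS]/(a * _) -[a *: y _]/(a * _) !mulrA (mulrC a).
Qed.

HB.instance Definition _ := GRing.Lalgebra_isAlgebra.Build k A OBscalerAr.
HB.instance Definition _ := Algebra_isFalgebra.Build k A.

End OBAlgebra.

Record fdmod (k : fieldType) (A : falgType k) := FdMod {
  fdspace :> vectType k;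
  act : A -> 'End(fdspace);
  act_linear : linear act;
  act1 : act 1 = \1%VF;
  actM : forall a b, act (a * b) = (act a \o act b)%VF }.

Section Modules.

Variables (k : fieldType) (A : falgType k).
Implicit Types (M N L P I D : fdmod A).

Definition is_hom M N (f : 'Hom(M, N)) : Prop :=
  forall a x, f (act M a x) = act N a (f x).

Definition fdmod_iso M N : Prop := exists2 f : 'Hom(M, N), is_hom f & bijective f.

Definition submod M (U : {vspace M}) : Prop := forall a, (act M a @: U <= U)%VS.

Definition simple_mod M : Prop :=
  (fullv : {vspace M}) <> 0%VS /\
  forall U : {vspace M}, submod U -> U = 0%VS \/ U = fullv.

Definition indecomposable M : Prop :=
  (fullv : {vspace M}) <> 0%VS /\
  forall U U' : {vspace M}, submod U -> submod U' ->
    (U + U')%VS = fullv -> (U :&: U')%VS = 0%VS -> U = 0%VS \/ U' = 0%VS.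

Definition direct_summand N M : Prop :=
  exists (f : 'Hom(N, M)) (g : 'Hom(M, N)),
    [/\ is_hom f, is_hom g & forall x, g (f x) = x].

(* U' / U is isomorphic to N: f is a linear extension to M of a surjective
   homomorphism U' -> N with kernel U. *)
Definition subquotient_iso M (U U' : {vspace M}) N : Prop :=
  (U <= U')%VS /\
  exists f : 'Hom(M, N),
    [/\ forall a x, x \in U' -> f (act M a x) = act N a (f x),
        (f @: U')%VS = fullv & (U' :&: lker f)%VS = U].

Definition composition_factor M (U : {vspace M}) L : Prop :=
  simple_mod L /\
  exists U1 U2 : {vspace M},
    [/\ submod U1, submod U2, (U2 <= U)%VS & subquotient_iso U1 U2 L].

Definition has_filtration (C : fdmod A -> Prop) M (U : {vspace M}) : Prop :=
  exists (l : nat) (E : nat -> {vspace M}),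
    [/\ E 0%N = 0%VS, E l = U, forall i, (i <= l)%N -> submod (E i) &
        forall i, (i < l)%N -> exists2 N, C N & subquotient_iso (E i) (E i.+1) N].

Definition projective_mod P : Prop :=
  forall M N (f : 'Hom(M, N)) (g : 'Hom(P, N)),
    is_hom f -> is_hom g -> limg f = fullv ->
    exists2 h : 'Hom(P, M), is_hom h & (f \o h)%VF = g.

Definition injective_mod I : Prop :=
  forall M N (f : 'Hom(M, N)) (g : 'Hom(M, I)),
    is_hom f -> is_hom g -> lker f = 0%VS ->
    exists2 h : 'Hom(N, I), is_hom h & (h \o f)%VF = g.

Definition projective_cover P L : Prop :=
  projective_mod P /\
  exists f : 'Hom(P, L),
    [/\ is_hom f, limg f = fullv &
        forall U : {vspace P}, submod U -> (f @: U)%VS = fullv -> U = fullv].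

Definition injective_hull I L : Prop :=
  injective_mod I /\
  exists f : 'Hom(L, I),
    [/\ is_hom f, lker f = 0%VS &
        forall U : {vspace I}, submod U -> (U :&: limg f)%VS = 0%VS -> U = 0%VS].

(* D = A (x)_R S, where R is a subalgebra of A (given as a subspace) acting on
   S by ract: D carries the universal R-balanced bilinear map A x S -> D, and
   A acts through the left factor. *)
Section Induced.

Variables (R : {vspace A}) (S : vectType k) (ract : A -> S -> S).

Definition balanced (Z : vectType k) (t : 'Hom(A, 'Hom(S, Z))) : Prop :=
  forall a x y, x \in R -> t (a * x) y = t a (ract x y).

Definition is_induced D : Prop :=
  exists t : 'Hom(A, 'Hom(S, D)),
    [/\ balanced t, forall b a y, t (b * a) y = act D b (t a y) &
        forall (Z : vectType k) (t' : 'Hom(A, 'Hom(S, Z))), balanced t' ->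
          exists! h : 'Hom(D, Z), forall a y, h (t a y) = t' a y].

End Induced.

(* Std l D means that D is isomorphic to the standard module with label l. *)
Section Tilting.

Variables (Lab : Type) (lt : Lab -> Lab -> Prop) (Std : Lab -> fdmod A -> Prop).

(* L is the simple module L(l), i.e. the simple top of the standard module. *)
Definition simple_label (l : Lab) L : Prop :=
  simple_mod L /\
  exists D (f : 'Hom(D, L)), [/\ Std l D, is_hom f & limg f = fullv].

Definition factors_below (C : Lab -> Prop) M (U : {vspace M}) : Prop :=
  forall L, composition_factor U L -> exists2 l, C l & simple_label l L.

Definition quasi_hereditary : Prop :=
  [/\ (forall l, ~ lt l l) /\ (forall l1 l2 l3, lt l1 l2 -> lt l2 l3 -> lt l1 l3),
      (* l |-> L(l) is a bijection from Lab to isoclasses of simples *)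
      [/\ forall l, exists L, simple_label l L,
          forall L, simple_mod L -> exists! l, simple_label l L &
          forall l L L', simple_label l L -> simple_label l L' -> fdmod_iso L L'],
      (* [D(l) : L(l)] = 1 and the other factors are L(l') with l' < l *)
      forall l D, Std l D -> exists (U : {vspace D}) L,
        [/\ submod U, simple_label l L, subquotient_iso U fullv L &
            factors_below (fun l' => lt l' l) U] &
      (* P(l) ->> D(l) with kernel filtered by D(l') with l' > l *)
      forall l, exists P L D (f : 'Hom(P, D)),
        [/\ simple_label l L, projective_cover P L, Std l D,
            is_hom f /\ limg f = fullv &
            has_filtration (fun N => exists2 l', lt l l' & Std l' N) (lker f)]].

(* The costandard module with label l is the largest submodule of the injective
   hull of L(l) all of whose composition factors are L(l') with l' <= l. *)
Definition is_costandard (l : Lab) N : Prop :=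
  let le_l l' := l' = l \/ lt l' l in
  exists L I (f : 'Hom(N, I)),
    [/\ simple_label l L, injective_hull I L, is_hom f /\ lker f = 0%VS,
        factors_below le_l (limg f) &
        forall U : {vspace I}, submod U -> factors_below le_l U -> (U <= limg f)%VS].

Definition is_tilting M : Prop :=
  has_filtration (fun N => exists l, Std l N) (fullv : {vspace M}) /\
  has_filtration (fun N => exists l, is_costandard l N) (fullv : {vspace M}).

(* The modules T(l) are the indecomposable tilting modules, up to isomorphism. *)
Definition is_complete_tilting T : Prop :=
  is_tilting T /\
  forall N, is_tilting N -> indecomposable N -> direct_summand N T.

End Tilting.

End Modules.

Arguments quasi_hereditary {k} A {Lab} lt Std.

(* An isomorphism of k-algebras from End_A(M)^op to End_B(N), extended to a
   linear map on all linear endomorphisms of M. *)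
Definition End_op_iso (k : fieldType) (A B : falgType k)
    (M : fdmod A) (N : fdmod B) : Prop :=
  exists Phi : 'Hom('End(M), 'End(N)),
    [/\ forall f : 'End(M), is_hom f -> is_hom (Phi f),
        forall g : 'End(N), is_hom g ->
          exists! f : 'End(M), is_hom f /\ Phi f = g,
        Phi \1%VF = \1%VF &
        forall f g : 'End(M), is_hom f -> is_hom g ->
          Phi (f \o g)%VF = (Phi g \o Phi f)%VF].

(* The algebra End_B(N) is the Ringel dual of A given by the complete tilting
   module T. *)
Definition is_ringel_dual (k : fieldType) (A B : falgType k)
    (Lab : Type) (lt : Lab -> Lab -> Prop) (Std : Lab -> fdmod A -> Prop)
    (T : fdmod A) (N : fdmod B) : Prop :=
  is_complete_tilting lt Std T /\ End_op_iso T N.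

Record superspace (k : fieldType) := SuperSpace {
  sspace :> vectType k;
  even_part : {vspace sspace};
  odd_part : {vspace sspace};
  sspace_sum : (even_part + odd_part)%VS = fullv;
  sspace_cap : (even_part :&: odd_part)%VS = 0%VS }.

Definition has_sdim k (V : superspace k) (m n : nat) : Prop :=
  \dim (even_part V) = m /\ \dim (odd_part V) = n.

Section Tensors.

Variables (k : fieldType) (V : superspace k).

Definition letter_space (c : bool) : vectType k :=
  if c then V : vectType k else 'Hom(V, k^o).

Definition pairing_space c : letter_space c -> letter_space (~~ c) -> k :=
  match c with
  | true => fun v alpha => (alpha : 'Hom(V, k^o)) v
  | false => fun alpha v => (alpha : 'Hom(V, k^o)) v
  end.

(* Parity true is odd; an element of the dual has parity p if it vanishes on the
   part of V of the opposite parity. *)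
Definition homog c (p : bool) : letter_space c -> Prop :=
  match c with
  | true => fun v => (v : V) \in (if p then odd_part V else even_part V)
  | false => fun alpha => forall v : V,
      v \in (if p then even_part V else odd_part V) -> (alpha : 'Hom(V, k^o)) v = 0
  end.

(* For finite dimensional X, X (x) Y is realised as Hom(X^*, Y), with u (x) y
   the map alpha |-> alpha(u) y; here letter_space (~~ c) is the dual of
   letter_space c. *)
Fixpoint tens (a : word) : vectType k :=
  match a with
  | [::] => k^o
  | c :: a' => 'Hom(letter_space (~~ c), tens a')
  end.

Definition tunit : tens [::] := (1 : k).

Definition tcons c a (u : letter_space c) (x : tens a) : tens (c :: a) :=
  linfun (fun alpha : letter_space (~~ c) => pairing_space u alpha *: x).

Fixpoint tcat (a b : word) : tens a -> tens b -> tens (a ++ b) :=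
  match a with
  | [::] => fun (x : k) y => x *: y
  | c :: a' => fun f y =>
      linfun (fun alpha : letter_space (~~ c) =>
                tcat ((f : 'Hom(letter_space (~~ c), tens a')) alpha) y)
  end.

(* The grading of the tensor product. *)
Fixpoint thomog (a : word) (p : bool) : tens a -> Prop :=
  match a with
  | [::] => fun x => p -> x = 0
  | c :: a' => fun f => forall q (alpha : letter_space (~~ c)), homog q alpha ->
      thomog (p (+) q) ((f : 'Hom(letter_space (~~ c), tens a')) alpha)
  end.

Lemma pairing_space_linear c (u : letter_space c) :
  linear (pairing_space u : _ -> k^o).
Proof.
case: c u => u a x y /=; first by rewrite add_lfunE scale_lfunE.
by rewrite linearP.
Qed.

Lemma tconsE c a (u : letter_space c) (x : tens a) alpha :
  (tcons u x : 'Hom(_, _)) alpha = pairing_space u alpha *: x.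
Proof.
have lin : linear (fun alpha => pairing_space u alpha *: x).
  by move=> z v1 v2; rewrite pairing_space_linear scalerDl scalerA.
pose H := GRing.isLinear.Build _ _ _ _ _ lin.
pose f : {linear _ -> _} := HB.pack (fun alpha => pairing_space u alpha *: x) H.
by rewrite /tcons -[LHS]/(linfun f _) lfunE.
Qed.

Lemma tcat_linear a b (y : tens b) : linear (fun x : tens a => tcat x y).
Proof.
elim: a => [|c a IHa] z /= f1 f2; first by rewrite scalerDl scalerA.
have E (f : 'Hom(letter_space (~~ c), tens a)) alpha :
    (linfun (fun alpha => tcat (f alpha) y) : 'Hom(_, tens (a ++ b))) alpha
    = tcat (f alpha) y.
  have lin : linear (fun alpha => tcat (f alpha) y).
    by move=> z' v1 v2; rewrite linearP IHa.
  pose H := GRing.isLinear.Build _ _ _ _ _ lin.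
  pose g : {linear _ -> _} := HB.pack (fun alpha => tcat (f alpha) y) H.
  by rewrite -[LHS]/(linfun g _) lfunE.
by apply/lfunP=> alpha; rewrite E add_lfunE !scale_lfunE !add_lfunE !scale_lfunE !E IHa.
Qed.

Lemma tcatE c a b (f : tens (c :: a)) (y : tens b) alpha :
  (tcat f y : 'Hom(_, tens (a ++ b))) alpha
  = tcat ((f : 'Hom(letter_space (~~ c), tens a)) alpha) y.
Proof.
have lin : linear (fun alpha => tcat ((f : 'Hom(letter_space (~~ c), tens a)) alpha) y).
  by move=> z' v1 v2; rewrite linearP tcat_linear.
pose H := GRing.isLinear.Build _ _ _ _ _ lin.
pose g : {linear _ -> _} :=
  HB.pack (fun alpha => tcat ((f : 'Hom(letter_space (~~ c), tens a)) alpha) y) H.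
by rewrite -[LHS]/(linfun g _) lfunE.
Qed.

End Tensors.

(* A k-linear symmetric monoidal functor from OB(delta) to super vector spaces,
   given by its values on diagrams, sending vee to V, wedge to V^*, and the cap
   from wedge vee to the empty word to evaluation. *)
Record OBfunctor (k : fieldType) (delta : k) (V : superspace k) := OBFunctor {
  obF : forall a b, diag a b -> 'Hom(tens V a, tens V b);
  obF_even : forall a b (d : diag a b) p (x : tens V a),
    thomog p x -> thomog p (obF d x);
  obF_id : forall a, obF (diag1 a) = \1%VF;
  obF_comp : forall a b c (d : diag a b) (e : diag b c),
    (obF e \o obF d)%VF = delta ^+ loops d e *: obF (comp d e);
  obF_juxt : forall a b a' b' (d : diag a b) (d' : diag a' b')
      (x : tens V a) (y : tens V a'),
    obF (juxt d d') (tcat x y) = tcat (obF d x) (obF d' y);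
  obF_cross : forall c c' p p' (u : letter_space V c) (v : letter_space V c'),
    homog p u -> homog p' v ->
    obF (cross c c') (tcons u (tcons v (tunit V))) =
      (-1) ^+ (p && p') *: tcons v (tcons u (tunit V));
  obF_cap : forall (alpha : 'Hom(V, k^o)) (v : V),
    obF cap (tcons (alpha : letter_space V wedge)
                   (tcons (v : letter_space V vee) (tunit V))) = (alpha v : k^o) }.

Definition dsum (k : fieldType) n (E : 'I_n -> vectType k) : Type :=
  {dffun forall i, E i}.

Section DirectSum.

Import VectorInternalTheory.

Variables (k : fieldType) (n : nat) (E : 'I_n -> vectType k).
Local Notation D := (dsum E).
Implicit Types f g h : D.

HB.instance Definition _ := Choice.on D.

Definition dsum_of (F : forall i, E i) : D := finfun F.

Lemma dsumE (F : forall i, E i) i : dsum_of F i = F i.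
Proof. exact: ffunE. Qed.

Lemma dsumP f g : (forall i, f i = g i) -> f = g.
Proof. by move=> fg; apply/ffunP. Qed.

Fact dsum_addA : associative (fun f g => dsum_of (fun i => f i + g i)).
Proof. by move=> f g h; apply: dsumP => i /=; rewrite !dsumE addrA. Qed.
Fact dsum_addC : commutative (fun f g => dsum_of (fun i => f i + g i)).
Proof. by move=> f g; apply: dsumP => i /=; rewrite !dsumE addrC. Qed.
Fact dsum_add0 : left_id (dsum_of (fun i => 0)) (fun f g => dsum_of (fun i => f i + g i)).
Proof. by move=> f; apply: dsumP => i /=; rewrite !dsumE add0r. Qed.
Fact dsum_addN : left_inverse (dsum_of (fun i => 0)) (fun f => dsum_of (fun i => - f i))
  (fun f g => dsum_of (fun i => f i + g i)).
Proof. by move=> f; apply: dsumP => i /=; rewrite !dsumE addNr. Qed.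

HB.instance Definition _ := GRing.isZmodule.Build D
  dsum_addA dsum_addC dsum_add0 dsum_addN.

Lemma dsum_addE f g i : (f + g) i = f i + g i.
Proof. exact: dsumE. Qed.

Definition dsum_scale (a : k) f : D := dsum_of (fun i => a *: f i).

Fact dsum_scaleA a b f : dsum_scale a (dsum_scale b f) = dsum_scale (a * b) f.
Proof. by apply: dsumP => i /=; rewrite !dsumE scalerA. Qed.
Fact dsum_scale1 : left_id 1 dsum_scale.
Proof. by move=> f; apply: dsumP => i /=; rewrite dsumE scale1r. Qed.
Fact dsum_scaleDr : right_distributive dsum_scale +%R.
Proof. by move=> a f g; apply: dsumP => i /=; rewrite dsum_addE !dsumE ?dsum_addE scalerDr. Qed.
Fact dsum_scaleDl f : {morph dsum_scale^~ f : a b / a + b}.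
Proof. by move=> a b; apply: dsumP => i /=; rewrite dsum_addE !dsumE scalerDl. Qed.

HB.instance Definition _ := GRing.Zmodule_isLmodule.Build k D
  dsum_scaleA dsum_scale1 dsum_scaleDr dsum_scaleDl.

Lemma dsum_scaleE a f i : (a *: f) i = a *: f i.
Proof. exact: dsumE. Qed.

Fact dsum_vect : Vector.axiom (\sum_i dim (E i)) D.
Proof.
exists (fun f => \mxrow_i v2r (f i)).
  move=> a f g; apply/mxrowP => i; rewrite mxrowK dsum_addE dsum_scaleE linearP /=.
  rewrite submxrowD mxrowK; congr (_ + _).
  transitivity (a *: submxrow (\mxrow_l v2r (f l)) i); first by rewrite mxrowK.
  by apply/matrixP=> i0 j0; rewrite !mxE.
exists (fun r => dsum_of (fun i => r2v (submxrow r i))) => [f|r].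
  by apply: dsumP => i; rewrite dsumE mxrowK v2rK.
by apply/mxrowP=> i; rewrite mxrowK dsumE r2vK.
Qed.

HB.instance Definition _ := Lmodule_hasFinDim.Build k D dsum_vect.

End DirectSum.

Section OBModule.

Variables (k : fieldType) (delta : k) (V : superspace k) (F : OBfunctor delta V).
Variables (n : nat) (w : 'I_n.+1 -> word).
Local Notation A := (OBalg delta w).
Local Notation T := (dsum (fun i => tens V (w i))).

Definition OBact_fun (x : A) (v : T) : T :=
  dsum_of (fun j => \sum_i \sum_(d : diag (w i) (w j)) x (obb d) *: obF F d (v i)).

Lemma OBact_fun_linear x : linear (OBact_fun x).
Proof.
move=> a u v; apply: dsumP => j; rewrite dsum_addE dsum_scaleE !dsumE.
rewrite scaler_sumr -big_split; apply: eq_bigr => i _.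
rewrite scaler_sumr -big_split; apply: eq_bigr => d _.
by rewrite dsum_addE dsum_scaleE linearP scalerDr !scalerA mulrC.
Qed.

HB.instance Definition _ x :=
  GRing.isLinear.Build k T T _ (OBact_fun x) (OBact_fun_linear x).

Definition OBact (x : A) : 'End(T) := linfun (OBact_fun x).

Lemma OBactE x v j :
  OBact x v j = \sum_i \sum_(d : diag (w i) (w j)) x (obb d) *: obF F d (v i).
Proof. by rewrite lfunE dsumE. Qed.

Lemma OBact_linear : linear OBact.
Proof.
move=> a x y; apply/lfunP=> v; apply: dsumP => j.
rewrite add_lfunE scale_lfunE dsum_addE dsum_scaleE !OBactE.
rewrite scaler_sumr -big_split; apply: eq_bigr => i _.
rewrite scaler_sumr -big_split; apply: eq_bigr => d _.
by rewrite !ffunE scalerDl scalerA.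
Qed.

Lemma OBact1 : OBact 1 = \1%VF.
Proof.
apply/lfunP=> v; apply: dsumP => j; rewrite OBactE id_lfunE.
rewrite (bigD1 j) //= [X in _ + X]big1 ?addr0 => [|i neq]; last first.
  by rewrite big1 // => d _; rewrite OBone_neq // scale0r.
rewrite (bigD1 (diag1 (w j))) //= big1 ?addr0 => [|d /negPf ne]; last first.
  by rewrite OBone_diag ne scale0r.
by rewrite OBone_diag eqxx scale1r obF_id id_lfunE.
Qed.

Lemma OBactM x y : OBact (x * y) = (OBact x \o OBact y)%VF.
Proof.
apply/lfunP=> v; apply: dsumP => j; rewrite comp_lfunE !OBactE.
transitivity (\sum_i \sum_l \sum_(d : diag (w i) (w l)) \sum_(e : diag (w l) (w j))
   (x (obb e) * y (obb d)) *: obF F e (obF F d (v i))).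
  apply: eq_bigr => i _.
  under eq_bigr => c _ do rewrite OBmulE scaler_suml.
  rewrite exchange_big; apply: eq_bigr => l _.
  under eq_bigr => c _ do rewrite scaler_suml.
  rewrite exchange_big; apply: eq_bigr => d _.
  under eq_bigr => c _ do rewrite scaler_suml.
  rewrite exchange_big; apply: eq_bigr => e _.
  rewrite (bigD1 (comp d e)) //= big1 ?addr0 => [|c /negPf ne]; last first.
    by rewrite eq_sym ne mulr0 scale0r.
  rewrite eqxx mulr1 -scalerA; congr (_ *: _).
  by have /lfunP/(_ (v i)) := obF_comp F d e; rewrite comp_lfunE scale_lfunE.
rewrite exchange_big; apply: eq_bigr => l _.
under [RHS]eq_bigr => e _ do rewrite OBactE linear_sum scaler_sumr.
rewrite [RHS]exchange_big; apply: eq_bigr => i _.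
under [RHS]eq_bigr => e _ do rewrite linear_sum scaler_sumr.
rewrite [RHS]exchange_big; apply: eq_bigr => d _; apply: eq_bigr => e _.
by rewrite linearZ scalerA.
Qed.

Definition OBmod : fdmod A := FdMod OBact_linear OBact1 OBactM.


End OBModule.

Definition mixed (r s : nat) : word := nseq r vee ++ nseq s wedge.

Definition mixed_family r s (j : 'I_(minn r s).+1) : word := mixed (r - j) (s - j).

(* End(vee^r wedge^s), as the case of a family of one word. *)
Definition walled_Brauer (k : fieldType) (delta : k) (r s : nat) : falgType k :=
  OBalg delta (fun _ : 'I_1 => mixed r s).

Definition walled_Brauer_c (k : fieldType) (delta : k) (r s : nat) : falgType k :=
  OBalg delta (@mixed_family r s).

Definition cupless (k : fieldType) (delta : k) (r s : nat) :
    {vspace walled_Brauer_c delta r s} :=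
  <<[seq ([ffun z' => (z' == z)%:R] : OBalg delta (@mixed_family r s))
       | z <- enum (OBbasis (@mixed_family r s)) & ~~ has_cup (tagged z)]>>%VS.

Record partn (n : nat) := Partn {
  parts :> seq nat;
  partnP : [&& sorted geq parts, 0%N \notin parts & sumn parts == n] }.

Section Specht.

Variables (k : fieldType) (n : nat) (lambda : seq nat).

(* In the tableau of shape lambda filled with 0, ..., n-1 in reading order, i is
   in row reshape_index lambda i and column reshape_offset lambda i. *)
Definition row_stab : {set 'S_n} :=
  [set p : 'S_n | [forall i, reshape_index lambda (p i) == reshape_index lambda i]].

Definition col_stab : {set 'S_n} :=
  [set q : 'S_n | [forall i, reshape_offset lambda (q i) == reshape_offset lambda i]].

(* The group algebra kS_n is the space of functions on 'S_n, with product coming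
   from the composition of permutations as functions: q o p is (p * q)%g. *)
Definition young_symmetrizer : {ffun 'S_n -> k^o} :=
  \sum_(q in col_stab) \sum_(p in row_stab)
    [ffun x => (-1) ^+ q * (x == (p * q)%g)%:R].

Definition perm_translate (sigma : 'S_n) (f : {ffun 'S_n -> k^o}) : {ffun 'S_n -> k^o} :=
  [ffun x => f (x * sigma^-1)%g].

(* The left ideal generated by the Young symmetrizer; it is the span of the
   polytabloids, once the tabloid {t} is identified with the sum of the row
   stabiliser of t. *)
Definition specht : {vspace {ffun 'S_n -> k^o}} :=
  <<[seq perm_translate sigma young_symmetrizer | sigma : 'S_n]>>%VS.

End Specht.

Section OuterProduct.

Variables (k : fieldType) (a b : nat).
Local Notation kSS := {ffun 'S_a * 'S_b -> k^o}.

Definition outer_prod (f : {ffun 'S_a -> k^o}) (g : {ffun 'S_b -> k^o}) : kSS :=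
  [ffun x => f x.1 * g x.2].

Definition specht_box (lambda mu : seq nat) : {vspace kSS} :=
  <<[seq outer_prod f g | f <- vbasis (specht k a lambda), g <- vbasis (specht k b mu)]>>%VS.

Definition perm_translate2 (st : 'S_a * 'S_b) (h : kSS) : kSS :=
  [ffun x => h ((x.1 * st.1^-1)%g, (x.2 * st.2^-1)%g)].

End OuterProduct.

Definition bipart (r s : nat) : Type :=
  {j : 'I_(minn r s).+1 & (partn (r - j) * partn (s - j))%type}.

Definition bipart_lt r s (l l' : bipart r s) : Prop :=
  (sumn (tagged l').1 < sumn (tagged l).1)%N.

Section Standard.

Variables (k : fieldType) (delta : k) (r s : nat).
Local Notation Bc := (walled_Brauer_c delta r s).

Definition perm_diag2 (j : 'I_(minn r s).+1) (st : 'S_(r - j) * 'S_(s - j)) :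
    diag (mixed_family j) (mixed_family j) :=
  juxt (perm_diag vee st.1) (perm_diag wedge st.2).

(* Among the diagrams without cups, those without caps are permutation diagrams
   of the words vee^(r-i) wedge^(s-i); the ones with i = j act by the group
   action, and the others, like the diagrams with caps, by zero.  The subspace
   specht_box is stable under the translations, so vsproj only restores the
   subtype. *)
Definition cupless_act (j : 'I_(minn r s).+1) (lambda mu : seq nat)
    (x : OBalg delta (@mixed_family r s)) (y : subvs_of (specht_box k (r - j) (s - j) lambda mu)) :
    subvs_of (specht_box k (r - j) (s - j) lambda mu) :=
  vsproj _ (\sum_(st : 'S_(r - j) * 'S_(s - j))
     OBcoef x (perm_diag2 st) *:
       perm_translate2 st (vsval y)).

Definition is_standard (l : bipart r s) (D : fdmod Bc) : Prop :=
  is_induced (cupless delta r s)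
    (@cupless_act (tag l) (tagged l).1 (tagged l).2) D.

End Standard.

Definition has_characteristic (k : fieldType) (p : nat) : Prop :=
  if p is 0 then [pchar k] =i pred0 else p \in [pchar k].

Section MixedTensors.

Variables (k : fieldType) (delta : k) (V : superspace k) (F : OBfunctor delta V).

(* V^(x)r (x) W^(x)s *)
Definition mixed_tensors (r s : nat) : fdmod (walled_Brauer delta r s) :=
  OBmod F (fun _ : 'I_1 => mixed r s).

(* (+)_j V^(x)(r-j) (x) W^(x)(s-j) *)
Definition mixed_tensors_c (r s : nat) : fdmod (walled_Brauer_c delta r s) :=
  OBmod F (@mixed_family r s).

End MixedTensors.

Definition superdim (k : fieldType) (m n : nat) : k := m%:R - n%:R.

(* Main.v *)
(* Every diagram is a product of a cup diagram, a permutation and a cap diagram,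
   which cuts the algebra into layers, one for each j.  In a module M, the
   images of the nontrivial cups and the vectors killed by the nontrivial caps
   give an upper bound for dim M, respectively its dual, in terms of the layers;
   equality holds in the first bound exactly when M has a filtration by standard
   modules, in the second exactly when it has one by costandard modules.  The
   hypothesis on p makes the group algebras of the layers semisimple.

   For the mixed tensors both equalities are obtained by counting labelled basis
   tensors.  A basis tensor in which some v_i and its dual v_i^* occupy a pair
   of positions (x, y) with i = x + y can be traded, modulo the images of cups,
   for basis tensors where i <> x + y, since a cup at (x, y) is a sum over i; the
   tensors which remain are in bijection with labelled diagrams.  A form on the
   tensors for which mirror images of diagrams are adjoint gives the dual count.
   The tensor v_0 v_1 v_2 ... with distinct labels, cyclic for a regular module of
   the group of the layer, is killed by caps and independent of the images of
   cups; hence every indecomposable tilting module is a summand, by extension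
   of homomorphisms from standardly filtered to costandardly filtered modules.

   Finally, a cup diagram from layer j to layer 0 acts injectively and its mirror
   image surjectively, so that an endomorphism is determined by its restriction
   to layer 0, where it can be any endomorphism commuting with the diagrams; the
   adjoint turns restriction into an anti-isomorphism. *)
From HB Require Import structures.
Require Import Defs.
From mathcomp Require Import all_boot all_order all_algebra all_fingroup all_field.
From mathcomp Require Import zify.
From Stdlib Require Import Classical.
Import Defs.

Set Implicit Arguments.
Unset Strict Implicit.
Unset Printing Implicit Defensive.

Import GRing.Theory.
Local Open Scope ring_scope.

Local Notation "a ** x" := (act _ a x) (at level 40, left associativity).

(** * Linear algebra and modules *)

Section LinearAlgebra.

Variable k : fieldType.
Implicit Types (U V W : vectType k).

Lemma lfun_factor U V W (a : 'Hom(U, V)) (b : 'Hom(U, W)) :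
  (lker a <= lker b)%VS -> exists f : 'Hom(V, W), forall x, f (a x) = b x.
Proof.
move=> /subvP ab; exists (b \o a^-1)%VF => x; rewrite comp_lfunE /=.
have : (a^-1)%VF (a x) - x \in lker a.
  by rewrite memv_ker linearB /= limg_lfunVK ?subrr // memv_img // memvf.
by move/ab; rewrite memv_ker linearB subr_eq0 => /eqP.
Qed.

Lemma lfun_of_linear U V (f : U -> V) : linear f ->
  exists g : 'Hom(U, V), forall x, g x = f x.
Proof.
move=> lin; pose H := GRing.isLinear.Build _ _ _ _ _ lin.
pose g : {linear _ -> _} := HB.pack f H.
by exists (linfun g) => x; rewrite -[RHS]/(g x) lfunE.
Qed.

Lemma dim_bigcap_ker U V (I : Type) (r : seq I) (f : I -> 'Hom(U, V)) (X : {vspace U}) :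
  (\dim X <= \dim (X :&: \bigcap_(i <- r) lker (f i)) +
             \sum_(i <- r) \dim (f i @: X))%N.
Proof.
elim: r => [|i r IHr]; first by rewrite !big_nil capvf addn0.
rewrite !big_cons; apply: leq_trans IHr _; set Y := (\bigcap_(j <- r) _)%VS.
rewrite addnA leq_add2r -(limg_ker_dim (f i) (X :&: Y)).
rewrite -capvA [(Y :&: _)%VS]capvC leq_add2l.
by apply: dimvS; apply: limgS; apply: capvSl.
Qed.

Lemma addvP U (X Y : {vspace U}) x :
  reflect (exists u v, [/\ u \in X, v \in Y & x = u + v]) (x \in (X + Y)%VS).
Proof.
apply: (iffP memv_addP) => [[u Xu [v Yv ->]]|[u [v [Xu Yv ->]]]]; first by exists u, v.
by exists u => //; exists v.
Qed.

Lemma dimv_sum_leq U (I : Type) (r : seq I) (P : pred I) (X : I -> {vspace U}) :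
  (\dim (\sum_(i <- r | P i) X i)%VS <= \sum_(i <- r | P i) \dim (X i))%N.
Proof.
elim/big_rec2: _ => [|i d Y _ IH]; first by rewrite dimv0.
by rewrite (leq_trans (dimv_add_leqif _ _)) // leq_add2l.
Qed.

Lemma dimv_add_cap U (X Y : {vspace U}) :
  (\dim (X + Y) + \dim (X :&: Y) = \dim X + \dim Y)%N.
Proof. exact: dimv_sum_cap. Qed.

Lemma dim_limg_inj U V (f : 'Hom(U, V)) (X : {vspace U}) :
  (X :&: lker f)%VS = 0%VS -> \dim (f @: X) = \dim X.
Proof. exact: limg_dim_eq. Qed.

Lemma vspace_neq0 U (X : {vspace U}) : X <> 0%VS -> exists2 x, x \in X & x != 0.
Proof.
move=> /eqP X0; exists (vpick X); first exact: memv_pick.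
by rewrite vpick0.
Qed.

Lemma vspace_eq0P U (X : {vspace U}) : (forall x, x \in X -> x = 0) -> X = 0%VS.
Proof.
move=> X0; apply/eqP; rewrite -vpick0; apply/eqP/X0/memv_pick.
Qed.

End LinearAlgebra.

Section GenericModules.

Variables (k : fieldType) (A : falgType k).
Implicit Types (M N L P : fdmod A).

Section One.
Variable M : fdmod A.
Implicit Types (a b : A) (x y : M) (U : {vspace M}).

Lemma actDl a b x : (a + b) ** x = a ** x + b ** x.
Proof.
by have := act_linear M 1 a b; rewrite !scale1r => ->; rewrite add_lfunE.
Qed.

Lemma act0l x : 0 ** x = 0 :> M.
Proof. by apply: (addIr (0 ** x)); rewrite -actDl !add0r. Qed.

Lemma actZl c a x : (c *: a) ** x = c *: (a ** x) :> M.
Proof.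
by have := act_linear M c a 0; rewrite addr0 => ->; rewrite add_lfunE scale_lfunE act0l addr0.
Qed.

Lemma act_suml I (r : seq I) (P : pred I) (F : I -> A) x :
  (\sum_(i <- r | P i) F i) ** x = \sum_(i <- r | P i) F i ** x :> M.
Proof. by elim/big_rec2: _ => [|i y a _ IH]; rewrite ?act0l // actDl IH. Qed.

Lemma act_mul a b x : (a * b) ** x = a ** (b ** x).
Proof. by rewrite actM comp_lfunE. Qed.

Lemma act_one x : 1 ** x = x.
Proof. by rewrite act1 id_lfunE. Qed.

Lemma submodP U : submod U <-> forall a x, x \in U -> a ** x \in U.
Proof.
split=> sU a; first by move=> x Ux; apply/(subvP (sU a))/memv_img.
by apply/subvP => _ /memv_imgP[x Ux ->]; apply: sU.
Qed.

Lemma submod0 : submod (0%VS : {vspace M}).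
Proof. by move=> a; rewrite limg0 sub0v. Qed.

Lemma submodf : submod (fullv : {vspace M}).
Proof. by move=> a; apply: subvf. Qed.

Lemma submodD U U' : submod U -> submod U' -> submod (U + U')%VS.
Proof. by move=> sU sU' a; rewrite limgD addvS. Qed.

Lemma submod_cap U U' : submod U -> submod U' -> submod (U :&: U')%VS.
Proof.
move=> /submodP sU /submodP sU'; apply/submodP => a x /memv_capP[Ux U'x].
by rewrite memv_cap sU ?sU'.
Qed.

Definition aspan (B : {vspace A}) U : {vspace M} :=
  (\sum_(i < \dim B) (act M (vbasis B)`_i @: U))%VS.

Lemma mem_aspan (B : {vspace A}) U b x : b \in B -> x \in U -> b ** x \in aspan B U.
Proof.
move=> Bb Ux; rewrite (coord_vbasis Bb) act_suml; apply: memv_sumr => i _.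
by rewrite actZl memvZ // memv_img.
Qed.

Lemma aspan_le (B : {vspace A}) U (X : {vspace M}) :
  (forall b x, b \in B -> x \in U -> b ** x \in X) -> (aspan B U <= X)%VS.
Proof.
move=> BX; apply/subv_sumP => i _; apply/subvP => _ /memv_imgP[x Ux ->].
by apply: BX => //; apply/vbasis_mem/mem_nth; rewrite size_tuple.
Qed.

Definition gensub U := aspan fullv U.

Lemma gensub_submod U : submod (gensub U).
Proof.
move=> a; rewrite -[X in (_ @: X)%VS]/(aspan _ _) limg_sum; apply/subv_sumP => i _.
apply/subvP => _ /memv_imgP[_ /memv_imgP[x Ux ->] ->].
by rewrite -act_mul mem_aspan ?memvf.
Qed.

Lemma mem_gensub U a x : x \in U -> a ** x \in gensub U.
Proof. by move=> Ux; rewrite mem_aspan ?memvf. Qed.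

Lemma sub_gensub U : (U <= gensub U)%VS.
Proof. by apply/subvP => x /(mem_gensub 1); rewrite act_one. Qed.

Lemma gensub_le U (X : {vspace M}) : submod X -> (U <= X)%VS -> (gensub U <= X)%VS.
Proof.
move=> /submodP sX /subvP UX; apply: aspan_le => a x _ /UX; exact: sX.
Qed.

(* The largest submodule which a maps into U. *)
Definition colon (a : A) U : {vspace M} :=
  (\bigcap_(i < \dim {:A}) (act M (a * (vbasis {:A})`_i) @^-1: U))%VS.

Lemma mem_colon a U x : reflect (forall b, a ** (b ** x) \in U) (x \in colon a U).
Proof.
apply: (iffP idP) => [xU b|xU].
  rewrite (coord_vbasis (memvf b)) act_suml linear_sum memv_suml // => i _.
  rewrite actZl linearZ memvZ //; move: xU; rewrite memvE => /subv_bigcapP/(_ i isT).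
  by rewrite -memvE -memv_preim act_mul.
rewrite memvE; apply/subv_bigcapP => i _; rewrite -memvE -memv_preim act_mul; exact: xU.
Qed.

Lemma colon_submod a U : submod (colon a U).
Proof.
by apply/submodP => b x /mem_colon xU; apply/mem_colon => b'; rewrite -[b' ** _]act_mul; apply: xU.
Qed.

End One.

Lemma is_hom_comp M N P (f : 'Hom(M, N)) (g : 'Hom(N, P)) :
  is_hom f -> is_hom g -> is_hom (g \o f)%VF.
Proof. by move=> hf hg a x; rewrite !comp_lfunE hf hg. Qed.

Lemma is_hom_id M : is_hom (\1%VF : 'End(M)).
Proof. by move=> a x; rewrite !id_lfunE. Qed.

Lemma submod_ker M N (f : 'Hom(M, N)) : is_hom f -> submod (lker f).
Proof.
by move=> hf; apply/submodP=> a x; rewrite !memv_ker hf => /eqP->; rewrite linear0.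
Qed.

Lemma submod_img M N (f : 'Hom(M, N)) (U : {vspace M}) :
  is_hom f -> submod U -> submod (f @: U)%VS.
Proof.
move=> hf /submodP sU; apply/submodP=> a _ /memv_imgP[x Ux ->].
by rewrite -hf memv_img // sU.
Qed.

Lemma submod_preim M N (f : 'Hom(M, N)) (U : {vspace N}) :
  is_hom f -> submod U -> submod (f @^-1: U)%VS.
Proof.
move=> hf /submodP sU; apply/submodP=> a x; rewrite -!memv_preim hf; exact: sU.
Qed.

Lemma hom_inv M N (f : 'Hom(M, N)) (g : 'Hom(N, M)) :
  is_hom f -> limg f = fullv -> (forall x, g (f x) = x) -> is_hom g.
Proof.
move=> hf fS gK a y; have /memv_imgP[x _ ->] : y \in limg f by rewrite fS memvf.
by rewrite -hf !gK.
Qed.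

Lemma lfun_bij (V W : vectType k) (f : 'Hom(V, W)) :
  lker f = 0%VS -> limg f = fullv -> bijective f.
Proof.
move=> f0 fS; exists (f^-1)%VF => x; first by rewrite lker0_lfunK //; apply/eqP.
by rewrite limg_lfunVK // fS memvf.
Qed.

Lemma simple_hom_inj L N (f : 'Hom(L, N)) x :
  simple_mod L -> is_hom f -> f x != 0 -> lker f = 0%VS.
Proof.
move=> [_ sL] /submod_ker/sL[//|kf] /eqP[].
by apply/eqP; rewrite -memv_ker kf memvf.
Qed.

Lemma simple_hom_surj M L (f : 'Hom(M, L)) x :
  simple_mod L -> is_hom f -> f x != 0 -> limg f = fullv.
Proof.
move=> [_ sL] hf fx; case: (sL (limg f)) => [|f0|//].
  exact: submod_img (@submodf _).
by move: (memv_img f (memvf x)); rewrite f0 memv0 (negPf fx).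
Qed.

Section Subquotient.

Variables (M : fdmod A) (U U' : {vspace M}).
Hypotheses (sU : submod U) (sU' : submod U') (UU' : (U <= U')%VS).

Let W := (U' :\: U)%VS.
Let WU0 : (W :&: U)%VS = 0%VS. Proof. exact: capv_diff. Qed.
Let WU : (W + U)%VS = U'.
Proof. by rewrite addv_diff; apply/addv_idPl. Qed.

Definition sq_space : vectType k := subvs_of W.

Definition sq_map : 'Hom(M, sq_space) := (linfun (vsproj W) \o daddv_pi W U)%VF.

Lemma sq_mapE x : vsval (sq_map x) = daddv_pi W U x.
Proof. by rewrite comp_lfunE lfunE /= vsprojK // memv_pi. Qed.

Lemma sq_map_ker x : x \in U' -> (sq_map x == 0) = (x \in U).
Proof.
rewrite -WU => xWU; have xE := daddv_pi_add WU0 xWU.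
apply/eqP/idP => [/(congr1 vsval)|xU].
  by rewrite sq_mapE /= => x0; rewrite -xE x0 add0r memv_pi.
apply: val_inj; rewrite /= [LHS]sq_mapE -[RHS](subrr x) -{2}xE.
have -> : daddv_pi U W x = x by apply: daddv_pi_id => //; rewrite capvC.
by rewrite addrK.
Qed.

Lemma sq_map_val (y : subvs_of W) : sq_map (vsval y) = y.
Proof. by apply: val_inj; rewrite /= [LHS]sq_mapE daddv_pi_id // subvsP. Qed.

Lemma sq_val_mem (y : subvs_of W) : vsval y \in U'.
Proof. by apply: (subvP (diffvSl U' U)); apply: subvsP. Qed.

Definition sq_act (a : A) : 'End(sq_space) :=
  (sq_map \o act M a \o linfun (vsval : subvs_of W -> M))%VF.

Lemma sq_actE a (y : subvs_of W) : sq_act a y = sq_map (a ** vsval y).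
Proof. by rewrite 2!comp_lfunE; congr (sq_map (_ ** _)); apply: lfunE. Qed.

Lemma sq_map_act a x : x \in U' -> sq_map (a ** x) = sq_act a (sq_map x).
Proof.
move=> xU'; rewrite sq_actE sq_mapE.
have qU : daddv_pi U W x \in U by apply: memv_pi.
have aqU : a ** daddv_pi U W x \in U by move/submodP: sU; apply.
have aqU' := subvP UU' _ aqU.
have xE : x = daddv_pi W U x + daddv_pi U W x by rewrite daddv_pi_add // WU.
rewrite {1}xE !linearD /=; move: aqU; rewrite -sq_map_ker // => /eqP->.
by rewrite addr0.
Qed.

Lemma sq_act_linear : linear sq_act.
Proof.
move=> c a b; apply/lfunP => y; rewrite add_lfunE scale_lfunE !sq_actE.
by rewrite actDl actZl linearP.
Qed.

Lemma sq_act1 : sq_act 1 = \1%VF.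
Proof. by apply/lfunP=> y; rewrite sq_actE act_one sq_map_val id_lfunE. Qed.

Lemma sq_actM a b : sq_act (a * b) = (sq_act a \o sq_act b)%VF.
Proof.
apply/lfunP=> y; rewrite comp_lfunE !sq_actE act_mul -sq_actE -sq_map_act //.
by move/submodP: sU'; apply; apply: sq_val_mem.
Qed.

Definition sqmod : fdmod A := FdMod sq_act_linear sq_act1 sq_actM.

Lemma sq_map_surj : (sq_map @: U')%VS = fullv.
Proof.
apply/eqP; rewrite eqEsubv subvf; apply/subvP=> y _.
by rewrite -[y]sq_map_val memv_img // sq_val_mem.
Qed.

Lemma sqmod_iso : subquotient_iso U U' sqmod.
Proof.
split=> //; exists sq_map; split=> [a x|| ]; first exact: sq_map_act.
  exact: sq_map_surj.
apply/vspaceP => x; rewrite memv_cap memv_ker.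
by case: (boolP (x \in U')) => [/sq_map_ker->|/(contra (subvP UU' x))/negPf->].
Qed.

Lemma subquotient_exists : exists N (q : 'Hom(M, N)),
  [/\ forall a x, x \in U' -> q (a ** x) = a ** q x, (q @: U')%VS = fullv,
      forall x, x \in U' -> (q x == 0) = (x \in U) & subquotient_iso U U' N].
Proof.
exists sqmod, sq_map; split=> [a x|||]; last exact: sqmod_iso.
- exact: sq_map_act.
- exact: sq_map_surj.
- exact: sq_map_ker.
Qed.

End Subquotient.

Section Submodule.

Variables (M : fdmod A) (U : {vspace M}).
Hypothesis sU : submod U.

Definition sub_space : vectType k := subvs_of U.

Definition sub_act (a : A) : 'End(sub_space) :=
  (linfun (vsproj U) \o act M a \o linfun (vsval : subvs_of U -> M))%VF.

Lemma sub_actE a (y : subvs_of U) : vsval (sub_act a y) = a ** vsval y.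
Proof.
rewrite !comp_lfunE !lfunE /= vsprojK //.
by move/submodP: sU; apply; apply: subvsP.
Qed.

Lemma sub_act_linear : linear sub_act.
Proof.
move=> c a b; apply/lfunP => y; apply: val_inj; rewrite add_lfunE scale_lfunE /=.
transitivity (c *: (a ** vsval y) + b ** vsval y).
  by rewrite [LHS]sub_actE actDl actZl.
by rewrite -!sub_actE.
Qed.

Lemma sub_act1 : sub_act 1 = \1%VF.
Proof. by apply/lfunP=> y; apply: val_inj; rewrite /= sub_actE act_one id_lfunE. Qed.

Lemma sub_actM a b : sub_act (a * b) = (sub_act a \o sub_act b)%VF.
Proof.
by apply/lfunP=> y; apply: val_inj; rewrite /= comp_lfunE !sub_actE act_mul.
Qed.

Definition subm : fdmod A := FdMod sub_act_linear sub_act1 sub_actM.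

Definition subm_incl : 'Hom(subm, M) := linfun (vsval : subvs_of U -> M).

Lemma subm_inclE y : subm_incl y = vsval y. Proof. by rewrite lfunE. Qed.

Lemma subm_incl_hom : is_hom subm_incl.
Proof. by move=> a y; rewrite !subm_inclE sub_actE. Qed.

Lemma subm_incl_inj : lker subm_incl = 0%VS.
Proof.
apply: vspace_eq0P => y; rewrite memv_ker subm_inclE => /eqP y0.
exact: val_inj.
Qed.

Lemma limg_subm_incl : limg subm_incl = U.
Proof.
apply/vspaceP => x; apply/memv_imgP/idP => [[y _ ->]|xU].
  by rewrite subm_inclE subvsP.
by exists (vsproj U x); rewrite ?memvf // subm_inclE vsprojK.
Qed.

Lemma dim_subm : \dim {:subm} = \dim U.
Proof.
by rewrite -[in RHS]limg_subm_incl dim_limg_inj // subm_incl_inj capv0.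
Qed.

End Submodule.

Lemma fitting N (h : 'End(N)) : is_hom h ->
  exists g : 'End(N), [/\ is_hom g, (lker g :&: limg g)%VS = 0%VS,
    (lker g + limg g)%VS = fullv, (limg g <= limg h)%VS & (lker h <= lker g)%VS] /\
    [/\ forall x, h x = x -> g x = x &
    forall (W : vectType k) (f : 'Hom(N, W)), (forall x, f (h x) = f x) ->
      forall x, f (g x) = f x].
Proof.
move nE : (\dim {:N} - \dim (lker h))%N => n.
elim/ltn_ind: n h nE => n IHn h nE hh.
have kh : (lker h <= lker (h \o h))%VS.
  apply/subvP=> x; rewrite !memv_ker comp_lfunE => /eqP->.
  by rewrite linear0.
have := dimvS kh; rewrite leq_eqVlt => /orP[/eqP eqd|ltd].
  exists h; have h0 : (lker h :&: limg h)%VS = 0%VS.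
    apply: vspace_eq0P => x /memv_capP[xk /memv_imgP[y _ xE]].
    have : y \in lker (h \o h) by rewrite memv_ker comp_lfunE -xE -memv_ker.
    have /eqP <- : (lker h == lker (h \o h))%VS by rewrite eqEdim kh eqd leqnn.
    by rewrite memv_ker -xE => /eqP.
  split; split=> //; apply/eqP; rewrite eqEdim subvf /=.
  have := dimv_add_cap (lker h) (limg h); rewrite h0 dimv0 addn0 => ->.
  by rewrite -(limg_ker_dim h fullv) capfv.
have ltn' : (\dim {:N} - \dim (lker (h \o h)) < n)%N.
  by rewrite -nE ltn_sub2l // (leq_trans ltd) // dimvS // subvf.
have [g [[hg g0 gS gi gk] [gfix gf]]] := IHn _ ltn' _ erefl (is_hom_comp hh hh).
exists g; split; split=> //.
- apply: subv_trans gi _; apply/subvP => _ /memv_imgP[x _ ->].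
  by rewrite comp_lfunE memv_img // memvf.
- exact: subv_trans kh gk.
- by move=> x hx; apply: gfix; rewrite comp_lfunE !hx.
- by move=> W f fh x; apply: gf => y; rewrite comp_lfunE !fh.
Qed.

End GenericModules.

(** * Layers *)

(* A triangular decomposition of A: every element is a combination of products
   cc c * hh g * cs c', with cc c a cup diagram out of layer src c, cs c its
   mirror image, and hh l the group of units of layer l. *)
Record layering (k : fieldType) (A : falgType k) := Layering {
  nlay : nat;
  le : 'I_nlay.+1 -> A;
  CC : finType;
  src : CC -> 'I_nlay.+1;
  tgt : CC -> 'I_nlay.+1;
  cu : 'I_nlay.+1 -> CC;
  cc : CC -> A;
  cs : CC -> A;
  GG : 'I_nlay.+1 -> finGroupType;
  hh : forall l, GG l -> A;
  le_idem : forall i j, le i * le j = if i == j then le i else 0;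
  le_sum : \sum_i le i = 1;
  cu_src : forall l, src (cu l) = l;
  cu_tgt : forall l, tgt (cu l) = l;
  cc_cu : forall l, cc (cu l) = le l;
  cs_cu : forall l, cs (cu l) = le l;
  lt_tgt : forall c, c != cu (src c) -> (tgt c < src c)%N;
  cc_le : forall c, le (tgt c) * cc c * le (src c) = cc c;
  cs_le : forall c, le (src c) * cs c * le (tgt c) = cs c;
  hh1 : forall l, hh (1%g : GG l) = le l;
  hhM : forall l (g h : GG l), hh (g * h)%g = hh h * hh g;
  cc_cc : forall c c', tgt c' = src c -> exists c'' (g : GG (src c')),
    [/\ src c'' = src c', tgt c'' = tgt c & cc c * cc c' = cc c'' * hh g];
  hh_cc : forall c (g : GG (tgt c)), exists c'' (g' : GG (src c)),
    [/\ src c'' = src c, tgt c'' = tgt c & hh g * cc c = cc c'' * hh g'];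
  cs_cs : forall c c', tgt c' = src c -> exists c'' (g : GG (src c')),
    [/\ src c'' = src c', tgt c'' = tgt c & cs c' * cs c = hh g * cs c''];
  cs_hh : forall c (g : GG (tgt c)), exists c'' (g' : GG (src c)),
    [/\ src c'' = src c, tgt c'' = tgt c & cs c * hh g = hh g' * cs c''];
  A_span : forall U : {vspace A},
    (forall c c' l (g : GG l), src c = l -> src c' = l -> cc c * hh g * cs c' \in U) ->
    forall a, a \in U;
  A_dim : (\sum_l #|[pred c | src c == l]| ^ 2 * #|GG l| <= \dim {:A})%N;
  GG_unit : forall l, (#|GG l|%:R : k) != 0 }.

Section Layers.

Variables (k : fieldType) (A : falgType k) (B : layering A).
Local Notation I := ('I_(nlay B).+1).
Local Notation e := (@le k A B).
Local Notation src := (@src k A B).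
Local Notation tgt := (@tgt k A B).
Local Notation u := (@cu k A B).
Local Notation cc := (@cc k A B).
Local Notation cs := (@cs k A B).
Local Notation CC := (CC B).

Definition csize (l : I) : nat := #|[pred c | src c == l]|.

Lemma cc_layer l : #|[pred c | src c == l]| = csize l. Proof. by []. Qed.

Lemma sum_csize (f : I -> nat) : (\sum_(c : CC) f (src c) = \sum_l csize l * f l)%N.
Proof.
rewrite (partition_big src xpredT) //=; apply: eq_bigr => l _.
rewrite (eq_bigr (fun _ => f l)) => [|c /eqP-> //].
by rewrite sum_nat_const.
Qed.

Lemma le_layer c : (tgt c <= src c)%N.
Proof.
have [/eqP cE|/lt_tgt/ltnW//] := boolP (c == u (src c)).
by rewrite {1}cE cu_tgt.
Qed.

Lemma tgt_src_cu c : tgt c = src c -> c = u (src c).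
Proof. by move=> ts; apply/eqP; apply/idPn => /lt_tgt; rewrite ts ltnn. Qed.

Section OneModule.

Variable M : fdmod A.
Implicit Types (x : M) (U : {vspace M}).

Definition gr (l : I) : {vspace M} := limg (act M (e l)).

Lemma le_le i j x : e i ** (e j ** x) = if i == j then e i ** x else 0.
Proof. by rewrite -act_mul le_idem; case: eqP => // _; rewrite act0l. Qed.

Lemma mem_gr l x : (x \in gr l) = (e l ** x == x).
Proof.
apply/memv_imgP/eqP => [[y _ ->]|<-]; first by rewrite le_le eqxx.
by exists x; rewrite ?memvf.
Qed.

Lemma grP l x : x \in gr l -> e l ** x = x.
Proof. by rewrite mem_gr => /eqP. Qed.

Lemma gr_neq l j x : x \in gr l -> l != j -> e j ** x = 0.
Proof. by move=> /grP <- lj; rewrite le_le eq_sym (negPf lj). Qed.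

Lemma le_gr l x : e l ** x \in gr l.
Proof. by rewrite mem_gr le_le eqxx. Qed.

Lemma sum_le x : \sum_l e l ** x = x.
Proof. by rewrite -act_suml le_sum act_one. Qed.

Lemma ccE c x : cc c ** x = e (tgt c) ** (cc c ** (e (src c) ** x)).
Proof. by rewrite -!act_mul ?mulrA cc_le. Qed.

Lemma csE c x : cs c ** x = e (src c) ** (cs c ** (e (tgt c) ** x)).
Proof. by rewrite -!act_mul ?mulrA cs_le. Qed.

Lemma cc_gr c x : cc c ** x \in gr (tgt c). Proof. by rewrite ccE le_gr. Qed.
Lemma cs_gr c x : cs c ** x \in gr (src c). Proof. by rewrite csE le_gr. Qed.

Lemma cc_src c x : cc c ** (e (src c) ** x) = cc c ** x.
Proof. by rewrite [RHS]ccE [LHS]ccE le_le eqxx. Qed.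

Lemma cs_tgt c x : cs c ** (e (tgt c) ** x) = cs c ** x.
Proof. by rewrite [RHS]csE [LHS]csE le_le eqxx. Qed.

Lemma cc_0 c l x : x \in gr l -> l != src c -> cc c ** x = 0.
Proof. by move=> xl ls; rewrite -cc_src (gr_neq xl ls) linear0. Qed.

Lemma cs_0 c l x : x \in gr l -> l != tgt c -> cs c ** x = 0.
Proof. by move=> xl ls; rewrite -cs_tgt (gr_neq xl ls) linear0. Qed.

Lemma hh_e l (g : GG l) : e l * hh g = hh g /\ hh g * e l = hh g.
Proof. by rewrite -!hh1 -!hhM mulg1 mul1g. Qed.

Lemma hh_gr l (g : GG l) x : hh g ** x \in gr l.
Proof. by rewrite -(hh_e g).1 act_mul le_gr. Qed.

Lemma hh_le l (g : GG l) x : hh g ** (e l ** x) = hh g ** x.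
Proof. by rewrite -act_mul (hh_e g).2. Qed.

Definition graded U := forall l x, x \in U -> e l ** x \in U.

Lemma submod_graded U : submod U -> graded U.
Proof. by move=> /submodP sU l x; apply: sU. Qed.

Lemma graded_addcap U U' l : graded U -> graded U' ->
  ((U + U') :&: gr l = (U :&: gr l) + (U' :&: gr l))%VS.
Proof.
move=> gU gU'; apply/eqP; rewrite eqEsubv; apply/andP; split; last first.
  by rewrite subv_add !capvS ?addvSl ?addvSr.
apply/subvP => x /memv_capP[/addvP[y [z [Uy Uz ->]]] /grP<-].
by rewrite linearD memv_add // memv_cap le_gr ?gU ?gU'.
Qed.

Lemma graded_add U U' : graded U -> graded U' -> graded (U + U')%VS.
Proof.
move=> gU gU' l x /addvP[y [z [Uy Uz ->]]].
by rewrite linearD memv_add ?gU ?gU'.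
Qed.

Definition KK U : {vspace M} := (\sum_(c | c != u (src c)) (act M (cc c) @: U))%VS.

Lemma mem_KK U c x : c != u (src c) -> x \in U -> cc c ** x \in KK U.
Proof.
move=> cu xU; apply: (subvP (sumv_sup c cu (subvv _))); exact: memv_img.
Qed.

Lemma KK_le U (X : {vspace M}) :
  (forall c x, c != u (src c) -> x \in U -> cc c ** x \in X) -> (KK U <= X)%VS.
Proof.
move=> h; apply/subv_sumP => c cu; apply/subvP => _ /memv_imgP[x xU ->].
exact: h.
Qed.

Lemma KK_graded U : graded (KK U).
Proof.
move=> l x; move: x; suff /subvP h : (KK U <= act M (e l) @^-1: KK U)%VS.
  by move=> x /h; rewrite -memv_preim.
apply: KK_le => c x cu xU; rewrite -memv_preim.
have := cc_gr c x; have [<- /grP->|ne /gr_neq->//] := eqVneq (tgt c) l.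
  exact: mem_KK.
exact: mem0v.
Qed.

Lemma KK_sub U : submod U -> (KK U <= U)%VS.
Proof. by move=> /submodP sU; apply: KK_le => c x _; apply: sU. Qed.

Lemma KK_mono U U' : (U <= U')%VS -> (KK U <= KK U')%VS.
Proof. by move=> /subvP UU; apply: KK_le => c x cu /UU; apply: mem_KK. Qed.

Definition top l U U' : nat := (\dim (U' :&: gr l) - \dim ((KK U' + U) :&: gr l))%N.

(* By [top_bound], tops and socs are at least dim U' - dim U; the case of equality
   means that U'/U has a standard, respectively costandard, filtration. *)
Definition tops U U' : nat := (\sum_l csize l * top l U U')%N.

Lemma top_bound U U' : submod U -> submod U' -> (U <= U')%VS ->
  (\dim U' <= \dim U + tops U U')%N.
Proof.
move=> sU sU' UU'; have /submodP pU := sU; have /submodP pU' := sU'.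
pose X l := ((KK U' + U) :&: gr l)%VS.
pose W l := ((U' :&: gr l) :\: X l)%VS.
pose Y := (U + \sum_c (act M (cc c) @: W (src c)))%VS.
have XU l : (X l <= U' :&: gr l)%VS by rewrite capvS // subv_add KK_sub.
have dW l : \dim (W l) = top l U U'.
  have := dimv_cap_compl (U' :&: gr l) (X l).
  by rewrite (capv_idPr (XU l)) /top => <-; rewrite addKn.
have YU x : x \in U -> x \in Y by apply/subvP/addvSl.
have key : forall d c x, (nlay B - src c <= d)%N -> x \in U' -> x \in gr (src c) ->
    cc c ** x \in Y.
  elim=> [|d IHd] c x ltd xU' xg.
  - have {xU' xg} xWX : x \in (W (src c) + X (src c))%VS.
      by rewrite addv_diff (subvP (addvSl _ _)) // memv_cap xU' xg.
    case/addvP: xWX => w [y [Ww /memv_capP[yKU yg] ->]].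
    rewrite linearD memvD //.
      apply: (subvP (addvSr _ _)).
      by apply: (subvP (sumv_sup c isT (subvv _))); apply: memv_img.
    case/addvP: yKU => z [v [zK vU ->]]; rewrite linearD memvD //; last exact/YU/pU.
    move: zK; move: z {yg}; suff /subvP h : (KK U' <= act M (cc c) @^-1: Y)%VS.
      by move=> z /h; rewrite -memv_preim.
    apply: KK_le => c' z cu zU'; rewrite -memv_preim.
    have [tE|ne] := eqVneq (tgt c') (src c); last by rewrite (cc_0 (cc_gr c' z) ne) mem0v.
    have := lt_tgt cu; have := ltn_ord (src c'); move: ltd; rewrite tE.
    by move=> *; exfalso; lia.
  - have {xU' xg} xWX : x \in (W (src c) + X (src c))%VS.
      by rewrite addv_diff (subvP (addvSl _ _)) // memv_cap xU' xg.
    case/addvP: xWX => w [y [Ww /memv_capP[yKU yg] ->]].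
    rewrite linearD memvD //.
      apply: (subvP (addvSr _ _)).
      by apply: (subvP (sumv_sup c isT (subvv _))); apply: memv_img.
    case/addvP: yKU => z [v [zK vU ->]]; rewrite linearD memvD //; last exact/YU/pU.
    move: zK; move: z {yg}; suff /subvP h : (KK U' <= act M (cc c) @^-1: Y)%VS.
      by move=> z /h; rewrite -memv_preim.
    apply: KK_le => c' z cu zU'; rewrite -memv_preim.
    have [tE|ne] := eqVneq (tgt c') (src c); last by rewrite (cc_0 (cc_gr c' z) ne) mem0v.
    have [c'' [g [sE _ cE]]] := cc_cc tE; rewrite -act_mul cE act_mul.
    apply: IHd; first by rewrite sE; have := lt_tgt cu; move: ltd; rewrite tE; lia.
      exact: pU'.
    by rewrite sE hh_gr.
have : (U' <= Y)%VS.
  apply/subvP => x xU'; rewrite -(sum_le x); apply: memv_suml => l _.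
  rewrite -[e l ** x](grP (le_gr l x)) -cc_cu; apply: (key (nlay B)).
  - exact: leq_subr.
  - exact: pU'.
  - by rewrite cu_src cc_cu le_gr.
move/dimvS/leq_trans; apply; apply: leq_trans (dimv_add_leqif _ _) _.
rewrite leq_add2l; apply: leq_trans (dimv_sum_leq _ _ _) _.
rewrite /tops -(sum_csize (fun l => top l U U')); apply: leq_sum => c _.
by rewrite -dW -(limg_ker_dim (act M (cc c)) (W (src c))) leq_addl.
Qed.

Lemma top_trans l U U' U'' : submod U -> submod U' -> submod U'' ->
  (U <= U')%VS -> (U' <= U'')%VS -> (top l U U'' <= top l U U' + top l U' U'')%N.
Proof.
move=> sU sU' sU'' UU' U'U''.
have gU := submod_graded sU; have gU' := submod_graded sU'.
have UU'' := subv_trans UU' U'U''.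
pose X := (KK U'' + U)%VS; have gX : graded X by apply: graded_add => //; apply: KK_graded.
have E : ((KK U'' + U') :&: gr l = (X :&: gr l) + (U' :&: gr l))%VS.
  rewrite -graded_addcap // /X -addvA; congr ((_ + _) :&: _)%VS.
  by apply/esym/addv_idPr.
have := dimv_add_cap (X :&: gr l) (U' :&: gr l); rewrite -E.
have : (\dim ((KK U' + U) :&: gr l) <= \dim ((X :&: gr l) :&: (U' :&: gr l)))%N.
  apply: dimvS; rewrite subv_cap; apply/andP; split; apply: capvS => //.
    by rewrite addvS // KK_mono.
  by rewrite subv_add KK_sub.
have : (\dim ((KK U' + U) :&: gr l) <= \dim (U' :&: gr l))%N.
  by apply: dimvS; rewrite capvS // subv_add KK_sub.
have : (\dim ((KK U'' + U') :&: gr l) <= \dim (U'' :&: gr l))%N.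
  by apply: dimvS; rewrite capvS // subv_add KK_sub.
rewrite /top -/X; lia.
Qed.

Definition ZZ U U' : {vspace M} :=
  (U' :&: \bigcap_(c | c != u (src c)) (act M (cs c) @^-1: U))%VS.

Lemma mem_ZZ U U' x : reflect
  (x \in U' /\ forall c, c != u (src c) -> cs c ** x \in U) (x \in ZZ U U').
Proof.
apply: (iffP memv_capP) => [[xU' xc]|[xU' xc]]; split=> //.
  by move=> c cu; rewrite memv_preim; move: xc; rewrite memvE => /subv_bigcapP/(_ c cu).
by rewrite memvE; apply/subv_bigcapP => c cu; rewrite -memvE -memv_preim xc.
Qed.

Definition soc l U U' : nat := (\dim (ZZ U U' :&: gr l) - \dim (U :&: gr l))%N.

Lemma sub_ZZ U U' : submod U -> (U <= U')%VS -> (U <= ZZ U U')%VS.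
Proof.
move=> /submodP sU /subvP UU'; apply/subvP=> x xU; apply/mem_ZZ; split; first exact: UU'.
by move=> c _; apply: sU.
Qed.

Lemma ZZ_mono U U1 U2 : (U1 <= U2)%VS -> (ZZ U U1 <= ZZ U U2)%VS.
Proof. by move=> h; apply: capvS. Qed.

Definition socs U U' : nat := (\sum_l csize l * soc l U U')%N.

Lemma soc_bound U U' : submod U -> submod U' -> (U <= U')%VS ->
  (\dim U' <= \dim U + socs U U')%N.
Proof.
move=> sU sU' UU'; have /submodP pU := sU; have /submodP pU' := sU'.
pose Ul l := (U :&: gr l)%VS; pose Z l := (ZZ U U' :&: gr l)%VS.
pose W l := (Z l :\: Ul l)%VS.
have UZ l : (Ul l <= Z l)%VS by rewrite capvS // sub_ZZ.
have dW l : \dim (W l) = soc l U U'.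
  have := dimv_cap_compl (Z l) (Ul l).
  by rewrite (capv_idPr (UZ l)) /soc => <-; rewrite addKn.
pose pi l := daddv_pi (W l) (Ul l).
have piP l z : z \in Z l -> pi l z = 0 -> z \in U.
  move=> zZ piz; have zWU : z \in (W l + Ul l)%VS.
    by rewrite addv_diff (subvP (addvSl _ _)).
  have := daddv_pi_add (capv_diff _ _) zWU; rewrite -/(pi l) piz add0r => <-.
  by apply: (subvP (capvSl U (gr l))); apply: memv_pi.
pose th c := (pi (src c) \o act M (cs c))%VF.
have := dim_bigcap_ker (index_enum CC) th U'.
move/leq_trans; apply; apply: leq_add.
  apply: dimvS; apply/subvP => x /memv_capP[xU' xk].
  have thx c : th c x = 0.
    by apply/eqP; rewrite -memv_ker; move: xk; rewrite memvE => /subv_bigcapP/(_ c isT).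
  have key : forall d c, (nlay B - src c <= d)%N -> cs c ** x \in U.
    have step c : (forall c', (src c < src c')%N -> cs c' ** x \in U) -> cs c ** x \in U.
      move=> IH; apply: (piP (src c)); last by rewrite -[RHS](thx c) comp_lfunE.
      rewrite memv_cap cs_gr andbT; apply/mem_ZZ; split; first exact: pU'.
      move=> c' cu; have [tE|ne] := eqVneq (tgt c') (src c); last first.
        by rewrite (cs_0 (cs_gr c x)) ?mem0v // eq_sym.
      have [c'' [g [sE _ cE]]] := cs_cs tE; rewrite -act_mul cE act_mul.
      by apply/pU/IH; rewrite sE -tE lt_tgt.
    elim=> [|d IHd] c ltd; apply: step => c' lt.
      by have := ltn_ord (src c'); move: lt ltd => *; exfalso; lia.
    by apply: IHd; move: lt ltd; lia.
  rewrite -(sum_le x); apply: memv_suml => l _; rewrite -cs_cu.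
  by apply: (key (nlay B)); apply: leq_subr.
rewrite /socs -(sum_csize (fun l => soc l U U')); apply: leq_sum => c _.
rewrite -dW; apply: dimvS; apply/subvP => _ /memv_imgP[x _ ->].
by rewrite comp_lfunE memv_pi.
Qed.

Lemma soc_trans l U U' U'' : submod U -> submod U' -> submod U'' ->
  (U <= U')%VS -> (U' <= U'')%VS -> (soc l U U'' <= soc l U U' + soc l U' U'')%N.
Proof.
move=> sU sU' sU'' UU' U'U''.
pose Z := (ZZ U U'' :&: gr l)%VS; pose Ul := (U' :&: gr l)%VS.
have := dimv_add_cap Z Ul.
have : (\dim (Z :&: Ul) <= \dim (ZZ U U' :&: gr l))%N.
  apply: dimvS; apply/subvP=> x /memv_capP[/memv_capP[/mem_ZZ[_ xc] xg] /memv_capP[xU' _]].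
  by rewrite memv_cap xg andbT; apply/mem_ZZ.
have : (\dim (Z + Ul) <= \dim (ZZ U' U'' :&: gr l))%N.
  apply: dimvS; rewrite subv_add; apply/andP; split.
    apply/subvP=> x /memv_capP[/mem_ZZ[xU xc] xg].
    rewrite memv_cap xg andbT; apply/mem_ZZ; split=> // c cu.
    by apply: (subvP UU'); apply: xc.
  by apply: capvS => //; apply: sub_ZZ.
have : (\dim (U :&: gr l) <= \dim (ZZ U U' :&: gr l))%N.
  by apply: dimvS; apply: capvS => //; apply: sub_ZZ.
have : (\dim Ul <= \dim (ZZ U' U'' :&: gr l))%N.
  by apply: dimvS; apply: capvS => //; apply: sub_ZZ.
rewrite /soc -/Z -/Ul; lia.
Qed.

Definition free_over U U' := (tops U U' <= \dim U' - \dim U)%N.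
Lemma tops_trans U U' U'' : submod U -> submod U' -> submod U'' ->
  (U <= U')%VS -> (U' <= U'')%VS -> (tops U U'' <= tops U U' + tops U' U'')%N.
Proof.
move=> *; rewrite /tops /socs -big_split; apply: leq_sum => l _; rewrite /= -mulnDr leq_mul2l.
by rewrite top_trans ?orbT.
Qed.

Lemma socs_trans U U' U'' : submod U -> submod U' -> submod U'' ->
  (U <= U')%VS -> (U' <= U'')%VS -> (socs U U'' <= socs U U' + socs U' U'')%N.
Proof.
move=> *; rewrite /tops /socs -big_split; apply: leq_sum => l _; rewrite /= -mulnDr leq_mul2l.
by rewrite soc_trans ?orbT.
Qed.

Definition cofree_over U U' := (socs U U' <= \dim U' - \dim U)%N.

End OneModule.

Section SubquotientLayers.

Variables (M N : fdmod A) (U U' : {vspace M}).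
Hypotheses (sU : submod U) (sU' : submod U') (sqN : subquotient_iso U U' N).

Let UU' : (U <= U')%VS. Proof. by case: sqN. Qed.

Let sq_dim (f : 'Hom(M, N)) (X : {vspace M}) :
  (forall a x, x \in U' -> f (a ** x) = a ** f x) -> (U' :&: lker f)%VS = U ->
  graded X -> (U <= X)%VS -> (X <= U')%VS ->
  forall l, (f @: (X :&: gr M l) = (f @: X) :&: gr N l)%VS /\
    \dim ((f @: X) :&: gr N l) = (\dim (X :&: gr M l) - \dim (U :&: gr M l))%N.
Proof.
move=> hf kf gX UX XU' l; have E : (f @: (X :&: gr M l) = (f @: X) :&: gr N l)%VS.
  apply/vspaceP => y; apply/memv_imgP/memv_capP => [[x /memv_capP[xX xg] ->]|].
    split; first exact: memv_img.
    by rewrite mem_gr -hf ?(grP xg) // (subvP XU').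
  case=> /memv_imgP[x xX ->] /grP yE; exists (e l ** x).
    by rewrite memv_cap gX // le_gr.
  by rewrite hf ?yE // (subvP XU').
split=> //; rewrite -E -(limg_ker_dim f (X :&: gr M l)).
have -> : (X :&: gr M l :&: lker f = U :&: gr M l)%VS; last by rewrite addKn.
apply/vspaceP=> x; rewrite -kf !memv_cap.
case xX: (x \in X); first by rewrite (subvP XU' _ xX) andbC /= andbC.
rewrite /=; apply/esym/negP => /andP[/andP[xU' xk] _]; move: xX.
by rewrite (subvP UX) // -kf memv_cap xU' xk.
Qed.

Lemma dim_sq : \dim {:N} = (\dim U' - \dim U)%N.
Proof.
case: sqN => _ [f [_ fS kf]]; rewrite -fS -(limg_ker_dim f U') kf.
by rewrite addKn.
Qed.

Lemma gr_sq l : \dim (gr N l) = (\dim (U' :&: gr M l) - \dim (U :&: gr M l))%N.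
Proof.
case: sqN => _ [f [hf fS kf]].
have [_] := sq_dim hf kf (submod_graded sU') UU' (subvv _) l.
by rewrite fS capfv.
Qed.

Lemma top_sq l : top l 0%VS (fullv : {vspace N}) = top l U U'.
Proof.
case: sqN => _ [f [hf fS kf]].
have sKU : (KK U' + U <= U')%VS by rewrite subv_add KK_sub.
have gKU : graded (KK U' + U)%VS.
  by apply: graded_add; [apply: KK_graded | apply: submod_graded].
have [_] := sq_dim hf kf gKU (addvSr _ _) sKU l.
have -> : (f @: (KK U' + U) = KK (fullv : {vspace N}) + 0)%VS.
  rewrite addv0; apply/eqP; rewrite eqEsubv; apply/andP; split.
    rewrite limgD subv_add; apply/andP; split; last first.
      apply/subvP => _ /memv_imgP[x xU ->]; move: xU; rewrite -kf => /memv_capP[_].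
      by rewrite memv_ker => /eqP->; apply: mem0v.
    rewrite limg_sum; apply/subv_sumP=> c cu; apply/subvP => _ /memv_imgP[_ /memv_imgP[x xU ->] ->].
    by rewrite hf // mem_KK // memvf.
  apply: KK_le => c y cu _; have /memv_imgP[x xU' ->] : y \in (f @: U')%VS by rewrite fS memvf.
  rewrite -hf // memv_img // (subvP (addvSl _ _)) //; exact: mem_KK.
rewrite /top => ->; rewrite capfv gr_sq.
have : (\dim (U :&: gr M l) <= \dim ((KK U' + U) :&: gr M l))%N.
  by apply: dimvS; apply: capvS => //; apply: addvSr.
have : (\dim ((KK U' + U) :&: gr M l) <= \dim (U' :&: gr M l))%N.
  by apply: dimvS; apply: capvS.
lia.
Qed.

Lemma soc_sq l : soc l 0%VS (fullv : {vspace N}) = soc l U U'.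
Proof.
case: sqN => _ [f [hf fS kf]]; have /submodP pU' := sU'; have /submodP pU := sU.
have UZ := sub_ZZ sU UU'.
have gZ : graded (ZZ U U').
  move=> j x /mem_ZZ[xU' xc]; apply/mem_ZZ; split; first exact: pU'.
  move=> c cu; have [->|ne] := eqVneq j (tgt c); first by rewrite cs_tgt xc.
  by rewrite (cs_0 (le_gr j x) ne) mem0v.
have [_] := sq_dim hf kf gZ UZ (capvSl _ _) l.
have -> : (f @: ZZ U U' = ZZ 0 (fullv : {vspace N}))%VS.
  apply/vspaceP => y; apply/memv_imgP/mem_ZZ => [[x /mem_ZZ[xU' xc] ->]|[_ yc]].
    split; [exact: memvf | move=> c cu]; rewrite -hf // memv0 -memv_ker.
    by have := xc c cu; rewrite -kf => /memv_capP[].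
  have /memv_imgP[x xU' yE] : y \in (f @: U')%VS by rewrite fS memvf.
  exists x => //; apply/mem_ZZ; split=> // c cu; rewrite -kf memv_cap pU' //=.
  by rewrite memv_ker hf // -yE -memv0 yc.
by rewrite /soc cap0v dimv0 subn0.
Qed.

Lemma tops_sq : tops 0%VS (fullv : {vspace N}) = tops U U'.
Proof. by apply: eq_bigr => l _; rewrite top_sq. Qed.

Lemma socs_sq : socs 0%VS (fullv : {vspace N}) = socs U U'.
Proof. by apply: eq_bigr => l _; rewrite soc_sq. Qed.

End SubquotientLayers.

End Layers.

(** * Standard and costandard steps *)

Section Regular.

Variables (k : fieldType) (A : falgType k).

Lemma reg_linear : linear (@amull k A).
Proof.
move=> c a b; apply/lfunP => x; rewrite add_lfunE scale_lfunE !lfunE /=.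
by rewrite mulrDl scalerAl.
Qed.

Lemma reg1 : amull (1 : A) = \1%VF.
Proof. by apply/lfunP => x; rewrite lfunE id_lfunE /= mul1r. Qed.

Lemma regM (a b : A) : amull (a * b) = (amull a \o amull b)%VF.
Proof. by apply/lfunP => x; rewrite comp_lfunE !lfunE /= mulrA. Qed.

Definition reg : fdmod A := FdMod reg_linear reg1 regM.

Lemma regE (a : A) (x : reg) : a ** x = a * x :> A.
Proof. by rewrite -[LHS]/(amull a x) lfunE. Qed.

Definition coreg_act (a : A) : 'End('Hom(A, k^o)) :=
  linfun (fun f : 'Hom(A, k^o) => (f \o amulr a)%VF).

Lemma coreg_actE a f x : coreg_act a f x = f (x * a).
Proof.
have lin : linear (fun f : 'Hom(A, k^o) => (f \o amulr a)%VF).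
  by move=> c g h; apply/lfunP=> y; rewrite !(comp_lfunE, add_lfunE, scale_lfunE).
pose H := GRing.isLinear.Build _ _ _ _ _ lin.
pose g : {linear _ -> _} := HB.pack (fun f : 'Hom(A, k^o) => (f \o amulr a)%VF) H.
by rewrite /coreg_act -[linfun _]/(linfun g) lfunE /= comp_lfunE lfunE.
Qed.

Lemma coreg_linear : linear coreg_act.
Proof.
move=> c a b; apply/lfunP => f; apply/lfunP => x.
rewrite add_lfunE scale_lfunE add_lfunE scale_lfunE !coreg_actE.
by rewrite mulrDr -scalerAr linearP.
Qed.

Lemma coreg1 : coreg_act 1 = \1%VF.
Proof. by apply/lfunP => f; apply/lfunP => x; rewrite coreg_actE id_lfunE mulr1. Qed.

Lemma coregM (a b : A) : coreg_act (a * b) = (coreg_act a \o coreg_act b)%VF.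
Proof.
by apply/lfunP => f; apply/lfunP => x; rewrite comp_lfunE !coreg_actE mulrA.
Qed.

Definition coreg : fdmod A := FdMod coreg_linear coreg1 coregM.

Lemma coregE (a : A) (f : coreg) x : (a ** f : 'Hom(A, k^o)) x = (f : 'Hom(A, k^o)) (x * a).
Proof. exact: coreg_actE. Qed.

Lemma ev_exists (M : fdmod A) (x : M) : exists f : 'Hom(A, M), forall a, f a = a ** x.
Proof. by apply: lfun_of_linear => c a b; rewrite actDl actZl. Qed.

End Regular.

Section Steps.

Variables (k : fieldType) (A : falgType k) (B : layering A).
Local Notation I := ('I_(nlay B).+1).
Local Notation e := (@le k A B).
Local Notation src := (@src k A B).
Local Notation tgt := (@tgt k A B).
Local Notation u := (@cu k A B).
Local Notation cc := (@cc k A B).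
Local Notation cs := (@cs k A B).
Local Notation CC := (CC B).
Local Notation gr := (@gr k A B).

Section Averaging.

Variables (M N : fdmod A) (l : I) (f : 'Hom(M, N)).

Definition avg : 'Hom(M, N) :=
  (#|GG l|%:R : k)^-1 *: \sum_(g : GG l) (act N (hh g^-1%g) \o f \o act M (hh g))%VF.

Lemma avgE x : avg x = (#|GG l|%:R : k)^-1 *: \sum_(g : GG l) hh g^-1%g ** f (hh g ** x).
Proof.
rewrite scale_lfunE sum_lfunE; congr (_ *: _); apply: eq_bigr => g _.
by rewrite !comp_lfunE.
Qed.

Lemma avg_equiv (g : GG l) x : avg (hh g ** x) = hh g ** avg x.
Proof.
rewrite !avgE [RHS]linearZ; congr (_ *: _); rewrite [RHS]linear_sum.
rewrite (reindex_inj (mulgI g^-1)%g) /=; apply: eq_bigr => h _.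
by rewrite -!act_mul -!hhM mulKVg invMg invgK.
Qed.

Lemma avg_const x y :
  (forall g : GG l, hh g^-1%g ** f (hh g ** x) = y) -> avg x = y.
Proof.
move=> h; rewrite avgE (eq_bigr (fun _ => y)) => [|g _]; last exact: h.
by rewrite sumr_const cardT -cardE -scaler_nat scalerA mulVf ?scale1r ?GG_unit.
Qed.

Lemma avg_mem x (U : {vspace N}) :
  (forall g : GG l, hh g^-1%g ** f (hh g ** x) \in U) -> avg x \in U.
Proof. by move=> h; rewrite avgE memvZ // memv_suml. Qed.

End Averaging.

Section OneModule.

Variable M : fdmod A.
Implicit Types (x : M) (U X : {vspace M}).

Definition hstable (l : I) X := forall (g : GG l) x, x \in X -> hh g ** x \in X.

Lemma submod_hstable l X : submod X -> hstable l X.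
Proof. by move=> /submodP sX g x; apply: sX. Qed.

Lemma hstable_cap l X U : hstable l X -> hstable l U -> hstable l (X :&: U)%VS.
Proof.
by move=> sX sU g x /memv_capP[xX xU]; rewrite memv_cap sX ?sU.
Qed.

Lemma gr_hstable l : hstable l (gr M l).
Proof. by move=> g x _; apply: hh_gr. Qed.

Lemma maschke l X W : (X <= gr M l)%VS -> hstable l X -> hstable l W -> (W <= X)%VS ->
  exists W', [/\ hstable l W', (W' <= X)%VS, (W :&: W')%VS = 0%VS & (W + W')%VS = X].
Proof.
move=> Xg sX sW WX; pose pi := avg l (projv W : 'Hom(M, M)).
have piW x : x \in W -> pi x = x.
  move=> xW; apply: avg_const => g; rewrite projv_id; last exact: sW.
  by rewrite -act_mul -hhM mulgV hh1 grP // (subvP Xg) // (subvP WX).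
have piX x : x \in X -> pi x \in W.
  by move=> xX; apply: avg_mem => g; apply: sW; apply: memv_proj.
exists (X :&: lker pi)%VS; split.
- apply: hstable_cap => // g x; rewrite !memv_ker avg_equiv => /eqP->.
  by rewrite linear0.
- exact: capvSl.
- apply: vspace_eq0P => x /memv_capP[xW /memv_capP[_]].
  by rewrite memv_ker piW // => /eqP.
- apply/eqP; rewrite eqEsubv subv_add WX capvSl; apply/subvP => x xX.
  rewrite -(subrK (pi x) x) addrC memv_add ?piX // memv_cap memvB //.
    by rewrite memv_ker linearB /= [pi (pi x)]piW ?subrr ?piX.
  by apply: (subvP WX); apply: piX.
Qed.

Lemma A_ind x U :
  (forall c c' (l : I) (g : GG l), src c = l -> src c' = l ->
     cc c ** (hh g ** (cs c' ** x)) \in U) ->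
  forall a, a ** x \in U.
Proof.
move=> h a; have [ev evE] := ev_exists x.
rewrite -evE memv_preim; apply: (@A_span _ _ B) => c c' l g sc sc'.
by rewrite -memv_preim evE !act_mul h.
Qed.

Definition layer_span (l : I) X : {vspace M} := (\sum_(c | src c == l) (act M (cc c) @: X))%VS.

Lemma mem_layer_span l X c x : src c = l -> x \in X -> cc c ** x \in layer_span l X.
Proof.
move=> /eqP sc xX; apply: (subvP (sumv_sup c sc (subvv _))); exact: memv_img.
Qed.

Lemma dim_layer_span l X : (\dim (layer_span l X) <= csize l * \dim X)%N.
Proof.
apply: leq_trans (dimv_sum_leq _ _ _) _; rewrite -[(csize l * _)%N]sum_nat_const.
apply: leq_sum => c _.
by rewrite -(limg_ker_dim (act M (cc c)) X) leq_addl.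
Qed.

Lemma layer_direct l U X :
  (\dim U + csize l * \dim X <= \dim (U + layer_span l X))%N ->
  forall x (s : CC -> M), x \in U -> (forall c, s c \in X) ->
    x + \sum_(c | src c == l) cc c ** s c = 0 ->
    x = 0 /\ forall c, src c = l -> s c = 0.
Proof.
move=> dimE x s xU sX s0.
pose Y c := (act M (cc c) @: X)%VS.
have leY c : (\dim (Y c) <= \dim X)%N.
  by rewrite -(limg_ker_dim (act M (cc c)) X) leq_addl.
have leS : (\sum_(c | src c == l) \dim (Y c) <= csize l * \dim X)%N.
  by rewrite -[(csize l * _)%N]sum_nat_const; apply: leq_sum => c _.
have dir : directv (U + \sum_(c | src c == l) Y c).
  rewrite directvEgeq /=; apply: leq_trans dimE; by rewrite leq_add2l.
have eqS : \sum_(c | src c == l) \dim (Y c) = (csize l * \dim X)%N.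
  apply/eqP; rewrite eqn_leq leS /= -(leq_add2l (\dim U)).
  apply: leq_trans dimE _; apply: leq_trans (dimv_add_leqif _ _) _.
  by rewrite leq_add2l; apply: dimv_sum_leq.
have dY c : src c = l -> \dim (Y c) = \dim X.
  move=> sc; have := eqS; rewrite -[(csize l * _)%N]sum_nat_const => eqS'.
  have h := leqif_sum (fun (c : CC) (_ : src c == l) => leqif_eq (leY c)).
  have := (geq_leqif h); rewrite eqS' leqnn => /esym/forall_inP/(_ c).
  by rewrite sc eqxx => /(_ isT)/eqP.
move: dir; rewrite directv_addE => /and3P[_ dS /eqP cap0].
have sumY : \sum_(c | src c == l) cc c ** s c \in (\sum_(c | src c == l) Y c)%VS.
  by apply: memv_sumr => c _; apply: memv_img.
have x0 : x = 0.
  apply/eqP; rewrite -memv0 -cap0 memv_cap xU /=.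
  by rewrite (canRL (addrK _) s0) sub0r memvN.
split=> // c sc; move: s0; rewrite x0 add0r => s0.
have /(_ c) := directv_sum_independent dS _ (fun c _ => memv_img _ (sX c)) s0.
rewrite sc eqxx => /(_ isT) cc0.
have : s c \in (X :&: lker (act M (cc c)))%VS by rewrite memv_cap sX memv_ker cc0 eqxx.
have := limg_ker_dim (act M (cc c)) X; rewrite -/(Y c) dY // => dk.
have -> : (X :&: lker (act M (cc c)))%VS = 0%VS.
  by apply/eqP; rewrite -dimv_eq0; move: dk; lia.
by rewrite memv0 => /eqP.
Qed.

Lemma gen_layer l U X : submod U -> (X <= gr M l)%VS -> hstable l X ->
  (forall c x, c != u l -> x \in X -> cs c ** x \in U) ->
  (gensub X <= U + layer_span l X)%VS.
Proof.
move=> /submodP sU Xg sX XU; apply: aspan_le => a x _ xX.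
apply: A_ind => c c' j g sc sc'; have xg := subvP Xg _ xX.
have [c'E|ne] := eqVneq c' (u l); last first.
  by apply: (subvP (addvSl _ _)); do 2!apply: (sU); apply: XU.
have jl : j = l by rewrite -sc' c'E cu_src.
move: g sc; rewrite jl => g sc; apply: (subvP (addvSr _ _)).
rewrite c'E cs_cu (grP xg).
by apply: mem_layer_span => //; apply: sX.
Qed.

Section FreeStep.

Variables (U S : {vspace M}) (l : I).
Hypotheses (sU : submod U) (Ul : forall l' : I, (l < l')%N -> (gr M l' <= U)%VS).
Hypotheses (Sg : (S <= gr M l)%VS) (sS : hstable l S) (SU : (S :&: U)%VS = 0%VS).
Hypothesis freeU : free_over B U (fullv : {vspace M}).

Lemma caps_above c x : c != u l -> x \in gr M l -> cs c ** x \in U.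
Proof.
move=> cu xg; have [tl|ne] := eqVneq l (tgt c); last by rewrite (cs_0 xg ne) mem0v.
apply: (subvP (Ul (l' := src c) _)); last exact: cs_gr.
rewrite tl; apply: lt_tgt; apply: contra cu => /eqP cE; move: tl; rewrite cE cu_tgt => ->.
by [].
Qed.

Let X := (U + gensub S)%VS.

Lemma free_step_submod : submod X.
Proof. by apply: submodD => //; apply: gensub_submod. Qed.

Lemma free_step_span : X = (U + layer_span l S)%VS.
Proof.
apply/eqP; rewrite eqEsubv !subv_add !addvSl /=; apply/andP; split.
  apply: gen_layer => // c x cu xS; apply: caps_above => //; exact: (subvP Sg).
apply: subv_trans (addvSr _ _); apply/subv_sumP => c _; apply/subvP => _ /memv_imgP[x xS ->].
exact: mem_gensub.
Qed.

Let dimX_le : (\dim X <= \dim U + csize l * \dim S)%N.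
Proof.
rewrite free_step_span; apply: leq_trans (dimv_add_leqif _ _) _.
by rewrite leq_add2l dim_layer_span.
Qed.

Let UX : (U <= X)%VS. Proof. exact: addvSl. Qed.

Let topX : (tops B X fullv + csize l * \dim S <= tops B U fullv)%N.
Proof.
rewrite /tops.
have mono (j : I) : (top j X fullv <= top j U fullv)%N.
  by apply: leq_sub2l; apply: dimvS; apply: capvS => //; apply: addvS.
rewrite (bigD1 l) //= [X in (_ <= X)%N](bigD1 l) //= addnAC -mulnDr.
apply: leq_add; last by apply: leq_sum => j _; rewrite leq_mul2l mono orbT.
rewrite leq_mul2l; apply/orP; right.
have KU : ((KK B fullv + U) :&: gr M l <= U :&: gr M l)%VS.
  rewrite graded_addcap; [|exact: KK_graded|exact: submod_graded].
  rewrite subv_add subvv andbT subv_cap capvSr andbT.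
  apply/subvP => x /memv_capP[xK xg]; rewrite -(grP xg).
  move: xK; move: x {xg}; suff /subvP h : (KK B fullv <= act M (e l) @^-1: U)%VS.
    by move=> x /h; rewrite -memv_preim.
  apply: KK_le => c y cu _; rewrite -memv_preim.
  have [tl|ne] := eqVneq (tgt c) l; last by rewrite (gr_neq (cc_gr c y) ne) mem0v.
  have /submodP pU := sU; rewrite -cc_src; do 2!apply: (pU).
  by apply: (subvP (Ul (l' := src c) _)); [rewrite -tl lt_tgt | apply: le_gr].
have US : (U :&: gr M l + S <= (KK B fullv + X) :&: gr M l)%VS.
  rewrite subv_add; apply/andP; split.
    by apply: capvS => //; apply: subv_trans UX (addvSr _ _).
  rewrite subv_cap Sg andbT; apply: subv_trans (sub_gensub S) _.
  exact: subv_trans (addvSr U _) (addvSr _ _).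
have := dimv_add_cap (U :&: gr M l) S.
have -> : ((U :&: gr M l) :&: S)%VS = 0%VS.
  by apply/eqP; rewrite -subv0 -SU capvC capvS // capvSl.
rewrite dimv0 addn0 => dE; have := dimvS US; rewrite dE.
have := dimvS KU; have : (\dim ((KK B fullv + X) :&: gr M l) <= \dim (fullv :&: gr M l))%N.
  by apply: dimvS; apply: capvS => //; apply: subvf.
rewrite /top; lia.
Qed.

Lemma free_step : \dim X = (\dim U + csize l * \dim S)%N /\ free_over B X fullv.
Proof.
have b := top_bound B free_step_submod (@submodf _ _ M) (subvf X).
have := dimvS (subvf X); have := dimvS (subvf U); have := dimX_le; have := topX.
move: freeU b; rewrite /free_over; lia.
Qed.

Lemma free_step_direct x (s : CC -> M) : x \in U -> (forall c, s c \in S) ->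
    x + \sum_(c | src c == l) cc c ** s c = 0 ->
    x = 0 /\ forall c, src c = l -> s c = 0.
Proof. by apply: layer_direct; rewrite -free_step_span free_step.1. Qed.

End FreeStep.

Section CofreeStep.

Variables (X S : {vspace M}) (l : I).
Hypotheses (sX : submod X) (Xl : forall l' : I, (l < l')%N -> (X :&: gr M l')%VS = 0%VS).
Hypotheses (SX : (S <= X :&: gr M l)%VS) (sS : hstable l S).
Hypothesis cofreeX : cofree_over B 0%VS X.

Let X' := (X :&: colon (e l) S)%VS.

Lemma caps_zero c x : c != u l -> x \in (X :&: gr M l)%VS -> cs c ** x = 0.
Proof.
move=> cu /memv_capP[xX xg]; have [tl|ne] := eqVneq l (tgt c); last by rewrite (cs_0 xg ne).
apply/eqP; rewrite -memv0 -(Xl (l' := src c)).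
  by rewrite memv_cap cs_gr andbT; move/submodP: sX; apply.
rewrite tl; apply: lt_tgt; apply: contra cu => /eqP cE; move: tl; rewrite cE cu_tgt => ->.
by [].
Qed.

Lemma cofree_step_submod : submod X'.
Proof. by apply: submod_cap => //; apply: colon_submod. Qed.

Let e_cc c c' l' (g : GG l') x : src c = l' -> src c' = l' -> x \in X ->
  (l' = l -> cs c' ** x \in S) -> e l ** (cc c ** (hh g ** (cs c' ** x))) \in S.
Proof.
move=> sc sc' xX h; have [tl|ne] := eqVneq (tgt c) l; last first.
  by rewrite (gr_neq (cc_gr c _) ne) mem0v.
have [l'l|ne] := eqVneq l' l; last first.
  have cl : (l < l')%N.
    rewrite -tl -sc; apply: lt_tgt; apply: contra ne => /eqP cE.
    by rewrite -sc -tl {2}cE cu_tgt.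
  have -> : cs c' ** x = 0; last by rewrite !linear0 mem0v.
  apply/eqP; rewrite -memv0 -(Xl cl) memv_cap -[X in gr M X]sc' cs_gr andbT.
  by move/submodP: sX; apply.
have cE : c = u l by rewrite -l'l -sc; apply: tgt_src_cu; rewrite tl sc l'l.
rewrite cE cc_cu le_le eqxx; move: h g; rewrite l'l => h g; rewrite (grP (hh_gr g _)).
by apply: sS; apply: h.
Qed.

Lemma cofree_step_top : (X' :&: gr M l)%VS = S.
Proof.
apply/eqP; rewrite eqEsubv; apply/andP; split.
  apply/subvP=> x /memv_capP[/memv_capP[_ /mem_colon/(_ 1)]].
  by rewrite act_one => + /grP xg; rewrite xg.
have Sg := subv_trans SX (capvSr _ _).
rewrite !subv_cap (subv_trans SX (capvSl _ _)) Sg /= andbT.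
apply/subvP => x xS; apply/mem_colon => b; rewrite memv_preim; apply: A_ind.
move=> c c' j g sc sc'; rewrite -memv_preim.
apply: (e_cc g sc sc') => [|jl]; first exact: (subvP (subv_trans SX (capvSl _ _))).
have [cE|ne] := eqVneq c' (u l); first by rewrite cE cs_cu (grP (subvP Sg _ xS)).
by rewrite caps_zero ?mem0v // (subvP SX).
Qed.

Let X'X : (X' <= X)%VS. Proof. exact: capvSl. Qed.

Let socX : (socs B 0 X' + csize l * (\dim (X :&: gr M l) - \dim S) <= socs B 0 X)%N.
Proof.
rewrite /socs.
have mono (j : I) : (soc j 0%VS X' <= soc j 0%VS X)%N.
  by apply: leq_sub2r; apply: dimvS; apply: capvS => //; apply: ZZ_mono.
rewrite (bigD1 l) //= [X in (_ <= X)%N](bigD1 l) //= addnAC -mulnDr.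
apply: leq_add; last by apply: leq_sum => j _; rewrite leq_mul2l mono orbT.
rewrite leq_mul2l; apply/orP; right; rewrite /soc cap0v dimv0 !subn0.
have : (\dim (ZZ B 0 X' :&: gr M l) <= \dim S)%N.
  by rewrite -cofree_step_top; apply: dimvS; apply: capvS => //; apply: capvSl.
have : (\dim (X :&: gr M l) <= \dim (ZZ B 0 X :&: gr M l))%N.
  apply: dimvS; apply/subvP => x xX; have /memv_capP[xX1 xg] := xX.
  rewrite memv_cap xg andbT; apply/mem_ZZ; split=> // c cu.
  have [ul|ne] := eqVneq c (u l); last by rewrite caps_zero ?mem0v.
  by move: cu; rewrite ul cu_src eqxx.
have := dimvS SX; lia.
Qed.

Let socX' : (socs B X' X <= csize l * (\dim (X :&: gr M l) - \dim S))%N.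
Proof.
rewrite /socs.
rewrite (bigD1 l) //= big1 ?addn0 => [|j jl].
  rewrite leq_mul2l; apply/orP; right; rewrite /soc cofree_step_top.
  by apply: leq_sub2r; apply: dimvS; apply: capvS => //; apply: capvSl.
apply/eqP; rewrite muln_eq0 subn_eq0; apply/orP; right; apply: dimvS.
apply/subvP => x /memv_capP[/mem_ZZ[xX xc] xg]; rewrite memv_cap xg andbT memv_cap xX /=.
apply/mem_colon => b; rewrite memv_preim; apply: A_ind => c c' i g sc sc'.
rewrite -memv_preim; apply: (e_cc g sc sc') => // il.
have [tj|ne] := eqVneq j (tgt c'); last by rewrite (cs_0 xg ne) mem0v.
rewrite -cofree_step_top memv_cap -[X in gr M X]il -[X in gr M X]sc' cs_gr andbT xc //.
by apply: contra jl => /eqP cE; rewrite tj cE cu_tgt sc' il.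
Qed.

Lemma cofree_step : cofree_over B 0%VS X' /\
  \dim X = (\dim X' + csize l * (\dim (X :&: gr M l) - \dim S))%N.
Proof.
have b1 := soc_bound B cofree_step_submod sX X'X.
have b2 := soc_bound B (@submod0 _ _ M) cofree_step_submod (sub0v _).
have := dimvS X'X; have := socX; have := socX'.
move: cofreeX b1 b2; rewrite /cofree_over dimv0; lia.
Qed.

End CofreeStep.
End OneModule.
End Steps.

(** * Standard modules *)

Definition equivariant (k : fieldType) (A : falgType k) (B : layering A)
    (l : 'I_(nlay B).+1) (S : vectType k) (r : GG l -> 'End(S)) (M : fdmod A)
    (f : 'Hom(S, M)) : Prop :=
  forall g y, f (r g y) = hh g ** f y.

(* A complete list Sp of simple modules of the groups GG l, and the action on
   them of the algebra Rs spanned by the cupless diagrams. *)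
Record labelling (k : fieldType) (A : falgType k) (B : layering A) := Labelling {
  Lab : Type;
  lay : Lab -> 'I_(nlay B).+1;
  Sp : Lab -> vectType k;
  rho : forall lab, GG (lay lab) -> 'End(Sp lab);
  Rs : {vspace A};
  ract : forall lab, A -> Sp lab -> Sp lab;
  Rs_mem : forall c (l : 'I_(nlay B).+1) (g : GG l), src c = l -> hh g * cs c \in Rs;
  Rs_ind : forall U : {vspace A},
    (forall c (l : 'I_(nlay B).+1) (g : GG l), src c = l -> hh g * cs c \in U) ->
    (Rs <= U)%VS;
  ract_linear : forall lab y, linear (fun a => @ract lab a y);
  ract_hh : forall lab (g : GG (lay lab)) y, ract (hh g) y = rho g y;
  ract_cs : forall lab c (l : 'I_(nlay B).+1) (g : GG l) (y : Sp lab), src c = l -> c != cu (lay lab) ->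
    ract (hh g * cs c) y = 0;
  Sp_neq0 : forall lab, (fullv : {vspace Sp lab}) <> 0%VS;
  Sp_simple : forall lab (X : {vspace Sp lab}),
    (forall g x, x \in X -> rho g x \in X) -> X = 0%VS \/ X = fullv;
  Sp_inj : forall (M : fdmod A) lab lab' (f : 'Hom(Sp lab, M)) (f' : 'Hom(Sp lab', M)),
    lay lab = lay lab' -> equivariant (@rho lab) f -> equivariant (@rho lab') f' ->
    lker f = 0%VS -> lker f' = 0%VS -> limg f = limg f' -> lab = lab';
  Sp_exists : forall (M : fdmod A) (l : 'I_(nlay B).+1) (W : {vspace M}),
    (W <= gr M l)%VS -> hstable l W -> W <> 0%VS ->
    exists lab (f : 'Hom(Sp lab, M)),
      [/\ lay lab = l, lker f = 0%VS, equivariant (@rho lab) f & (limg f <= W)%VS];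
  Sp_reg : forall lab, exists f : 'Hom(Sp lab, reg A),
    [/\ equivariant (@rho lab) f, (limg f <= gr (reg A) (lay lab))%VS &
        forall y, f y \in KK B fullv -> y = 0] }.

Lemma has_filtration_append (k : fieldType) (A : falgType k) (C : fdmod A -> Prop)
    (M N : fdmod A) (U X : {vspace M}) :
  has_filtration C U -> submod X -> C N -> subquotient_iso U X N -> has_filtration C X.
Proof.
move=> [l [E [E0 El sE cE]]] sX CN sq.
exists l.+1, (fun i => if (i <= l)%N then E i else X); split=> //.
- by rewrite ltnn.
- by move=> i _; case: ifP => // /sE.
move=> i; rewrite ltnS => il; rewrite il; case: ifP => [lt|]; first exact: cE.
move=> /negbT; rewrite -ltnNge ltnS => li.
have -> : i = l by apply/eqP; rewrite eqn_leq il li.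
by exists N => //; rewrite El.
Qed.

Lemma has_filtration0 (k : fieldType) (A : falgType k) (C : fdmod A -> Prop) (M : fdmod A) :
  has_filtration C (0%VS : {vspace M}).
Proof.
exists 0%N, (fun=> 0%VS); split=> // i _; exact: submod0.
Qed.

Section Standard.

Variables (k : fieldType) (A : falgType k) (B : layering A) (Y : labelling B).
Local Notation I := ('I_(nlay B).+1).
Local Notation e := (@le k A B).
Local Notation src := (@src k A B).
Local Notation tgt := (@tgt k A B).
Local Notation u := (@cu k A B).
Local Notation cc := (@cc k A B).
Local Notation cs := (@cs k A B).
Local Notation CC := (CC B).
Local Notation gr := (@gr k A B).
Local Notation Lab := (Lab Y).
Local Notation lay := (@lay k A B Y).
Local Notation Sp := (@Sp k A B Y).
Local Notation rho lab := (@rho k A B Y lab).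
Implicit Types (M N D L P : fdmod A) (lab : Lab).

Definition Std lab D : Prop := is_induced (Rs Y) (@ract k A B Y lab) D.

Section LabelMaps.
Variables (lab : Lab) (M : fdmod A) (f : 'Hom(Sp lab, M)).

Definition killed : Prop := forall c y, c != u (lay lab) -> cs c ** f y = 0.

Lemma killed_gr : killed -> (limg f <= gr M (lay lab))%VS.
Proof.
move=> fk; apply/subvP => _ /memv_imgP[y _ ->].
rewrite -(sum_le B (f y)); apply: memv_suml => l _.
have [->|ne] := eqVneq l (lay lab); first exact: le_gr.
rewrite -cs_cu fk ?mem0v //; apply: contra ne => /eqP/(congr1 src).
by rewrite !cu_src => ->.
Qed.

Lemma killedP : killed <-> (limg f <= gr M (lay lab))%VS /\
  forall c y, c != u (src c) -> cs c ** f y = 0.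
Proof.
split=> [fk|[fg fk] c y cu].
  split; first exact: killed_gr.
  move=> c y cu; have [ts|ne] := eqVneq (tgt c) (lay lab).
    apply: fk; apply: contra cu => /eqP cE; rewrite {1}cE; apply/eqP; congr (u _).
    by rewrite cE cu_src.
  rewrite (cs_0 (subvP (killed_gr fk) _ (memv_img f (memvf y)))) //.
  by rewrite eq_sym.
have [cE|/fk->//] := eqVneq c (u (src c)).
rewrite (cs_0 (subvP fg _ (memv_img f (memvf y)))) //.
by apply: contra cu => /eqP->; rewrite {1}cE cE !(cu_tgt, cu_src).
Qed.

Lemma equiv_hstable : equivariant (rho lab) f -> hstable (lay lab) (limg f).
Proof. by move=> eq_f g _ /memv_imgP[y _ ->]; rewrite -eq_f memv_img ?memvf. Qed.

Lemma equiv_ker : equivariant (rho lab) f -> (exists y, f y != 0) -> lker f = 0%VS.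
Proof.
move=> eq_f [y fy]; case: (@Sp_simple _ _ _ Y lab (lker f)) => // [g x|kf].
  by rewrite !memv_ker eq_f => /eqP->; rewrite linear0.
by case/eqP: fy; apply/eqP; rewrite -memv_ker kf memvf.
Qed.

Lemma killed_cs c y l (g : GG l) : killed -> equivariant (rho lab) f -> src c = l ->
  hh g ** (cs c ** f y) = f (ract (hh g * cs c) y).
Proof.
move=> fk eq_f sc; have [cE|ne] := eqVneq c (u (lay lab)); last first.
  by rewrite fk // (@ract_cs _ _ _ Y) // !linear0.
have ll : l = lay lab by rewrite -sc cE cu_src.
move: g sc; rewrite ll => g sc; rewrite cE cs_cu (hh_e g).2 ract_hh eq_f hh_le.
by [].
Qed.

Lemma killed_Rs a y : killed -> equivariant (rho lab) f -> a \in Rs Y ->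
  a ** f y = f (ract a y).
Proof.
move=> fk eq_f; have [ev evE] := ev_exists (f y).
have [ra raE] := lfun_of_linear (@ract_linear _ _ _ Y lab y).
suff h : (Rs Y <= lker (ev - (f \o ra)%VF))%VS.
  move=> /(subvP h); rewrite memv_ker add_lfunE opp_lfunE comp_lfunE evE raE.
  by rewrite subr_eq0 => /eqP.
apply: Rs_ind => c l g sc; rewrite memv_ker add_lfunE opp_lfunE comp_lfunE evE raE.
by rewrite act_mul killed_cs // subrr.
Qed.

End LabelMaps.

Lemma csize_gt0 (l : I) : (0 < csize l)%N.
Proof. by apply/card_gt0P; exists (u l); rewrite inE cu_src. Qed.

Lemma gensub_layer_span lab M (f : 'Hom(Sp lab, M)) :
  equivariant (rho lab) f -> killed f ->
  (gensub (limg f) <= layer_span (lay lab) (limg f))%VS.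
Proof.
move=> eq_f fk; rewrite -[layer_span _ _]add0v; apply: gen_layer.
- exact: submod0.
- exact: killed_gr.
- exact: equiv_hstable.
by move=> c _ cu /memv_imgP[y _ ->]; rewrite fk // mem0v.
Qed.

Section StdOfMap.

Variables (lab : Lab) (M : fdmod A) (f : 'Hom(Sp lab, M)).
Hypotheses (eq_f : equivariant (rho lab) f) (fk : killed f).
Hypothesis gen_f : gensub (limg f) = fullv.
Hypothesis dim_f : (csize (lay lab) * \dim {:Sp lab} <= \dim {:M})%N.

Lemma std_map_inj : lker f = 0%VS.
Proof.
have := dimvS (gensub_layer_span eq_f fk); rewrite gen_f.
move/leq_trans/(_ (dim_layer_span _ _))/(leq_trans dim_f).
rewrite leq_pmul2l ?csize_gt0 // -[X in (X <= _)%N](limg_ker_dim f) capfv => d.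
by apply/eqP; rewrite -dimv_eq0; move: d; lia.
Qed.

Lemma std_map_direct (s : CC -> Sp lab) :
  \sum_(c | src c == lay lab) cc c ** f (s c) = 0 -> forall c, src c = lay lab -> s c = 0.
Proof.
move=> s0; have dS : \dim (limg f) = \dim {:Sp lab}.
  by rewrite dim_limg_inj // std_map_inj capv0.
have [||//|//|_ h] := @layer_direct _ _ B M (lay lab) 0%VS (limg f) _ 0 (fun c => f (s c)).
- rewrite dimv0 add0n add0v dS; apply: leq_trans dim_f _; rewrite -gen_f.
  exact/dimvS/gensub_layer_span.
- exact: mem0v.
- by move=> c; apply/memv_img/memvf.
- by rewrite add0r.
move=> c /h fc; apply/eqP; rewrite -memv0 -std_map_inj memv_ker; exact/eqP.
Qed.

Lemma std_of_map : Std lab M.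
Proof.
have [t tE] : exists t : 'Hom(A, 'Hom(Sp lab, M)), forall a, t a = (act M a \o f)%VF.
  apply: lfun_of_linear => c a b; apply/lfunP => y.
  by rewrite add_lfunE scale_lfunE !comp_lfunE actDl actZl.
have tE2 a y : t a y = a ** f y by rewrite tE comp_lfunE.
exists t; split.
- by move=> a x y xR; rewrite !tE2 act_mul killed_Rs.
- by move=> b a y; rewrite !tE2 act_mul.
move=> Z t' bal.
have [psi psiE] : exists psi : 'Hom({ffun CC -> Sp lab}, M),
    forall s, psi s = \sum_(c | src c == lay lab) cc c ** f (s c).
  apply: lfun_of_linear => a s1 s2; rewrite scaler_sumr -big_split.
  by apply: eq_bigr => c _; rewrite !ffunE !linearP.
have [b bE] : exists b : 'Hom({ffun CC -> Sp lab}, Z),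
    forall s, b s = \sum_(c | src c == lay lab) t' (cc c) (s c).
  apply: lfun_of_linear => a s1 s2; rewrite scaler_sumr -big_split.
  by apply: eq_bigr => c _; rewrite !ffunE !linearP.
have [h hE] : exists h : 'Hom(M, Z), forall s, h (psi s) = b s.
  apply: lfun_factor; apply/subvP => s; rewrite !memv_ker psiE bE => /eqP s0.
  apply/eqP/big1 => c /eqP sc; rewrite (std_map_direct s0 sc); exact: linear0.
have hP a y : h (a ** f y) = t' a y.
  have [ev evE] := ev_exists (f y).
  have [ty tyE] : exists ty : 'Hom(A, Z), forall a, ty a = t' a y.
    by apply: lfun_of_linear => d a1 a2; rewrite linearP add_lfunE scale_lfunE.
  suff : a \in lker ((h \o ev)%VF - ty).
    by rewrite memv_ker add_lfunE opp_lfunE comp_lfunE evE tyE subr_eq0 => /eqP.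
  move: a; apply: (@A_span _ _ B) => c c' j g sc sc'.
  rewrite memv_ker add_lfunE opp_lfunE comp_lfunE evE tyE -mulrA act_mul act_mul killed_cs //.
  rewrite bal; last exact: Rs_mem.
  have [c'E|ne] := eqVneq c' (u (lay lab)); last first.
    by rewrite (@ract_cs _ _ _ Y) // !linear0 ?subrr ?addr0.
  set z := ract _ _; have scl : src c = lay lab by rewrite sc -sc' c'E cu_src.
  have := hE [ffun c0 => if c0 == c then z else 0]; rewrite psiE bE.
  rewrite (bigD1 c) ?scl //= ffunE eqxx big1 ?addr0 => [->|c0 /andP[_ /negPf ne]]; last first.
    by rewrite ffunE ne !linear0.
  rewrite (bigD1 c) ?scl //= ffunE eqxx big1 ?addr0 ?subrr // => c0 /andP[_ /negPf ne].
  by rewrite ffunE ne linear0.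
exists h; split=> [a y|h' h'E]; first by rewrite tE2 hP.
apply/eqP; rewrite -subr_eq0; apply/eqP/lfunP => x; rewrite zero_lfunE; apply/eqP.
rewrite -memv_ker; have : x \in gensub (limg f) by rewrite gen_f memvf.
apply: subvP; apply: aspan_le => a _ _ /memv_imgP[y _ ->].
by rewrite memv_ker add_lfunE opp_lfunE subr_eq0 hP -tE2 h'E.
Qed.

End StdOfMap.
End Standard.

(** * Standardly filtered modules *)

Section FreeModules.

Variables (k : fieldType) (A : falgType k) (B : layering A) (Y : labelling B).
Local Notation I := ('I_(nlay B).+1).
Local Notation e := (@le k A B).
Local Notation src := (@src k A B).
Local Notation tgt := (@tgt k A B).
Local Notation u := (@cu k A B).
Local Notation cc := (@cc k A B).
Local Notation cs := (@cs k A B).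
Local Notation CC := (CC B).
Local Notation gr := (@gr k A B).
Local Notation Lab := (Lab Y).
Local Notation lay := (@lay k A B Y).
Local Notation Sp := (@Sp k A B Y).
Local Notation rho lab := (@rho k A B Y lab).
Local Notation Std := (@Std k A B Y).
Implicit Types (M N D L P : fdmod A) (lab : Lab).

Lemma le_cs c : e (src c) * cs c = cs c.
Proof. by rewrite -[in RHS]cs_le -[in LHS]cs_le !mulrA le_idem eqxx. Qed.

Lemma hh_Rs (l : I) (g : GG l) : hh g \in Rs Y.
Proof.
by have := Rs_mem Y g (cu_src l); rewrite cs_cu (hh_e g).2.
Qed.

Lemma std_univ lab D : Std lab D -> exists f : 'Hom(Sp lab, D),
  [/\ equivariant (rho lab) f, killed f, gensub (limg f) = fullv &
    forall M (f' : 'Hom(Sp lab, M)), equivariant (rho lab) f' -> killed f' ->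
      exists2 h : 'Hom(D, M), is_hom h & forall y, h (f y) = f' y].
Proof.
case=> t [bal tM univ].
have t1 a y : t a y = a ** t 1 y by rewrite -tM mulr1.
have gen : gensub (limg (t 1%R)) = fullv.
  have [h [_ hu]] := univ D t bal.
  have E1 := hu \1%VF (fun a y => id_lfunE _).
  have E2 : h = projv (gensub (limg (t 1%R))).
    apply: hu => a y; rewrite projv_id // t1 mem_gensub //; exact/memv_img/memvf.
  apply/eqP; rewrite eqEsubv subvf /=; apply/subvP => x _.
  by rewrite -[x](id_lfunE x) -E1 E2 memv_proj.
exists (t 1); split=> //.
- by move=> g y; rewrite -(@ract_hh _ _ _ Y) -bal ?hh_Rs // mul1r t1.
- move=> c y ne; rewrite -t1 -[cs c]mul1r bal; last first.
    by rewrite -le_cs -hh1 (Rs_mem Y).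
  by rewrite -le_cs -hh1 (@ract_cs _ _ _ Y) // linear0.
move=> M f' eq_f fk.
have [t' t'E] : exists t' : 'Hom(A, 'Hom(Sp lab, M)), forall a, t' a = (act M a \o f')%VF.
  apply: lfun_of_linear => c a b; apply/lfunP => y.
  by rewrite add_lfunE scale_lfunE !comp_lfunE actDl actZl.
have t'E2 a y : t' a y = a ** f' y by rewrite t'E comp_lfunE.
have bal' : balanced (Rs Y) (@ract _ _ _ Y lab) t'.
  by move=> a x y xR; rewrite !t'E2 act_mul (killed_Rs (Y := Y)).
have [h [hE _]] := univ M t' bal'.
exists h => [b x|y]; last by rewrite hE t'E2 act_one.
suff /subvP/(_ x) : (gensub (limg (t 1%R)) <= lker ((h \o act D b)%VF - (act M b \o h)%VF))%VS.
  rewrite gen memvf => /(_ isT).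
  by rewrite memv_ker add_lfunE opp_lfunE !comp_lfunE subr_eq0 => /eqP.
apply: aspan_le => a _ _ /memv_imgP[y _ ->].
rewrite memv_ker add_lfunE opp_lfunE !comp_lfunE -!t1 -tM !hE !t'E2 act_mul subrr.
by [].
Qed.

Definition above (l0 : nat) M : {vspace M} := gensub (\sum_(l : I | (l0 <= l)%N) gr M l)%VS.

Lemma above_submod l0 M : submod (above l0 M).
Proof. exact: gensub_submod. Qed.

Lemma above0 M : above 0 M = fullv.
Proof.
apply/eqP; rewrite eqEsubv subvf; apply/subvP=> x _.
apply: (subvP (sub_gensub _)); rewrite -(sum_le B x); apply: memv_sumr => l _.
exact: le_gr.
Qed.

Lemma gr_above (l : I) l0 M : (l0 <= l)%N -> (gr M l <= above l0 M)%VS.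
Proof.
by move=> h; apply: subv_trans (sub_gensub _); apply: (sumv_sup l).
Qed.

Lemma above_le l0 M (X : {vspace M}) : submod X ->
  (forall l : I, (l0 <= l)%N -> (gr M l <= X)%VS) -> (above l0 M <= X)%VS.
Proof. by move=> sX h; apply: gensub_le => //; apply/subv_sumP => l; apply: h. Qed.

Lemma above_KK M (l : I) x : x \in above l.+1 M -> x \in gr M l -> x \in KK B fullv.
Proof.
move=> xa /grP <-; rewrite memv_preim; move: xa; apply: subvP; apply: aspan_le => a z _ zs.
move: z zs; suff /subvP h :
    (\sum_(l' : I | (l.+1 <= l')%N) gr M l' <= act M a @^-1: (act M (e l) @^-1: KK B fullv))%VS.
  by move=> z zz; rewrite memv_preim; apply: h.
apply/subv_sumP => l' ll'; apply/subvP => z zg; rewrite -memv_preim.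
apply: A_ind => c c' j g sc sc'; rewrite -memv_preim.
have [tl|ne] := eqVneq (tgt c) l; last by rewrite (gr_neq (cc_gr c _) ne) mem0v.
have := cc_gr c (hh g ** (cs c' ** z)); rewrite tl => /grP ->.
have [cE|cu] := eqVneq c (u (src c)); last by rewrite mem_KK // memvf.
have sl : src c = l by rewrite -tl {2}cE cu_tgt.
have -> : cs c' ** z = 0; last by rewrite !linear0 mem0v.
apply: (cs_0 zg); apply: contraL ll' => /eqP ->; rewrite -leqNgt.
by rewrite (leq_trans (le_layer c')) // sc' -sc sl.
Qed.

Lemma max_layer (P : pred I) : (exists l, P l) ->
  exists l, P l /\ forall l' : I, (l < l')%N -> ~~ P l'.
Proof.
case=> l0 Pl0; case: (@arg_maxnP _ l0 P (@nat_of_ord _) Pl0) => l Pl lmax.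
exists l; split=> // l'; apply: contraL => /lmax; rewrite -leqNgt.
by [].
Qed.

Lemma free_induction M l0 (P : {vspace M} -> Prop) :
  free_over B 0 (fullv : {vspace M}) -> P 0%VS ->
  (forall U lab (f : 'Hom(Sp lab, M)), submod U -> P U -> free_over B U fullv ->
     (forall l' : I, (lay lab < l')%N -> (gr M l' <= U)%VS) -> lker f = 0%VS ->
     equivariant (rho lab) f -> (limg f <= gr M (lay lab))%VS ->
     (limg f :&: U)%VS = 0%VS -> (l0 <= lay lab)%N -> P (U + gensub (limg f))%VS) ->
  P (above l0 M) /\ free_over B (above l0 M) fullv.
Proof.
move=> free0 P0 step.
suff: forall d U, (\dim {:M} - \dim U <= d)%N -> submod U -> P U -> (U <= above l0 M)%VS ->
    free_over B U fullv -> P (above l0 M) /\ free_over B (above l0 M) fullv.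
  by apply; [apply: leqnn | apply: submod0 | apply: P0 | apply: sub0v | apply: free0].
elim=> [|d IHd] U; first rewrite leqn0 subn_eq0.
  move=> dU sU PU Ua fU; suff -> : above l0 M = U by [].
  have /eqP -> : U == fullv by rewrite eqEdim subvf.
  apply/eqP; rewrite eqEsubv subvf /= (subv_trans _ Ua) //.
  by have /eqP -> : U == fullv by rewrite eqEdim subvf.
move=> dU sU PU Ua fU.
pose bad (l : I) := (l0 <= l)%N && ~~ (gr M l <= U)%VS.
have [nobad|hasbad] := classic (forall l, ~~ bad l).
  suff -> : above l0 M = U by [].
  apply/eqP; rewrite eqEsubv Ua andbT; apply: above_le => // l ll.
  by have := nobad l; rewrite /bad ll /= negbK.
have [l [/andP[l0l lU] lmax]] : exists l, bad l /\ forall l' : I, (l < l')%N -> ~~ bad l'.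
  apply: max_layer; apply: NNPP => nb; apply: hasbad => l; apply/negP => bl.
  by apply: nb; exists l.
have Ul (l' : I) : (l < l')%N -> (gr M l' <= U)%VS.
  move=> ll'; have := lmax _ ll'; rewrite /bad negb_and negbK.
  by rewrite (ltnW (leq_ltn_trans l0l ll')).
have [W [sW Wg UW0 UWg]] := maschke (subvv _) (@gr_hstable _ _ _ _ l)
  (hstable_cap (submod_hstable sU) (@gr_hstable _ _ _ _ l)) (capvSr _ _).
have W0 : W <> 0%VS.
  by move=> W0; move: lU; rewrite -UWg W0 addv0 capvSl.
have [lab [f [labl kf eq_f fW]]] := Sp_exists Y Wg sW W0.
move: (subv_trans fW Wg) Ul l0l; rewrite -labl => fg Ul l0l.
have fU0 : (limg f :&: U)%VS = 0%VS.
  apply/eqP; rewrite -subv0 -UW0 !subv_cap capvSr (subv_trans (capvSl _ _) fW) andbT /=.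
  by rewrite -labl (subv_trans (capvSl _ _) fg).
have [dX fX] := free_step sU Ul fg (equiv_hstable eq_f) fU0 fU.
apply: (IHd (U + gensub (limg f))%VS) => //.
- have : (0 < csize (lay lab) * \dim (limg f))%N.
    rewrite muln_gt0 csize_gt0 dim_limg_inj ?kf ?capv0 // lt0n dimv_eq0.
    by apply/eqP; apply: Sp_neq0.
  have := dimvS (subvf (U + gensub (limg f))); move: dU dX; lia.
- exact: free_step_submod.
- by apply: step; rewrite // dim_limg_inj.
- rewrite subv_add Ua; apply: gensub_le; first exact: above_submod.
  exact: subv_trans fg (gr_above M l0l).
Qed.

Section StepStd.

Variables (M : fdmod A) (U : {vspace M}) (lab : Lab) (f : 'Hom(Sp lab, M)).
Hypotheses (sU : submod U) (fU : free_over B U (fullv : {vspace M})).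
Hypotheses (Ul : forall l' : I, (lay lab < l')%N -> (gr M l' <= U)%VS).
Hypotheses (eq_f : equivariant (rho lab) f) (fg : (limg f <= gr M (lay lab))%VS).
Hypotheses (kf : lker f = 0%VS) (fU0 : (limg f :&: U)%VS = 0%VS).

Let X := (U + gensub (limg f))%VS.
Let sX : submod X. Proof. exact: free_step_submod. Qed.
Let UX : (U <= X)%VS. Proof. exact: addvSl. Qed.

Lemma step_std : exists N (f' : 'Hom(Sp lab, N)),
  [/\ subquotient_iso U X N, equivariant (rho lab) f', killed f',
      gensub (limg f') = fullv & (csize (lay lab) * \dim {:Sp lab})%N = \dim {:N}].
Proof.
have fX y : f y \in X.
  apply: (subvP (addvSr _ _)); apply: (subvP (sub_gensub _)); exact/memv_img/memvf.
have [N [q [hq qS qk sq]]] := subquotient_exists sU sX UX.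
have [f' f'E] : exists f' : 'Hom(Sp lab, N), forall y, f' y = q (f y).
  by exists (q \o f)%VF => y; rewrite comp_lfunE.
exists N, f'; split=> //.
- by move=> g y; rewrite !f'E eq_f hq.
- move=> c y cu; rewrite f'E -hq //; apply/eqP.
  rewrite qk //; first exact: caps_above cu (subvP fg _ (memv_img f (memvf y))).
  by move/submodP: sX; apply.
- apply/eqP; rewrite eqEsubv subvf -qS limgD subv_add /=.
  apply/andP; split.
    apply/subvP => _ /memv_imgP[x xU ->].
    have /eqP -> : q x == 0 by rewrite qk // (subvP UX).
    exact: mem0v.
  apply/subvP => _ /memv_imgP[x xg ->]; rewrite memv_preim; move: x xg; apply/subvP.
  apply: aspan_le => a _ _ /memv_imgP[y _ ->]; rewrite -memv_preim hq //.
  by apply: mem_gensub; rewrite -f'E memv_img ?memvf.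
have := (free_step sU Ul fg (equiv_hstable eq_f) fU0 fU).1.
rewrite (dim_sq sq) -/X => ->.
by rewrite addKn dim_limg_inj // kf capv0.
Qed.

Lemma step_std_iso : exists2 N, Std lab N & subquotient_iso U X N.
Proof.
have [N [f' [sq eq_f' fk gen d]]] := step_std.
by exists N => //; apply: (@std_of_map _ _ _ _ _ _ f') => //; rewrite d.
Qed.

End StepStd.

Lemma free_filtration M l0 : free_over B 0 (fullv : {vspace M}) ->
  has_filtration (fun N => exists2 lab, (l0 <= lay lab)%N & Std lab N) (above l0 M) /\
  free_over B (above l0 M) fullv.
Proof.
move=> free0; apply: free_induction => //; first exact: has_filtration0.
move=> U lab f sU hU fU Ul kf eq_f fg fU0 l0l.
have [N sN sq] := step_std_iso sU fU Ul eq_f fg kf fU0.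
by apply: has_filtration_append hU (free_step_submod _ sU) _ sq; exists lab.
Qed.

Lemma reg_free : free_over B 0 (fullv : {vspace reg A}).
Proof.
rewrite /free_over dimv0 subn0; apply: leq_trans (A_dim B); apply: leq_sum => l _.
rewrite expnS expn1 -mulnA leq_mul2l; apply/orP; right.
pose T (c : CC) (g : GG l) : {vspace reg A} := <[hh g * cs c]>%VS.
pose X := (\sum_(c | src c == l) \sum_(g : GG l) T c g)%VS.
have dX : (\dim X <= csize l * #|GG l|)%N.
  apply: leq_trans (dimv_sum_leq _ _ _) _; rewrite -[(csize l * _)%N]sum_nat_const.
  apply: leq_sum => c _; apply: leq_trans (dimv_sum_leq _ _ _) _.
  rewrite cardE -sum1_size big_enum /=; apply: leq_sum => g _.
  by rewrite dim_vline; case: (_ == _).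
have gK : (gr (reg A) l <= KK B fullv :&: gr (reg A) l + X)%VS.
  apply/subvP => x /grP <-; rewrite memv_preim.
  have -> : x = act (reg A) x 1 by rewrite regE mulr1.
  apply: A_ind => c c' j g sc sc'; rewrite -memv_preim.
  have [tl|ne] := eqVneq (tgt c) l; last by rewrite (gr_neq (cc_gr c _) ne) mem0v.
  have cg := cc_gr c (hh g ** (cs c' ** (1 : reg A))); rewrite tl in cg; rewrite (grP cg).
  have [cE|cu] := eqVneq c (u (src c)); last first.
    by apply: (subvP (addvSl _ _)); rewrite memv_cap cg andbT mem_KK // memvf.
  apply: (subvP (addvSr _ _)); have jl : j = l by rewrite -sc -tl {2}cE cu_tgt.
  move: g sc sc' cg; rewrite jl => g sc sc' cg.
  rewrite cE cc_cu sc (grP (hh_gr g _)) !regE mulr1.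
  apply: (subvP (sumv_sup c' (introT eqP sc') (subvv _))).
  exact: (subvP (sumv_sup g isT (subvv _))) (memv_line _).
have := leq_trans (dimvS gK) (dimv_add_leqif _ _).
rewrite /top addv0 capfv cc_layer; lia.
Qed.

Lemma std_exists lab : exists D (f : 'Hom(Sp lab, D)),
  [/\ Std lab D, equivariant (rho lab) f, killed f,
      gensub (limg f) = fullv & (csize (lay lab) * \dim {:Sp lab})%N = \dim {:D}].
Proof.
have [f [eq_f fg fK]] := Sp_reg lab; have [_ fU] := free_filtration (lay lab).+1 reg_free.
have kf : lker f = 0%VS.
  apply: vspace_eq0P => y; rewrite memv_ker => /eqP y0; apply: fK.
  by rewrite y0 mem0v.
have [||N [f' [sq eq_f' fk gen d]]] := step_std (@above_submod (lay lab).+1 _) fU _ eq_f fg kf.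
- by move=> l' ll'; apply: gr_above.
- apply: vspace_eq0P => _ /memv_capP[/memv_imgP[y _ ->] ya].
  rewrite (fK y) ?linear0 //; apply: above_KK ya _.
  by apply: (subvP fg); apply/memv_img/memvf.
by exists N, f'; split=> //; apply: (@std_of_map _ _ _ _ _ _ f') => //; rewrite d.
Qed.

Lemma stdP lab D : Std lab D -> exists f : 'Hom(Sp lab, D),
  [/\ equivariant (rho lab) f, killed f, gensub (limg f) = fullv, lker f = 0%VS &
      (csize (lay lab) * \dim {:Sp lab})%N = \dim {:D}] /\
  forall M (f' : 'Hom(Sp lab, M)), equivariant (rho lab) f' -> killed f' ->
      exists2 h : 'Hom(D, M), is_hom h & forall y, h (f y) = f' y.
Proof.
move=> /std_univ[f [eq_f fk gen univ]]; have [D0 [f0 [_ eq_f0 fk0 gen0 d0]]] := std_exists lab.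
have [h hh hf] := univ D0 f0 eq_f0 fk0.
have hS : limg h = fullv.
  apply/eqP; rewrite eqEsubv subvf -gen0 /=; apply: gensub_le.
    exact: submod_img (@submodf _ _ D).
  by apply/subvP => _ /memv_imgP[y _ ->]; rewrite -hf memv_img ?memvf.
have d1 : (\dim {:D0} <= \dim {:D})%N.
  by rewrite -hS -[X in (_ <= X)%N](limg_ker_dim h) leq_addl.
have d2 : (\dim {:D} <= csize (lay lab) * \dim {:Sp lab})%N.
  have := dimvS (gensub_layer_span eq_f fk); rewrite gen => /leq_trans; apply.
  apply: leq_trans (dim_layer_span _ _) _; rewrite leq_mul2l; apply/orP; right.
  by rewrite -[X in (_ <= X)%N](limg_ker_dim f) leq_addl.
have d : (csize (lay lab) * \dim {:Sp lab})%N = \dim {:D}.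
  by apply/eqP; rewrite eqn_leq d2 andbT d0.
exists f; split=> //; split=> //; apply: (std_map_inj eq_f fk gen); by rewrite d.
Qed.

Lemma std_free lab D : Std lab D -> free_over B 0 (fullv : {vspace D}).
Proof.
case/stdP=> f [[eq_f fk gen kf d] _]; rewrite /free_over dimv0 subn0 -d.
pose S := limg f; have Sg : (S <= gr D (lay lab))%VS := killed_gr fk.
have gS : graded B S.
  move=> l x xS; have [->|ne] := eqVneq l (lay lab); first by rewrite (grP (subvP Sg _ xS)).
  by rewrite (gr_neq (subvP Sg _ xS)) ?mem0v // eq_sym.
have KS : (KK B (fullv : {vspace D}) + S)%VS = fullv.
  apply/eqP; rewrite eqEsubv subvf -{1}gen /=.
  apply: subv_trans (gensub_layer_span eq_f fk) _; apply/subv_sumP => c /eqP sc.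
  apply/subvP => _ /memv_imgP[x xS ->]; have [cE|cu] := eqVneq c (u (src c)).
    apply: (subvP (addvSr _ _)); rewrite cE cc_cu sc (grP (subvP Sg _ xS)).
    exact: xS.
  by apply: (subvP (addvSl _ _)); rewrite mem_KK // memvf.
have topl l : (top l 0%VS (fullv : {vspace D}) <= \dim (S :&: gr D l))%N.
  have := graded_addcap l (@KK_graded _ _ _ D fullv) gS; rewrite KS /top addv0 => E.
  by rewrite {1}E leq_subLR (leq_trans (dimv_add_leqif _ _)).
apply: (@leq_trans (\sum_l csize l * \dim (S :&: gr D l))%N).
  by apply: leq_sum => l _; rewrite leq_mul2l topl orbT.
rewrite (bigD1 (lay lab)) //= big1 ?addn0 => [|l ne].
  rewrite leq_mul2l; apply/orP; right; rewrite -[X in (_ <= X)%N](limg_ker_dim f).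
  by rewrite kf capv0 dimv0 add0n dimvS // capvSl.
have -> : (S :&: gr D l)%VS = 0%VS; last by rewrite dimv0 muln0.
apply: vspace_eq0P => x /memv_capP[xS xl].
by rewrite -(grP xl) (gr_neq (subvP Sg _ xS)) // eq_sym.
Qed.

Lemma filtration_ind (C : fdmod A -> Prop) M (U : {vspace M}) (F : {vspace M} -> Prop) :
  has_filtration C U -> F 0%VS ->
  (forall X X' N, submod X -> submod X' -> F X -> C N -> subquotient_iso X X' N -> F X') ->
  F U.
Proof.
case=> l [E [E0 El sE cE]] F0 step.
have key i : (i <= l)%N -> F (E i).
  elim: i => [|i IHi] il; first by rewrite E0.
  have [N CN sq] := cE i il.
  by apply: step sq; [apply/sE/ltnW | apply: sE | apply/IHi/ltnW | ].
by rewrite -El; apply: key.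
Qed.

Lemma filtration_free M (U : {vspace M}) :
  has_filtration (fun N => exists lab, Std lab N) U -> free_over B 0 U.
Proof.
move=> hU; apply: (filtration_ind (F := fun X => free_over B 0 X) hU).
  rewrite /free_over dimv0 /tops big1 // => l _.
  by rewrite /top cap0v dimv0 sub0n muln0.
move=> X X' N sX sX' fX [lab /std_free fN] sq.
have XX' : (X <= X')%VS by case: sq.
have := tops_trans B (@submod0 _ _ M) sX sX' (sub0v _) XX'.
move: fX fN; rewrite /free_over (tops_sq B sX sX' sq) (dim_sq sq) !dimv0 !subn0.
have := dimvS XX'; lia.
Qed.

End FreeModules.

(** * Quasi-heredity *)

Section QuasiHereditary.

Variables (k : fieldType) (A : falgType k) (B : layering A) (Y : labelling B).
Local Notation I := ('I_(nlay B).+1).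
Local Notation e := (@le k A B).
Local Notation src := (@src k A B).
Local Notation tgt := (@tgt k A B).
Local Notation u := (@cu k A B).
Local Notation cc := (@cc k A B).
Local Notation cs := (@cs k A B).
Local Notation CC := (CC B).
Local Notation gr := (@gr k A B).
Local Notation Lab := (Lab Y).
Local Notation lay := (@lay k A B Y).
Local Notation Sp := (@Sp k A B Y).
Local Notation rho lab := (@rho k A B Y lab).
Local Notation Std := (@Std k A B Y).
Implicit Types (M N D L P : fdmod A) (lab : Lab).

Variable lt : Lab -> Lab -> Prop.
Hypothesis ltP : forall lab lab', lt lab lab' <-> (lay lab < lay lab')%N.
Local Notation simple_label := (simple_label Std).

Lemma gen_top M (l : I) (W : {vspace M}) x : (W <= gr M l)%VS -> hstable l W ->
  (forall c y, c != u l -> y \in W -> cs c ** y = 0) ->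
  x \in gensub W -> e l ** x \in W.
Proof.
move=> Wg sW cW /(subvP (gen_layer (@submod0 _ _ M) Wg sW _)) xW.
rewrite memv_preim; move: x xW => x /(_ _)/[!add0v] xW.
have : x \in layer_span l W by apply: xW => c y cu yW; rewrite cW ?mem0v.
move: x {xW}; apply/subvP.
apply/subv_sumP => c /eqP sc; apply/subvP => _ /memv_imgP[x xS ->]; rewrite -memv_preim.
have [tl|ne] := eqVneq (tgt c) l; last by rewrite (gr_neq (cc_gr c _) ne) mem0v.
have -> : c = u l by rewrite -sc; apply: tgt_src_cu; rewrite tl sc.
by rewrite cc_cu le_le eqxx (grP (subvP Wg _ xS)).
Qed.

Section Generated.

Variables (lab : Lab) (M : fdmod A) (f : 'Hom(Sp lab, M)).
Hypotheses (eq_f : equivariant (rho lab) f) (fk : killed f).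

Lemma gensub_top x : x \in gensub (limg f) -> e (lay lab) ** x \in limg f.
Proof.
apply: gen_top; [exact: killed_gr | exact: equiv_hstable |].
by move=> c _ cu /memv_imgP[y _ ->]; apply: fk.
Qed.

Lemma gensub_above (l : I) x : (lay lab < l)%N -> x \in gensub (limg f) -> e l ** x = 0.
Proof.
move=> ll /(subvP (gensub_layer_span eq_f fk)) xs; apply/eqP; rewrite -memv_ker.
move: x xs; apply/subvP.
apply/subv_sumP => c /eqP sc; apply/subvP => _ /memv_imgP[x xS ->]; rewrite memv_ker.
rewrite (gr_neq (cc_gr c _)) //; apply: contraTneq ll => <-.
by rewrite -leqNgt -sc le_layer.
Qed.

End Generated.

Definition simple_map lab L (f : 'Hom(Sp lab, L)) : Prop :=
  [/\ equivariant (rho lab) f, killed f, lker f = 0%VS, limg f = gr L (lay lab) &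
      forall l : I, (lay lab < l)%N -> gr L l = 0%VS].

Lemma Sp_witness lab : exists y : Sp lab, y != 0.
Proof. by have [y _ y0] := vspace_neq0 (@Sp_neq0 _ _ _ Y lab); exists y. Qed.

Lemma simple_mapI lab L (f : 'Hom(Sp lab, L)) y : simple_mod L ->
  equivariant (rho lab) f -> killed f -> f y != 0 -> simple_map f.
Proof.
move=> [_ sL] eq_f fk fy.
have gen : gensub (limg f) = fullv.
  case: (sL (gensub (limg f))) => [|g0|//]; first exact: gensub_submod.
  have := subvP (sub_gensub (limg f)) _ (memv_img f (memvf y)).
  by rewrite g0 memv0 (negPf fy).
split=> //; first by apply: equiv_ker => //; exists y.
  apply/eqP; rewrite eqEsubv killed_gr //=; apply/subvP => x /grP <-.
  by apply: gensub_top; rewrite ?gen ?memvf.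
move=> l ll; apply: vspace_eq0P => x /grP <-.
by apply: gensub_above eq_f fk _ _ ll _; rewrite gen memvf.
Qed.

Lemma simple_top L : simple_mod L -> exists lab (f : 'Hom(Sp lab, L)), simple_map f.
Proof.
move=> sL; have [L0 _] := sL.
have [l [/eqP gl lmax]] : exists l, gr L l != 0%VS /\ forall l' : I, (l < l')%N -> ~~ (gr L l' != 0%VS).
  apply: (@max_layer _ _ B (fun l => gr L l != 0%VS)); apply: NNPP => nb; apply: L0.
  apply: vspace_eq0P => x _; rewrite -(sum_le B x) big1 // => l _.
  apply/eqP; rewrite -memv0; have -> : 0%VS = gr L l; last exact: le_gr.
  by apply/esym/eqP/negPn/negP => gl; apply: nb; exists l.
have [lab [f [ll kf eq_f fg]]] := Sp_exists Y (subvv _) (@gr_hstable _ _ _ _ l) gl.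
have [y y0] := Sp_witness lab.
exists lab, f; apply: (@simple_mapI _ _ _ y) => //.
  apply/killedP; rewrite ll; split=> // c y' cu.
  have fy : f y' \in gr L l by apply: (subvP fg); apply/memv_img/memvf.
  have [tl|ne] := eqVneq l (tgt c); last by rewrite (cs_0 fy).
  apply/eqP; rewrite -memv0; have /eqP <- : gr L (src c) == 0%VS.
    by apply/negPn/lmax; rewrite tl lt_tgt.
  exact: cs_gr.
by apply: contra y0; rewrite -memv_ker kf memv0.
Qed.

Lemma std_gr lab D (f : 'Hom(Sp lab, D)) : equivariant (rho lab) f -> killed f ->
  gensub (limg f) = fullv -> gr D (lay lab) = limg f /\
  forall l : I, (lay lab < l)%N -> gr D l = 0%VS.
Proof.
move=> eq_f fk gen; split.
  apply/eqP; rewrite eqEsubv killed_gr // andbT; apply/subvP => x /grP <-.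
  by apply: gensub_top; rewrite ?gen ?memvf.
move=> l ll; apply: vspace_eq0P => x /grP <-.
by apply: gensub_above eq_f fk _ _ ll _; rewrite gen memvf.
Qed.

Definition rad lab D : {vspace D} := colon (e (lay lab)) 0%VS.

Lemma rad_submod lab D : submod (rad lab D). Proof. exact: colon_submod. Qed.

Lemma rad_gr lab D : (rad lab D :&: gr D (lay lab))%VS = 0%VS.
Proof.
apply: vspace_eq0P => x /memv_capP[/mem_colon/(_ 1)].
by rewrite act_one memv0 => /eqP + /grP xE; rewrite xE.
Qed.

Lemma std_submod lab D (X : {vspace D}) : Std lab D -> submod X ->
  (X <= rad lab D)%VS \/ X = fullv.
Proof.
move=> /stdP[f [[eq_f fk gen kf _] _]] sX; have /submodP pX := sX.
have [gl _] := std_gr eq_f fk gen.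
case: (@Sp_simple _ _ _ Y lab (f @^-1: X)%VS) => [g y|X0|XS].
- by rewrite -!memv_preim eq_f; apply: pX.
- left; apply/subvP => x xX; apply/mem_colon => b.
  have : e (lay lab) ** (b ** x) \in limg f by rewrite -gl le_gr.
  case/memv_imgP=> y _ yE; have : y \in (f @^-1: X)%VS by rewrite -memv_preim -yE; do 2!apply: (pX).
  by rewrite yE X0 memv0 => /eqP->; rewrite linear0 mem0v.
right; apply/eqP; rewrite eqEsubv subvf -gen gensub_le //.
apply/subvP => _ /memv_imgP[y _ ->]; have : y \in (f @^-1: X)%VS by rewrite XS memvf.
by rewrite -memv_preim.
Qed.

Lemma rad_proper lab D : Std lab D -> rad lab D <> fullv.
Proof.
move=> sD rE; have [f [[eq_f fk gen kf _] _]] := stdP sD; have [y y0] := Sp_witness lab.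
have : f y \in (rad lab D :&: gr D (lay lab))%VS.
  by rewrite rE memv_cap memvf (subvP (killed_gr fk)) // memv_img ?memvf.
by rewrite rad_gr memv0 -memv_ker kf memv0 (negPf y0).
Qed.

Lemma std_ker lab D L (h : 'Hom(D, L)) : Std lab D -> simple_mod L -> is_hom h ->
  limg h = fullv -> lker h = rad lab D.
Proof.
move=> sD [L0 sL] hh hS; apply/eqP; rewrite eqEsubv; apply/andP; split.
  case: (std_submod sD (submod_ker hh)) => // hk; case: L0.
  by rewrite -hS; apply/eqP; rewrite -subv0; apply/subvP => _ /memv_imgP[x _ ->];
    rewrite memv0 -memv_ker hk memvf.
have [f [[eq_f fk gen kf _] _]] := stdP sD; have [gl _] := std_gr eq_f fk gen.
case: (sL (h @: rad lab D)%VS) => [|r0|rS].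
- exact: submod_img (@rad_submod _ _).
- apply/subvP => x xr; rewrite memv_ker -memv0 -r0; exact: memv_img.
case: L0; rewrite -hS -gen; apply/eqP; rewrite -subv0.
have fk0 y : h (f y) = 0.
  have /memv_imgP[x xr hx] : h (f y) \in (h @: rad lab D)%VS by rewrite rS memvf.
  have fg : e (lay lab) ** f y = f y.
    by apply: grP; rewrite gl; apply/memv_img/memvf.
  rewrite -fg hh hx -hh; have := mem_colon _ _ _ xr 1.
  by rewrite act_one memv0 => /eqP->; rewrite linear0.
apply/subvP => _ /memv_imgP[x xg ->]; rewrite memv0 -memv_ker; move: x xg.
apply/subvP/gensub_le; first exact: submod_ker.
by apply/subvP => _ /memv_imgP[y _ ->]; rewrite memv_ker fk0.
Qed.

Lemma std_head lab D : Std lab D -> exists L (q : 'Hom(D, L)),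
  [/\ simple_mod L, is_hom q, limg q = fullv & subquotient_iso (rad lab D) fullv L].
Proof.
move=> sD; have [L [q [hq qS qk sq]]] :=
  subquotient_exists (@rad_submod lab D) (@submodf _ _ D) (subvf _).
have hq' : is_hom q by move=> a x; rewrite hq ?memvf.
exists L, q; split=> //; split.
  move=> L0; apply: (rad_proper sD); apply/eqP; rewrite eqEsubv subvf; apply/subvP => x _.
  by rewrite -qk ?memvf // -memv0 -L0 memvf.
move=> X sX; have XE : X = (q @: (q @^-1: X))%VS by rewrite lpreimK // qS subvf.
case: (std_submod sD (submod_preim hq' sX)) => [Xr|XS]; [left|right]; rewrite XE.
  apply/eqP; rewrite -subv0; apply/subvP => _ /memv_imgP[x xX ->].
  by rewrite memv0 qk ?memvf // (subvP Xr).
by rewrite XS.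
Qed.

Lemma simple_labelP lab L : simple_label lab L <->
  simple_mod L /\ exists f : 'Hom(Sp lab, L), simple_map f.
Proof.
split=> [[sL [D [h [sD hh hS]]]]|[sL [f [eq_f fk kf fg _]]]].
  split=> //; have [f [[eq_f fk gen kf _] _]] := stdP sD.
  have eq_hf : equivariant (rho lab) (h \o f)%VF.
    by move=> g y; rewrite !comp_lfunE eq_f hh.
  have hfk : killed (h \o f)%VF.
    by move=> c y cu; rewrite comp_lfunE -hh fk // linear0.
  have [y y0] := Sp_witness lab.
  exists (h \o f)%VF; apply: (@simple_mapI _ _ _ y) => //.
  rewrite comp_lfunE -memv_ker (std_ker sD sL hh hS); apply: contra y0 => fr.
  rewrite -memv0 -kf memv_ker -memv0 -(rad_gr lab) memv_cap fr.
  by rewrite (subvP (killed_gr fk)) // memv_img ?memvf.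
split=> //; have [D [_ [sD _ _ _ _]]] := std_exists lab.
have [fD [[_ _ _ _ _] univ]] := stdP sD; have [h hh hf] := univ L f eq_f fk.
exists D, h; split=> //; have [y y0] := Sp_witness lab.
apply: (@simple_hom_surj _ _ _ _ _ (fD y)) => //.
by rewrite hf -memv_ker kf memv0.
Qed.

Lemma gr_simple_neq0 lab L (f : 'Hom(Sp lab, L)) : simple_map f -> gr L (lay lab) <> 0%VS.
Proof.
case=> _ _ kf fg _ g0; have [y y0] := Sp_witness lab.
have : f y \in gr L (lay lab) by rewrite -fg; apply/memv_img/memvf.
by rewrite g0 memv0 -memv_ker kf memv0 (negPf y0).
Qed.

Lemma label_unique L lab lab' (f : 'Hom(Sp lab, L)) (f' : 'Hom(Sp lab', L)) :
  simple_map f -> simple_map f' -> lab = lab'.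
Proof.
move=> sf sf'; have g0 := gr_simple_neq0 sf; have g0' := gr_simple_neq0 sf'.
case: sf sf' => [eq_f _ kf fg fa] [eq_f' _ kf' fg' fa'].
have ll : lay lab = lay lab'.
  apply: val_inj; apply/eqP; rewrite eqn_leq.
  by rewrite [(lay lab <= _)%N]leqNgt [(lay lab' <= _)%N]leqNgt; apply/andP; split;
    apply/negP => h; [apply: g0; apply: fa' | apply: g0'; apply: fa].
by apply: (Sp_inj ll eq_f eq_f') => //; rewrite fg fg' ll.
Qed.

Lemma simple_label_iso lab L L' : simple_label lab L -> simple_label lab L' -> fdmod_iso L L'.
Proof.
move=> [sL [D [h [sD hh hS]]]] [sL' [D' [h' [sD' hh' hS']]]].
have [f [[eq_f fk gen kf _] univ]] := stdP sD; have [f' [[eq_f' fk' gen' kf' _] _]] := stdP sD'.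
have [i hi iE] := univ D' f' eq_f' fk'.
pose j := (h' \o i)%VF; have hj : is_hom j by apply: is_hom_comp.
have [y y0] := Sp_witness lab.
have jy : j (f y) != 0.
  rewrite comp_lfunE iE -memv_ker (std_ker sD' sL' hh' hS'); apply: contra y0 => fr.
  rewrite -memv0 -kf' memv_ker -memv0 -(rad_gr lab) memv_cap fr.
  by rewrite (subvP (killed_gr fk')) // memv_img ?memvf.
have jS := simple_hom_surj sL' hj jy.
have [g gE] : exists g : 'Hom(L, L'), forall x, g (h x) = j x.
  by apply: lfun_factor; rewrite (std_ker sD sL hh hS) (std_ker sD sL' hj jS).
have hg : is_hom g.
  move=> a x; have /memv_imgP[z _ ->] : x \in limg h by rewrite hS memvf.
  by rewrite -hh !gE hj.
exists g => //; apply: lfun_bij; first by apply: (@simple_hom_inj _ _ _ _ _ (h (f y))); rewrite ?gE.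
by apply: (@simple_hom_surj _ _ _ _ _ (h (f y))); rewrite ?gE.
Qed.

Lemma factor_layer M (U : {vspace M}) L : composition_factor U L ->
  exists lab (f : 'Hom(Sp lab, L)), simple_map f /\ (U :&: gr M (lay lab))%VS <> 0%VS.
Proof.
case=> sL [U1 [U2 [sU1 sU2 U2U sq]]]; have [lab [f sf]] := simple_top sL.
exists lab, f; split=> // Ul; apply: (gr_simple_neq0 sf); apply/eqP; rewrite -dimv_eq0.
rewrite (gr_sq sU2 sq); have : (\dim (U2 :&: gr M (lay lab)) <= 0)%N.
  by rewrite -[0%N](dimv0 M) -Ul; apply: dimvS; apply: capvS.
by rewrite leqn0 => /eqP->.
Qed.

Lemma rad_factors lab D : Std lab D -> factors_below Std (fun l' => lt l' lab) (rad lab D).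
Proof.
move=> sD L cL; have [lab' [f [sf rl]]] := factor_layer cL.
have [f0 [[eq_f fk gen kf _] _]] := stdP sD; have [_ ga] := std_gr eq_f fk gen.
exists lab'; last by apply/simple_labelP; split; [case: cL | exists f].
apply/ltP; case: ltngtP => // [h|/val_inj h]; case: rl.
  by rewrite ga // capv0.
by rewrite h rad_gr.
Qed.

Lemma direct_summand_trans P M N : direct_summand P M -> direct_summand M N -> direct_summand P N.
Proof.
move=> [f [g [hf hg gf]]] [f' [g' [hf' hg' gf']]].
exists (f' \o f)%VF, (g \o g')%VF; split; [exact: is_hom_comp | exact: is_hom_comp | ].
by move=> x; rewrite !comp_lfunE gf' gf.
Qed.

Lemma complement_summand M (U U' : {vspace M}) (sU : submod U) : submod U' ->
  (U :&: U')%VS = 0%VS -> (U + U')%VS = fullv -> direct_summand (subm sU) M.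
Proof.
move=> sU' c0 s1; have UU'f x : x \in (U + U')%VS by rewrite s1 memvf.
have piE x : daddv_pi U U' x + daddv_pi U' U x = x by apply: daddv_pi_add.
have pi0 x : x \in U' -> daddv_pi U U' x = 0.
  move=> xU'; apply: (addIr (daddv_pi U' U x)); rewrite piE add0r daddv_pi_id //.
  by rewrite capvC.
have hpi : is_hom (daddv_pi U U' : 'Hom(M, M)).
  move=> a x; rewrite -{1}(piE x) !linearD /= [X in _ + X]pi0 ?addr0.
    by rewrite [daddv_pi U U' (a ** _)]daddv_pi_id //; move/submodP: sU; apply; apply: memv_pi.
  by move/submodP: sU'; apply; apply: memv_pi.
have [g gE] : exists g : 'Hom(M, subm sU), forall x, subm_incl sU (g x) = daddv_pi U U' x.
  exists (linfun (vsproj U : M -> subvs_of U) \o daddv_pi U U')%VF => x.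
  by rewrite comp_lfunE subm_inclE lfunE /= vsprojK ?memv_pi.
have inj := lker0P (introT eqP (subm_incl_inj sU)).
exists (subm_incl sU), g; split; first exact: subm_incl_hom.
  by move=> a x; apply: inj; rewrite gE hpi subm_incl_hom gE.
by move=> x; apply: inj; rewrite gE daddv_pi_id // subm_inclE subvsP.
Qed.

Lemma summand_dims M P (f : 'Hom(P, M)) (g : 'Hom(M, P)) : is_hom f -> is_hom g ->
  (forall x, g (f x) = x) ->
  [/\ submod (limg f), submod (lker g), (limg f :&: lker g)%VS = 0%VS,
      (limg f + lker g)%VS = fullv & subquotient_iso 0 (limg f) P].
Proof.
move=> hf hg gf; have c0 : (limg f :&: lker g)%VS = 0%VS.
  apply: vspace_eq0P => _ /memv_capP[/memv_imgP[x _ ->]].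
  by rewrite memv_ker gf => /eqP->; rewrite linear0.
split=> //; [exact: submod_img (@submodf _ _ P) | exact: submod_ker | |].
  apply/eqP; rewrite eqEsubv subvf; apply/subvP => x _.
  rewrite -[x](subrK (f (g x))) addrC memv_add ?memv_img ?memvf //.
  by rewrite memv_ker linearB /= gf subrr.
split; [exact: sub0v | exists g; split=> //].
apply/eqP; rewrite eqEsubv subvf; apply/subvP => x _.
by rewrite -[x]gf; do 2!apply: memv_img; apply: memvf.
Qed.

Lemma direct_sum_gr M (U U' : {vspace M}) l : submod U -> submod U' ->
  (U :&: U')%VS = 0%VS -> (U + U')%VS = fullv ->
  \dim (gr M l) = (\dim (U :&: gr M l) + \dim (U' :&: gr M l))%N.
Proof.
move=> sU sU' c0 s1.
rewrite -(dimv_add_cap (U :&: gr M l) (U' :&: gr M l)).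
have -> : (U :&: gr M l :&: (U' :&: gr M l))%VS = 0%VS.
  apply/eqP; rewrite -subv0 -c0; apply/subvP => x /memv_capP[/memv_capP[xU _] /memv_capP[xU' _]].
  by rewrite memv_cap xU xU'.
by rewrite dimv0 addn0 -graded_addcap ?s1 ?capfv //; apply: submod_graded.
Qed.

Lemma summand_free M P : direct_summand P M ->
  free_over B 0 (fullv : {vspace M}) -> free_over B 0 (fullv : {vspace P}).
Proof.
move=> [f [g [hf hg gf]]]; have [sU sU' c0 s1 sq] := summand_dims hf hg gf.
set U := limg f in sU c0 s1 sq; set U' := lker g in sU' c0 s1.
rewrite /free_over (tops_sq B (@submod0 _ _ M) sU sq) (dim_sq sq) !dimv0 !subn0 => fM.
have b := top_bound B (@submod0 _ _ M) sU' (sub0v _); rewrite dimv0 add0n in b.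
have dE : \dim {:M} = (\dim U + \dim U')%N.
  by rewrite -dimv_add_cap c0 dimv0 addn0 s1.
suff : (tops B 0 U + tops B 0 U' <= tops B 0 (fullv : {vspace M}))%N by lia.
rewrite /tops -big_split; apply: leq_sum => l _ /=; rewrite -mulnDr leq_mul2l.
apply/orP; right; rewrite /top !addv0 capfv (direct_sum_gr l sU sU' c0 s1).
have KE : (KK B (fullv : {vspace M}) <= KK B U + KK B U')%VS.
  apply: KK_le => c x cu _; have : x \in (U + U')%VS by rewrite s1 memvf.
  by case/addvP => y [z [yU zU ->]]; rewrite linearD memv_add ?mem_KK.
have : (\dim (KK B fullv :&: gr M l) <= \dim (KK B U :&: gr M l) + \dim (KK B U' :&: gr M l))%N.
  apply: leq_trans (dimv_add_leqif _ _); apply: dimvS.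
  by rewrite -graded_addcap ?capvS //; apply: KK_graded.
have : (\dim (KK B U :&: gr M l) <= \dim (U :&: gr M l))%N by rewrite dimvS // capvS // KK_sub.
have : (\dim (KK B U' :&: gr M l) <= \dim (U' :&: gr M l))%N by rewrite dimvS // capvS // KK_sub.
lia.
Qed.

Lemma summand_cofree M P : direct_summand P M ->
  cofree_over B 0 (fullv : {vspace M}) -> cofree_over B 0 (fullv : {vspace P}).
Proof.
move=> [f [g [hf hg gf]]]; have [sU sU' c0 s1 sq] := summand_dims hf hg gf.
set U := limg f in sU c0 s1 sq; set U' := lker g in sU' c0 s1.
rewrite /cofree_over (socs_sq B (@submod0 _ _ M) sU sq) (dim_sq sq) !dimv0 !subn0 => fM.
have b := soc_bound B (@submod0 _ _ M) sU' (sub0v _); rewrite dimv0 add0n in b.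
have dE : \dim {:M} = (\dim U + \dim U')%N.
  by rewrite -dimv_add_cap c0 dimv0 addn0 s1.
suff : (socs B 0 U + socs B 0 U' <= socs B 0 (fullv : {vspace M}))%N by lia.
rewrite /socs -big_split; apply: leq_sum => l _ /=; rewrite -mulnDr leq_mul2l.
apply/orP; right; rewrite /soc !cap0v !dimv0 !subn0.
pose Z := (ZZ B 0 U :&: gr M l)%VS; pose Z' := (ZZ B 0 U' :&: gr M l)%VS.
rewrite -/Z -/Z' -dimv_add_cap; have -> : (Z :&: Z')%VS = 0%VS.
  apply: vspace_eq0P => x /memv_capP[/memv_capP[/mem_ZZ[xU _] _] /memv_capP[/mem_ZZ[xU' _] _]].
  by apply/eqP; rewrite -memv0 -c0 memv_cap xU xU'.
by rewrite dimv0 addn0 dimvS // subv_add !capvS ?ZZ_mono ?subvf.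
Qed.

Lemma summand_projective P : direct_summand P (reg A) -> projective_mod P.
Proof.
move=> [f [g [hf hg gf]]] M N q h hq hh qS.
have /memv_imgP[m _ mE] : h (g (1 : A)) \in limg q by rewrite qS memvf.
have [ev evE] := ev_exists m.
exists (ev \o f)%VF => [a x|].
  by rewrite !comp_lfunE !evE hf regE act_mul.
apply/lfunP => x; rewrite !comp_lfunE evE hq -mE -hh -hg.
by congr (h _); rewrite regE mulr1 gf.
Qed.

Lemma projective_cover_exists L : simple_mod L -> exists P,
  direct_summand P (reg A) /\ projective_cover P L.
Proof.
move=> sL; have [L0 _] := sL; have [x0 _ x0n] := vspace_neq0 L0.
suff : forall d P (h : 'Hom(P, L)), \dim {:P} = d -> direct_summand P (reg A) -> is_hom h ->
    (exists x, h x != 0) -> exists P, direct_summand P (reg A) /\ projective_cover P L.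
  have [ev evE] := ev_exists x0; move/(_ _ (reg A) ev erefl); apply.
  - exists \1%VF, \1%VF; split; try exact: is_hom_id.
    by move=> x; rewrite !id_lfunE.
  - by move=> a x; rewrite !evE regE act_mul.
  - by exists (1 : A); rewrite evE act_one.
elim/ltn_ind=> d IHd P h dP sP hh [x hx].
have hS := simple_hom_surj sL hh hx; have pP := summand_projective sP.
have [cov|nocov] := classic (forall U : {vspace P}, submod U -> (h @: U)%VS = fullv -> U = fullv).
  by exists P; split=> //; split=> //; exists h.
have [U [sU hU Uf]] : exists U : {vspace P}, [/\ submod U, (h @: U)%VS = fullv & U <> fullv].
  by apply: NNPP => no; apply: nocov => U sU hU; apply: NNPP => Uf; apply: no; exists U.
have hi : is_hom (h \o subm_incl sU)%VF by apply: is_hom_comp => //; apply: subm_incl_hom.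
have [|p hp pE] := pP _ _ _ _ hi hh.
  by rewrite limg_comp limg_subm_incl.
pose q := (subm_incl sU \o p)%VF; have hq : is_hom q.
  by apply: is_hom_comp => //; apply: subm_incl_hom.
have hqE y : h (q y) = h y by rewrite -[in RHS]pE !comp_lfunE.
have [g [[hg g0 gS gi _] [_ gh]]] := fitting hq.
have sI := submod_img hg (@submodf _ _ P).
have gU : (limg g <= U)%VS.
  apply: subv_trans gi _; apply/subvP => _ /memv_imgP[y _ ->].
  by rewrite comp_lfunE subm_inclE subvsP.
apply: (IHd _ _ (subm sI) (h \o subm_incl sI)%VF erefl).
- rewrite dim_subm -dP (leq_ltn_trans (dimvS gU)) // ltn_neqAle dimvS ?subvf // andbT.
  by apply/eqP => dU; apply: Uf; apply/eqP; rewrite eqEdim subvf dU leqnn.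
- apply: direct_summand_trans sP; apply: complement_summand (submod_ker hg) _ _.
    by rewrite capvC.
  by rewrite addvC.
- by apply: is_hom_comp => //; apply: subm_incl_hom.
have : g x \in limg (subm_incl sI) by rewrite limg_subm_incl memv_img ?memvf.
case/memv_imgP=> y _ yE; exists y.
by rewrite comp_lfunE -yE gh.
Qed.

Lemma projective_cover_std lab : exists P L D (f : 'Hom(P, D)),
  [/\ simple_label lab L, projective_cover P L, Std lab D, is_hom f /\ limg f = fullv &
      has_filtration (fun N => exists2 l', lt lab l' & Std l' N) (lker f)].
Proof.
have [D [_ [sD _ _ _ _]]] := std_exists lab; have [L [q [sL hq qS sqL]]] := std_head sD.
have [P [sP [pP [h [hh hS cov]]]]] := projective_cover_exists sL.
have [f hf fE] := pP _ _ _ _ hq hh qS.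
have [fD [[eq_f fk gen kf dD] _]] := stdP sD; have [gl ga] := std_gr eq_f fk gen.
set l := lay lab in gl ga dD.
have fS : limg f = fullv.
  case: (std_submod sD (submod_img hf (@submodf _ _ P))) => // fr.
  have [L0 _] := sL; case: L0; rewrite -hS -fE limg_comp; apply/eqP; rewrite -subv0.
  apply/subvP => _ /memv_imgP[x xf ->]; rewrite memv0 -memv_ker.
  by rewrite (std_ker sD sL hq qS) (subvP fr).
exists P, L, D, f; split=> //.
- by split=> //; exists D, q.
- by split=> //; exists h.
have fP := summand_free sP (reg_free B).
have [hJ _] := free_filtration Y l.+1 fP.
pose J := above B l.+1 P; have sJ : submod J by apply: above_submod.
have Jk : (J <= lker f)%VS.
  apply: above_le; first exact: submod_ker.
  move=> l' ll'; apply/subvP => x /grP <-; rewrite memv_ker hf.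
  by rewrite -memv0 -(ga _ ll') le_gr.
suff kJ : lker f = J.
  rewrite kJ; have [n [E [E0 El sE cE]]] := hJ; exists n, E; split=> // i /cE[N [l' ll' sN] sq].
  by exists N => //; exists l' => //; apply/ltP.
have [S1 [sS1 S1g S10 S1S]] := maschke (subvv (gr P l)) (@gr_hstable _ _ _ _ l)
  (hstable_cap (submod_hstable (l := l) (submod_ker hf)) (@gr_hstable _ _ _ _ l)) (capvSr _ _).
have kS1 : (S1 :&: lker f)%VS = 0%VS.
  apply/eqP; rewrite -subv0 -S10; apply/subvP => x /memv_capP[xS xk].
  by rewrite !memv_cap xk xS (subvP S1g).
have fS1 : (f @: S1)%VS = gr D l.
  apply/eqP; rewrite eqEsubv; apply/andP; split; apply/subvP.
    by move=> _ /memv_imgP[x xS ->]; rewrite mem_gr -hf (grP (subvP S1g _ xS)).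
  move=> y yg; have /memv_imgP[x _ yE] : y \in limg f by rewrite fS memvf.
  have : e l ** x \in (lker f :&: gr P l + S1)%VS by rewrite S1S le_gr.
  case/addvP=> z [s [/memv_capP[zk _] sS xE]]; rewrite -(grP yg) yE -hf xE linearD /=.
  by move: zk; rewrite memv_ker => /eqP->; rewrite add0r memv_img.
have genS : gensub S1 = fullv.
  apply: cov; first exact: gensub_submod.
  apply/eqP; rewrite eqEsubv subvf -qS -{1}gen /= -fE limg_comp limgS //.
  apply: gensub_le; first by apply: submod_img => //; apply: gensub_submod.
  by rewrite -gl -fS1 limgS // sub_gensub.
have dS1 : \dim S1 = \dim {:Sp lab}.
  by rewrite -(dim_limg_inj kS1) fS1 gl dim_limg_inj // kf capv0.
have PE : (KK B fullv + J + S1)%VS = fullv.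
  apply/eqP; rewrite eqEsubv subvf -{1}genS; apply: aspan_le => a x _ xS.
  have xg := subvP S1g _ xS; apply: A_ind => c c' j g sc sc'.
  have [cE|cu] := eqVneq c (u (src c)); last first.
    by rewrite -addvA (subvP (addvSl _ _)) // mem_KK ?memvf.
  have [tl|ne] := eqVneq l (tgt c'); last by rewrite (cs_0 xg ne) !linear0 mem0v.
  have zg := hh_gr g (cs c' ** x); rewrite cE cc_cu sc (grP zg).
  have [c'E|cu'] := eqVneq c' (u (src c')).
    have jl : j = l by rewrite -sc' tl {2}c'E cu_tgt.
    move: g sc sc' zg; rewrite jl => g sc sc' zg; apply: (subvP (addvSr _ _)).
    by apply: sS1; rewrite c'E cs_cu sc' (grP xg).
  apply: (subvP (addvSl _ _)); apply: (subvP (addvSr _ _)).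
  by apply: (subvP (gr_above P _)) zg; rewrite tl -sc' lt_tgt.
have gS : graded B S1.
  move=> j x xS; have [->|ne] := eqVneq j l; first by rewrite (grP (subvP S1g _ xS)).
  by rewrite (gr_neq (subvP S1g _ xS)) ?mem0v // eq_sym.
have tP : (tops B J fullv <= csize l * \dim S1)%N.
  apply: (@leq_trans (\sum_j csize j * \dim (S1 :&: gr P j))%N).
    apply: leq_sum => j _; rewrite leq_mul2l; apply/orP; right.
    have gKJ : graded B (KK B fullv + J)%VS.
      by apply: graded_add; [apply: KK_graded | apply: submod_graded].
    have := graded_addcap j gKJ gS; rewrite PE /top => {1}->.
    by rewrite leq_subLR (leq_trans (dimv_add_leqif _ _)).
  rewrite (bigD1 l) //= big1 ?addn0 => [|j ne].
    by rewrite leq_mul2l dimvS ?orbT // capvSl.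
  have -> : (S1 :&: gr P j)%VS = 0%VS; last by rewrite dimv0 muln0.
  apply: vspace_eq0P => x /memv_capP[xS xl].
  by rewrite -(grP xl) (gr_neq (subvP S1g _ xS)) // eq_sym.
apply/esym/eqP; rewrite eqEdim Jk /=.
have b := top_bound B sJ (@submodf _ _ P) (subvf _).
have dP := limg_ker_dim f fullv; rewrite capfv fS in dP.
by move: b tP dP; rewrite dS1 -dD; lia.
Qed.

Theorem layering_quasi_hereditary : quasi_hereditary A lt Std.
Proof.
split.
- split=> [l /ltP|l1 l2 l3 /ltP h1 /ltP h2]; first by rewrite ltnn.
  by apply/ltP; apply: ltn_trans h1 h2.
- split=> [l|L sL|l L L'].
  + have [D [_ [sD _ _ _ _]]] := std_exists l; have [L [q [sL hq qS _]]] := std_head sD.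
    by exists L; split=> //; exists D, q.
  + have [lab [f sf]] := simple_top sL; exists lab; split.
      by apply/simple_labelP; split=> //; exists f.
    by move=> lab' /simple_labelP[_ [f' sf']]; apply: label_unique sf sf'.
  + exact: simple_label_iso.
- move=> l D sD; have [L [q [sL hq qS sq]]] := std_head sD.
  exists (rad l D), L; split=> //; first exact: rad_submod.
    by split=> //; exists D, q.
  exact: rad_factors.
exact: projective_cover_std.
Qed.

End QuasiHereditary.

(** * Costandard modules *)

Section Costandard.

Variables (k : fieldType) (A : falgType k) (B : layering A) (Y : labelling B).
Local Notation I := ('I_(nlay B).+1).
Local Notation e := (@le k A B).
Local Notation src := (@src k A B).
Local Notation tgt := (@tgt k A B).
Local Notation u := (@cu k A B).
Local Notation cc := (@cc k A B).
Local Notation cs := (@cs k A B).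
Local Notation CC := (CC B).
Local Notation gr := (@gr k A B).
Local Notation Lab := (Lab Y).
Local Notation lay := (@lay k A B Y).
Local Notation Sp := (@Sp k A B Y).
Local Notation rho lab := (@rho k A B Y lab).
Local Notation Std := (@Std k A B Y).
Implicit Types (M N D L P : fdmod A) (lab : Lab).

Variable lt : Lab -> Lab -> Prop.
Hypothesis ltP : forall lab lab', lt lab lab' <-> (lay lab < lay lab')%N.
Local Notation simple_label := (simple_label Std).

Section Evaluation.
Variables (M : fdmod A) (x : M).

Definition evl : 'Hom(A, M) := linfun (fun a : A => a ** x).

Lemma evlE a : evl a = a ** x.
Proof.
have lin : linear (fun a : A => a ** x) by move=> c b d; rewrite actDl actZl.
pose H := GRing.isLinear.Build _ _ _ _ _ lin.
pose g : {linear _ -> _} := HB.pack (fun a : A => a ** x) H.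
by rewrite /evl -[linfun _]/(linfun g) lfunE.
Qed.

End Evaluation.

Lemma coreg_cofree : cofree_over B 0 (fullv : {vspace coreg A}).
Proof.
rewrite /cofree_over dimv0 subn0.
have -> : \dim {: coreg A} = \dim {:A} by rewrite !dimvf /= /dim /= muln1.
apply: leq_trans (A_dim B); apply: leq_sum => l _.
rewrite expnS expn1 -mulnA leq_mul2l; apply/orP; right.
rewrite /soc cap0v dimv0 subn0; set Z := (_ :&: _)%VS.
have ev_ex (a : A) : exists f : 'Hom(coreg A, k^o), forall x, f x = (x : 'Hom(A, k^o)) a.
  by apply: lfun_of_linear => c x y; rewrite add_lfunE scale_lfunE.
have thex (p : CC * GG l) : exists f : 'Hom(coreg A, k^o),
    if src p.1 == l then forall x, f x = (x : 'Hom(A, k^o)) (cc p.1 * hh p.2) else f = 0.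
  have [f fE] := ev_ex (cc p.1 * hh p.2).
  by have [sl|sl] := boolP (src p.1 == l); [exists f | exists 0].
have [th thE] := fin_all_exists thex.
apply: leq_trans (dim_bigcap_ker (index_enum _) th Z) _.
have -> : (Z :&: \bigcap_p lker (th p))%VS = 0%VS.
  apply: vspace_eq0P => f /memv_capP[/memv_capP[/mem_ZZ[_ fc] fg] fk].
  have fth p : th p f = 0.
    by apply/eqP; rewrite -memv_ker; move: fk; rewrite memvE => /subv_bigcapP/(_ p isT).
  apply/lfunP => a; rewrite zero_lfunE; apply/eqP; rewrite -memv_ker.
  move: a; apply: (@A_span _ _ B) => c c' j g sc sc'; rewrite memv_ker -coregE.
  have [c'E|cu] := eqVneq c' (u (src c')); last first.
    by have := fc _ cu; rewrite memv0 => /eqP->; rewrite zero_lfunE.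
  rewrite c'E cs_cu sc'; have [jl|ne] := eqVneq l j; last first.
    by rewrite (gr_neq fg ne) zero_lfunE.
  move: g sc sc'; rewrite -jl => g sc sc'; rewrite (grP fg).
  by have := thE (c, g); rewrite /= sc eqxx => <-; rewrite fth.
rewrite dimv0 add0n (bigID (fun p => src p.1 == l)) /= [X in (_ + X)%N]big1 ?addn0; last first.
  move=> p /negPf sp; have := thE p; rewrite sp => ->; apply/eqP.
  by rewrite dimv_eq0 -subv0; apply/subvP => _ /memv_imgP[x _ ->]; rewrite zero_lfunE mem0v.
apply: (@leq_trans (\sum_(p : CC * GG l | src p.1 == l) 1)%N).
  by apply: leq_sum => p _; apply: leq_trans (dimvS (subvf _)) _; rewrite dimvf.
rewrite sum1_card /csize -cardX; apply: subset_leq_card.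
by apply/subsetP => p; rewrite !inE /= andbT.
Qed.

Lemma subm_lift (V : vectType k) M (U : {vspace M}) (sU : submod U) (f : 'Hom(V, M)) :
  (limg f <= U)%VS -> exists f1 : 'Hom(V, subm sU), forall y, subm_incl sU (f1 y) = f y.
Proof.
move=> fU; exists (linfun (vsproj U : M -> subvs_of U) \o f)%VF => y.
by rewrite comp_lfunE subm_inclE lfunE /= vsprojK // (subvP fU) // memv_img ?memvf.
Qed.

Lemma subm_incl_injective M (U : {vspace M}) (sU : submod U) : injective (subm_incl sU).
Proof. by apply/lker0P/eqP/subm_incl_inj. Qed.

Lemma subm_lift_hom M N (U : {vspace M}) (sU : submod U) (f : 'Hom(N, M)) (f1 : 'Hom(N, subm sU)) :
  is_hom f -> (forall y, subm_incl sU (f1 y) = f y) -> is_hom f1.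
Proof.
move=> hf f1E a y; apply: (@subm_incl_injective _ _ sU).
by rewrite subm_incl_hom !f1E hf.
Qed.

Lemma summand_injective N : direct_summand N (coreg A) -> injective_mod N.
Proof.
move=> [f [g [hf hg gf]]] M P h phi hh hphi h0.
have [xi xiE] : exists xi : 'Hom(M, k^o), forall x, xi x = (f (phi x) : 'Hom(A, k^o)) 1.
  by apply: lfun_of_linear => c x y; rewrite !linearP add_lfunE scale_lfunE.
have [xi' xi'E] : exists xi' : 'Hom(P, k^o), forall x, xi' (h x) = xi x.
  by apply: lfun_factor; rewrite h0 sub0v.
have [H HE] : exists H : 'Hom(P, coreg A), forall x, H x = (xi' \o evl x)%VF.
  apply: lfun_of_linear => c x y; apply/lfunP => a.
  by rewrite add_lfunE scale_lfunE !comp_lfunE !evlE !linearP.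
have HE2 x a : (H x : 'Hom(A, k^o)) a = xi' (a ** x) by rewrite HE comp_lfunE evlE.
have hH : is_hom H.
  by move=> a x; apply/lfunP => b; rewrite [RHS]coregE !HE2 act_mul.
exists (g \o H)%VF; first exact: is_hom_comp.
apply/lfunP => x; rewrite !comp_lfunE -[RHS]gf; congr (g _); apply/lfunP => a.
by rewrite HE2 -hh xi'E xiE hphi hf coregE mul1r.
Qed.

Lemma injective_hull_exists L : simple_mod L -> exists N,
  direct_summand N (coreg A) /\ injective_hull N L.
Proof.
move=> sL; have [L0 _] := sL; have [x0 _ x0n] := vspace_neq0 L0.
suff : forall d N (f : 'Hom(L, N)), \dim {:N} = d -> direct_summand N (coreg A) -> is_hom f ->
    lker f = 0%VS -> exists N, direct_summand N (coreg A) /\ injective_hull N L.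
  have [a aE] : exists a : 'Hom(k^o, L), forall c, a c = c *: x0.
    by apply: lfun_of_linear => c y z; rewrite scalerDl scalerA.
  have [xi xiE] : exists xi : 'Hom(L, k^o), forall c, xi (a c) = (\1%VF : 'End(k^o)) c.
    apply: lfun_factor; apply/subvP => c; rewrite memv_ker aE scaler_eq0 (negPf x0n) orbF.
    by move=> /eqP->; apply: mem0v.
  have [H HE] : exists H : 'Hom(L, coreg A), forall x, H x = (xi \o evl x)%VF.
    apply: lfun_of_linear => c x y; apply/lfunP => b.
    by rewrite add_lfunE scale_lfunE !comp_lfunE !evlE !linearP.
  have HE2 x b : (H x : 'Hom(A, k^o)) b = xi (b ** x) by rewrite HE comp_lfunE evlE.
  have hH : is_hom H by move=> b x; apply/lfunP => d; rewrite [RHS]coregE !HE2 act_mul.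
  move/(_ _ (coreg A) H erefl); apply=> //.
    exists \1%VF, \1%VF; split; try exact: is_hom_id.
    by move=> x; rewrite !id_lfunE.
  apply: (@simple_hom_inj _ _ _ _ _ x0) => //; apply/eqP => /lfunP/(_ 1).
  rewrite HE2 act_one zero_lfunE -[x0]scale1r -aE xiE id_lfunE.
  by apply/eqP; apply: oner_neq0.
elim/ltn_ind=> d IHd N f dN sN hf f0; have iN := summand_injective sN.
have [hull|nohull] := classic (forall U : {vspace N}, submod U -> (U :&: limg f)%VS = 0%VS -> U = 0%VS).
  by exists N; split=> //; split=> //; exists f.
have [U [sU Uf U0]] : exists U : {vspace N}, [/\ submod U, (U :&: limg f)%VS = 0%VS & U <> 0%VS].
  by apply: NNPP => no; apply: nohull => U sU hU; apply: NNPP => Uf; apply: no; exists U.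
have [Q [q [hq qS qk _]]] := subquotient_exists sU (@submodf _ _ N) (subvf _).
have hq' : is_hom q by move=> a x; rewrite hq ?memvf.
have hqf : is_hom (q \o f)%VF by apply: is_hom_comp.
have kqf : lker (q \o f)%VF = 0%VS.
  apply: vspace_eq0P => y; rewrite memv_ker comp_lfunE qk ?memvf // => fU.
  apply/eqP; rewrite -memv0 -f0 memv_ker -memv0 -Uf memv_cap fU memv_img ?memvf //.
have [p hp pE] := iN _ _ _ _ hqf hf kqf.
have hpq : is_hom (p \o q)%VF by apply: is_hom_comp.
have fixf y : (p \o q)%VF (f y) = f y by rewrite -[in RHS]pE !comp_lfunE.
have [g [[hg g0 gS _ kg] [gfix _]]] := fitting hpq.
have sI := submod_img hg (@submodf _ _ N).
have Ug : (U <= lker g)%VS.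
  apply: subv_trans kg; apply/subvP => x xU; rewrite memv_ker comp_lfunE.
  by have := qk x (memvf x); rewrite xU => /eqP->; rewrite linear0.
have [|f1 f1E] := @subm_lift _ _ _ sI f.
  by apply/subvP => _ /memv_imgP[y _ ->]; rewrite -(gfix _ (fixf y)) memv_img ?memvf.
apply: (IHd _ _ (subm sI) f1 erefl).
- rewrite dim_subm -dN; have := dimv_add_cap (lker g) (limg g); rewrite g0 gS dimv0.
  have := dimvS Ug; have : (0 < \dim U)%N by rewrite lt0n dimv_eq0; apply/eqP.
  lia.
- apply: direct_summand_trans sN; apply: complement_summand (submod_ker hg) _ _.
    by rewrite capvC.
  by rewrite addvC.
- exact: subm_lift_hom hf f1E.
apply: vspace_eq0P => y; rewrite memv_ker => /eqP fy; apply/eqP.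
by rewrite -memv0 -f0 memv_ker -f1E fy linear0.
Qed.

Section Hull.

Variables (N L : fdmod A) (f : 'Hom(L, N)) (lab : Lab) (phi : 'Hom(Sp lab, L)).
Hypotheses (sL : simple_mod L) (hf : is_hom f) (f0 : lker f = 0%VS).
Hypothesis hull : forall U : {vspace N}, submod U -> (U :&: limg f)%VS = 0%VS -> U = 0%VS.
Hypothesis sphi : simple_map phi.

Let fphi_neq0 y : y != 0 -> f (phi y) != 0.
Proof.
case: sphi => _ _ kphi _ _; apply: contra.
by rewrite -memv_ker f0 memv0 -memv_ker kphi memv0.
Qed.

Lemma hull_meets (X : {vspace N}) : submod X -> (forall y, f (phi y) \in X -> y = 0) -> X = 0%VS.
Proof.
move=> sX Xphi; apply: hull => //; have [L0 sL'] := sL.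
case: (sL' _ (submod_preim hf sX)) => [X0|XS].
  apply: vspace_eq0P => x' /memv_capP[xX /memv_imgP[x _ xE]].
  have : x \in (f @^-1: X)%VS by rewrite -memv_preim -xE.
  by rewrite X0 memv0 xE => /eqP->; rewrite linear0.
have [y y0] := Sp_witness lab; case/eqP: y0; apply: Xphi.
by rewrite memv_preim XS memvf.
Qed.

Lemma hull_faithful (x : N) : (forall a, e (lay lab) ** (a ** x) = 0) -> x = 0.
Proof.
move=> xa; suff X0 : gensub <[x]>%VS = 0%VS.
  apply/eqP; rewrite -memv0 -X0; apply: (subvP (sub_gensub _)); exact: memv_line.
apply: hull_meets; first exact: gensub_submod.
move=> y; have /subvP h : (gensub <[x]> <= colon (e (lay lab)) 0)%VS.
  apply: gensub_le; first exact: colon_submod.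
  apply/subvP => _ /vlineP[c ->]; rewrite memvZ //; apply/mem_colon => b.
  by rewrite xa mem0v.
move=> /h/mem_colon/(_ 1); rewrite act_one memv0 -hf.
have [_ fk _ _ _] := sphi; rewrite (grP (subvP (killed_gr fk) _ (memv_img phi (memvf y)))).
by move=> fy; apply/eqP; apply: contraTT fy; apply: fphi_neq0.
Qed.

Variable U : {vspace N}.
Hypotheses (sU : submod U) (Ua : forall l : I, (lay lab < l)%N -> (U :&: gr N l)%VS = 0%VS).

Let caps0 c x : c != u (lay lab) -> x \in (U :&: gr N (lay lab))%VS -> cs c ** x = 0.
Proof. exact: caps_zero. Qed.

Lemma hull_top : (U :&: gr N (lay lab) <= limg (f \o phi))%VS.
Proof.
have [eq_phi kphi _ phig _] := sphi.
have eq_fp : equivariant (rho lab) (f \o phi)%VF.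
  by move=> g y; rewrite !comp_lfunE eq_phi hf.
set W := (U :&: _)%VS; set S := limg _.
have sW : hstable (lay lab) W.
  by apply: hstable_cap; [apply: submod_hstable | apply: gr_hstable].
have [W' [sW' W'W W'0 W'S]] := maschke (capvSr _ _) sW
  (hstable_cap sW (equiv_hstable eq_fp)) (capvSl _ _).
suff W'E : W' = 0%VS by move: W'S; rewrite W'E addv0 -/W => <-; apply: capvSr.
apply/eqP; rewrite -subv0; apply: subv_trans (sub_gensub _) _.
rewrite (hull_meets (gensub_submod W')) // => y yX.
have fyg : f (phi y) \in gr N (lay lab).
  by rewrite mem_gr -hf (grP (subvP (killed_gr kphi) _ (memv_img phi (memvf y)))).
have : f (phi y) \in W'.
  rewrite -(grP fyg); apply: gen_top yX => //; first exact: subv_trans W'W (capvSr _ _).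
  by move=> c x cu xW'; apply: caps0 => //; apply: (subvP W'W).
move=> fyW'; apply/eqP; apply: contraT => /fphi_neq0 /negP[].
rewrite -memv0 -W'0 memv_cap fyW' andbT memv_cap; apply/andP; split.
  exact: (subvP W'W).
by rewrite -comp_lfunE memv_img ?memvf.
Qed.

Lemma hull_soc : (socs B 0 U <= csize (lay lab) * \dim {:Sp lab})%N.
Proof.
rewrite /socs (bigD1 (lay lab)) //= big1 ?addn0 => [|j jl].
  rewrite leq_mul2l; apply/orP; right; rewrite /soc cap0v dimv0 subn0.
  apply: (@leq_trans (\dim (limg (f \o phi)))).
    by apply: dimvS; apply: subv_trans hull_top; apply: capvS => //; apply: capvSl.
  by rewrite -[X in (_ <= X)%N](limg_ker_dim (f \o phi)) leq_addl.
apply/eqP; rewrite muln_eq0 subn_eq0; apply/orP; right.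
suff -> : (ZZ B 0 U :&: gr N j)%VS = 0%VS by rewrite dimv0.
apply: vspace_eq0P => x /memv_capP[/mem_ZZ[xU xc] xg]; apply: hull_faithful => a.
apply/eqP; rewrite -memv_ker; move: a; apply: A_ind => c c' i g sc sc'.
rewrite memv_ker; have [c'E|cu] := eqVneq c' (u (src c')); last first.
  by have := xc _ cu; rewrite memv0 => /eqP->; rewrite !linear0.
rewrite c'E cs_cu sc'; have [ij|ne] := eqVneq j i; last by rewrite (gr_neq xg ne) !linear0.
move: g sc sc'; rewrite -ij => g sc sc'; rewrite (grP xg).
have [tl|ne] := eqVneq (tgt c) (lay lab); last by rewrite (gr_neq (cc_gr c _) ne).
have lj : (lay lab < j)%N.
  rewrite -tl -sc; apply: lt_tgt; apply: contra jl => /eqP cE.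
  by rewrite -sc -tl {2}cE cu_tgt.
have -> : x = 0; last by rewrite !linear0.
by apply/eqP; rewrite -memv0 -(Ua lj) memv_cap xU.
Qed.

Lemma hull_dim : (\dim U <= csize (lay lab) * \dim {:Sp lab})%N.
Proof.
have := soc_bound B (@submod0 _ _ N) sU (sub0v _).
by rewrite dimv0 add0n => /leq_trans; apply; apply: hull_soc.
Qed.

End Hull.

Lemma generated_factor M lab (f : 'Hom(Sp lab, M)) :
  equivariant (rho lab) f -> killed f -> lker f = 0%VS ->
  exists L (f' : 'Hom(Sp lab, L)), simple_map f' /\ composition_factor (gensub (limg f)) L.
Proof.
move=> eq_f fk kf; pose X := gensub (limg f); pose R := (X :&: rad lab M)%VS.
have sX : submod X by apply: gensub_submod.
have /submodP pX := sX.
have sR : submod R by apply: submod_cap => //; apply: rad_submod.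
have [L [q [hq qS qk sq]]] := subquotient_exists sR sX (capvSl _ _).
have fX y : f y \in X by apply: (subvP (sub_gensub _)); rewrite memv_img ?memvf.
have fg y : f y \in gr M (lay lab) by rewrite (subvP (killed_gr fk)) ?memv_img ?memvf.
have qf y : y != 0 -> q (f y) != 0.
  apply: contra; rewrite qk // => /memv_capP[_ fr].
  rewrite -memv0 -kf memv_ker -memv0 -(rad_gr lab M) memv_cap fr; exact: fg.
have [y y0] := Sp_witness lab.
have sL : simple_mod L.
  split.
    by move=> L0; have := qf y y0; rewrite -memv0 -L0 memvf.
  move=> Z sZ; have /submodP pZ := sZ; pose Z' := (X :&: q @^-1: Z)%VS.
  have pZ' a x : x \in Z' -> a ** x \in Z'.
    by move=> /memv_capP[xX xZ]; rewrite memv_cap pX // -memv_preim hq // pZ // memv_preim.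
  have ZE : Z = (q @: Z')%VS.
    apply/vspaceP => z; apply/idP/memv_imgP => [zZ|[x /memv_capP[_] + ->]]; last first.
      by rewrite -memv_preim.
    have /memv_imgP[x xX xE] : z \in (q @: X)%VS by rewrite qS memvf.
    by exists x => //; rewrite memv_cap xX -memv_preim -xE.
  case: (@Sp_simple _ _ _ Y lab (f @^-1: Z')%VS) => [g z|Z0|ZS].
  - by rewrite -!memv_preim eq_f; apply: pZ'.
  - left; rewrite ZE; apply/eqP; rewrite -subv0; apply/subvP => _ /memv_imgP[x xZ ->].
    have /memv_capP[xX _] := xZ; rewrite memv0 qk // memv_cap xX; apply/mem_colon => b.
    have : e (lay lab) ** (b ** x) \in limg f by apply: gensub_top => //; apply: pX.
    case/memv_imgP=> z _ zE; have : z \in (f @^-1: Z')%VS.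
      by rewrite -memv_preim -zE; do 2!apply: (pZ').
    by rewrite zE Z0 memv0 => /eqP->; rewrite linear0 mem0v.
  right; apply/eqP; rewrite eqEsubv subvf ZE -qS; apply: limgS.
  have sZ' : submod Z' by apply/submodP.
  apply: gensub_le => //; apply/subvP => _ /memv_imgP[z _ ->].
  by rewrite memv_preim ZS memvf.
have [f' f'E] : exists f' : 'Hom(Sp lab, L), forall z, f' z = q (f z).
  by exists (q \o f)%VF => z; rewrite comp_lfunE.
exists L, f'; split; last by split=> //; exists R, X; split.
apply: (@simple_mapI _ _ _ _ _ _ _ y) => //; last by rewrite f'E qf.
  by move=> g z; rewrite !f'E eq_f hq.
by move=> c z cu; rewrite f'E -hq // fk // linear0.
Qed.

Lemma factor_sub M (U U' : {vspace M}) L :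
  (U <= U')%VS -> composition_factor U L -> composition_factor U' L.
Proof.
move=> UU' [sL [U1 [U2 [s1 s2 U2U sq]]]]; split=> //; exists U1, U2.
by split=> //; apply: subv_trans UU'.
Qed.

Lemma top_killed M (U : {vspace M}) lab (f : 'Hom(Sp lab, M)) : submod U ->
  (forall l' : I, (lay lab < l')%N -> (U :&: gr M l')%VS = 0%VS) ->
  (limg f <= U :&: gr M (lay lab))%VS -> killed f.
Proof.
move=> sU Ua fU c y cu; apply: (caps_zero sU Ua cu).
by apply: (subvP fU); apply/memv_img/memvf.
Qed.

Definition le_lab lab lab' := lab' = lab \/ lt lab' lab.

Lemma factors_le_layers M (U : {vspace M}) lab : submod U ->
  factors_below Std (le_lab lab) U ->
  forall l : I, (lay lab < l)%N -> (U :&: gr M l)%VS = 0%VS.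
Proof.
move=> sU fU l ll; apply: NNPP => /eqP Ul.
have [j [/andP[lj /eqP Uj] jmax]] : exists j : I, ((lay lab < j)%N && ((U :&: gr M j)%VS != 0%VS)) /\
    forall l' : I, (j < l')%N -> ~~ ((lay lab < l')%N && ((U :&: gr M l')%VS != 0%VS)).
  apply: (@max_layer _ _ B (fun j : I => (lay lab < j)%N && ((U :&: gr M j)%VS != 0%VS))).
  by exists l; rewrite ll Ul.
have Ua (l' : I) : (j < l')%N -> (U :&: gr M l')%VS = 0%VS.
  by move=> jl; have := jmax _ jl; rewrite (ltn_trans lj jl) /= negbK => /eqP.
have [lab' [f [l'E kf eq_f fU']]] := Sp_exists Y (capvSr _ _)
  (hstable_cap (submod_hstable (l := j) sU) (@gr_hstable _ _ _ _ j)) Uj.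
move: lj Ua fU'; rewrite -l'E => lj Ua fU'.
have [L [f' [sf cL]]] := generated_factor eq_f (top_killed sU Ua fU') kf.
have cU : composition_factor U L.
  by apply: factor_sub cL; apply: gensub_le => //; apply: subv_trans fU' (capvSl _ _).
have [lab1 le1 /simple_labelP[_ [f1 sf1]]] := fU _ cU.
have E := label_unique sf1 sf; rewrite E in le1.
by case: le1 => [E1|/ltP]; [move: lj; rewrite E1 ltnn | rewrite ltnNge ltnW].
Qed.

Lemma factor_label M (U : {vspace M}) lab (psi : 'Hom(Sp lab, M)) L lab' (f : 'Hom(Sp lab', L)) :
  equivariant (rho lab) psi -> killed psi -> (U :&: gr M (lay lab) <= limg psi)%VS ->
  composition_factor U L -> simple_map f -> lay lab' = lay lab -> lab' = lab.
Proof.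
move=> eq_p kp Up [sL [U1 [U2 [s1 s2 U2U [U12 [q [hq qS _]]]]]]] sf ll.
have /submodP p2 := s2.
have [y] := vspace_neq0 (gr_simple_neq0 sf); rewrite ll => yg y0.
have /memv_imgP[x xU2 xE] : y \in (q @: U2)%VS by rewrite qS memvf.
have exU : e (lay lab) ** x \in (U2 :&: gr M (lay lab))%VS by rewrite memv_cap le_gr p2.
have /memv_imgP[z _ zE] : e (lay lab) ** x \in limg psi.
  apply: (subvP Up); move: exU; rewrite !memv_cap => /andP[+ ->].
  by rewrite andbT; apply/subvP.
have qz : q (psi z) = y by rewrite -zE hq // -xE (grP yg).
case: (@Sp_simple _ _ _ Y lab (psi @^-1: U2)%VS) => [g w|P0|PS].
- by rewrite -!memv_preim eq_p; apply: p2.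
- have : z \in (psi @^-1: U2)%VS by rewrite -memv_preim -zE; case/memv_capP: exU.
  by rewrite P0 memv0 => /eqP z0; move: y0; rewrite -qz z0 !linear0 eqxx.
have pU w : psi w \in U2 by rewrite memv_preim PS memvf.
have [f' f'E] : exists f' : 'Hom(Sp lab, L), forall w, f' w = q (psi w).
  by exists (q \o psi)%VF => w; rewrite comp_lfunE.
apply: (label_unique sf (f' := f')); apply: (@simple_mapI _ _ _ _ _ _ _ z) => //.
- by move=> g w; rewrite !f'E eq_p hq.
- by move=> c w cu; rewrite f'E -hq // kp // linear0.
by rewrite f'E qz.
Qed.

Section CostandardOf.

Variables (lab : Lab) (Q : fdmod A) (psi : 'Hom(Sp lab, Q)).
Hypotheses (eq_p : equivariant (rho lab) psi) (kp : lker psi = 0%VS).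
Hypotheses (pg : limg psi = gr Q (lay lab)).
Hypothesis Qa : forall l : I, (lay lab < l)%N -> gr Q l = 0%VS.
Hypothesis Qf : forall x : Q, (forall a, e (lay lab) ** (a ** x) = 0) -> x = 0.
Hypothesis dQ : (csize (lay lab) * \dim {:Sp lab} <= \dim {:Q})%N.

Let pk : killed psi.
Proof.
apply: (top_killed (@submodf _ _ Q)); last by rewrite capfv pg.
by move=> l /Qa ->; rewrite capv0.
Qed.

Let sub_zero (X : {vspace Q}) : submod X -> (psi @^-1: X)%VS = 0%VS -> X = 0%VS.
Proof.
move=> /submodP sX X0; apply: vspace_eq0P => x xX; apply: Qf => a.
have : e (lay lab) ** (a ** x) \in limg psi by rewrite pg le_gr.
case/memv_imgP=> y _ yE; have : y \in (psi @^-1: X)%VS.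
  by rewrite -memv_preim -yE; do 2!apply: (sX).
by rewrite yE X0 memv0 => /eqP->; rewrite linear0.
Qed.

Let sub_or (X : {vspace Q}) : submod X -> X = 0%VS \/ (limg psi <= X)%VS.
Proof.
move=> sX; have /submodP pX := sX.
case: (@Sp_simple _ _ _ Y lab (psi @^-1: X)%VS) => [g y|X0|XS].
- by rewrite -!memv_preim eq_p; apply: pX.
- by left; apply: sub_zero.
by right; apply/subvP => _ /memv_imgP[y _ ->]; rewrite memv_preim XS memvf.
Qed.

Lemma costandard_of : is_costandard lt Std lab Q.
Proof.
have [y y0] := Sp_witness lab; have sG := gensub_submod (limg psi).
have injG := @subm_incl_injective _ _ sG.
have [f1 f1E] := subm_lift sG (sub_gensub (limg psi)).
have f1n z : z != 0 -> f1 z != 0.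
  apply: contra => /eqP f10; rewrite -memv0 -kp memv_ker -f1E f10 linear0.
  by [].
have sL : simple_mod (subm sG).
  split; first by move=> L0; have := f1n y y0; rewrite -memv0 -L0 memvf.
  move=> X sX; case: (sub_or (submod_img (@subm_incl_hom _ _ _ _ sG) sX)) => [X0|Xp]; [left|right].
    apply: vspace_eq0P => x xX; apply: injG; rewrite linear0; apply/eqP.
    by rewrite -memv0 -X0 memv_img.
  apply/eqP; rewrite eqEsubv subvf; apply/subvP => x _.
  have : subm_incl sG x \in gensub (limg psi) by rewrite subm_inclE subvsP.
  move/(subvP (gensub_le (submod_img (@subm_incl_hom _ _ _ _ sG) sX) Xp)).
  by case/memv_imgP=> x' x'X /injG->.
have sf1 : simple_map f1.
  apply: (@simple_mapI _ _ _ _ _ _ _ y) => //; last exact: f1n.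
    by move=> g z; apply: injG; rewrite subm_incl_hom !f1E eq_p.
  by move=> c z cu; apply: injG; rewrite subm_incl_hom f1E pk // linear0.
have [N [_ hullN]] := injective_hull_exists sL.
have [iN [f [hf f0 ess]]] := hullN.
have [F hF FE] := iN _ _ _ _ (@subm_incl_hom _ _ _ _ sG) hf (@subm_incl_inj _ _ _ _ sG).
have FE2 x : F (subm_incl sG x) = f x by rewrite -FE comp_lfunE.
have F0 : lker F = 0%VS.
  case: (sub_or (submod_ker hF)) => // pF; case/negP: y0.
  have := subvP pF _ (memv_img psi (memvf y)); rewrite memv_ker -f1E FE2 -memv_ker f0 memv0.
  by move=> f10; apply: contraLR f10; apply: f1n.
have eq_Fp : equivariant (rho lab) (F \o psi)%VF by move=> g z; rewrite !comp_lfunE eq_p hF.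
have kFp : killed (F \o psi)%VF by move=> c z cu; rewrite comp_lfunE -hF pk // linear0.
have grF l : (limg F :&: gr N l <= F @: gr Q l)%VS.
  apply/subvP => _ /memv_capP[/memv_imgP[x _ ->] /grP <-]; rewrite -hF memv_img //.
  exact: le_gr.
have Fa (l : I) : (lay lab < l)%N -> (limg F :&: gr N l)%VS = 0%VS.
  by move=> ll; apply/eqP; rewrite -subv0 (subv_trans (grF l)) // Qa // limg0.
have sF := submod_img hF (@submodf _ _ Q).
exists (subm sG), N, F; split=> //; first by apply/simple_labelP; split=> //; exists f1.
  move=> L cL; have [lab' [f' [sf' Fl]]] := factor_layer Y cL.
  exists lab'; last by apply/simple_labelP; split; [case: cL | exists f'].
  case: (ltngtP (lay lab') (lay lab)) => [h|h|/val_inj h]; first by right; apply/ltP.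
    by case: Fl; apply: Fa.
  left; apply: (factor_label eq_Fp kFp _ cL sf') => //.
  by apply: subv_trans (grF _) _; rewrite -pg limg_comp.
move=> U sU fU; have Ua := factors_le_layers sU fU.
have sUF := submodD sU sF.
have UFa (l : I) : (lay lab < l)%N -> ((U + limg F) :&: gr N l)%VS = 0%VS.
  by move=> ll; rewrite graded_addcap ?Ua ?Fa ?add0v //; apply: submod_graded.
have dUF := hull_dim sL hf f0 ess sf1 sUF UFa.
have -> : limg F = (U + limg F)%VS; last exact: addvSl.
apply/eqP; rewrite eqEdim addvSr /= (leq_trans dUF) // (leq_trans dQ) //.
by rewrite dim_limg_inj // F0 capv0.
Qed.

End CostandardOf.

Lemma cofree_filtration M (X : {vspace M}) : submod X -> cofree_over B 0 X ->
  has_filtration (fun N => exists lab, is_costandard lt Std lab N) X.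
Proof.
move dX : (\dim X) => d; elim/ltn_ind: d X dX => d IHd X dX sX cX.
have [X0|Xn] := classic (X = 0%VS); first by rewrite X0; apply: has_filtration0.
have /submodP pX := sX.
have [l [/eqP Xl lmax]] : exists l, (X :&: gr M l)%VS != 0%VS /\
    forall l' : I, (l < l')%N -> ~~ ((X :&: gr M l')%VS != 0%VS).
  apply: (@max_layer _ _ B (fun l => (X :&: gr M l)%VS != 0%VS)); apply: NNPP => nb; apply: Xn.
  apply: vspace_eq0P => x xX; rewrite -(sum_le B x) big1 // => l _; apply/eqP.
  have E : (X :&: gr M l)%VS = 0%VS by apply/eqP/negPn/negP => h; apply: nb; exists l.
  by rewrite -memv0 -E memv_cap le_gr pX.
have Xa (l' : I) : (l < l')%N -> (X :&: gr M l')%VS = 0%VS.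
  by move=> ll; have := lmax _ ll; rewrite negbK => /eqP.
have sXl := hstable_cap (submod_hstable (l := l) sX) (@gr_hstable _ _ _ M l).
have [lab [f [labl kf eq_f fX]]] := Sp_exists Y (capvSr _ _) sXl Xl.
move: sXl fX Xa {Xl lmax}; rewrite -labl => sXl fX Xa {l labl}.
have [S [sS SX fS0 fS]] := maschke (capvSr _ _) sXl (equiv_hstable eq_f) fX.
pose X' := (X :&: colon (e (lay lab)) S)%VS.
have sX' : submod X' by apply: cofree_step_submod.
have X'g : (X' :&: gr M (lay lab))%VS = S by apply: cofree_step_top.
have [cX' dX'] := cofree_step sX Xa SX sS cX; rewrite -/X' in cX' dX'.
have dS : (\dim (X :&: gr M (lay lab)) - \dim S)%N = \dim {:Sp lab}.
  rewrite -fS -(dim_limg_inj (f := f)) ?kf ?capv0 //.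
  by have := dimv_add_cap (limg f) S; rewrite fS0 dimv0; lia.
rewrite dS in dX'.
have dpos : (0 < csize (lay lab) * \dim {:Sp lab})%N.
  by rewrite muln_gt0 csize_gt0 lt0n dimv_eq0; apply/eqP; apply: Sp_neq0.
have [Q [q [hq qS qk sq]]] := subquotient_exists sX' sX (capvSl _ _).
have fX1 y : f y \in X by have /memv_capP[] := subvP fX _ (memv_img f (memvf y)).
have [psi pE] : exists psi : 'Hom(Sp lab, Q), forall z, psi z = q (f z).
  by exists (q \o f)%VF => z; rewrite comp_lfunE.
have dQ := dim_sq sq.
apply: has_filtration_append (IHd (\dim X') _ X' erefl sX' cX') sX _ sq; first by rewrite -dX dX'; lia.
have qgr l y : y \in gr Q l -> exists2 x, x \in (X :&: gr M l)%VS & y = q x.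
  move=> yg; have /memv_imgP[x xX yE] : y \in (q @: X)%VS by rewrite qS memvf.
  by exists (e l ** x); rewrite ?memv_cap ?le_gr ?pX // hq // -yE (grP yg).
have fl y : f y \in gr M (lay lab) by have /memv_capP[] := subvP fX _ (memv_img f (memvf y)).
exists lab; apply: (@costandard_of _ _ psi).
- by move=> g y; rewrite !pE eq_f hq.
- apply: vspace_eq0P => y; rewrite memv_ker pE qk // => fX'.
  have fS1 : f y \in S by rewrite -X'g memv_cap fX' fl.
  apply/eqP; rewrite -memv0 -kf memv_ker -memv0 -fS0 memv_cap fS1 andbT.
  exact/memv_img/memvf.
- apply/eqP; rewrite eqEsubv; apply/andP; split; apply/subvP.
    by move=> _ /memv_imgP[y _ ->]; rewrite pE mem_gr -hq // (grP (fl y)).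
  move=> y /qgr[x]; rewrite -fS => /addvP[_ [s [/memv_imgP[z _ ->] sS1 ->]]] ->.
  rewrite linearD /= [X in _ + X](_ : _ = 0) ?addr0; first by rewrite -pE memv_img ?memvf.
  by apply/eqP; rewrite qk; [move: sS1; rewrite -X'g => /memv_capP[] |
     have /memv_capP[] := subvP SX _ sS1].
- move=> l /Xa Xl; apply: vspace_eq0P => y /qgr[x]; rewrite Xl memv0 => /eqP-> ->.
  exact: linear0.
- move=> y ye; have /memv_imgP[x xX yE] : y \in (q @: X)%VS by rewrite qS memvf.
  rewrite yE; apply/eqP; rewrite qk // memv_cap xX; apply/mem_colon => b.
  rewrite -X'g memv_cap le_gr andbT -qk; last by do 2!apply: (pX).
  by rewrite hq ?hq ?pX // -yE ye.
by rewrite dQ dX' addKn.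
Qed.

Lemma cofree_truncate M (l : I) : cofree_over B 0 (fullv : {vspace M}) ->
  exists X : {vspace M}, [/\ submod X, cofree_over B 0 X,
    forall l' : I, (l < l')%N -> (X :&: gr M l')%VS = 0%VS &
    forall Z : {vspace M}, submod Z ->
      (forall l' : I, (l < l')%N -> (Z :&: gr M l')%VS = 0%VS) -> (Z <= X)%VS].
Proof.
move=> cM; pose goodsub (X : {vspace M}) := forall Z : {vspace M}, submod Z ->
  (forall l' : I, (l < l')%N -> (Z :&: gr M l')%VS = 0%VS) -> (Z <= X)%VS.
suff : forall d X, \dim X = d -> submod X -> cofree_over B 0 X -> goodsub X ->
    exists X : {vspace M}, [/\ submod X, cofree_over B 0 X,
    forall l' : I, (l < l')%N -> (X :&: gr M l')%VS = 0%VS & goodsub X].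
  by apply; [reflexivity | exact: submodf | exact: cM | move=> Z _ _; apply: subvf].
elim/ltn_ind => d IHd X dX sX cX gX.
pose bad (j : I) := (l < j)%N && ((X :&: gr M j)%VS != 0%VS).
have [ok|nok] := classic (forall j, ~~ bad j).
  exists X; split=> // j lj; have := ok j; rewrite /bad lj /= negbK.
  by move/eqP.
have [j [/andP[lj /eqP Xj] jmax]] : exists j, bad j /\ forall l' : I, (j < l')%N -> ~~ bad l'.
  apply: max_layer; apply: NNPP => nb; apply: nok => j; apply/negP => bj.
  by apply: nb; exists j.
have Xa (l' : I) : (j < l')%N -> (X :&: gr M l')%VS = 0%VS.
  by move=> jl; have := jmax _ jl; rewrite /bad (ltn_trans lj jl) /= negbK => /eqP.
have s0 : hstable j (0%VS : {vspace M}) by apply: submod_hstable; apply: submod0.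
have [cX' dX'] := cofree_step sX Xa (sub0v _) s0 cX.
apply: IHd cX' _; [|reflexivity| |].
- rewrite -dX dX' dimv0 subn0; have : (0 < csize j * \dim (X :&: gr M j))%N.
    by rewrite muln_gt0 csize_gt0 lt0n dimv_eq0; apply/eqP.
  lia.
- exact: cofree_step_submod.
move=> Z sZ Za; rewrite subv_cap gX //=; apply/subvP => z zZ; apply/mem_colon => b.
rewrite -(Za _ lj) memv_cap le_gr andbT.
by have /submodP pZ := sZ; do 2!apply: (pZ).
Qed.

Lemma costandard_cofree lab N : is_costandard lt Std lab N ->
  cofree_over B 0 (fullv : {vspace N}).
Proof.
case=> L [J [f [sl [iJ [fL [hL kL ess]]] [hf kf] fbelow fmax]]].
have /simple_labelP[sL [phi sphi]] := sl; have [eq_phi pk kphi phig _] := sphi.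
have sU := submod_img hf (@submodf _ _ N); set U := limg f in fbelow fmax sU.
have Ua := factors_le_layers sU fbelow.
have [J0 [sJ0 [iJ0 [f0 [h0 k0 ess0]]]]] := injective_hull_exists sL.
have [X [sX cX Xa Xmax]] := cofree_truncate (lay lab) (summand_cofree sJ0 coreg_cofree).
have fX : (limg f0 <= X)%VS.
  apply: Xmax; first exact: submod_img (@submodf _ _ L).
  move=> l ll; apply/eqP; rewrite -subv0; apply/subvP.
  move=> _ /memv_capP[/memv_imgP[x _ ->] /grP <-]; rewrite -h0.
  have [_ _ _ _ La] := sphi; have -> : e l ** x = 0.
    by apply/eqP; rewrite -memv0 -(La _ ll) le_gr.
  by rewrite linear0 mem0v.
have dX : (csize (lay lab) * \dim {:Sp lab} <= \dim X)%N.
  move: cX; rewrite /cofree_over dimv0 subn0; apply: leq_trans.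
  rewrite /socs (bigD1 (lay lab)) //= (leq_trans _ (leq_addr _ _)) // leq_mul2l.
  apply/orP; right; rewrite /soc cap0v dimv0 subn0.
  have <- : \dim (limg (f0 \o phi)) = \dim {:Sp lab}.
    apply: dim_limg_inj; rewrite capfv; apply: vspace_eq0P => y.
    by rewrite memv_ker comp_lfunE -memv_ker k0 memv0 -memv_ker kphi memv0 => /eqP.
  apply: dimvS; apply/subvP => _ /memv_imgP[y _ ->]; rewrite comp_lfunE memv_cap.
  apply/andP; split; last first.
    by rewrite mem_gr -h0 (grP (subvP (killed_gr pk) _ (memv_img phi (memvf y)))).
  apply/mem_ZZ; split; first by apply: (subvP fX); rewrite memv_img ?memvf.
  by move=> c cu; rewrite -h0 ((killedP phi).1 pk).2 ?linear0 ?mem0v.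
have [i0 i0E] := subm_lift sX fX; have hi0 := subm_lift_hom h0 i0E.
have ki0 : lker i0 = 0%VS.
  apply: vspace_eq0P => y; rewrite memv_ker => /eqP y0; apply/eqP.
  by rewrite -memv0 -k0 memv_ker -i0E y0 linear0.
have [h hh hE] := iJ _ _ _ _ hi0 hL ki0.
have hE2 x : h (i0 x) = fL x by rewrite -hE comp_lfunE.
have kh : lker h = 0%VS.
  suff Z0 : (subm_incl sX @: lker h)%VS = 0%VS.
    apply: vspace_eq0P => x xk; apply: (@subm_incl_injective _ _ sX); rewrite linear0.
    by apply/eqP; rewrite -memv0 -Z0 memv_img.
  apply: ess0; first by apply: submod_img (submod_ker hh); apply: subm_incl_hom.
  apply: vspace_eq0P => _ /memv_capP[/memv_imgP[x xk ->] /memv_imgP[y _]].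
  rewrite -i0E => /(@subm_incl_injective _ _ sX) xE; move: xk; rewrite memv_ker xE hE2.
  by rewrite -memv_ker kL memv0 => /eqP->; rewrite !linear0.
have sh := submod_img hh (@submodf _ _ (subm sX)).
have ha (l : I) : (lay lab < l)%N -> (limg h :&: gr J l)%VS = 0%VS.
  move=> ll; apply/eqP; rewrite -subv0; apply/subvP.
  move=> _ /memv_capP[/memv_imgP[x _ ->] /grP <-]; rewrite -hh.
  have -> : e l ** x = 0; last by rewrite linear0 mem0v.
  apply: (@subm_incl_injective _ _ sX); rewrite subm_incl_hom linear0; apply/eqP.
  rewrite -memv0 -(Xa _ ll) memv_cap le_gr andbT; have /submodP pX := sX.
  by apply: pX; rewrite subm_inclE subvsP.
have eq_fp : equivariant (rho lab) (fL \o phi)%VF by move=> g y; rewrite !comp_lfunE eq_phi hL.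
have kfp : killed (fL \o phi)%VF by move=> c z cu; rewrite comp_lfunE -hL pk // linear0.
have hU : (limg h <= U)%VS.
  apply: fmax => // L' cL; have [lab' [f' [sf' Fl]]] := factor_layer Y cL.
  exists lab'; last by apply/simple_labelP; split; [case: cL | exists f'].
  case: (ltngtP (lay lab') (lay lab)) => [lt'|gt'|/val_inj eq']; first by right; apply/ltP.
    by case: Fl; apply: ha.
  left; apply: (factor_label eq_fp kfp _ cL sf') => //.
  exact: (hull_top sL hL kL ess sphi).
have sq : subquotient_iso 0 U N.
  split; first exact: sub0v.
  exists (f^-1)%VF; have fK x : (f^-1)%VF (f x) = x by apply: lker0_lfunK; apply/eqP.
  split; first by move=> a _ /memv_imgP[x _ ->]; rewrite -hf !fK.
    apply/eqP; rewrite eqEsubv subvf; apply/subvP => x _.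
    by rewrite -[x]fK memv_img // memv_img ?memvf.
  apply: vspace_eq0P => _ /memv_capP[/memv_imgP[x _ ->]].
  by rewrite memv_ker fK => /eqP->; rewrite linear0.
rewrite /cofree_over (socs_sq B (@submod0 _ _ J) sU sq) (dim_sq sq) !dimv0 !subn0.
apply: leq_trans (hull_soc sL hL kL ess sphi sU Ua) _.
apply: leq_trans dX _; apply: leq_trans (dimvS hU).
by rewrite dim_limg_inj ?kh ?capv0 // dim_subm.
Qed.

Lemma filtration_cofree M (U : {vspace M}) :
  has_filtration (fun N => exists lab, is_costandard lt Std lab N) U -> cofree_over B 0 U.
Proof.
move=> hU; apply: (filtration_ind (F := fun X => cofree_over B 0 X) hU).
  rewrite /cofree_over dimv0 /socs big1 // => l _.
  rewrite /soc cap0v dimv0 subn0.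
  have -> : (ZZ B 0 (0 : {vspace M}) :&: gr M l)%VS = 0%VS; last by rewrite dimv0 muln0.
  by apply: vspace_eq0P => x /memv_capP[/mem_ZZ[]]; rewrite memv0 => /eqP.
move=> X X' N sX sX' fX [lab /costandard_cofree fN] sq.
have XX' : (X <= X')%VS by case: sq.
have := socs_trans B (@submod0 _ _ M) sX sX' (sub0v _) XX'.
move: fX fN; rewrite /cofree_over (socs_sq B sX sX' sq) (dim_sq sq) !dimv0 !subn0.
have := dimvS XX'; lia.
Qed.

End Costandard.

(** * Tilting modules *)

Section Tilting.

Variables (k : fieldType) (A : falgType k) (B : layering A) (Y : labelling B).
Local Notation I := ('I_(nlay B).+1).
Local Notation e := (@le k A B).
Local Notation src := (@src k A B).
Local Notation tgt := (@tgt k A B).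
Local Notation u := (@cu k A B).
Local Notation cc := (@cc k A B).
Local Notation cs := (@cs k A B).
Local Notation CC := (CC B).
Local Notation gr := (@gr k A B).
Local Notation Lab := (Lab Y).
Local Notation lay := (@lay k A B Y).
Local Notation Sp := (@Sp k A B Y).
Local Notation rho lab := (@rho k A B Y lab).
Local Notation Std := (@Std k A B Y).
Implicit Types (M N D L P : fdmod A) (lab : Lab).

Implicit Types (E T : fdmod A).
Variable lt : Lab -> Lab -> Prop.
Hypothesis ltP : forall lab lab', lt lab lab' <-> (lay lab < lay lab')%N.

Lemma joint_surjective (J : finType) (V W : vectType k) (f : J -> 'Hom(V, W)) (X : J -> {vspace W}) :
  (forall c, (limg (f c) <= X c)%VS) -> (forall x, (forall c, f c x = 0) -> x = 0) ->
  (\sum_c \dim (X c) <= \dim {:V})%N ->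
  forall v, (forall c, v c \in X c) -> exists x, forall c, f c x = v c.
Proof.
move=> fX f0 dX v vX.
have [F FE] : exists F : 'Hom(V, {ffun J -> W}), forall x, F x = [ffun c => f c x].
  apply: lfun_of_linear => a x y; apply/ffunP => c.
  by rewrite !ffunE linearP.
have ioex c : exists i : 'Hom(W, {ffun J -> W}), forall w, i w = [ffun d => if d == c then w else 0].
  apply: lfun_of_linear => a x y; apply/ffunP => d; rewrite !ffunE.
  by case: eqP => // _; rewrite scaler0 addr0.
have [io ioE] := fin_all_exists ioex.
have sumE (w : J -> W) : [ffun c => w c] = \sum_c io c (w c).
  apply/ffunP => c; rewrite ffunE sum_ffunE (bigD1 c) //= ioE ffunE eqxx.
  by rewrite big1 ?addr0 // => d /negPf dc; rewrite ioE ffunE eq_sym dc.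
pose P := (\sum_c (io c @: X c))%VS.
have FP : (limg F <= P)%VS.
  apply/subvP => _ /memv_imgP[x _ ->]; rewrite FE sumE; apply: memv_sumr => c _.
  by rewrite memv_img // (subvP (fX c)) // memv_img ?memvf.
have dP : (\dim P <= \dim {:V})%N.
  apply: leq_trans dX; apply: leq_trans (dimv_sum_leq _ _ _) _; apply: leq_sum => c _.
  by rewrite -[X in (_ <= X)%N](limg_ker_dim (io c)) leq_addl.
have kF : lker F = 0%VS.
  apply: vspace_eq0P => x; rewrite memv_ker FE => /eqP/ffunP F0; apply: f0 => c.
  by have := F0 c; rewrite !ffunE.
have PE : limg F = P.
  by apply/eqP; rewrite eqEdim FP dim_limg_inj // kF capv0.
have : [ffun c => v c] \in limg F.
  by rewrite PE sumE; apply: memv_sumr => c _; apply: memv_img.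
case/memv_imgP => x _ xE; exists x => c.
by have /ffunP/(_ c) := xE; rewrite FE !ffunE.
Qed.

Definition hom_on (E M : fdmod A) (U : {vspace E}) (phi : 'Hom(E, M)) : Prop :=
  forall a x, x \in U -> phi (a ** x) = a ** phi x.

Lemma cs_hh_layer c (l : I) (g : GG l) : tgt c = l -> exists c'' (g' : GG (src c)),
  [/\ src c'' = src c, tgt c'' = tgt c & cs c * hh g = hh g' * cs c''].
Proof. by move=> tl; move: g; rewrite -tl; apply: cs_hh. Qed.

Lemma cofree_lift E M (U : {vspace E}) (phi : 'Hom(E, M)) (l : I) (n : E) :
  cofree_over B 0 (fullv : {vspace M}) -> submod U -> hom_on U phi -> n \in gr E l ->
  (forall c, c != u l -> cs c ** n \in U) ->
  exists2 x, x \in gr M l & forall c, c != u l -> cs c ** x = phi (cs c ** n).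
Proof.
move=> cM /submodP sU hphi ng nU.
pose W j := (ZZ B 0 (fullv : {vspace M}) :&: gr M j)%VS.
have Wst j : hstable j (W j).
  apply: hstable_cap; last exact: gr_hstable.
  move=> g x /mem_ZZ[_ xc]; apply/mem_ZZ; split=> [|c cu]; first exact: memvf.
  have [tl|ne] := eqVneq (tgt c) j; last first.
    by rewrite (cs_0 (hh_gr g x)) ?mem0v // eq_sym.
  have [c'' [g' [sE tE cE]]] := cs_hh_layer g tl.
  rewrite -act_mul cE act_mul; have := xc c''.
  have -> : c'' != u (src c'').
    by apply: contra cu => /eqP; rewrite sE => c''E; apply/eqP; apply: tgt_src_cu;
      rewrite -tE c''E cu_tgt.
  by move=> /(_ isT); rewrite !memv0 => /eqP->; rewrite linear0.
pose pi j := avg j (projv (W j) : 'Hom(M, M)).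
have piW j x : x \in W j -> pi j x = x.
  move=> xW; apply: avg_const => g; rewrite projv_id; last exact: Wst.
  rewrite -act_mul -hhM mulgV hh1 grP //; exact: (subvP (capvSr _ _) _ xW).
have piX j x : pi j x \in W j.
  by apply: avg_mem => g; apply: Wst; apply: memv_proj.
pose th c := (pi (src c) \o act M (cs c))%VF.
have topdown (Q : CC -> Prop) : (forall c, (forall c', (src c < src c')%N -> Q c') -> Q c) ->
    forall c, Q c.
  move=> step; suff : forall d c, (nlay B - src c <= d)%N -> Q c by move=> h c; apply: (h (nlay B)); apply: leq_subr.
  elim=> [|d IHd] c ltd; apply: step => c' lt'.
    by have := ltn_ord (src c'); move: lt' ltd => *; exfalso; lia.
  by apply: IHd; move: lt' ltd; lia.
have inW c y : y \in gr M (src c) ->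
    (forall c', tgt c' = src c -> c' != u (src c') -> cs c' ** y = 0) -> y \in W (src c).
  move=> yg yc; rewrite memv_cap yg andbT; apply/mem_ZZ; split=> [|c' cu]; first exact: memvf.
  have [tl|ne] := eqVneq (tgt c') (src c); first by rewrite yc // mem0v.
  by rewrite (cs_0 yg) ?mem0v // eq_sym.
have th0 x : (forall c, th c x = 0) -> x = 0.
  move=> thx; have cs0 : forall c, cs c ** x = 0.
    apply: (topdown (fun c => cs c ** x = 0)) => c IH; rewrite -(piW (src c) (cs c ** x)); last first.
      apply: inW; first exact: cs_gr.
      move=> c' tl cu; have [c'' [g [sE _ cE]]] := cs_cs tl.
      by rewrite -act_mul cE act_mul IH ?linear0 // sE -tl lt_tgt.
    by rewrite -[RHS](thx c) comp_lfunE.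
  by rewrite -(sum_le B x) big1 // => j _; rewrite -cs_cu cs0.
have thW c : (limg (th c) <= W (src c))%VS.
  by apply/subvP => _ /memv_imgP[x _ ->]; rewrite comp_lfunE.
have dW : (\sum_c \dim (W (src c)) <= \dim {:M})%N.
  rewrite (sum_csize (fun j => \dim (W j))); move: cM; rewrite /cofree_over dimv0 subn0.
  apply: leq_trans; rewrite /socs leq_eqVlt; apply/orP; left; apply/eqP.
  by apply: eq_bigr => j _; rewrite /soc cap0v dimv0 subn0.
pose v c := if (tgt c == l) && (c != u l) then pi (src c) (phi (cs c ** n)) else 0.
have [|x' xE] := joint_surjective thW th0 dW (v := v).
  by move=> c; rewrite /v; case: ifP => _; rewrite ?piX ?mem0v.
exists (e l ** x'); first exact: le_gr.
pose w c := cs c ** (e l ** x') - phi (cs c ** n).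
suff w0 : forall c, c != u l -> w c = 0.
  by move=> c /w0/eqP; rewrite subr_eq0 => /eqP.
apply: (topdown (fun c => c != u l -> w c = 0)) => c IH cu.
have [tl|ne] := eqVneq l (tgt c); last first.
  by rewrite /w (cs_0 (le_gr l x') ne) (cs_0 ng ne) linear0 subr0.
have sl : (l < src c)%N.
  rewrite tl; apply: lt_tgt; apply: contra cu => /eqP cE.
  by rewrite tl; have -> : tgt c = src c; [rewrite {1}cE cu_tgt | rewrite -cE].
have phig c0 : c0 != u l -> phi (cs c0 ** n) = e (src c0) ** phi (cs c0 ** n).
  by move=> cu0; rewrite -hphi ?nU // (grP (cs_gr c0 n)).
have wW : w c \in W (src c).
  apply: inW; first by rewrite memvB ?cs_gr // phig // le_gr.
  move=> c' tl' cu'; have [c'' [g [sE _ cE]]] := cs_cs tl'.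
  have c''u : c'' != u l.
    apply: contraTneq sl => c''E; have := lt_tgt cu'; rewrite tl' -sE c''E cu_src.
    by rewrite -leqNgt => /ltnW.
  have capE (P : fdmod A) (z : P) : cs c' ** (cs c ** z) = hh g ** (cs c'' ** z).
    by rewrite -act_mul cE act_mul.
  rewrite /w linearB /= -hphi ?nU // !capE hphi ?nU //.
  rewrite -linearB -/(w c'') IH ?linear0 // sE -tl'; exact: lt_tgt.
rewrite -(piW _ _ wW) /w linearB /=; apply/eqP; rewrite subr_eq0; apply/eqP.
have := xE c; rewrite /v -tl eqxx cu /= => <-.
by rewrite comp_lfunE /= tl cs_tgt.
Qed.

Section ExtendStep.

Variables (E M : fdmod A) (U S : {vspace E}) (l : I) (phi psi : 'Hom(E, M)).
Hypotheses (sU : submod U) (Ul : forall l' : I, (l < l')%N -> (gr E l' <= U)%VS).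
Hypotheses (Sg : (S <= gr E l)%VS) (sS : hstable l S) (SU : (S :&: U)%VS = 0%VS).
Hypothesis freeU : free_over B U (fullv : {vspace E}).
Hypotheses (hphi : hom_on U phi).
Hypothesis psi_equiv : forall (g : GG l) x, x \in S -> psi (hh g ** x) = hh g ** psi x.
Hypothesis psi_gr : forall x, x \in S -> psi x \in gr M l.
Hypothesis psi_caps : forall c x, x \in S -> c != u l -> cs c ** psi x = phi (cs c ** x).

Lemma extend_step : exists phi' : 'Hom(E, M),
  [/\ hom_on (U + gensub S) phi', forall x, x \in U -> phi' x = phi x &
      forall x, x \in S -> phi' x = psi x].
Proof.
have /submodP pU := sU.
pose Z : vectType k := {ffun option CC -> E}.
have [p pE] : exists p : 'Hom(Z, E), forall v, p v =
    projv U (v None) + \sum_(c | src c == l) cc c ** projv S (v (Some c)).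
  apply: lfun_of_linear => a v w; rewrite !ffunE linearP scalerDr -!addrA; congr (_ + _).
  rewrite [RHS]addrCA; congr (_ + _); rewrite scaler_sumr -big_split; apply: eq_bigr => c _.
  by rewrite !ffunE !linearP.
have [b bE] : exists b : 'Hom(Z, M), forall v, b v =
    phi (projv U (v None)) + \sum_(c | src c == l) cc c ** psi (projv S (v (Some c))).
  apply: lfun_of_linear => a v w; rewrite !ffunE !linearP scalerDr -!addrA; congr (_ + _).
  rewrite [RHS]addrCA; congr (_ + _); rewrite scaler_sumr -big_split; apply: eq_bigr => c _.
  by rewrite !ffunE !linearP.
have [phi' phi'E] : exists phi' : 'Hom(E, M), forall v, phi' (p v) = b v.
  apply: lfun_factor; apply/subvP => v; rewrite !memv_ker pE bE => /eqP v0.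
  have [||n0 s0] := free_step_direct sU Ul Sg sS SU freeU _ _ v0.
  - exact: memv_proj.
  - by move=> c; apply: memv_proj.
  by rewrite n0 linear0 add0r big1 // => c /eqP /s0 ->; rewrite !linear0.
have phiU x : x \in U -> phi' x = phi x.
  move=> xU; have := phi'E [ffun o => if o is None then x else 0].
  rewrite pE bE !ffunE projv_id // !big1 ?addr0 // => c _; by rewrite ffunE !linear0.
have phiS c x : src c = l -> x \in S -> phi' (cc c ** x) = cc c ** psi x.
  move=> sc xS; have := phi'E [ffun o => if o is Some c' then (if c' == c then x else 0) else 0].
  rewrite pE bE !ffunE !linear0 !add0r (bigD1 c) ?sc //= [in RHS](bigD1 c) ?sc //=.
  rewrite !ffunE eqxx projv_id // !big1 ?addr0 //;
    by move=> c' /andP[_ /negPf ne]; rewrite ffunE ne !linear0.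
have phiSe x : x \in S -> phi' x = psi x.
  move=> xS; have := phiS (u l) x (cu_src l) xS.
  by rewrite cc_cu (grP (subvP Sg _ xS)) (grP (psi_gr xS)).
have key a x : x \in S -> phi' (a ** x) = a ** psi x.
  move=> xS; have xg := subvP Sg _ xS.
  suff : a \in lker ((phi' \o evl x)%VF - evl (psi x)).
    by rewrite memv_ker add_lfunE opp_lfunE comp_lfunE !evlE subr_eq0 => /eqP.
  move: a; apply: (@A_span _ _ B) => c c' j g sc sc'.
  rewrite memv_ker add_lfunE opp_lfunE comp_lfunE !evlE subr_eq0 !act_mul; apply/eqP.
  have [cE|cu] := eqVneq c' (u l); last first.
    have cU : cs c' ** x \in U by apply: caps_above cu xg.
    have hU : hh g ** (cs c' ** x) \in U by apply: pU.
    by rewrite psi_caps // -hphi // -hphi // phiU //; apply: pU.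
  have jl : j = l by rewrite -sc' cE cu_src.
  move: g sc sc'; rewrite jl => g sc sc'; rewrite cE cs_cu (grP xg) (grP (psi_gr xS)).
  by rewrite phiS ?psi_equiv //; apply: sS.
exists phi'; split=> // a x; rewrite (free_step_span sU Ul Sg sS).
case/addvP=> y [z [yU zS ->]]; rewrite !linearD /= phiU ?pU // hphi // -phiU //.
congr (_ + _); apply/eqP; rewrite -subr_eq0; move: z zS.
suff /subvP h : (layer_span l S <= lker ((phi' \o act E a)%VF - (act M a \o phi')%VF))%VS.
  by move=> z /h; rewrite memv_ker add_lfunE opp_lfunE !comp_lfunE.
apply/subv_sumP => c /eqP sc; apply/subvP => _ /memv_imgP[z zS ->].
rewrite memv_ker add_lfunE opp_lfunE !comp_lfunE subr_eq0 -act_mul !key //.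
by rewrite act_mul.
Qed.

End ExtendStep.

Lemma extend_hom E M (U : {vspace E}) (phi : 'Hom(E, M)) :
  cofree_over B 0 (fullv : {vspace M}) -> submod U -> free_over B U (fullv : {vspace E}) ->
  hom_on U phi ->
  exists2 Phi : 'Hom(E, M), is_hom Phi & forall x, x \in U -> Phi x = phi x.
Proof.
move=> cM; move dE : (\dim {:E} - \dim U)%N => d.
elim/ltn_ind: d U phi dE => d IHd U phi dE sU fU hphi.
have [Uf|Un] := classic (U = fullv).
  by exists phi => // a x; apply: hphi; rewrite Uf memvf.
have [l [lU lmax]] : exists l, ~~ (gr E l <= U)%VS /\
    forall l' : I, (l < l')%N -> ~~ ~~ (gr E l' <= U)%VS.
  apply: (@max_layer _ _ B (fun l => ~~ (gr E l <= U)%VS)); apply: NNPP => nb; apply: Un.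
  apply/eqP; rewrite eqEsubv subvf; apply/subvP => x _; rewrite -(sum_le B x).
  apply: memv_suml => l _; have /subvP h : (gr E l <= U)%VS.
    by apply/negPn/negP => h; apply: nb; exists l.
  by apply: h; apply: le_gr.
have Ul (l' : I) : (l < l')%N -> (gr E l' <= U)%VS by move=> /lmax; rewrite negbK.
have [S [sS Sg UW0 UWg]] := maschke (subvv _) (@gr_hstable _ _ _ _ l)
  (hstable_cap (submod_hstable (l := l) sU) (@gr_hstable _ _ _ _ l)) (capvSr _ _).
have SU : (S :&: U)%VS = 0%VS.
  apply/eqP; rewrite -subv0 -UW0; apply/subvP => x /memv_capP[xS xU].
  by rewrite !memv_cap xU xS (subvP Sg).
have lift (i : 'I_(\dim S)) : exists x, x \in gr M l /\
    forall c, c != u l -> cs c ** x = phi (cs c ** (vbasis S)`_i).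
  have bS : (vbasis S)`_i \in S by apply/vbasis_mem/mem_nth; rewrite size_tuple.
  have [|x xg xc] := cofree_lift cM sU hphi (subvP Sg _ bS).
    by move=> c cu; apply: caps_above cu (subvP Sg _ bS).
  by exists x.
have [xi xiP] := fin_all_exists lift.
have [psi0 psi0E] : exists psi0 : 'Hom(E, M), forall x, psi0 x = \sum_i coord (vbasis S) i x *: xi i.
  apply: lfun_of_linear => a x y; rewrite scaler_sumr -big_split; apply: eq_bigr => i _.
  by rewrite linearP scalerDl scalerA.
have psi0g x : psi0 x \in gr M l.
  by rewrite psi0E; apply: memv_suml => i _; rewrite memvZ //; case: (xiP i).
have psi0c c x : x \in S -> c != u l -> cs c ** psi0 x = phi (cs c ** x).
  move=> xS cu; rewrite psi0E linear_sum [in RHS](coord_vbasis xS) !linear_sum.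
  by apply: eq_bigr => i _; rewrite !linearZ /= (xiP i).2.
have psic c x : x \in S -> c != u l -> cs c ** avg l psi0 x = phi (cs c ** x).
  move=> xS cu; rewrite avgE linearZ linear_sum /=.
  rewrite (eq_bigr (fun _ => phi (cs c ** x))) => [|g _]; last first.
    have [tl|ne] := eqVneq (tgt c) l; last first.
      have xg := subvP Sg _ xS; rewrite (cs_0 xg) 1?eq_sym // linear0.
      by rewrite (cs_0 (hh_gr _ _)) // eq_sym.
    have [c'' [g' [sE tE cE]]] := cs_hh_layer g^-1%g tl.
    have c''u : c'' != u l.
      apply: contra cu => /eqP c''E; apply/eqP; rewrite -(cu_src (l0 := B) l) -c''E sE.
      by apply: tgt_src_cu; rewrite tl -sE c''E cu_src.
    have xg := subvP Sg _ xS.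
    rewrite -act_mul cE act_mul psi0c ?sS // -hphi; last by apply: caps_above c''u (hh_gr _ _).
    congr (phi _); rewrite -!act_mul -cE -mulrA -hhM mulgV hh1 act_mul.
    by rewrite (grP xg).
  rewrite sumr_const cardT -cardE -scaler_nat scalerA mulVf ?scale1r ?GG_unit //.
have [phi' [hphi' phi'U phi'S]] := extend_step (psi := avg l psi0) sU Ul Sg sS SU fU hphi
  (fun g x _ => avg_equiv psi0 g x)
  (fun x _ => avg_mem (U := gr M l) (fun g => hh_gr _ _)) psic.
have [dX fX] := free_step sU Ul Sg sS SU fU.
have [||Phi hPhi PhiE] := IHd _ _ (U + gensub S)%VS phi' erefl _ fX hphi'.
- rewrite -dE; have S0 : (0 < \dim S)%N.
    rewrite lt0n dimv_eq0; apply: contra lU => /eqP S0.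
    by rewrite -UWg S0 addv0 capvSl.
  have : (0 < csize l * \dim S)%N by rewrite muln_gt0 csize_gt0.
  have := dimvS (subvf (U + gensub S)); move: dX; lia.
- exact: free_step_submod.
exists Phi => // x xU; rewrite PhiE ?phi'U //.
by apply: (subvP (addvSl _ _)).
Qed.

Lemma extend_label E M lab (f : 'Hom(Sp lab, E)) (f' : 'Hom(Sp lab, M)) :
  free_over B 0 (fullv : {vspace E}) -> cofree_over B 0 (fullv : {vspace M}) ->
  equivariant (rho lab) f -> killed f -> lker f = 0%VS ->
  (limg f :&: above B (lay lab).+1 E)%VS = 0%VS ->
  equivariant (rho lab) f' -> killed f' ->
  exists2 Phi : 'Hom(E, M), is_hom Phi & forall y, Phi (f y) = f' y.
Proof.
move=> fE cM eq_f fk kf fa eq_f' fk'.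
set U := above _ _ _ in fa; have [_ fU] := free_filtration Y (lay lab).+1 fE.
have sU : submod U by apply: above_submod.
have Ul (l' : I) : (lay lab < l')%N -> (gr E l' <= U)%VS by move=> ll; apply: gr_above.
have [psi psiE] : exists psi : 'Hom(E, M), forall y, psi (f y) = f' y.
  by apply: lfun_factor; rewrite kf sub0v.
have h0 : hom_on U (0 : 'Hom(E, M)) by move=> a x _; rewrite !zero_lfunE linear0.
have [|||phi [hphi phiU phiS]] := extend_step (psi := psi) sU Ul (killed_gr fk)
    (equiv_hstable eq_f) fa fU h0.
- by move=> g _ /memv_imgP[y _ ->]; rewrite -eq_f !psiE eq_f'.
- by move=> _ /memv_imgP[y _ ->]; rewrite psiE (subvP (killed_gr fk')) ?memv_img ?memvf.
- by move=> c _ /memv_imgP[y _ ->] cu; rewrite psiE fk' // zero_lfunE.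
have [_ fX] := free_step sU Ul (killed_gr fk) (equiv_hstable eq_f) fa fU.
have [|Phi hPhi PhiE] := extend_hom cM _ fX hphi; first exact: free_step_submod.
exists Phi => // y; rewrite PhiE ?phiS ?psiE ?memv_img ?memvf //.
apply: (subvP (addvSr _ _)); apply: (subvP (sub_gensub _)); by rewrite memv_img ?memvf.
Qed.

Theorem complete_tilting_of T :
  free_over B 0 (fullv : {vspace T}) -> cofree_over B 0 (fullv : {vspace T}) ->
  (forall lab, exists f : 'Hom(Sp lab, T), [/\ equivariant (rho lab) f, killed f &
     forall y, f y \in KK B fullv -> y = 0]) ->
  is_complete_tilting lt Std T.
Proof.
move=> fT cT lT; split.
  split; last by apply: cofree_filtration => //; apply: submodf.
  have [h _] := free_filtration Y 0 fT; move: h; rewrite above0.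
  move=> [n [E [E0 El sE cE]]]; exists n, E; split=> // i /cE[N [lab _ sN] sq].
  by exists N => //; exists lab.
move=> N [dN nN] [N0 indec].
have fN := filtration_free dN; have cN := filtration_cofree ltP nN.
have [l [/eqP Nl lmax]] : exists l, gr N l != 0%VS /\
    forall l' : I, (l < l')%N -> ~~ (gr N l' != 0%VS).
  apply: (@max_layer _ _ B (fun l => gr N l != 0%VS)); apply: NNPP => nb; apply: N0.
  apply: vspace_eq0P => x _; rewrite -(sum_le B x) big1 // => l _.
  apply/eqP; rewrite -memv0; have -> : 0%VS = gr N l; last exact: le_gr.
  by apply/esym/eqP/negPn/negP => gl; apply: nb; exists l.
have Na (l' : I) : (l < l')%N -> gr N l' = 0%VS by move=> /lmax; rewrite negbK => /eqP.
have [lab [f [ll kf eq_f fg]]] := Sp_exists Y (subvv _) (@gr_hstable _ _ _ _ l) Nl.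
move: Na fg; rewrite -ll => Na fg {l ll Nl lmax}.
have fk : killed f.
  apply: (top_killed (@submodf _ _ N)); last by rewrite capfv.
  by move=> l /Na ->; rewrite capv0.
have fa : (limg f :&: above B (lay lab).+1 N)%VS = 0%VS.
  apply/eqP; rewrite -subv0; apply: subv_trans (capvSr _ _) _; apply: above_le.
    exact: submod0.
  by move=> l ll; rewrite Na.
have [fT0 [eq_fT fTk fTK]] := lT lab.
have kfT : lker fT0 = 0%VS.
  by apply: vspace_eq0P => y; rewrite memv_ker => /eqP y0; apply: fTK; rewrite y0 mem0v.
have fTa : (limg fT0 :&: above B (lay lab).+1 T)%VS = 0%VS.
  apply: vspace_eq0P => x' /memv_capP[/memv_imgP[y _ ->] ya].
  rewrite (fTK y) ?linear0 //; apply: above_KK ya _.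
  by apply: (subvP (killed_gr fTk)); apply/memv_img/memvf.
have [Phi hPhi PhiE] := extend_label fN cT eq_f fk kf fa eq_fT fTk.
have [Psi hPsi PsiE] := extend_label fT cN eq_fT fTk kfT fTa eq_f fk.
pose h := (Psi \o Phi)%VF; have hh' : is_hom h by apply: is_hom_comp.
have hf y : h (f y) = f y by rewrite comp_lfunE PhiE PsiE.
have [g [[hg g0 gS _ kg] [gfix _]]] := fitting hh'.
have [y y0] := Sp_witness lab.
have k0 : lker g = 0%VS.
  case: (indec _ _ (submod_ker hg) (submod_img hg (@submodf _ _ N)) gS g0) => // i0.
  have : f y \in limg g by rewrite -(gfix _ (hf y)) memv_img ?memvf.
  by rewrite i0 memv0 -memv_ker kf memv0 (negPf y0).
have kh : lker h = 0%VS by apply/eqP; rewrite -subv0 -k0.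
have hS : limg h = fullv.
  apply/eqP; rewrite eqEdim subvf dim_limg_inj ?leqnn //.
  by apply/eqP; rewrite -subv0 -kh capvSr.
have hK x : (h^-1)%VF (h x) = x by apply: lker0_lfunK; apply/eqP.
exists Phi, ((h^-1) \o Psi)%VF; split=> // [|x].
  by apply: is_hom_comp => //; apply: hom_inv hh' hS hK.
by rewrite -[RHS]hK !comp_lfunE.
Qed.

End Tilting.

(** * Group algebras *)

(* The group algebra, with the product delta g * delta h = delta (h g) that
   makes it act on the left of spaces with a right action of the group. *)
Definition galg (k : fieldType) (gT : finGroupType) : Type := {ffun gT -> k^o}.

Section GroupAlgebra.

Variables (k : fieldType) (gT : finGroupType).
Local Notation K := (galg k gT).

HB.instance Definition _ := Vector.on K.

Definition gmul (x y : K) : K := [ffun z => \sum_g x g * y (z * g^-1)%g].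
Definition gone : K := [ffun z => (z == 1%g)%:R].

Fact gmul1l : left_id gone gmul.
Proof.
move=> y; apply/ffunP => z; rewrite ffunE (bigD1 1%g) //= ffunE eqxx mul1r invg1 mulg1.
by rewrite big1 ?addr0 // => g /negPf g1; rewrite ffunE g1 mul0r.
Qed.

Fact gmul1r : right_id gone gmul.
Proof.
move=> x; apply/ffunP => z; rewrite ffunE (bigD1 z) //= ffunE mulgV eqxx mulr1.
by rewrite big1 ?addr0 // => g gz; rewrite ffunE -eq_mulgV1 eq_sym (negPf gz) mulr0.
Qed.

Fact gmulA : associative gmul.
Proof.
move=> x y w; apply/ffunP => z; rewrite !ffunE.
under [RHS]eq_bigr => g _ do rewrite ffunE mulr_suml.
rewrite [RHS]exchange_big; apply: eq_bigr => h _ /=; rewrite ffunE mulr_sumr.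
rewrite (reindex_inj (mulIg h^-1)%g) /=; apply: eq_bigr => g _.
by rewrite mulrA invMg invgK -mulgA mulKg.
Qed.

Fact gmulDl : left_distributive gmul +%R.
Proof.
move=> x y w; apply/ffunP => z; rewrite !ffunE -big_split; apply: eq_bigr => g _.
by rewrite ffunE mulrDl.
Qed.

Fact gmulDr : right_distributive gmul +%R.
Proof.
move=> x y w; apply/ffunP => z; rewrite !ffunE -big_split; apply: eq_bigr => g _.
by rewrite ffunE mulrDr.
Qed.

Fact gone_neq0 : gone != 0.
Proof.
by apply/eqP => /ffunP/(_ 1%g)/eqP; rewrite !ffunE eqxx; apply/negP/oner_neq0.
Qed.

HB.instance Definition _ := GRing.Zmodule_isNzRing.Build K
  gmulA gmul1l gmul1r gmulDl gmulDr gone_neq0.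

Fact gscaleAl (a : k) (x y : K) : a *: (x * y) = (a *: x) * y.
Proof.
apply/ffunP => z; rewrite !ffunE scaler_sumr; apply: eq_bigr => g _.
by rewrite ffunE -[LHS]/(a * _) mulrA.
Qed.

HB.instance Definition _ := GRing.Lmodule_isLalgebra.Build k K gscaleAl.

Fact gscaleAr (a : k) (x y : K) : a *: (x * y) = x * (a *: y).
Proof.
apply/ffunP => z; rewrite !ffunE scaler_sumr; apply: eq_bigr => g _.
by rewrite ffunE -[LHS]/(a * _) -[a *: y _]/(a * _) mulrCA.
Qed.

HB.instance Definition _ := GRing.Lalgebra_isAlgebra.Build k K gscaleAr.
HB.instance Definition _ := Algebra_isFalgebra.Build k K.

Lemma gmulE (x y : K) z : (x * y) z = \sum_g x g * y (z * g^-1)%g.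
Proof. by rewrite ffunE. Qed.

Definition gdelta (g : gT) : K := [ffun z => (z == g)%:R].

Lemma gdeltaMx g (x : K) z : (gdelta g * x) z = x (z * g^-1)%g.
Proof.
rewrite gmulE (bigD1 g) //= ffunE eqxx mul1r big1 ?addr0 // => h /negPf hg.
by rewrite ffunE hg mul0r.
Qed.

Lemma gdeltaxM g (x : K) z : (x * gdelta g) z = x (g^-1 * z)%g.
Proof.
rewrite gmulE (bigD1 (g^-1 * z)%g) //= ffunE invMg invgK mulKVg eqxx mulr1.
rewrite big1 ?addr0 // => h hg; rewrite ffunE; case: eqP => [zE|]; rewrite ?mulr0 //.
by case/eqP: hg; rewrite -zE invMg invgK mulgKV.
Qed.

Lemma gdeltaM g h : gdelta g * gdelta h = gdelta (h * g)%g.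
Proof.
apply/ffunP => z; rewrite gdeltaMx !ffunE; congr (_%:R); congr nat_of_bool.
by apply/eqP/eqP => [<-|->]; rewrite ?mulgK ?mulgKV.
Qed.

Lemma gdelta1 : gdelta 1 = 1.
Proof. by []. Qed.

Lemma gdelta_sum (x : K) : x = \sum_g x g *: gdelta g.
Proof.
apply/ffunP => z; rewrite sum_ffunE (bigD1 z) //= big1 => [|g gz]; last first.
  by rewrite !ffunE eq_sym (negPf gz) scaler0.
by rewrite !ffunE eqxx addr0 -[RHS]/(_ * _) mulr1.
Qed.

Lemma galg_lin (P : K -> Prop) : P 0 -> (forall a x y, P x -> P y -> P (a *: x + y)) ->
  (forall g, P (gdelta g)) -> forall z, P z.
Proof.
move=> P0 PD Pd z; rewrite (gdelta_sum z); elim/big_ind: _ => // [x y Px Py|g _].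
  by rewrite -[x]scale1r; apply: PD.
by rewrite -[_ *: _]addr0; apply: PD.
Qed.

Hypothesis G_unit : (#|gT|%:R : k) != 0.

Definition lideal (X : {vspace K}) := forall g x, x \in X -> gdelta g * x \in X.
Definition rideal (X : {vspace K}) := forall g x, x \in X -> x * gdelta g \in X.

Lemma lideal_mul X (x y : K) : lideal X -> y \in X -> x * y \in X.
Proof.
move=> lX yX; rewrite (gdelta_sum x) mulr_suml memv_suml // => g _.
by rewrite -scalerAl memvZ // lX.
Qed.

Lemma rideal_mul X (x y : K) : rideal X -> x \in X -> x * y \in X.
Proof.
move=> lX xX; rewrite (gdelta_sum y) mulr_sumr memv_suml // => g _.
by rewrite -scalerAr memvZ // lX.
Qed.

Lemma sum_const_unit (V : lmodType k) (v : V) :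
  (#|gT|%:R : k)^-1 *: \sum_(g : gT) v = v.
Proof. by rewrite sumr_const cardT -cardE -scaler_nat scalerA mulVf ?scale1r. Qed.

Lemma lideal_unit X : lideal X -> exists2 f, f \in X & forall x, x \in X -> x * f = x.
Proof.
move=> lX; pose pi (x : K) : K :=
  (#|gT|%:R : k)^-1 *: \sum_g gdelta g^-1 * projv X (gdelta g * x).
have piX x : pi x \in X.
  by rewrite memvZ // memv_suml // => g _; apply: lX; apply: memv_proj.
have pi_id x : x \in X -> pi x = x.
  move=> xX; rewrite /pi -[RHS]sum_const_unit; congr (_ *: _); apply: eq_bigr => g _.
  by rewrite projv_id ?lX // mulrA gdeltaM mulgV mul1r.
have piD x y : pi (x + y) = pi x + pi y.
  by rewrite /pi -scalerDr -big_split; congr (_ *: _); apply: eq_bigr => g _;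
    rewrite mulrDr linearD mulrDr.
have piZ a x : pi (a *: x) = a *: pi x.
  rewrite /pi [RHS]scalerA [a * _]mulrC -[RHS]scalerA; congr (_ *: _); rewrite [RHS]scaler_sumr; apply: eq_bigr => g _.
  by rewrite -scalerAr linearZ -scalerAr.
have pi0 : pi 0 = 0 by rewrite -[in LHS](scale0r (0 : K)) piZ scale0r.
have pi_delta h x : pi (gdelta h * x) = gdelta h * pi x.
  rewrite /pi -scalerAr mulr_sumr; congr (_ *: _).
  rewrite (reindex_inj (mulgI h^-1)%g) /=; apply: eq_bigr => g _.
  rewrite [in RHS]mulrA gdeltaM mulrA gdeltaM mulKVg; congr (gdelta _ * _).
  by rewrite invMg invgK.
exists (pi 1); first exact: piX.
move=> x xX; rewrite -[RHS]pi_id // [in LHS](gdelta_sum x) [in RHS](gdelta_sum x).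
rewrite mulr_suml (big_morph pi piD pi0); apply: eq_bigr => g _.
by rewrite piZ -scalerAl -{2}[gdelta g]mulr1 pi_delta.
Qed.

Lemma rideal_unit X : rideal X -> exists2 f, f \in X & forall x, x \in X -> f * x = x.
Proof.
move=> lX; pose pi (x : K) : K :=
  (#|gT|%:R : k)^-1 *: \sum_g projv X (x * gdelta g) * gdelta g^-1.
have piX x : pi x \in X.
  by rewrite memvZ // memv_suml // => g _; apply: lX; apply: memv_proj.
have pi_id x : x \in X -> pi x = x.
  move=> xX; rewrite /pi -[RHS]sum_const_unit; congr (_ *: _); apply: eq_bigr => g _.
  by rewrite projv_id ?lX // -mulrA gdeltaM mulVg mulr1.
have piD x y : pi (x + y) = pi x + pi y.
  by rewrite /pi -scalerDr -big_split; congr (_ *: _); apply: eq_bigr => g _;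
    rewrite mulrDl linearD mulrDl.
have piZ a x : pi (a *: x) = a *: pi x.
  rewrite /pi [RHS]scalerA [a * _]mulrC -[RHS]scalerA; congr (_ *: _); rewrite [RHS]scaler_sumr; apply: eq_bigr => g _.
  by rewrite -scalerAl linearZ -scalerAl.
have pi0 : pi 0 = 0 by rewrite -[in LHS](scale0r (0 : K)) piZ scale0r.
have pi_delta h x : pi (x * gdelta h) = pi x * gdelta h.
  rewrite /pi -scalerAl mulr_suml; congr (_ *: _).
  rewrite (reindex_inj (mulIg h^-1)%g) /=; apply: eq_bigr => g _.
  rewrite -[in RHS]mulrA gdeltaM -mulrA gdeltaM mulgKV; congr (_ * gdelta _).
  by rewrite invMg invgK.
exists (pi 1); first exact: piX.
move=> x xX; rewrite -[RHS]pi_id // [in LHS](gdelta_sum x) [in RHS](gdelta_sum x).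
rewrite mulr_sumr (big_morph pi piD pi0); apply: eq_bigr => g _.
by rewrite piZ -scalerAr -{2}[gdelta g]mul1r pi_delta.
Qed.

Lemma ideal_unit X : lideal X -> rideal X ->
  exists f, [/\ f \in X, forall x, x \in X -> x * f = x & forall y, y * f = f * y].
Proof.
move=> lX rX; have [f fX fr] := lideal_unit lX; have [f' f'X f'l] := rideal_unit rX.
have ff : f' = f by rewrite -(fr f') // f'l.
rewrite ff in f'l; exists f; split=> // y.
by rewrite -[LHS]f'l ?lideal_mul // mulrA [RHS](esym (fr _ _)) // rideal_mul.
Qed.

Definition lgen (c : K) : {vspace K} := <<[seq (gdelta g * c)%R | g : gT]>>%VS.

Lemma lgenP (c x : K) : reflect (exists y, x = y * c) (x \in lgen c).
Proof.
have mem g : gdelta g * c \in lgen c by apply/memv_span/image_f.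
apply: (iffP idP) => [|[y ->]]; last first.
  rewrite (gdelta_sum y) mulr_suml memv_suml // => g _.
  by rewrite -scalerAl memvZ.
move: x; pose X := (amulr c @: fullv)%VS.
suff /subvP h : (lgen c <= X)%VS.
  by move=> x /h /memv_imgP[y _ ->]; exists y; rewrite lfunE.
apply/span_subvP => _ /imageP[g _ ->].
have -> : gdelta g * c = amulr c (gdelta g) by rewrite lfunE.
by rewrite memv_img ?memvf.
Qed.

Lemma lgen_lideal (c : K) : lideal (lgen c).
Proof. by move=> g x /lgenP[y ->]; apply/lgenP; exists (gdelta g * y); rewrite mulrA. Qed.

Lemma lgen_gen (c : K) : c \in lgen c.
Proof. by apply/lgenP; exists 1; rewrite mul1r. Qed.

Section Primitive.

Variable c : K.
Hypothesis cP : forall x, exists a : k, c * x * c = a *: c.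

Lemma lgen_simple (X : {vspace K}) : lideal X -> (X <= lgen c)%VS -> X = 0%VS \/ X = lgen c.
Proof.
move=> lX /subvP Xc; have [Xx|noX] := classic (exists2 x, x \in X & c * x != 0).
  right; apply/eqP; rewrite eqEsubv; apply/andP; split; apply/subvP; first exact: Xc.
  case: Xx => x xX cx; have /lgenP[y xE] := Xc _ xX.
  have [a aE] := cP y; move: cx; rewrite xE mulrA aE => ac0.
  have a0 : a != 0 by apply: contraNneq ac0 => ->; rewrite scale0r.
  have cX : c \in X.
    have : c * x \in X by apply: lideal_mul.
    by rewrite xE mulrA aE => /(memvZ a^-1); rewrite scalerA mulVf // scale1r.
  by move=> _ /lgenP[z ->]; apply: lideal_mul.
left; have [f fX ff] := lideal_unit lX.
have cX x : x \in X -> c * x = 0.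
  by move=> xX; apply/eqP/negPn/negP => cx; apply: noX; exists x.
have f0 : f = 0.
  by have /lgenP[y yE] := Xc _ fX; rewrite -(ff f fX) {1}yE -mulrA cX ?mulr0.
by apply: vspace_eq0P => x xX; rewrite -(ff x xX) f0 mulr0.
Qed.

End Primitive.

Lemma lgen_self (c : K) : c != 0 -> ~ (forall x, x \in lgen c -> c * x = 0).
Proof.
move=> c0 h; have [f fX ff] := lideal_unit (@lgen_lideal c).
have f0 : f = 0 by rewrite -(ff f fX); have /lgenP[y yE] := fX; rewrite {1}yE -mulrA h ?mulr0.
by case/eqP: c0; rewrite -(ff c (lgen_gen c)) f0 mulr0.
Qed.

Definition ggen (c : K) : {vspace K} :=
  <<[seq (gdelta gh.1 * c * gdelta gh.2)%R | gh : gT * gT]>>%VS.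

Lemma ggen_mem (c x y : K) : x * c * y \in ggen c.
Proof.
rewrite (gdelta_sum x) !mulr_suml memv_suml // => g _; rewrite -!scalerAl memvZ //.
rewrite (gdelta_sum y) mulr_sumr memv_suml // => h _; rewrite -scalerAr memvZ //.
apply/memv_span; have := image_f (fun gh : gT * gT => gdelta gh.1 * c * gdelta gh.2).
by move=> /(_ predT (g, h) isT).
Qed.

Lemma ggen_sub (c : K) (X : {vspace K}) :
  (forall x y, x * c * y \in X) -> (ggen c <= X)%VS.
Proof. by move=> h; apply/span_subvP => _ /imageP[[g g'] _ ->]; apply: h. Qed.

Lemma ggen_lideal (c : K) : lideal (ggen c).
Proof.
move=> g x xc; have : x \in (amull (gdelta g) @^-1: ggen c)%VS.
  move: x xc; apply/subvP/ggen_sub => y z; rewrite -memv_preim lfunE /= !mulrA.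
  exact: ggen_mem.
by rewrite -memv_preim lfunE.
Qed.

Lemma ggen_rideal (c : K) : rideal (ggen c).
Proof.
move=> g x xc; have : x \in (amulr (gdelta g) @^-1: ggen c)%VS.
  move: x xc; apply/subvP/ggen_sub => y z; rewrite -memv_preim lfunE /= -!mulrA mulrA.
  exact: ggen_mem.
by rewrite -memv_preim lfunE.
Qed.

Section Exhaust.

Variables (T : finType) (c : T -> K).
Hypothesis T_card : (#|classes [set: gT]| <= #|T|)%N.
Hypothesis c_neq0 : forall i, c i != 0.
Hypothesis c_orth : forall i j, i != j ->
  (forall x, c i * x * c j = 0) \/ (forall x, c j * x * c i = 0).

Lemma ggen_orth i j (x y : K) : (forall z, c i * z * c j = 0) ->
  x \in ggen (c i) -> y \in ggen (c j) -> x * y = 0.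
Proof.
move=> h xi yj; have : x \in lker (amulr y : 'End(K)).
  move: x xi; apply/subvP/ggen_sub => x1 x2; rewrite memv_ker lfunE /=.
  have : y \in lker (amull (x1 * c i * x2) : 'End(K)).
    move: y yj; apply/subvP/ggen_sub => y1 y2; rewrite memv_ker lfunE /= !mulrA.
    have -> : x1 * c i * x2 * y1 * c j * y2 = x1 * (c i * (x2 * y1) * c j) * y2.
      by rewrite !mulrA.
    by rewrite h mulr0 mul0r.
  by rewrite memv_ker lfunE.
by rewrite memv_ker lfunE /= => /eqP.
Qed.

Lemma class_const (z : K) : (forall y, y * z = z * y) ->
  forall g h, z (g ^ h)%g = z g.
Proof.
move=> zc g h; have /ffunP/(_ (g * h)%g) := zc (gdelta h).
by rewrite gdeltaMx gdeltaxM mulgK conjgE => ->; rewrite mulgA.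
Qed.

Definition class_ind (C : {set gT}) : K := [ffun z => (z \in C)%:R].

Lemma center_dim (Z : {vspace K}) : (forall z, z \in Z -> forall y, y * z = z * y) ->
  (\dim Z <= #|classes [set: gT]|)%N.
Proof.
move=> Zc; rewrite cardE -(size_map class_ind); apply: leq_trans (dim_span _).
apply: dimvS; apply/subvP => z /Zc zc.
have -> : z = \sum_(C in classes [set: gT]) z (repr C) *: class_ind C.
  apply/ffunP => g; rewrite sum_ffunE (bigD1 (g ^: [set: gT])%g) ?mem_classes ?inE //=.
  rewrite !ffunE class_refl big1 => [|C /andP[/imsetP[h _ ->] ne]]; last first.
    rewrite !ffunE; case: (boolP (g \in _)) => [/class_eqP gE|]; last by rewrite scaler0.
    by rewrite gE eqxx in ne.
  rewrite addr0 -[RHS]/(_ * _) mulr1; have [x _ ->] := repr_class [set: gT]%G g.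
  by rewrite class_const.
apply: memv_suml => C CG; rewrite memvZ // memv_span //.
by apply/mapP; exists C; rewrite ?mem_enum.
Qed.

Lemma ggen_full (x : K) (X : {vspace K}) : (forall i y z, y * c i * z \in X) -> x \in X.
Proof.
move=> h; pose J := (\sum_i ggen (c i))%VS.
suff JX : J = fullv.
  have : (J <= X)%VS by apply/subv_sumP => i _; apply: ggen_sub => y z; apply: h.
  by move/subvP; apply; rewrite JX memvf.
have JI i : (ggen (c i) <= J)%VS by apply: sumv_sup (subvv _).
have lJ : lideal J.
  move=> g y yJ; have : y \in (amull (gdelta g) @^-1: J)%VS.
    move: y yJ; apply/subvP/subv_sumP => i _; apply/subvP => y yi.
    by rewrite -memv_preim lfunE /= (subvP (JI i)) // ggen_lideal.
  by rewrite -memv_preim lfunE.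
have rJ : rideal J.
  move=> g y yJ; have : y \in (amulr (gdelta g) @^-1: J)%VS.
    move: y yJ; apply/subvP/subv_sumP => i _; apply/subvP => y yi.
    by rewrite -memv_preim lfunE /= (subvP (JI i)) // ggen_rideal.
  by rewrite -memv_preim lfunE.
have [f [fJ fr fc]] := ideal_unit lJ rJ.
have epex i := ideal_unit (@ggen_lideal (c i)) (@ggen_rideal (c i)).
have [ep epP] := fin_all_exists epex.
have ep0 i : ep i != 0.
  have [_ h1 _] := epP i; apply: contra (c_neq0 i) => /eqP e0.
  have := h1 (c i); rewrite e0 mulr0 => <- //.
  by have := ggen_mem (c i) 1 1; rewrite mul1r mulr1.
have epo i j : i != j -> ep i * ep j = 0.
  move=> ij; have [mi _ ci] := epP i; have [mj _ _] := epP j.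
  case: (c_orth ij) => o; first exact: (ggen_orth o).
  by rewrite -ci; apply: (ggen_orth o).
have epp i : ep i * ep i = ep i by have [mi h1 _] := epP i; apply: h1.
have epf i : ep i * f = ep i by apply: fr; have [mi _ _] := epP i; apply: (subvP (JI i)).
have ff : f * f = f by apply: fr.
have [f1|f1] := eqVneq f 1.
  apply/eqP; rewrite eqEsubv subvf; apply/subvP => y _.
  by rewrite -[y]mulr1 -f1 lideal_mul.
pose b (o : option T) : K := if o is Some i then ep i else 1 - f.
have b0 o : b o != 0 by case: o => [i|] /=; rewrite ?ep0 // subr_eq0 eq_sym.
have bo o o' : b o * b o' = if o == o' then b o else 0.
  case: o o' => [i|] [j|] /=.
  - by case: (eqVneq (Some i) (Some j)) => [[->]|ne]; rewrite ?epp // epo //;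
      apply: contra ne => /eqP->.
  - by rewrite mulrBr mulr1 epf subrr.
  - by rewrite mulrBl mul1r -fc epf subrr.
  - by rewrite mulrBl mul1r mulrBr mulr1 ff subrr subr0.
have bc o y : y * b o = b o * y.
  case: o => [i|] /=; first by have [_ _ ->] := epP i.
  by rewrite mulrBr mulrBl mulr1 mul1r fc.
pose Z := (\sum_o <[b o]>)%VS.
have dZ : \dim Z = #|T|.+1.
  have /directvP : directv Z.
    apply/directv_sum_independent => us usb us0 o _.
    have /vlineP[a aE] := usb o isT.
    have := congr1 (fun x => x * b o) us0; rewrite /= mul0r mulr_suml (bigD1 o) //=.
    rewrite aE -scalerAl bo eqxx big1 ?addr0 // => o' ne.
    by have /vlineP[a' ->] := usb o' isT; rewrite -scalerAl bo (negPf ne) scaler0.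
  rewrite /= => ->; rewrite (eq_bigr (fun _ => 1%N)) => [|o _].
    by rewrite sum1_card card_option.
  by rewrite dim_vline b0.
have := center_dim (Z := Z); rewrite dZ => /(_ _)/leq_trans/(_ T_card).
rewrite ltnn => h0; exfalso; suff : false by []; apply: h0.
move=> z /memv_sumP[zs zsb ->] y; rewrite mulr_suml mulr_sumr; apply: eq_bigr => o _.
by have /vlineP[a ->] := zsb o isT; rewrite -scalerAr -scalerAl bc.
Qed.

End Exhaust.

End GroupAlgebra.

(** * Tableaux *)

Section Tableau.

Variables (n : nat) (la : partn n).

Definition trow (la : seq nat) (x : 'I_n) : nat := reshape_index la x.
Definition tcol (la : seq nat) (x : 'I_n) : nat := reshape_offset la x.

Lemma partn_sum : sumn la = n. Proof. by have /and3P[_ _ /eqP] := partnP la. Qed.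

Lemma tcell_inj (x y : 'I_n) : trow la x = trow la y -> tcol la x = tcol la y -> x = y.
Proof.
move=> rxy cxy; apply: val_inj; rewrite /= -(reshape_indexK la x) -(reshape_indexK la y).
by rewrite -/(trow la x) -/(trow la y) -/(tcol la x) -/(tcol la y) rxy cxy.
Qed.

Lemma tcol_lt (x : 'I_n) : (tcol la x < nth 0 la (trow la x))%N.
Proof. by apply: reshape_offsetP; rewrite partn_sum. Qed.

Lemma tcell_ex r c : (c < nth 0 la r)%N -> exists x : 'I_n, trow la x = r /\ tcol la x = c.
Proof.
move=> cr; have := flatten_indexP cr; rewrite partn_sum => lt.
by exists (Ordinal lt); rewrite /trow /tcol /= flatten_indexKl ?flatten_indexKr.
Qed.

Lemma tcol_down (x : 'I_n) j : (j <= trow la x)%N ->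
  exists y : 'I_n, trow la y = j /\ tcol la y = tcol la x.
Proof.
move=> jx; apply: tcell_ex; apply: leq_trans (tcol_lt x) _.
have /and3P[srt _ _] := partnP la.
have lt : (trow la x < size la)%N by rewrite reshape_indexP // partn_sum.
apply: (sorted_leq_nth _ _ 0%N srt) => //; last exact: leq_ltn_trans lt.
- by move=> a b c /= ab bc; apply: leq_trans bc ab.
- exact: leqnn.
Qed.

Lemma tcol_ex j c : (j < #|[pred y : 'I_n | tcol la y == c]|)%N ->
  exists y : 'I_n, trow la y = j /\ tcol la y = c.
Proof.
move=> lt; have [[x /eqP cx jx]|no] := classic (exists2 x : 'I_n, tcol la x == c & (j <= trow la x)%N).
  by rewrite -cx; apply: tcol_down.
exfalso; move: lt; rewrite ltnNge => /negP[]; rewrite cardE -(size_map (trow la)) -(size_iota 0 j).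
apply: uniq_leq_size.
  rewrite map_inj_in_uniq ?enum_uniq // => x y.
  by rewrite !mem_enum !inE => /eqP cx /eqP cy rxy; apply: tcell_inj; rewrite // cx.
move=> _ /mapP[x xc ->]; rewrite mem_iota /= add0n ltnNge; apply/negP => jx; apply: no.
by exists x; move: xc; rewrite ?mem_enum ?inE.
Qed.

Lemma card_trow r : #|[pred y : 'I_n | trow la y == r]| = nth 0 la r.
Proof.
rewrite cardE -(size_map (tcol la)) -(size_iota 0 (nth 0 la r)); apply/perm_size/uniq_perm.
- rewrite map_inj_in_uniq ?enum_uniq // => x y.
  by rewrite !mem_enum !inE => /eqP cx /eqP cy rxy; apply: tcell_inj; rewrite // cx.
- exact: iota_uniq.
move=> c; rewrite mem_iota /= add0n; apply/mapP/idP => [[x]|/tcell_ex[x [rx cx]]].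
  by rewrite mem_enum inE => /eqP<- ->; apply: tcol_lt.
by exists x; rewrite // mem_enum inE rx.
Qed.

End Tableau.

Lemma partn_eq n (la mu : partn n) : (forall r, nth 0 la r = nth 0 mu r)%N -> la = mu :> seq nat.
Proof.
have size_le (la1 mu1 : partn n) : (forall r, nth 0 la1 r = nth 0 mu1 r)%N ->
    (size la1 <= size mu1)%N.
  move=> h; rewrite leqNgt; apply/negP => lt; have := h (size mu1).
  rewrite [RHS]nth_default // => l0; have /and3P[_ + _] := partnP la1.
  by rewrite -l0 mem_nth.
move=> h; apply: (@eq_from_nth _ 0%N) => // ; apply/eqP; rewrite eqn_leq.
by rewrite !size_le.
Qed.

(* The obstruction in von Neumann's lemma: the transposition of x and y preserves
   the rows of mu, and its conjugate by g the columns of la. *)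
Definition collide n (la mu : seq nat) (g : 'S_n) :=
  [exists x, exists y, [&& x != y, trow mu x == trow mu y & tcol la (g x) == tcol la (g y)]].

Section VonNeumann.

Variables (n : nat) (la mu : partn n) (g : 'S_n).
Hypothesis g_ok : ~~ collide la mu g.

Lemma noncollide (x y : 'I_n) : trow mu x = trow mu y -> tcol la (g x) = tcol la (g y) -> x = y.
Proof.
move=> rxy cxy; apply/eqP/negPn/negP => ne; case/negP: g_ok.
by apply/existsP; exists x; apply/existsP; exists y; rewrite ne rxy cxy !eqxx.
Qed.

Let above (x : 'I_n) :=
  [pred x' : 'I_n | (tcol la (g x') == tcol la (g x)) && (trow mu x' < trow mu x)%N].

Let above_le x : (#|above x| <= trow mu x)%N.
Proof.
rewrite cardE -(size_map (trow mu)) -(size_iota 0 (trow mu x)); apply: uniq_leq_size.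
  rewrite map_inj_in_uniq ?enum_uniq // => y z.
  rewrite !mem_enum !inE => /andP[/eqP cy _] /andP[/eqP cz _] ryz.
  by apply: noncollide; rewrite // cy cz.
by move=> _ /mapP[y + ->]; rewrite mem_enum inE mem_iota => /andP[].
Qed.

Let above_ex x : exists y : 'I_n, trow la y = #|above x| /\ tcol la y = tcol la (g x).
Proof.
apply: tcol_ex; apply: (@leq_trans #|[pred x' : 'I_n | tcol la (g x') == tcol la (g x)]|).
  apply: proper_card; apply/properP; split.
    by apply/subsetP => y; rewrite !inE => /andP[].
  by exists x; rewrite !inE ?eqxx ?ltnn.
rewrite -(card_imset [pred x' : 'I_n | tcol la (g x') == tcol la (g x)] (@perm_inj _ g)).
apply: subset_leq_card; apply/subsetP => _ /imsetP[y + ->].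
by rewrite !inE.
Qed.

Lemma straighten : exists w : 'S_n,
  (forall x, tcol la (w x) = tcol la (g x)) /\ (forall x, trow la (w x) <= trow mu x)%N.
Proof.
have [f fP] := fin_all_exists above_ex.
have above_lt x y : tcol la (g x) = tcol la (g y) -> (trow mu x < trow mu y)%N ->
    (#|above x| < #|above y|)%N.
  move=> cxy rxy; apply: proper_card; apply/properP; split.
    apply/subsetP => z; rewrite !inE cxy => /andP[-> /ltn_trans] /=; exact.
  by exists x; rewrite !inE ?cxy ?eqxx ?ltnn ?andbF.
have f_inj : injective f.
  move=> x y fxy; have [rx cx] := fP x; have [ry cy] := fP y.
  have cxy : tcol la (g x) = tcol la (g y) by rewrite -cx -cy fxy.
  have rxy : #|above x| = #|above y| by rewrite -rx -ry fxy.
  apply: noncollide => //; have [lt|lt|//] := ltngtP (trow mu x) (trow mu y).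
    by have := above_lt _ _ cxy lt; rewrite rxy ltnn.
  by have := above_lt _ _ (esym cxy) lt; rewrite rxy ltnn.
exists (perm f_inj); split=> x; rewrite permE; have [rx cx] := fP x => //.
by rewrite rx above_le.
Qed.

Lemma noncollide_sum : (\sum_(x : 'I_n) trow la x <= \sum_(x : 'I_n) trow mu x)%N.
Proof.
have [w [_ ww]] := straighten; rewrite (reindex_inj (@perm_inj _ w)).
by apply: leq_sum => x _; apply: ww.
Qed.

Lemma straighten_eq : (\sum_(x : 'I_n) trow la x = \sum_(x : 'I_n) trow mu x)%N -> exists w : 'S_n,
  (forall x, tcol la (w x) = tcol la (g x)) /\ (forall x, trow la (w x) = trow mu x)%N.
Proof.
have [w [wc ww]] := straighten => sum_eq; exists w; split=> //.
have [_] := leqif_sum (fun x (_ : xpredT x) => leqif_eq (ww x)).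
by rewrite -sum_eq [X in (_ == X)](reindex_inj (@perm_inj _ w)) eqxx => /esym/forallP h x; apply/eqP/(h x).
Qed.

End VonNeumann.

Lemma collide_neq n (la mu : partn n) : la <> mu :> seq nat ->
  (forall g : 'S_n, collide la mu g) \/ (forall g : 'S_n, collide mu la g).
Proof.
move=> ne; have [?|no] := classic (forall g : 'S_n, collide la mu g); first by left.
right=> h; case: (boolP (collide mu la h)) => // hok; exfalso.
have [g gok] : exists g : 'S_n, ~~ collide la mu g.
  by apply: NNPP => h'; apply: no => g; case: (boolP (collide la mu g)) => // g'; case: h'; exists g.
have sum_eq : (\sum_(x : 'I_n) trow la x = \sum_(x : 'I_n) trow mu x)%N.
  by apply/eqP; rewrite eqn_leq (noncollide_sum gok) (noncollide_sum hok).
have [w [_ wr]] := straighten_eq gok sum_eq.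
apply: ne; apply: partn_eq => r; rewrite -!card_trow.
rewrite -(card_imset [pred x : 'I_n | trow mu x == r] (@perm_inj _ w)); apply: eq_card => y.
apply/idP/imsetP => [yr|[x xr ->]]; last by move: xr; rewrite !inE wr.
by exists (w^-1%g y); rewrite ?permKV // inE -wr permKV.
Qed.

Lemma collide_self n (la : partn n) (g : 'S_n) : ~~ collide la la g ->
  exists p q, [/\ p \in row_stab n la, q \in col_stab n la & g = (p * q)%g].
Proof.
move=> /straighten_eq/(_ erefl)[w [wc wr]]; exists w, (w^-1 * g)%g; rewrite mulKVg; split=> //.
  by rewrite inE; apply/forallP => x; apply/eqP/wr.
rewrite inE; apply/forallP => x; apply/eqP; rewrite permM.
by rewrite -[RHS](congr1 (tcol la) (permKV w x)) wc.
Qed.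

Lemma row_col_stab n (la : partn n) p q : p \in row_stab n la -> q \in col_stab n la ->
  (p * q = 1)%g -> p = 1%g /\ q = 1%g.
Proof.
rewrite !inE => /forallP pr /forallP qc pq.
have p1 : p = 1%g.
  apply/permP => x; rewrite perm1; apply: (@tcell_inj n la); first exact/eqP/(pr x).
  by have /eqP := qc (p x); rewrite -permM pq perm1 => E; apply: esym E.
by split=> //; move: pq; rewrite p1 mul1g.
Qed.

Section CycleType.

Variable n : nat.
Implicit Types s t : 'S_n.

Definition cycle_type s : seq nat := sort geq (map (fun X : {set 'I_n} => #|X|) (enum (porbits s))).

Lemma cycle_type_partn s :
  [&& sorted geq (cycle_type s), 0%N \notin cycle_type s & sumn (cycle_type s) == n].
Proof.
apply/and3P; split.
- by apply: sort_sorted => x y; apply: leq_total.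
- rewrite mem_sort; apply/mapP => -[X]; rewrite mem_enum => /imsetP[x _ ->].
  by move/eqP; rewrite eq_sym (negPf (card_porbit_neq0 s x)).
rewrite (perm_sumn (s2 := (map (fun X : {set 'I_n} => #|X|) (enum (porbits s))))).
  rewrite sumnE big_map big_enum; apply/eqP; rewrite -[RHS]card_ord -cardsT; apply/esym/card_partition.
  apply/and3P; split.
  - apply/eqP/setP => x; rewrite inE; apply/bigcupP; exists (porbit s x); rewrite ?porbit_id //.
    exact: imset_f.
  - apply/trivIsetP => _ _ /imsetP[x _ ->] /imsetP[y _ ->] ne.
    rewrite -setI_eq0; apply: contraNT ne => /set0Pn[z]; rewrite inE.
    by rewrite -!eq_porbit_mem => /andP[/eqP<- /eqP<-].
  - apply/imsetP => -[x _ /setP/(_ x)]; by rewrite inE porbit_id.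
by rewrite perm_sort.
Qed.

Definition cycle_partn s : partn n := Partn (cycle_type_partn s).

Lemma permX_porbit s x m : (s ^+ (m * #|porbit s x|))%g x = x.
Proof.
have sc : (s ^+ #|porbit s x|)%g x = x by rewrite permX iter_porbit.
by elim: m => [|m IH]; rewrite ?perm1 // mulSn expgD permM sc.
Qed.

Lemma permX_mod s x y t i j : #|porbit s x| = #|porbit t y| ->
  (s ^+ i)%g x = (s ^+ j)%g x -> (t ^+ i)%g y = (t ^+ j)%g y.
Proof.
move=> cst; wlog ij : i j / (i <= j)%N => [th|].
  by have [/th|/ltnW/th h e] := leqP i j => //; apply/esym/h.
rewrite -(subnK ij); set m := (j - i)%N; rewrite !expgD !permM.
move=> /perm_inj/esym sm; congr ((t ^+ i)%g _); apply: esym.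
have c_m : (#|porbit s x| %| m)%N.
  have c0 : (0 < #|porbit s x|)%N by rewrite lt0n card_porbit_neq0.
  set c := #|porbit s x| in c0 *.
  have sr : (s ^+ (m %% c))%g x = x.
    by rewrite -[RHS]sm {2}(divn_eq m c) expgD permM permX_porbit.
  have lt0 : (0 < size (traject s x c))%N by rewrite size_traject.
  have ltm : (m %% c < size (traject s x c))%N by rewrite size_traject ltn_mod.
  have := nth_uniq x lt0 ltm (uniq_traject_porbit s x).
  rewrite !nth_traject ?ltn_mod //= -permX sr eqxx => /esym/eqP e0.
  by rewrite /dvdn -e0.
by have /dvdnP[k ->] := c_m; rewrite cst permX_porbit.
Qed.

Lemma cycle_type_conj s t : cycle_type s = cycle_type t -> exists g, (s * g = g * t)%g.
Proof.
move=> ct; pose cd := fun X : {set 'I_n} => #|X|.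
have : perm_eq (map cd (enum (porbits s))) (map cd (enum (porbits t))).
  by rewrite -(perm_sort geq) -[X in perm_eq X]/(cycle_type s) ct perm_sort.
case/(perm_iotaP 0%N) => Is Isp csE.
have size_Is : size Is = size (enum (porbits s)) by rewrite -(size_map (nth 0%N (map cd (enum (porbits t)))) Is) -csE size_map.
pose phi (X : {set 'I_n}) := nth set0 (enum (porbits t)) (nth 0%N Is (index X (enum (porbits s)))).
have phi_mem X : X \in porbits s -> phi X \in porbits t /\ #|phi X| = #|X|.
  rewrite -mem_enum -index_mem => lt; set j := index X _ in lt *.
  have jI : nth 0%N Is j \in Is by rewrite mem_nth // size_Is.
  have lt' : (nth 0%N Is j < size (enum (porbits t)))%N.
    by move: jI; rewrite (perm_mem Isp) mem_iota add0n size_map.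
  split; first by rewrite -mem_enum mem_nth.
  have := congr1 (fun v => nth 0%N v j) csE.
  by rewrite (nth_map set0) // nth_index -?index_mem // (nth_map 0%N) ?size_Is // (nth_map set0) // => ->.
have phi_surj Z : Z \in porbits t -> exists2 X, X \in porbits s & phi X = Z.
  rewrite -mem_enum => Zt; have lt := Zt; rewrite -index_mem in lt.
  have : index Z (enum (porbits t)) \in Is by rewrite (perm_mem Isp) mem_iota add0n size_map.
  move=> /(nthP 0%N)[j]; rewrite size_Is => jl jE.
  exists (nth set0 (enum (porbits s)) j); first by rewrite -mem_enum mem_nth.
  by rewrite /phi index_uniq ?enum_uniq // jE nth_index.
have [n0|n0] := posnP n.
  by exists 1%g; apply/permP => x; have := ltn_ord x; rewrite {2}n0.
pose x0 := Ordinal n0; pose rp (X : {set 'I_n}) := odflt x0 [pick x in X].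
have rpP r X : X \in porbits r -> rp X \in X.
  rewrite /rp; case: pickP => //= no /imsetP[x _ XE]; have := no x.
  by rewrite XE /= porbit_id.
have rpo r X : X \in porbits r -> porbit r (rp X) = X.
  move=> Xr; have := rpP _ _ Xr; case/imsetP: Xr => x _ ->.
  by rewrite -eq_porbit_mem => /eqP.
have powP x : exists i, (s ^+ i)%g (rp (porbit s x)) = x.
  have : x \in porbit s (rp (porbit s x)) by rewrite (@rpo s) ?imset_f // porbit_id.
  by move/porbitP => [i xE]; exists i; apply: esym.
have fex x : exists y, exists i,
    (s ^+ i)%g (rp (porbit s x)) = x /\ y = (t ^+ i)%g (rp (phi (porbit s x))).
  by have [i iE] := powP x; exists ((t ^+ i)%g (rp (phi (porbit s x)))), i.
have [f fP] := fin_all_exists fex.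
have f_pow X m : X \in porbits s -> f ((s ^+ m)%g (rp X)) = (t ^+ m)%g (rp (phi X)).
  move=> Xs; have [pm pc] := phi_mem X Xs.
  have [i []] := fP ((s ^+ m)%g (rp X)); rewrite porbit_perm (rpo _ _ Xs) => si ->.
  by apply: permX_mod si; rewrite !rpo.
have f_surj z : exists x, f x = z.
  have [X Xs XZ] := phi_surj (porbit t z) (imset_f _ isT).
  have : z \in porbit t (rp (phi X)) by rewrite XZ (@rpo t) ?imset_f // porbit_id.
  by move/porbitP => [m ->]; exists ((s ^+ m)%g (rp X)); rewrite f_pow.
have [f' f'P] := fin_all_exists f_surj.
have f'_bij : bijective f' by apply/injF_bij/(can_inj f'P).
have f_inj : injective f.
  by have [h h1 h2] := f'_bij => x y; rewrite -(h2 x) -(h2 y) !f'P => ->.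
exists (perm f_inj); apply/permP => x; rewrite !permM !permE.
have [i [xE fx]] := fP x.
have Xs : porbit s x \in porbits s by apply: imset_f.
have -> : s x = (s ^+ i.+1)%g (rp (porbit s x)) by rewrite expgSr permM xE.
by rewrite f_pow // expgSr permM fx.
Qed.

End CycleType.

(** * Young symmetrizers *)

Section YoungSymmetrizers.

Variables (k : fieldType) (n : nat).
Hypothesis Sn_unit : (#|{: 'S_n}|%:R : k) != 0.
Local Notation K := (galg k 'S_n).
Local Notation "'d_ g" := (gdelta k g : K) (at level 8, g at level 2).

Definition csum (la : seq nat) : K := \sum_(q in col_stab n la) (-1) ^+ q *: 'd_q.
Definition rsum (la : seq nat) : K := \sum_(p in row_stab n la) 'd_p.
Definition ysym (la : seq nat) : K := csum la * rsum la.

Lemma ysymE la : ysym la = young_symmetrizer k n la.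
Proof.
rewrite /ysym mulr_suml; apply: eq_bigr => q _; rewrite mulr_sumr; apply: eq_bigr => p _.
rewrite -scalerAl gdeltaM; apply/ffunP => x; rewrite !ffunE; congr (_ * _).
Qed.

Lemma spechtE la : specht k n la = lgen (ysym la).
Proof.
rewrite /specht /lgen; congr <<_>>%VS; apply: eq_map => g; rewrite ysymE.
by apply/ffunP => x; rewrite gdeltaMx ffunE.
Qed.

Lemma csum_stab la q : q \in col_stab n la -> csum la * 'd_q = (-1) ^+ q *: csum la.
Proof.
rewrite inE => /forallP qc; rewrite mulr_suml scaler_sumr.
rewrite [RHS](reindex_inj (mulgI q)); apply: eq_big => [q'|q' _]; last first.
  rewrite -scalerAl gdeltaM scalerA odd_permM signr_addb mulrA -signr_addb addbb mul1r //.
rewrite !inE; apply/forallP/forallP => h x.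
  by rewrite permM (eqP (h (q x))) (eqP (qc x)).
rewrite -[x](permKV q); have := h (q^-1%g x); rewrite permM (permKV q) => /eqP->.
by rewrite -[X in _ == _ _ (nat_of_ord X)](permKV q) (eqP (qc _)).
Qed.

Lemma stab_rsum la p : p \in row_stab n la -> 'd_p * rsum la = rsum la.
Proof.
rewrite inE => /forallP pc; rewrite mulr_sumr [RHS](reindex_inj (mulIg p)).
apply: eq_big => [p'|p' _]; last by rewrite gdeltaM.
rewrite !inE; apply/forallP/forallP => h x.
  by rewrite permM (eqP (pc (p' x))) (eqP (h x)).
by rewrite -(eqP (pc (p' x))) -permM (eqP (h x)).
Qed.

Lemma two_neq0 (x y : 'I_n) : x != y -> (2%:R : k) != 0.
Proof.
move=> xy; have n2 : (2 <= n)%N.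
  case: n x y xy => [|[|//]] [x ltx] [y lty] //.
  by case: x y ltx lty => [|//] [|//] ? ?; rewrite -(inj_eq val_inj).
have : (2 %| n`!)%N by apply: dvdn_fact; rewrite n2.
move=> /dvdnP[m mE]; apply: contraNneq Sn_unit => two0.
by rewrite card_Sn mE natrM two0 mulr0.
Qed.

Lemma tperm_stab (f : 'I_n -> nat) (x y : 'I_n) : f x = f y ->
  forall z, f (tperm x y z) == f z.
Proof. by move=> fxy z; case: tpermP => [->|->|//]; rewrite fxy. Qed.

Lemma collide_0 (la mu : seq nat) (g : 'S_n) : collide la mu g ->
  csum la * 'd_g * rsum mu = 0.
Proof.
move=> /existsP[x /existsP[y /and3P[xy /eqP rxy /eqP cxy]]].
have t_row : tperm x y \in row_stab n mu by rewrite inE; apply/forallP/(tperm_stab rxy).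
have t_col : tperm (g x) (g y) \in col_stab n la.
  by rewrite inE; apply/forallP/(@tperm_stab (tcol la) _ _ cxy).
have tg : 'd_(tperm (g x) (g y)) * 'd_g = 'd_g * 'd_(tperm x y).
  rewrite !gdeltaM; congr (gdelta k _); rewrite -tpermJ conjgE !mulgA mulgV mul1g //.
have : csum la * 'd_g * rsum mu = - (csum la * 'd_g * rsum mu).
  rewrite -[in LHS](stab_rsum t_row) mulrA -[X in X * _]mulrA -tg mulrA (csum_stab t_col).
  by rewrite odd_tperm (inj_eq perm_inj) xy expr1 scaleN1r !mulNr.
move/eqP; rewrite -addr_eq0 -mulr2n -scaler_nat scaler_eq0 => /orP[|/eqP//].
by rewrite (negPf (two_neq0 xy)).
Qed.

Lemma sandwich_self (la : partn n) z : exists a, csum la * z * rsum la = a *: ysym la.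
Proof.
move: z; apply: galg_lin; first by exists 0; rewrite mulr0 mul0r scale0r.
  move=> a x y [b bE] [c cE]; exists (a * b + c).
  by rewrite mulrDr mulrDl -scalerAr -scalerAl bE cE scalerDl scalerA.
move=> g; have [/collide_0 h|] := boolP (collide la la g).
  by exists 0; rewrite h scale0r.
move=> /collide_self[p [q [pr qc ->]]]; exists ((-1) ^+ q).
by rewrite -gdeltaM mulrA (csum_stab qc) -mulrA stab_rsum // -scalerAl.
Qed.

Lemma sandwich_neq (la mu : partn n) : la <> mu :> seq nat ->
  (forall z, csum la * z * rsum mu = 0) \/ (forall z, csum mu * z * rsum la = 0).
Proof.
have lin (l m : partn n) : (forall g : 'S_n, collide l m g) -> forall z, csum l * z * rsum m = 0.
  move=> h; apply: galg_lin; first by rewrite mulr0 mul0r.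
    by move=> a x y hx hy; rewrite mulrDr mulrDl -scalerAr -scalerAl hx hy scaler0 addr0.
  by move=> g; apply: collide_0.
by move=> /collide_neq[] /lin; [left|right].
Qed.

Lemma ysym_self (la : partn n) z : exists a, ysym la * z * ysym la = a *: ysym la.
Proof.
have [a aE] := sandwich_self la (rsum la * z * csum la); exists a.
by rewrite -aE /ysym !mulrA.
Qed.

Lemma ysym_neq (la mu : partn n) : la <> mu :> seq nat ->
  (forall z, ysym la * z * ysym mu = 0) \/ (forall z, ysym mu * z * ysym la = 0).
Proof.
have E (l m : partn n) z : ysym l * z * ysym m = csum l * (rsum l * z * csum m) * rsum m.
  by rewrite /ysym !mulrA.
by move=> /sandwich_neq[] h; [left|right] => z; rewrite E h.
Qed.

Lemma ysym1 (la : partn n) : ysym la 1%g = 1.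
Proof.
rewrite ysymE sum_ffunE (bigD1 1%g) /=; last by rewrite inE; apply/forallP => x; rewrite perm1.
rewrite [X in _ + X]big1 ?addr0 => [|q /andP[qc q1]]; last first.
  rewrite sum_ffunE big1 // => p pr; rewrite ffunE.
  case: eqP => [/esym pq|]; last by rewrite mulr0.
  by have [_ /eqP] := row_col_stab pr qc pq; rewrite (negPf q1).
rewrite sum_ffunE (bigD1 1%g) /=; last by rewrite inE; apply/forallP => x; rewrite perm1.
rewrite big1 ?addr0 => [|p /andP[pr p1]].
  by rewrite ffunE odd_perm1 mulg1 eqxx mulr1.
by rewrite ffunE mulg1 eq_sym (negPf p1) mulr0.
Qed.

End YoungSymmetrizers.

Section OuterProducts.

Variables (k : fieldType) (a b : nat).
Hypothesis Sa_unit : (#|{: 'S_a}|%:R : k) != 0.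
Hypothesis Sb_unit : (#|{: 'S_b}|%:R : k) != 0.
Local Notation G := ('S_a * 'S_b)%type.
Local Notation K := (galg k G).
Implicit Types (x y : galg k 'S_a) (z w : galg k 'S_b).

Definition outer2 x z : K := outer_prod x z.

Lemma outer2_linl z : linear (outer2^~ z).
Proof.
move=> c x y; apply/ffunP => g; rewrite !ffunE mulrDl; congr (_ + _).
by rewrite -[c *: _]/(c * _) -[RHS]/(c * _) mulrA.
Qed.

Lemma outer2_linr x : linear (outer2 x).
Proof.
move=> c z w; apply/ffunP => g; rewrite !ffunE mulrDr; congr (_ + _).
by rewrite -[c *: _]/(c * _) -[RHS]/(c * _) mulrCA.
Qed.

Lemma outer2_delta g h : outer2 (gdelta k g) (gdelta k h) = gdelta k (g, h).
Proof.
apply/ffunP => -[g' h']; rewrite !ffunE /=.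
have -> : ((g', h') == (g, h)) = (g' == g) && (h' == h) by [].
by rewrite -natrM mulnb.
Qed.

Lemma outer2M x y z w : outer2 x z * outer2 y w = outer2 (x * y) (z * w).
Proof.
apply/ffunP => -[g h]; rewrite gmulE ffunE /= !gmulE mulr_suml.
under [RHS]eq_bigr => g' _ do rewrite mulr_sumr.
rewrite pair_bigA; apply: eq_bigr => -[g' h'] _; rewrite !ffunE /=.
by rewrite mulrACA.
Qed.

Lemma outer2_0l z : outer2 0 z = 0.
Proof. by apply/ffunP => g; rewrite !ffunE mul0r. Qed.

Lemma outer2_0r x : outer2 x 0 = 0.
Proof. by apply/ffunP => g; rewrite !ffunE mulr0. Qed.

Definition ysym2 (la mu : seq nat) : K := outer2 (ysym k a la) (ysym k b mu).

Lemma specht_boxE la mu : specht_box k a b la mu = lgen (ysym2 la mu).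
Proof.
have memo (U : {vspace galg k 'S_a}) (W : {vspace galg k 'S_b}) x z : x \in U -> z \in W ->
    outer2 x z \in <<[seq outer_prod f g | f <- vbasis U, g <- vbasis W]>>%VS.
  move=> xU zW; rewrite (coord_vbasis xU).
  pose f : {linear _ -> _} := HB.pack (outer2^~ z) (GRing.isLinear.Build _ _ _ _ _ (outer2_linl z)).
  rewrite -[outer2 _ z]/(f _) linear_sum; apply: memv_suml => i _; rewrite linearZ memvZ //=.
  rewrite (coord_vbasis zW).
  set v := (vbasis U)`_i.
  pose f' : {linear _ -> _} := HB.pack (outer2 v) (GRing.isLinear.Build _ _ _ _ _ (outer2_linr v)).
  rewrite -[outer2 _ _]/(f' _) linear_sum; apply: memv_suml => j _; rewrite linearZ memvZ //=.
  by apply/memv_span/allpairs_f; rewrite mem_nth // size_tuple.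
apply/eqP; rewrite eqEsubv; apply/andP; split; apply/span_subvP.
  move=> _ /allpairsP[[f g] [/= /vbasis_mem + /vbasis_mem + ->]].
  rewrite !spechtE => /lgenP[y ->] /lgenP[z ->].
  by rewrite -[outer_prod _ _]/(outer2 _ _) -outer2M; apply/lgenP; exists (outer2 y z).
move=> _ /imageP[[g h] _ ->]; rewrite -outer2_delta outer2M; apply: memo; rewrite spechtE.
  by apply/lgenP; exists (gdelta k g).
by apply/lgenP; exists (gdelta k h).
Qed.

Lemma ysym2_neq0 (la : partn a) (mu : partn b) : ysym2 la mu != 0.
Proof.
apply/eqP => /ffunP/(_ (1%g, 1%g))/eqP; rewrite [X in X == _]ffunE [X in _ == X]ffunE.
by rewrite [_.1]/= [_.2]/= !ysym1 mulr1; apply/negP/oner_neq0.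
Qed.

Lemma galg2_lin (P : K -> Prop) : P 0 -> (forall c (x y : K), P x -> P y -> P (c *: x + y)) ->
  (forall x z, P (outer2 x z)) -> forall z : K, P z.
Proof.
move=> P0 PD Pd z; rewrite (gdelta_sum z); elim/big_ind: _ => // [x y Px Py|[g h] _].
  by rewrite -[x]scale1r; apply: PD.
by rewrite -[_ *: _]addr0 -outer2_delta; apply: PD.
Qed.

Lemma ysym2_self (la : partn a) (mu : partn b) (z : K) :
  exists c, ysym2 la mu * z * ysym2 la mu = c *: ysym2 la mu.
Proof.
move: z; apply: galg2_lin; first by exists 0; rewrite mulr0 mul0r scale0r.
  move=> c x y [d dE] [e eE]; exists (c * d + e).
  by rewrite mulrDr mulrDl -scalerAr -scalerAl dE eE scalerDl scalerA.
move=> x z; rewrite !outer2M; have [c ->] := ysym_self Sa_unit la x.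
have [d ->] := ysym_self Sb_unit mu z; exists (c * d).
apply/ffunP => g; rewrite !ffunE -[c *: _]/(c * _) -[d *: _]/(d * _) -[RHS]/(c * d * _).
by rewrite mulrACA.
Qed.

Lemma ysym2_neq (la la' : partn a) (mu mu' : partn b) :
  ((la : seq nat), (mu : seq nat)) <> ((la' : seq nat), (mu' : seq nat)) ->
  (forall z : K, ysym2 la mu * z * ysym2 la' mu' = 0) \/
  (forall z : K, ysym2 la' mu' * z * ysym2 la mu = 0).
Proof.
have lin (f g : K) : (forall x z, f * outer2 x z * g = 0) -> forall z : K, f * z * g = 0.
  move=> h; apply: galg2_lin; first by rewrite mulr0 mul0r.
    by move=> c x y hx hy; rewrite mulrDr mulrDl -scalerAr -scalerAl hx hy scaler0 addr0.
  by move=> x z; apply: h.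
move=> ne; have [la_eq|/(ysym_neq Sa_unit)[] h] := classic (la = la' :> seq nat); last 2 first.
- by left; apply: lin => x z; rewrite !outer2M h outer2_0l.
- by right; apply: lin => x z; rewrite !outer2M h outer2_0l.
have mu_ne : mu <> mu' :> seq nat by move=> mu_eq; apply: ne; rewrite la_eq mu_eq.
case: (ysym_neq Sb_unit mu_ne) => h.
- by left; apply: lin => x z; rewrite !outer2M h outer2_0r.
- by right; apply: lin => x z; rewrite !outer2M h outer2_0r.
Qed.

Lemma SS_unit : (#|{: G}|%:R : k) != 0.
Proof. by rewrite card_prod natrM mulf_neq0. Qed.

Lemma ysym2_full (X : {vspace K}) :
  (forall (la : partn a) (mu : partn b) (y z : K), y * ysym2 la mu * z \in X) -> forall x : K, x \in X.
Proof.
move=> h x; pose T := {C : {set G} | C \in classes [set: G]}.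
pose ct (C : T) := (cycle_partn (repr (val C)).1, cycle_partn (repr (val C)).2).
apply: (@ggen_full k G SS_unit T (fun C => ysym2 (ct C).1 (ct C).2)).
- by rewrite card_sig; apply/eq_leq/eq_card => C; rewrite !inE.
- by move=> C; apply: ysym2_neq0.
- move=> C C' ne; apply: ysym2_neq => -[ct1 ct2]; case/eqP: ne; apply: val_inj.
  have /repr_classesP[_ ->] := valP C; have /repr_classesP[_ ->] := valP C'.
  have [g1 g1E] := cycle_type_conj ct1; have [g2 g2E] := cycle_type_conj ct2.
  apply/eqP; rewrite eq_sym; apply/eqP/class_eqP/imsetP; exists (g1, g2); rewrite ?inE //.
  apply: (mulgI (g1, g2)); rewrite -conjgC.
  exact: (congr2 pair (esym g1E) (esym g2E)).
- by move=> C y z; apply: h.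
Qed.

End OuterProducts.

(** * Diagrams *)

Section Flip.

Variables a b : word.

Definition pt_flip a b (x : pt a b) : pt b a :=
  match x with inl i => inr i | inr j => inl j end.

Lemma pt_flipK (x : pt a b) : pt_flip (pt_flip x) = x. Proof. by case: x. Qed.

Lemma sgn_flip (x : pt a b) : sgn (pt_flip x) = ~~ sgn x.
Proof. by case: x => i //=; rewrite negbK. Qed.

Variable d : diag a b.

Definition flip_fun (x : pt b a) : pt b a := pt_flip (d (pt_flip x)).

Lemma flip_funK : involutive flip_fun.
Proof. by case=> i; rewrite /flip_fun pt_flipK diagK. Qed.

Lemma flip_fun_sgn x : sgn (flip_fun x) = ~~ sgn x.
Proof. by rewrite sgn_flip diag_sgn; case: x => i //=; rewrite negbK. Qed.

Definition flip : diag b a := mk_diag flip_funK flip_fun_sgn.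

Lemma flipE x : flip x = pt_flip (d (pt_flip x)).
Proof. by rewrite ffunE. Qed.

Definition capless := [forall i, ~~ is_lower (d (inl i))].

Lemma caplessP : reflect (forall i, exists j, d (inl i) = inr j) capless.
Proof.
apply: (iffP forallP) => h i; have := h i; first by case: (d _) => // j _; exists j.
by case=> j ->.
Qed.

Lemma nocupP : reflect (forall j, exists i, d (inr j) = inl i) (~~ has_cup d).
Proof.
apply: (iffP negP) => [h j|h /existsP[[i|j] //= ]]; last by have [i ->] := h j.
case dj: (d (inr j)) => [i|j']; first by exists i.
by case: h; apply/existsP; exists (inr j); rewrite /= dj.
Qed.

Lemma diag_inv x y : d x = y -> d y = x.
Proof. by move=> <-; rewrite diagK. Qed.

End Flip.

Lemma flipK a b (d : diag a b) : flip (flip d) = d.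
Proof. by apply: diag_ext => x; rewrite !flipE !pt_flipK. Qed.

Lemma capless_flip a b (d : diag a b) : capless (flip d) = ~~ has_cup d.
Proof.
apply/caplessP/nocupP => h j; have [i E] := h j; exists i.
  by move: E; rewrite flipE /=; case: (d _) => // x [->].
by rewrite flipE /= E.
Qed.

Lemma nocup_flip a b (d : diag a b) : ~~ has_cup (flip d) = capless d.
Proof. by rewrite -capless_flip flipK. Qed.

Lemma flip1 a : flip (diag1 a) = diag1 a.
Proof. by apply: diag_ext => -[] i; rewrite flipE !ffunE. Qed.

Section CompCases.

Variables (a b c : word) (d : diag a b) (e : diag b c).
Local Notation S := (same_strand d e).

Let step_d x y : d x = y -> S (inl x) (inl y).
Proof. by move=> <-; apply: (same_strand_s d e (inl x)). Qed.

Let step_e x y : e x = y -> S (inr x) (inr y).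
Proof. by move=> <-; apply: (same_strand_s d e (inr x)). Qed.

Let step_g j : S (inl (inr j)) (inr (inl j)).
Proof. exact: (same_strand_g d e (inl (inr j))). Qed.

Let step_g' j : S (inr (inl j)) (inl (inr j)).
Proof. exact: (same_strand_g d e (inr (inl j))). Qed.

Let neqP a' b' (f : diag a' b') x y : f x = y -> y != x.
Proof. by move=> <-; apply: diag_neq. Qed.

Lemma comp_cap i i' : d (inl i) = inl i' -> comp d e (inl i) = inl i'.
Proof.
move=> h; apply: comp_eq; last exact: step_d.
by have := neqP h; apply: contra => /eqP[->].
Qed.

Lemma comp_cup j j' : e (inr j) = inr j' -> comp d e (inr j) = inr j'.
Proof.
move=> h; apply: comp_eq; last exact: step_e.
by have := neqP h; apply: contra => /eqP[->].
Qed.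

Lemma comp_through i x j : d (inl i) = inr x -> e (inl x) = inr j ->
  comp d e (inl i) = inr j.
Proof.
move=> h h'; apply: comp_eq => //.
exact: same_trans (step_d h) (same_trans (step_g _) (step_e h')).
Qed.

Lemma comp_through' i x j : e (inr j) = inl x -> d (inr x) = inl i ->
  comp d e (inr j) = inl i.
Proof. by move=> /diag_inv h /diag_inv h'; apply/diag_inv/(comp_through h' h). Qed.

Lemma comp_pull j j' x y : e (inr j) = inl x -> d (inr x) = inr y -> e (inl y) = inr j' ->
  comp d e (inr j) = inr j'.
Proof.
move=> h h' h''; apply: comp_eq.
  apply/eqP => -[jj]; move: h'' => /diag_inv; rewrite jj h => -[xy].
  by have := neqP h'; rewrite xy eqxx.
exact: same_trans (step_e h) (same_trans (step_g' _) (same_trans (step_d h')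
  (same_trans (step_g _) (step_e h'')))).
Qed.

Lemma loops_capless : capless e -> loops d e = 0%N.
Proof.
move=> /caplessP ec; apply: loops0 => -[] [] i.
- by exists (inl i); apply: connect0.
- have [j /step_e h] := ec i; exists (inr j); exact: same_trans (step_g _) h.
- by have [j /step_e h] := ec i; exists (inr j).
- by exists (inr i); apply: connect0.
Qed.

Lemma loops_nocup : ~~ has_cup d -> loops d e = 0%N.
Proof.
move=> /nocupP ec; apply: loops0 => -[] [] i.
- by exists (inl i); apply: connect0.
- by have [j /step_d h] := ec i; exists (inl j).
- have [j /step_d h] := ec i; exists (inl j); exact: same_trans (step_g' _) h.
- by exists (inr i); apply: connect0.
Qed.

Lemma capless_comp : capless d -> capless e -> capless (comp d e).
Proof.
move=> /caplessP dc /caplessP ec; apply/caplessP => i.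
by have [x h] := dc i; have [j h'] := ec x; exists j; apply: comp_through h h'.
Qed.

Lemma flip_comp : flip (comp d e) = comp (flip e) (flip d).
Proof.
apply/esym/diag_ext => x; apply: comp_eq; first exact: diag_neq.
pose phi (q : pt a b + pt b c) : pt c b + pt b a :=
  match q with inl x => inr (pt_flip x) | inr x => inl (pt_flip x) end.
have phiP q q' : S q q' -> same_strand (flip e) (flip d) (phi q) (phi q').
  move=> qq'; apply: (zigzag_ind (P := fun q' => same_strand (flip e) (flip d) (phi q) (phi q'))) qq'.
  - exact: connect0.
  - move=> y /same_trans; apply.
    have -> : phi (strand d e y) = strand (flip e) (flip d) (phi y).
      by case: y => y /=; rewrite flipE pt_flipK.
    exact: same_strand_s.
  - move=> y /same_trans; apply.
    have -> : phi (glue y) = glue (phi y) by case: y => [] [].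
    exact: same_strand_g.
have phio y : phi (outer b y) = outer b (pt_flip y) by case: y.
have := phiP _ _ (comp_same d e (pt_flip x)); rewrite !phio pt_flipK.
by rewrite flipE.
Qed.

End CompCases.

Lemma loops_flip a b c (d : diag a b) (e : diag b c) :
  capless e -> loops (flip e) (flip d) = 0%N.
Proof. by rewrite -nocup_flip => h; apply: loops_nocup. Qed.

Lemma nocup_comp a b c (d : diag a b) (e : diag b c) :
  ~~ has_cup d -> ~~ has_cup e -> ~~ has_cup (comp d e).
Proof.
by rewrite -!capless_flip flip_comp => dc ec; apply: capless_comp.
Qed.

Lemma comp_absorb a b c (d : diag a b) (e : diag c b) : capless e ->
  (forall x y, e (inr x) = inr y -> d (inr x) = inr y) ->
  comp (comp d (flip e)) e = d.
Proof.
move=> ec ed; have e_low j : (forall j', d (inr j) <> inr j') \/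
    (exists2 j', d (inr j) = inr j' & e (inr j) <> inr j') -> exists x, e (inr j) = inl x.
  move=> h; case ej: (e (inr j)) => [x|j']; first by exists x.
  case: h => [/(_ j')|[j'' dj]]; first by case; apply: ed.
  by move: dj; rewrite (ed _ _ ej) ej => -[<-].
have through i j : d (inl i) = inr j -> comp (comp d (flip e)) e (inl i) = inr j.
  move=> dij; have [x ex] : exists x, e (inr j) = inl x.
    by apply: e_low; left=> j'; rewrite (diag_inv dij).
  have fx : flip e (inl j) = inr x by rewrite flipE /= ex.
  exact: comp_through (comp_through dij fx) (diag_inv ex).
apply: diag_ext => -[i|j].
  case di: (d (inl i)) => [i'|j]; last exact: through.
  by do 2!apply: comp_cap.
case dj: (d (inr j)) => [i|j']; first exact/diag_inv/through/diag_inv.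
have [ej|ej] := eqVneq (e (inr j)) (inr j'); first exact: comp_cup.
have [x ex] : exists x, e (inr j) = inl x by apply: e_low; right; exists j' => //; apply/eqP.
have [x' ex'] : exists x, e (inr j') = inl x.
  apply: e_low; right; exists j; first exact: diag_inv.
  by move=> /diag_inv/eqP; rewrite (negPf ej).
apply: (comp_pull ex _ (diag_inv ex')); apply: (@comp_pull _ _ _ d (flip e) x x' j j') => //.
  by rewrite flipE /= (diag_inv ex).
by rewrite flipE /= ex'.
Qed.

Lemma comp_flip_capless a b (d : diag a b) : capless d -> comp d (flip d) = diag1 a.
Proof.
move=> /caplessP dc; have h i : comp d (flip d) (inl i) = inr i.
  have [j dj] := dc i; apply: (comp_through dj).
  by rewrite flipE /= (diag_inv dj).
apply: diag_ext => -[] i; rewrite [RHS]ffunE; first exact: h.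
by apply: (@diag_inv _ _ (comp d (flip d))); apply: h.
Qed.

Definition cupseq a b (d : diag a b) : seq (option nat) :=
  [seq (if d (inr x) is inr y then Some (nat_of_ord y) else None) | x : 'I_(size b)].

Lemma cupseqP a a' b (d : diag a b) (e : diag a' b) : cupseq d = cupseq e <->
  (forall x y, d (inr x) = inr y <-> e (inr x) = inr y).
Proof.
split=> [/eq_in_map h x y|h].
  have := h x; rewrite mem_enum => /(_ isT); case: (d _) (e _) => [i|j] [i'|j'] //= [] //.
  by move/val_inj->; split=> -[->].
apply: eq_map => x; have := h x.
case dx: (d _) => [i|j]; case ex: (e _) => [i'|j'] // hx; first by have /= := (hx j').2 erefl.
  by have := (hx j).1 erefl.
by have [->] := (hx j).1 erefl.
Qed.

Lemma cupseq_comp a b c (d : diag a b) (e : diag b c) : ~~ has_cup d ->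
  cupseq (comp d e) = cupseq e.
Proof.
move=> /nocupP dc; apply/cupseqP => x y; split=> [|/comp_cup//].
case ex: (e _) => [i|j]; last by rewrite (comp_cup _ ex) => -[->].
by have [i' h] := dc i; rewrite (comp_through' ex h).
Qed.

Lemma capless_size a b (d : diag a b) : capless d -> (size a <= size b)%N.
Proof.
move=> /caplessP/fin_all_exists[f fP]; rewrite -[X in (X <= _)%N]card_ord -[X in (_ <= X)%N]card_ord.
apply: (@leq_card _ _ f) => x y fxy; have := fP x; rewrite fxy -fP => /(congr1 d).
by rewrite !diagK => -[].
Qed.

Lemma capless_nocup a b (d : diag a b) : capless d -> size a = size b -> ~~ has_cup d.
Proof.
move=> /caplessP/fin_all_exists[f fP] sab; apply/nocupP => j.
have f_inj : injective f.
  by move=> x y fxy; have := fP x; rewrite fxy -fP => /(congr1 d); rewrite !diagK => -[].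
have : j \in codom f by apply: (inj_card_onto f_inj); rewrite !card_ord sab.
by case/codomP => i ->; exists i; apply/diag_inv/fP.
Qed.

Lemma nocup_size a b (d : diag a b) : capless d -> ~~ has_cup d -> size a = size b.
Proof.
rewrite -capless_flip => /capless_size ab /capless_size ba.
by apply/eqP; rewrite eqn_leq ab ba.
Qed.

(* Letter by letter, match the points of w with the upper points of d which are
   not on a cup. *)
Lemma capless_exists a b (d : diag a b) (w : word) :
  (forall c : bool, #|[pred i : 'I_(size w) | nth wedge w i == c]| =
     #|[pred j : 'I_(size b) | (nth wedge b j == c) && is_lower (d (inr j))]|) ->
  exists2 e : diag w b, capless e & cupseq e = cupseq d.
Proof.
move=> cnt; pose P c := [pred j : 'I_(size b) | (nth wedge b j == c) && is_lower (d (inr j))].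
pose Q c := [pred i : 'I_(size w) | nth wedge w i == c].
have fex (i : 'I_(size w)) : exists j : 'I_(size b),
    [/\ j \in P (nth wedge w i) & index i (enum (Q (nth wedge w i))) = index j (enum (P (nth wedge w i)))].
  set c := nth wedge w i.
  have lt : (index i (enum (Q c)) < size (enum (P c)))%N.
    by rewrite -cardE -cnt cardE index_mem mem_enum inE.
  case E : (enum (P c)) (lt) => [//|x0 s0] _; rewrite -E.
  exists (nth x0 (enum (P c)) (index i (enum (Q c)))); split; last by rewrite index_uniq ?enum_uniq.
  by rewrite -mem_enum mem_nth.
have [f fP] := fin_all_exists fex.
have fl i : nth wedge b (f i) = nth wedge w i by have [/andP[/eqP]] := fP i.
have ff i : is_lower (d (inr (f i))) by have [/andP[_]] := fP i.
have gex (j : 'I_(size b)) : is_lower (d (inr j)) -> exists i, f i = j.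
  move=> dj; set c := nth wedge b j; have jP : j \in P c by rewrite inE eqxx.
  have lt : (index j (enum (P c)) < size (enum (Q c)))%N.
    by rewrite -cardE cnt cardE index_mem mem_enum.
  case E : (enum (Q c)) (lt) => [//|x0 s0] _; pose i := nth x0 (enum (Q c)) (index j (enum (P c))).
  have iQ : i \in Q c by rewrite -mem_enum mem_nth.
  exists i; have [fiP fiE] := fP i; move: iQ; rewrite inE => /eqP iQ; rewrite iQ in fiP fiE.
  rewrite index_uniq ?enum_uniq // in fiE.
  have jm : j \in enum (P c) by rewrite mem_enum.
  have fm : f i \in enum (P c) by rewrite mem_enum.
  by rewrite -(nth_index j jm) fiE nth_index.
have f_inj : injective f.
  move=> x y fxy; have [_ ix] := fP x; have [_ iy] := fP y.
  have lxy : nth wedge w x = nth wedge w y by rewrite -!fl fxy.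
  rewrite -lxy -fxy -ix in iy.
  have xm : x \in enum (Q (nth wedge w x)) by rewrite mem_enum inE.
  have ym : y \in enum (Q (nth wedge w x)) by rewrite mem_enum inE lxy.
  by rewrite -(nth_index x xm) -iy nth_index.
have hex (x : pt w b) : exists y : pt w b, match x with
    | inl i => y = inr (f i)
    | inr j => match d (inr j) with inl _ => exists2 i, f i = j & y = inl i | inr j' => y = inr j' end
  end.
  case: x => [i|j]; first by exists (inr (f i)).
  case dj: (d (inr j)) => [i|j']; last by exists (inr j').
  by have [|i' iE] := @gex j; rewrite ?dj //; exists (inl i'), i'.
have [h hP] := fin_all_exists hex.
have hl i : h (inl i) = inr (f i) by have := hP (inl i).
have hf i : h (inr (f i)) = inl i.
  have := hP (inr (f i)); have := ff i; case: (d _) => // _ _ [i' /f_inj-> //].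
have hr j j' : d (inr j) = inr j' -> h (inr j) = inr j'.
  by move=> dj; have := hP (inr j); rewrite dj.
have hK : involutive h.
  case=> [i|j]; first by rewrite hl hf.
  case dj: (d (inr j)) => [i|j']; last by rewrite (hr _ _ dj) (hr _ _ (diag_inv dj)).
  by have [|i' <-] := @gex j; rewrite ?dj // hf hl.
have hs x : sgn (h x) = ~~ sgn x.
  case: x => [i|j]; first by rewrite hl /= fl.
  case dj: (d (inr j)) => [i|j']; last by rewrite (hr _ _ dj) -[RHS](diag_sgn d (inr j)) dj.
  by have [|i' <-] := @gex j; rewrite ?dj // hf /= negbK fl.
exists (mk_diag hK hs); first by apply/caplessP => i; exists (f i); rewrite ffunE hl.
apply/cupseqP => x y; rewrite ffunE; split=> [|/hr//].
case dx: (d (inr x)) => [i|j]; last by rewrite (hr _ _ dx) => -[->].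
by have [|i' <-] := @gex x; rewrite ?dx // hf.
Qed.

Lemma cup_letters a b (d : diag a b) :
  #|[pred j : 'I_(size b) | (nth wedge b j == vee) && ~~ is_lower (d (inr j))]| =
  #|[pred j : 'I_(size b) | (nth wedge b j == wedge) && ~~ is_lower (d (inr j))]|.
Proof.
suff le c : (#|[pred j : 'I_(size b) | (nth wedge b j == c) && ~~ is_lower (d (inr j))]| <=
    #|[pred j : 'I_(size b) | (nth wedge b j == ~~ c) && ~~ is_lower (d (inr j))]|)%N.
  by apply/eqP; rewrite eqn_leq (le vee) (le wedge).
pose f (j : 'I_(size b)) := if d (inr j) is inr j' then j' else j.
have fi : {in [pred j : 'I_(size b) | (nth wedge b j == c) && ~~ is_lower (d (inr j))] &, injective f}.
  move=> x y; rewrite !inE /f => /andP[_ dx] /andP[_ dy].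
  case ex: (d (inr x)) dx => [//|x'] _; case ey: (d (inr y)) dy => [//|y'] _ xy.
  by move: ex; rewrite xy -ey => /(congr1 d); rewrite !diagK => -[].
rewrite -(card_in_imset fi).
apply/subset_leq_card/subsetP => _ /imsetP[x + ->]; rewrite !inE /f => /andP[/eqP xc dx].
case ex: (d (inr x)) dx => [//|x'] _; rewrite (diag_inv ex) andbT.
have := diag_sgn d (inr x); rewrite ex /= xc => /negb_inj->; exact: eqxx.
Qed.

(** * Mixed words *)

Section MixedWords.

Variables a b : nat.
Local Notation w := (mixed a b).
Implicit Types st : ('S_a * 'S_b)%type.

Lemma size_mixed : size w = (a + b)%N.
Proof. by rewrite size_cat !size_nseq. Qed.

Definition mv (i : 'I_a) : 'I_(size w) := cast_ord (esym size_mixed) (lshift b i).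
Definition mw (j : 'I_b) : 'I_(size w) := cast_ord (esym size_mixed) (rshift a j).

Lemma mixed_cases (x : 'I_(size w)) : (exists i, x = mv i) \/ (exists j, x = mw j).
Proof.
case: (split_ordP (cast_ord size_mixed x)) => i xE; [left | right]; exists i;
  by apply: val_inj; rewrite /= -[LHS]/(nat_of_ord (cast_ord size_mixed x)) xE.
Qed.

Lemma nth_mv i : nth wedge w (mv i) = vee.
Proof. by rewrite nth_cat size_nseq /= ltn_ord nth_nseq ltn_ord. Qed.

Lemma nth_mw j : nth wedge w (mw j) = wedge.
Proof. by rewrite nth_cat size_nseq /= ltnNge leq_addr /= nth_nseq; case: ifP. Qed.

Lemma mv_inj : injective mv.
Proof. by move=> x y /(congr1 val) /= xy; apply: val_inj. Qed.

Lemma mw_inj : injective mw.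
Proof. by move=> x y /(congr1 val) /= /addnI xy; apply: val_inj. Qed.

Lemma letter_mv (x : 'I_(size w)) : nth wedge w x = vee -> exists i, x = mv i.
Proof. by case: (mixed_cases x) => [//|[j ->]]; rewrite nth_mw. Qed.

Lemma letter_mw (x : 'I_(size w)) : nth wedge w x = wedge -> exists i, x = mw i.
Proof. by case: (mixed_cases x) => [[j ->]|//]; rewrite nth_mv. Qed.

Lemma count_mixed c : #|[pred i : 'I_(size w) | nth wedge w i == c]| = if c then a else b.
Proof.
case: c; last first.
  rewrite -[RHS]card_ord -(card_codom mw_inj); apply: eq_card => x; rewrite inE.
  apply/eqP/codomP => [/letter_mw[i ->]|[i ->]]; [by exists i | exact: nth_mw].
rewrite -[RHS]card_ord -(card_codom mv_inj); apply: eq_card => x; rewrite inE.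
apply/eqP/codomP => [/letter_mv[i ->]|[i ->]]; [by exists i | exact: nth_mv].
Qed.

Definition pd st : diag w w := juxt (perm_diag vee st.1) (perm_diag wedge st.2).

Lemma pd_mv st i : pd st (inl (mv i)) = inr (mv (st.1 i)).
Proof.
rewrite ffunE /juxt_fun.
have -> : inl (mv i) = pt_join (inl (inl (cast_ord (esym (size_nseq a vee)) i)))
    :> pt (nseq a vee ++ nseq b wedge) (nseq a vee ++ nseq b wedge).
  by congr inl; apply: val_inj.
rewrite pt_joinK ffunE /= cast_ordKV; congr inr; exact: val_inj.
Qed.

Lemma pd_mw st j : pd st (inl (mw j)) = inr (mw (st.2 j)).
Proof.
rewrite ffunE /juxt_fun.
have -> : inl (mw j) = pt_join (inr (inl (cast_ord (esym (size_nseq b wedge)) j)))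
    :> pt (nseq a vee ++ nseq b wedge) (nseq a vee ++ nseq b wedge).
  by congr inl; apply: val_inj; rewrite /= size_nseq.
rewrite pt_joinK ffunE /= cast_ordKV; congr inr; apply: val_inj; by rewrite /= size_nseq.
Qed.

Lemma pd_capless st : capless (pd st).
Proof.
apply/caplessP => x; case: (mixed_cases x) => -[i ->]; first by exists (mv (st.1 i)); rewrite pd_mv.
by exists (mw (st.2 i)); rewrite pd_mw.
Qed.

Lemma pd_nocup st : ~~ has_cup (pd st).
Proof. exact: capless_nocup (pd_capless st) erefl. Qed.

End MixedWords.

Lemma nocup_ext a b (d d' : diag a b) : ~~ has_cup d' -> (forall i, d (inl i) = d' (inl i)) -> d = d'.
Proof.
move=> /nocupP dc h; apply: diag_ext => -[i|j]; first exact: h.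
by have [i iE] := dc j; rewrite iE; apply: (@diag_inv _ _ d); rewrite h; apply: diag_inv.
Qed.

Section MixedPerm.

Variables a b : nat.
Local Notation w := (mixed a b).
Implicit Types st : ('S_a * 'S_b)%type.

Lemma pd_comp st st' : comp (pd st) (pd st') = pd (st * st')%g.
Proof.
apply: nocup_ext; first exact: pd_nocup.
move=> x; case: (mixed_cases x) => -[i ->].
  by rewrite pd_mv permM; apply: comp_through (pd_mv _ _) (pd_mv _ _).
by rewrite pd_mw permM; apply: comp_through (pd_mw _ _) (pd_mw _ _).
Qed.

Lemma pd1 : pd (1%g : 'S_a * 'S_b) = diag1 w.
Proof.
apply: nocup_ext; first by rewrite -capless_flip flip1; apply/caplessP => i; exists i; rewrite ffunE.
move=> x; rewrite [RHS]ffunE; case: (mixed_cases x) => -[i ->].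
  by rewrite pd_mv perm1.
by rewrite pd_mw perm1.
Qed.

Lemma pd_inj : injective (@pd a b).
Proof.
move=> [s t] [s' t'] h; congr pair; apply/permP => i.
  have : pd (s, t) (inl (mv b i)) = pd (s', t') (inl (mv b i)) by rewrite h.
  by rewrite !pd_mv => -[/val_inj].
have : pd (s, t) (inl (mw a i)) = pd (s', t') (inl (mw a i)) by rewrite h.
by rewrite !pd_mw => -[/addnI/val_inj].
Qed.

Lemma pd_flip st : flip (pd st) = pd st^-1%g.
Proof.
apply: nocup_ext; first exact: pd_nocup.
move=> x; rewrite flipE; case: (mixed_cases x) => -[i ->].
  have E : pd st (inr (mv b i)) = inl (mv b (st^-1%g.1 i)).
    by apply: diag_inv; rewrite pd_mv permKV.
  by rewrite pd_mv [pt_flip (inl _)]/pt_flip E.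
have E : pd st (inr (mw a i)) = inl (mw a (st^-1%g.2 i)).
  by apply: diag_inv; rewrite pd_mw permKV.
by rewrite pd_mw [pt_flip (inl _)]/pt_flip E.
Qed.

Lemma capless_pd (d : diag w w) : capless d -> exists st, d = pd st.
Proof.
move=> /caplessP/fin_all_exists[f fP].
have f_inj x y : f x = f y -> x = y.
  by move=> fxy; have := fP x; rewrite fxy -fP => /(congr1 d); rewrite !diagK => -[].
have fl x : nth wedge w (f x) = nth wedge w x.
  by have := diag_sgn d (inl x); rewrite fP /= => /negb_inj.
have sv i : exists i', f (mv b i) = mv b i' by apply: letter_mv; rewrite fl nth_mv.
have sw j : exists j', f (mw a j) = mw a j' by apply: letter_mw; rewrite fl nth_mw.
have [p pP] := fin_all_exists sv; have [q qP] := fin_all_exists sw.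
have p_inj : injective p by move=> x y pxy; apply/mv_inj/f_inj; rewrite !pP pxy.
have q_inj : injective q by move=> x y pxy; apply/mw_inj/f_inj; rewrite !qP pxy.
exists (perm p_inj, perm q_inj); apply: nocup_ext; first exact: pd_nocup.
move=> x; case: (mixed_cases x) => -[i ->].
  by rewrite pd_mv fP pP permE.
by rewrite pd_mw fP qP permE.
Qed.

End MixedPerm.

Section DiagramBasis.

Variables (k : fieldType) (delta : k) (n : nat) (w : 'I_n.+1 -> word).
Local Notation A := (OBalg delta w).

Definition bz (z : OBbasis w) : A := [ffun z' => (z' == z)%:R].
(* Opaque, as unification would otherwise unfold it. *)
Fact bb_exists i j (d : diag (w i) (w j)) : {x : A | x = bz (obb d)}.
Proof. by exists (bz (obb d)). Qed.

Definition bb i j (d : diag (w i) (w j)) : A := sval (bb_exists d).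

Lemma bb_bz i j (d : diag (w i) (w j)) : bb d = bz (obb d).
Proof. exact: svalP (bb_exists d). Qed.

Lemma bbE i j (d : diag (w i) (w j)) z : bb d z = (z == obb d)%:R.
Proof. by rewrite bb_bz ffunE. Qed.

Lemma bb_coef i j (d d' : diag (w i) (w j)) : bb d (obb d') = (d' == d)%:R.
Proof. by rewrite bbE obb_eq. Qed.

Lemma bb_coef0 i j i' j' (d : diag (w i) (w j)) (d' : diag (w i') (w j')) :
  (i', j') != (i, j) -> bb d (obb d') = 0.
Proof.
move=> ne; rewrite bbE; case: eqP => // /(congr1 (@tag _ _)) /= E.
by rewrite E eqxx in ne.
Qed.

Lemma bb_mul i j l (d : diag (w i) (w j)) (e : diag (w j) (w l)) :
  bb e * bb d = delta ^+ loops d e *: bb (comp d e).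
Proof.
apply: OBext => i' l' c; rewrite [LHS]OBmulE.
transitivity (delta ^+ loops d e * bb (comp d e) (obb c)); last by rewrite [RHS]ffunE.
have sel m (d' : diag (w i') (w m)) (e' : diag (w m) (w l')) :
    (obb d' = obb d -> obb e' = obb e -> False) ->
    bb e (obb e') * bb d (obb d') * delta ^+ loops d' e' * (comp d' e' == c)%:R = 0.
  move=> h; have E1 := bbE e (obb e'); have E2 := bbE d (obb d'); rewrite -> E1, E2.
  by case: eqP => ee; rewrite ?mul0r //; case: eqP => dd; [case: h | rewrite mulr0 !mul0r].
have [il|ne] := eqVneq (i', l') (i, l); last first.
  have E0 : bb (comp d e) (obb c) = 0 by apply: bb_coef0.
  rewrite -> E0; rewrite mulr0 big1 // => m _; rewrite big1 // => d' _; rewrite big1 // => e' _; apply: sel.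
  move=> /(congr1 (@tag _ _))/= [ii _] /(congr1 (@tag _ _))/= [_ ll].
  by rewrite ii ll eqxx in ne.
case: il => ii ll; rewrite ii ll in c sel *.
have E0 : bb (comp d e) (obb c) = (c == comp d e)%:R by apply: bb_coef.
rewrite -> E0; rewrite (bigD1 j) //= [X in _ + X]big1 ?addr0 => [|m /eqP mj]; last first.
  rewrite big1 // => d' _; rewrite big1 // => e' _; apply: sel.
  by move=> /(congr1 (@tag _ _))/= [/mj].
rewrite (bigD1 d) //= [X in _ + X]big1 ?addr0 => [|d' dd]; last first.
  rewrite big1 // => e' _; apply: sel => /eqP; rewrite obb_eq => /eqP dE; by rewrite dE eqxx in dd.
rewrite (bigD1 e) //= [X in _ + X]big1 ?addr0 => [|e' ee]; last first.
  by apply: sel => _ /eqP; rewrite obb_eq => /eqP eE; rewrite eE eqxx in ee.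
have E1 : bb e (obb e) = 1 by rewrite bb_coef eqxx.
have E2 : bb d (obb d) = 1 by rewrite bb_coef eqxx.
transitivity (1 * 1 * delta ^+ loops d e * (comp d e == c)%:R : k); last by rewrite !mul1r eq_sym.
congr (_ * _ * _ * _); [exact: E1 | exact: E2].
Qed.

Lemma bb_mul0 i j j' l (d : diag (w i) (w j)) (e : diag (w j') (w l)) :
  j' != j -> bb e * bb d = 0.
Proof.
move=> ne; apply: OBext => i' l' c; rewrite [LHS]OBmulE [RHS]ffunE.
rewrite big1 // => m _; rewrite big1 // => d' _; rewrite big1 // => e' _.
have E1 := bbE e (obb e'); have E2 := bbE d (obb d'); rewrite -> E1, E2.
case: (obb d' =P obb d) => [/(congr1 (@tag _ _))/= [_ mj]|_]; last by rewrite mulr0 !mul0r.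
case: (obb e' =P obb e) => [/(congr1 (@tag _ _))/= [mj' _]|_]; last by rewrite !mul0r.
by rewrite -mj -mj' eqxx in ne.
Qed.

Lemma bb_sum1 : \sum_i bb (diag1 (w i)) = 1.
Proof.
apply: OBext => i j c; rewrite sum_ffunE (bigD1 i) //= big1 => [|l li]; last first.
  by rewrite bb_coef0 //; apply: contra li => /eqP[->].
rewrite addr0 [RHS]OBoneE; have [ij|ij] := eqVneq j i; first by rewrite bbE.
rewrite bb_coef0; last by apply: contra ij => /eqP[->].
case: eqP => // /(congr1 (@tag _ _)) /= [jj]; by rewrite jj eqxx in ij.
Qed.

Lemma bb_span (U : {vspace A}) : (forall i j (d : diag (w i) (w j)), bb d \in U) ->
  forall a, a \in U.
Proof.
move=> h a; have -> : a = \sum_z a z *: bz z.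
  apply/ffunP => z; rewrite sum_ffunE (bigD1 z) //= big1 => [|g gz].
    by rewrite !ffunE eqxx addr0 -[RHS]/(_ * _) mulr1.
  by rewrite !ffunE eq_sym (negPf gz) scaler0.
apply: memv_suml => -[[i j] d] _; apply: memvZ.
have := h i j d; rewrite /bb; case: (bb_exists d) => x /= ->; exact.
Qed.

Lemma OBalg_dim : \dim {:A} = #|{: OBbasis w}|.
Proof. by rewrite dimvf /dim /= muln1. Qed.

End DiagramBasis.

Lemma same_cups a a' b (d : diag a b) (c : diag a' b) : capless d -> capless c ->
  cupseq d = cupseq c ->
  [/\ d = comp (comp d (flip c)) c, capless (comp d (flip c)), ~~ has_cup (comp d (flip c))
    & size a = size a'].
Proof.
have cl a1 a2 b1 (f : diag a1 a2) (e : diag a2 b1) : capless (comp f e) -> capless f.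
  move=> /caplessP h; apply/caplessP => i; case fi: (f (inl i)) => [i'|j]; last by exists j.
  by have [j] := h i; rewrite (comp_cap _ fi).
move=> dc cc dE.
have dd : d = comp (comp d (flip c)) c.
  by apply/esym/comp_absorb => // x y; apply (cupseqP d c).1.
have ee : c = comp (comp c (flip d)) d.
  by apply/esym/comp_absorb => // x y; apply (cupseqP d c).1.
have f1 : capless (comp d (flip c)) by apply: (cl _ _ _ _ c); rewrite -dd.
have f2 : ~~ has_cup (comp d (flip c)).
  by rewrite -capless_flip flip_comp flipK; apply: (cl _ _ _ _ d); rewrite -ee.
by split=> //; apply: nocup_size f1 f2.
Qed.

(** * Walled Brauer algebras *)

Opaque OBmul.
Lemma cupseq_cup a a' b (d : diag a b) (c : diag a' b) x y : cupseq d = cupseq c ->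
  d (inr x) = inr y -> c (inr x) = inr y.
Proof. by move/cupseqP => /(_ x y)[]. Qed.

Section WalledBrauerLayering.

Variables (k : fieldType) (delta : k) (r s : nat).
Local Notation N := (minn r s).
Local Notation w := (@mixed_family r s).
Local Notation A := (walled_Brauer_c delta r s).
Local Notation G := (fun l : 'I_N.+1 => ('S_(r - l) * 'S_(s - l))%type).
Local Notation pw := (@perm_diag2 r s _).
Local Notation bb := (@bb k delta _ w _ _).
Implicit Types (i j l : 'I_N.+1).

Lemma size_family i : size (w i) = (r - i + (s - i))%N.
Proof. exact: size_mixed. Qed.

Lemma family_le i j : (size (w i) <= size (w j))%N -> (j <= i)%N.
Proof. by rewrite !size_family; have := ltn_ord i; have := ltn_ord j; lia. Qed.

Lemma family_inj i j : size (w i) = size (w j) -> i = j.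
Proof. by move=> ij; apply: val_inj; apply/eqP; rewrite eqn_leq !family_le ?ij. Qed.

Lemma pw_comp l (g h : G l) : comp (pw g) (pw h) = pw (g * h)%g.
Proof. exact: pd_comp. Qed.

Lemma pw_capless l (g : G l) : capless (pw g). Proof. exact: pd_capless. Qed.
Lemma pw_nocup l (g : G l) : ~~ has_cup (pw g). Proof. exact: pd_nocup. Qed.
Lemma pw_flip l (g : G l) : flip (pw g) = pw g^-1%g. Proof. exact: pd_flip. Qed.
Lemma pw1 l : pw (1%g : G l) = diag1 (w l). Proof. exact: pd1. Qed.
Lemma pw_inj l : injective (@perm_diag2 r s l). Proof. exact: pd_inj. Qed.
Lemma capless_pw l (d : diag (w l) (w l)) : capless d -> exists g : G l, d = pw g.
Proof. exact: capless_pd. Qed.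

Lemma diag1_capless l : capless (diag1 (w l)). Proof. by rewrite -pw1 pw_capless. Qed.
Lemma diag1_nocup l : ~~ has_cup (diag1 (w l)). Proof. by rewrite -pw1 pw_nocup. Qed.

Lemma bb_capless i j l (d : diag (w i) (w j)) (e : diag (w j) (w l)) : capless e ->
  bb e * bb d = bb (comp d e).
Proof. by move=> ec; rewrite bb_mul loops_capless // scale1r. Qed.

Lemma bb_nocup i j l (d : diag (w i) (w j)) (e : diag (w j) (w l)) : ~~ has_cup d ->
  bb e * bb d = bb (comp d e).
Proof. by move=> ec; rewrite bb_mul loops_nocup // scale1r. Qed.

Lemma bb_inj i j (d e : diag (w i) (w j)) : bb d = bb e -> d = e.
Proof.
move=> de; have := etrans (esym (bbE delta d (obb d)))
  (etrans (congr1 (fun x : A => x (obb d)) de) (bbE delta e (obb d))).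
rewrite (obb_eq d e) (eqxx (obb d)); case: (d =P e) => [dE _|_ /eqP]; first exact: dE.
by rewrite [_ == _](oner_eq0 k).
Qed.

Lemma has_cup_seq a b (d : diag a b) : has_cup d = has isSome (cupseq d).
Proof.
apply/existsP/hasP => [[[i|j] //= dj]|[o /mapP[x _ ->]]].
  exists (if d (inr j) is inr y then Some (nat_of_ord y) else None); last by case: (d _) dj.
  by apply: map_f; rewrite mem_enum.
by case dx: (d _) => [//|y] _; exists (inr x); rewrite /= dx.
Qed.

Implicit Types z : OBbasis w.

Definition rep z : OBbasis w :=
  if has_cup (tagged z) then
    choose [pred z' : OBbasis w | [&& capless (tagged z'), (tag z').2 == (tag z).2 &
                       cupseq (tagged z') == cupseq (tagged z)]] z
  else obb (diag1 (w (tag z).2)).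

Lemma rep_spec z : capless (tagged z) ->
  [/\ capless (tagged (rep z)), (tag (rep z)).2 = (tag z).2 &
      cupseq (tagged (rep z)) = cupseq (tagged z)].
Proof.
move=> zc; rewrite /rep; case: ifP => [_|/negbT nc].
  have : [pred z' : OBbasis w | [&& capless (tagged z'), (tag z').2 == (tag z).2 &
       cupseq (tagged z') == cupseq (tagged z)]] z by rewrite /= zc !eqxx.
  by move/chooseP => /and3P[h1 /eqP h2 /eqP h3]; split.
split=> //; first exact: diag1_capless.
apply/cupseqP => x y; rewrite ffunE /=.
by have /nocupP/(_ x)[i ->] := nc.
Qed.

Lemma rep_eq z z' : capless (tagged z) -> capless (tagged z') -> (tag z).2 = (tag z').2 ->
  cupseq (tagged z) = cupseq (tagged z') -> rep z = rep z'.
Proof.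
move=> zc zc' tzz czz; rewrite /rep !has_cup_seq czz; case: ifP => _; last by rewrite tzz.
rewrite tzz; apply: choose_id; by apply/and3P; split=> //; apply/eqP.
Qed.

Definition isrep z := capless (tagged z) && (rep z == z).
Definition cupdiag : finType := {z : OBbasis w | isrep z}.
Implicit Types c : cupdiag.

Definition csrc c := (tag (val c)).1.
Definition ctgt c := (tag (val c)).2.
Definition cdg c : diag (w (csrc c)) (w (ctgt c)) := tagged (val c).

Lemma cdg_capless c : capless (cdg c). Proof. by have /andP[] := valP c. Qed.

Lemma cupdiag_eq c c' : ctgt c = ctgt c' -> cupseq (cdg c) = cupseq (cdg c') -> c = c'.
Proof.
have /andP[cc /eqP cr] := valP c; have /andP[cc' /eqP cr'] := valP c'.
by move=> tcc dcc; apply: val_inj; rewrite -cr -cr'; apply: rep_eq.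
Qed.

Lemma rep_factor i j (d : diag (w i) (w j)) : capless d ->
  exists (c : diag (w i) (w j)) (g : G i), isrep (obb c) /\ d = comp (pw g) c.
Proof.
move=> dc; have [] := @rep_spec (obb d) dc.
case E : (rep (obb d)) => [[i' j'] c] /= cc jj; rewrite jj in c E cc *.
move=> /esym dcE; have [dE f1 _ /family_inj ii] := same_cups dc cc dcE.
rewrite -ii in c E cc dcE dE f1; have [g gE] := capless_pw f1.
exists c, g; split; last by rewrite -gE.
rewrite /isrep cc -{2}[obb c]E; apply/eqP.
by apply: rep_eq; rewrite //= dcE.
Qed.

Definition cone l : cupdiag.
Proof.
exists (obb (diag1 (w l))).
by rewrite /isrep /rep /= diag1_capless (negPf (diag1_nocup l)) eqxx.
Defined.

Definition cce c : A := bb (cdg c).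
Definition cst c : A := bb (flip (cdg c)).
Definition hel l (g : G l) : A := bb (pw g).
Definition ide l : A := bb (diag1 (w l)).

Lemma ide_bb i j (d : diag (w i) (w j)) : ide j * bb d = bb d.
Proof. by rewrite /ide (bb_capless d (diag1_capless j)) compd1. Qed.

Lemma bb_ide i j (d : diag (w i) (w j)) : bb d * ide i = bb d.
Proof. by rewrite /ide (bb_nocup d (diag1_nocup i)) comp1d. Qed.

Lemma hel_bb i j (d : diag (w i) (w j)) (g : G j) : hel g * bb d = bb (comp d (pw g)).
Proof. exact: bb_capless (pw_capless _). Qed.

Lemma bb_hel i j (d : diag (w i) (w j)) (g : G i) : bb d * hel g = bb (comp (pw g) d).
Proof. exact: bb_nocup (pw_nocup _). Qed.

Lemma capless_cce i j (d : diag (w i) (w j)) : capless d ->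
  exists c (g : G i), [/\ csrc c = i, ctgt c = j & bb d = cce c * hel g].
Proof.
move=> /rep_factor[c [g [cr ->]]]; exists (exist _ (obb c) cr), g.
split; [by [] | by [] | exact: esym (bb_hel c g)].
Qed.

Lemma nocup_cst i j (d : diag (w i) (w j)) : ~~ has_cup d ->
  exists c (g : G j), [/\ csrc c = j, ctgt c = i & bb d = hel g * cst c].
Proof.
rewrite -capless_flip => /rep_factor[c [g [cr dE]]]; exists (exist _ (obb c) cr), g^-1%g.
have dE' : d = comp (flip c) (pw g^-1%g) by rewrite -pw_flip -flip_comp -dE flipK.
split; [by [] | by [] | rewrite [RHS](hel_bb (flip c) g^-1%g) -dE'; reflexivity].
Qed.

Lemma ide_idem i j : ide i * ide j = if i == j then ide i else 0.
Proof.
have [<-|ij] := i =P j; last by rewrite /ide bb_mul0 //; apply/eqP.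
exact: ide_bb.
Qed.

Lemma hel1 l : hel (1%g : G l) = ide l.
Proof. by rewrite /hel pw1. Qed.

Lemma helM l (g h : G l) : hel (g * h)%g = hel h * hel g.
Proof. by rewrite /hel -pw_comp; apply/esym/bb_capless/pw_capless. Qed.

Lemma cupdiag_ind (P : cupdiag -> Prop) :
  (forall i j (d : diag (w i) (w j)) (dP : isrep (obb d)), P (exist _ (obb d) dP)) -> forall c, P c.
Proof. by move=> h [[[i j] d] dP]; apply: h. Qed.

Lemma cce_ide c : ide (ctgt c) * cce c * ide (csrc c) = cce c.
Proof. by rewrite /cce ide_bb bb_ide. Qed.

Lemma cst_ide c : ide (csrc c) * cst c * ide (ctgt c) = cst c.
Proof. by rewrite /cst ide_bb bb_ide. Qed.

Lemma cone_src l : csrc (cone l) = l. Proof. by []. Qed.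
Lemma cone_tgt l : ctgt (cone l) = l. Proof. by []. Qed.
Lemma cce_cone l : cce (cone l) = ide l. Proof. by []. Qed.
Lemma cst_cone l : cst (cone l) = ide l. Proof. by rewrite /cst /cdg /= flip1. Qed.

Lemma nocup_cone i (d : diag (w i) (w i)) (dP : isrep (obb d)) : ~~ has_cup d ->
  exist _ (obb d) dP = cone i :> cupdiag.
Proof.
move=> dc; apply: cupdiag_eq => //; rewrite /cdg /=.
by apply/cupseqP => x y; have /nocupP/(_ x)[i' ->] := dc; rewrite ffunE.
Qed.

Lemma ctgt_lt c : c != cone (csrc c) -> (ctgt c < csrc c)%N.
Proof.
elim/cupdiag_ind: c => i j d dP; rewrite /ctgt /csrc /= => ne.
have /andP[dc _] := dP; have le_ji := family_le (capless_size dc).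
rewrite ltn_neqAle le_ji andbT; apply: contra ne => /eqP/val_inj ji.
clear le_ji; rewrite ji in d dP dc *; apply/eqP/nocup_cone.
exact: (capless_nocup dc).
Qed.

Lemma cce_cce c c' : ctgt c' = csrc c -> exists c'' (g : G (csrc c')),
  [/\ csrc c'' = csrc c', ctgt c'' = ctgt c & cce c * cce c' = cce c'' * hel g].
Proof.
elim/cupdiag_ind: c => i j d dP; elim/cupdiag_ind: c' => i' j' d' dP' ji.
have {}ji : j' = i := ji; rewrite ji in d' dP' *.
have /andP[dc _] := dP; have /andP[dc' _] := dP'.
have [c'' [g [h1 h2 h3]]] := capless_cce (capless_comp dc' dc); exists c'', g.
by split; [exact: h1 | exact: h2 | exact: etrans (bb_capless d' dc) h3].
Qed.

Lemma hel_cce c (g : G (ctgt c)) : exists c'' (g' : G (csrc c)),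
  [/\ csrc c'' = csrc c, ctgt c'' = ctgt c & hel g * cce c = cce c'' * hel g'].
Proof.
elim/cupdiag_ind: c g => i j d dP g; have /andP[dc _] := dP.
have [c'' [g' [h1 h2 h3]]] := capless_cce (capless_comp dc (pw_capless g)); exists c'', g'.
by split; [exact: h1 | exact: h2 | exact: etrans (hel_bb d g) h3].
Qed.

Lemma cst_cst c c' : ctgt c' = csrc c -> exists c'' (g : G (csrc c')),
  [/\ csrc c'' = csrc c', ctgt c'' = ctgt c & cst c' * cst c = hel g * cst c''].
Proof.
elim/cupdiag_ind: c => i j d dP; elim/cupdiag_ind: c' => i' j' d' dP' ji.
have {}ji : j' = i := ji; rewrite ji in d' dP' *.
have /andP[dc _] := dP; have /andP[dc' _] := dP'.
have nd : ~~ has_cup (flip d) by rewrite nocup_flip.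
have nd' : ~~ has_cup (flip d') by rewrite nocup_flip.
have [c'' [g [h1 h2 h3]]] := nocup_cst (nocup_comp nd nd'); exists c'', g.
by split; [exact: h1 | exact: h2 | exact: etrans (bb_nocup (flip d') nd) h3].
Qed.

Lemma cst_hel c (g : G (ctgt c)) : exists c'' (g' : G (csrc c)),
  [/\ csrc c'' = csrc c, ctgt c'' = ctgt c & cst c * hel g = hel g' * cst c''].
Proof.
elim/cupdiag_ind: c g => i j d dP g; have /andP[dc _] := dP.
have nd : ~~ has_cup (flip d) by rewrite nocup_flip.
have [c'' [g' [h1 h2 h3]]] := nocup_cst (nocup_comp (pw_nocup g) nd); exists c'', g'.
by split; [exact: h1 | exact: h2 | exact: etrans (bb_hel (flip d) g) h3].
Qed.

Lemma capless_cups j i (d : diag (w i) (w j)) :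
  exists l (c : diag (w l) (w j)), capless c /\ cupseq c = cupseq d.
Proof.
pose C x := [pred y : 'I_(size (w j)) | (nth wedge (w j) y == x) && ~~ is_lower (d (inr y))].
pose D x := [pred y : 'I_(size (w j)) | (nth wedge (w j) y == x) && is_lower (d (inr y))].
have CD x : (#|D x| + #|C x| = if x then r - j else s - j)%N.
  rewrite -(@count_mixed (r - j) (s - j) x).
  rewrite -[RHS](cardID [pred y | is_lower (d (inr y))]); congr (_ + _)%N;
    by apply: eq_card => y; rewrite !inE // andbC.
have CC : #|C vee| = #|C wedge| := cup_letters d.
have := CD vee; have := CD wedge; rewrite -CC /= => Dw Dv.
have lt : (j + #|C vee| < N.+1)%N by have := ltn_ord j; lia.
have cnt x : #|[pred i : 'I_(size (w (Ordinal lt))) | nth wedge (w (Ordinal lt)) i == x]| = #|D x|.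
  rewrite [LHS](@count_mixed (r - Ordinal lt) (s - Ordinal lt) x).
  by case: x; rewrite [nat_of_ord _]/(j + #|C vee|)%N subnDA -?Dv -?Dw addnK.
by have [c cc cE] := capless_exists cnt; exists (Ordinal lt), c.
Qed.

Lemma nocup_rest a a' b (d : diag a b) (c : diag a' b) : capless c -> cupseq c = cupseq d ->
  ~~ has_cup (comp d (flip c)).
Proof.
move=> /caplessP cc cE; apply/nocupP => x; case fx: (comp d (flip c) (inr x)) => [i|y]; first by exists i.
have [x' cx] := cc x; have [y' cy] := cc y.
have dE : comp (comp d (flip c)) c = d.
  by apply: comp_absorb; [apply/caplessP | move=> u v; apply: cupseq_cup].
have : d (inr x') = inr y' by rewrite -{1}dE; apply: comp_pull (diag_inv cx) fx cy.
by move/(cupseq_cup (esym cE)); rewrite (diag_inv cx).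
Qed.

Lemma wb_span (U : {vspace A}) :
  (forall c c' l (g : G l), csrc c = l -> csrc c' = l -> cce c * hel g * cst c' \in U) ->
  forall a, a \in U.
Proof.
move=> h; apply: bb_span => i j d; have [l [c [cc cE]]] := capless_cups d.
have dE : d = comp (comp d (flip c)) c.
  by apply/esym/comp_absorb => // u v; apply: cupseq_cup.
have fc : ~~ has_cup (comp d (flip c)) by apply: nocup_rest.
have [c1 [g1 [s1 _ E1]]] := capless_cce cc.
have [c2 [g2 [s2 _ E2]]] := nocup_cst fc.
have F : bb d = bb c * bb (comp d (flip c)).
  exact: etrans (congr1 (fun f => bb f) dE) (esym (bb_capless (comp d (flip c)) cc)).
have M : cce c1 * hel g1 * (hel g2 * cst c2) = cce c1 * hel (g2 * g1)%g * cst c2.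
  have MM (R : nzRingType) (x y y' z : R) : x * y * (y' * z) = x * (y * y') * z by rewrite !mulrA.
  exact: etrans (MM _ _ _ _ _) (congr1 (fun u => cce c1 * u * cst c2) (esym (helM g2 g1))).
have F' := etrans F (etrans (congr2 (fun x y => x * y) E1 E2) M).
by rewrite -> F'; apply: h.
Qed.

Lemma mid_spec c c' l (g : G l) : csrc c = l -> csrc c' = l -> exists z,
  [/\ (tag z).1 = ctgt c', (tag z).2 = ctgt c, cupseq (tagged z) = cupseq (cdg c),
      cupseq (flip (tagged z)) = cupseq (cdg c') & cce c * hel g * cst c' = bz delta z].
Proof.
elim/cupdiag_ind: c => i j d dP; elim/cupdiag_ind: c' => i' j' d' dP'.
rewrite /ctgt /csrc /cst /cdg /cce /= => il il'; rewrite il in d dP *; rewrite il' in d' dP' *.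
have /andP[dc _] := dP; have /andP[dc' _] := dP'.
exists (obb (comp (flip d') (comp (pw g) d))); split=> //=.
- by rewrite !cupseq_comp ?nocup_flip ?pw_nocup.
- by rewrite !flip_comp flipK cupseq_comp // nocup_comp ?nocup_flip ?pw_capless.
- by rewrite bb_hel (bb_capless _ (capless_comp (pw_capless _) dc)) bb_bz.
Qed.

Lemma mid_inj c c' l (g h : G l) : csrc c = l -> csrc c' = l ->
  cce c * hel g * cst c' = cce c * hel h * cst c' -> g = h.
Proof.
elim/cupdiag_ind: c => i j d dP; elim/cupdiag_ind: c' => i' j' d' dP'.
rewrite /ctgt /csrc /cst /cdg /cce /= => il il'; rewrite il in d dP *; rewrite il' in d' dP' *.
have /andP[dc _] := dP; have /andP[dc' _] := dP'.
have E (x : G l) : bb d * hel x * bb (flip d') = bb (comp (flip d') (comp (pw x) d)).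
  by rewrite bb_hel (bb_capless _ (capless_comp (pw_capless _) dc)).
move=> H; have {H} := etrans (esym (E g)) (etrans H (E h)).
have K (x : G l) : comp (comp d' (comp (flip d') (comp (pw x) d))) (flip d) = pw x.
  by rewrite !compA -(compA d') (comp_flip_capless dc') (comp_flip_capless dc) comp1d compd1.
move=> /bb_inj HH.
have /pw_inj // := etrans (esym (K g)) (etrans (congr1 (fun f => comp (comp d' f) (flip d)) HH) (K h)).
Qed.

Lemma wb_dim : (\sum_l #|[pred c | csrc c == l]| ^ 2 * #|{: G l}| <= \dim {:A})%N.
Proof.
rewrite OBalg_dim.
pose T := {l : 'I_N.+1 & (({c | csrc c == l} * {c | csrc c == l}) * G l)%type}.
have -> : (\sum_l #|[pred c | csrc c == l]| ^ 2 * #|{: G l}|)%N = #|{: T}|.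
  rewrite card_tagged sumnE big_map big_enum; apply: eq_bigr => l _.
  by rewrite !card_prod !card_sig mulnn.
have fP (t : T) : exists z, let: (x, g) := tagged t in
  [/\ (tag z).1 = ctgt (val x.2), (tag z).2 = ctgt (val x.1),
     cupseq (tagged z) = cupseq (cdg (val x.1)), cupseq (flip (tagged z)) = cupseq (cdg (val x.2))
   & cce (val x.1) * hel g * cst (val x.2) = bz delta z].
  case: t => l [[[c cl] [c' cl']] g]; exact: mid_spec (eqP cl) (eqP cl').
have [f fE] := fin_all_exists fP.
apply: (@leq_card _ _ f) => -[l [[[c cl] [c' cl']] g]] [m [[[e em] [e' em']] h]] ff.
have [a1 a2 a3 a4 a5] := fE (existT _ l ((exist _ c cl, exist _ c' cl'), g)).
have [] := fE (existT _ m ((exist _ e em, exist _ e' em'), h)).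
rewrite -ff => b1 b2 b3 b4 b5.
have ce : c = e by apply: cupdiag_eq; [rewrite -a2 -b2 | rewrite -a3 -b3].
have ce' : c' = e' by apply: cupdiag_eq; [rewrite -a1 -b1 | rewrite -a4 -b4].
have lm : l = m by rewrite -(eqP cl) -(eqP em) ce.
clear ff a1 a2 a3 a4 b1 b2 b3 b4; subst m e e'.
have gh := mid_inj (eqP cl) (eqP cl') (etrans a5 (esym b5)).
by rewrite gh (bool_irrelevance em cl) (bool_irrelevance em' cl').
Qed.

End WalledBrauerLayering.

Section WalledBrauerLabelling.

Variables (k : fieldType) (delta : k) (r s : nat).
Hypothesis r_unit : (r`!%:R : k) != 0.
Hypothesis s_unit : (s`!%:R : k) != 0.
Local Notation N := (minn r s).
Local Notation w := (@mixed_family r s).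
Local Notation A := (walled_Brauer_c delta r s).
Local Notation G := (fun l : 'I_N.+1 => ('S_(r - l) * 'S_(s - l))%type).
Local Notation pw := (@perm_diag2 r s _).
Local Notation bb := (@bb k delta _ w _ _).
Implicit Types (i j l : 'I_N.+1).

Lemma fact_sub_unit n m : (n`!%:R : k) != 0 -> (#|{: 'S_(n - m)}|%:R : k) != 0.
Proof.
apply: contra; rewrite card_Sn => /eqP h.
have /dvdnP[q ->] : ((n - m)`! %| n`!)%N.
  have [mn|/ltnW/eqP->] := leqP m n; last by rewrite dvd1n.
  by rewrite -(bin_fact mn) mulnA dvdn_mull.
by rewrite natrM h mulr0.
Qed.

Lemma Sr_unit l : (#|{: 'S_(r - l)}|%:R : k) != 0. Proof. exact: fact_sub_unit. Qed.
Lemma Ss_unit l : (#|{: 'S_(s - l)}|%:R : k) != 0. Proof. exact: fact_sub_unit. Qed.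

Definition wb_layering : layering A.
Proof.
refine (@Layering k A N (@ide k delta r s) (cupdiag r s) (@csrc r s) (@ctgt r s) (@cone r s)
  (@cce k delta r s) (@cst k delta r s) (fun l => G l) (@hel k delta r s)
  _ _ _ _ _ _ _ _ _ _ _ _ _ _ _ _ _ _).
- exact (@ide_idem k delta r s).
- exact (@bb_sum1 k delta _ w).
- exact (@cone_src r s).
- exact (@cone_tgt r s).
- exact (@cce_cone k delta r s).
- exact (@cst_cone k delta r s).
- exact (@ctgt_lt r s).
- exact (@cce_ide k delta r s).
- exact (@cst_ide k delta r s).
- exact (@hel1 k delta r s).
- exact (@helM k delta r s).
- exact (@cce_cce k delta r s).
- exact (@hel_cce k delta r s).
- exact (@cst_cst k delta r s).
- exact (@cst_hel k delta r s).
- exact (@wb_span k delta r s).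
- exact (@wb_dim k delta r s).
- by move=> l; apply: SS_unit; [apply: Sr_unit | apply: Ss_unit].
Defined.

Local Notation B := wb_layering.
Local Notation galgG l := (galg k (G l)).

Definition th l (x : galgG l) : A := \sum_(g : G l) x g *: bb (pw g).

Lemma th_linear l : linear (@th l).
Proof.
move=> a x y; rewrite /th scaler_sumr -big_split; apply: eq_bigr => g _.
by rewrite !ffunE scalerDl scalerA.
Qed.

HB.instance Definition _ l := GRing.isLinear.Build k (galgG l) A _ (@th l) (@th_linear l).

Lemma th_delta l (g : G l) : th (gdelta k g) = @hel k delta r s l g.
Proof.
rewrite /th (bigD1 g) //= big1 => [|h hg]; first by rewrite ffunE eqxx scale1r addr0.
by rewrite ffunE (negPf hg) scale0r.
Qed.

Lemma thM l (x y : galgG l) : th (x * y) = th x * th y.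
Proof.
move: x; apply: galg_lin => [|a x x' hx hx'|g]; first by rewrite mul0r linear0 mul0r.
  by rewrite mulrDl -scalerAl !th_linear mulrDl -scalerAl hx hx'.
move: y; apply: galg_lin => [|a x x' hx hx'|h]; first by rewrite mulr0 linear0 mulr0.
  by rewrite mulrDr -scalerAr !th_linear mulrDr -scalerAr hx hx'.
by rewrite gdeltaM !th_delta; exact: helM.
Qed.

Lemma partn_inj n (la mu : partn n) : la = mu :> seq nat -> la = mu.
Proof. by case: la mu => [p pP] [q qP] /= pq; subst q; congr Partn; apply: bool_irrelevance. Qed.

Definition spb (lab : bipart r s) : {vspace galgG (tag lab)} :=
  specht_box k (r - tag lab) (s - tag lab) (tagged lab).1 (tagged lab).2.

Definition yb (lab : bipart r s) : galgG (tag lab) :=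
  ysym2 k (r - tag lab) (s - tag lab) (tagged lab).1 (tagged lab).2.

Lemma spbE lab : spb lab = lgen (yb lab). Proof. exact: specht_boxE. Qed.

Lemma yb_spb lab : yb lab \in spb lab. Proof. by rewrite spbE lgen_gen. Qed.

Lemma spb_gen lab (y : subvs_of (spb lab)) : exists z, vsval y = z * yb lab.
Proof. by apply/lgenP; rewrite -spbE subvsP. Qed.

Lemma spb_mul lab x y : y \in spb lab -> x * y \in spb lab.
Proof. by rewrite spbE => /lgenP[z ->]; apply/lgenP; exists (x * z); rewrite mulrA. Qed.

Definition wb_rho (lab : bipart r s) (g : G (tag lab)) : 'End(subvs_of (spb lab)) :=
  (linfun (vsproj (spb lab)) \o (amull (gdelta k g) \o linfun (@vsval _ _ (spb lab))))%VF.

Lemma wb_rhoE lab g y : vsval (wb_rho (lab := lab) g y) = gdelta k g * vsval y.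
Proof. by rewrite !comp_lfunE !lfunE /= vsprojK // spb_mul // subvsP. Qed.

Lemma wb_rho_simple lab (X : {vspace subvs_of (spb lab)}) :
  (forall g x, x \in X -> wb_rho (lab := lab) g x \in X) -> X = 0%VS \/ X = fullv.
Proof.
move=> hX; pose X' := (linfun (@vsval _ _ (spb lab)) @: X)%VS.
have memX' x : x \in X -> vsval x \in X'.
  by move=> xX; apply/memv_imgP; exists x; rewrite // lfunE.
have lX' : lideal X'.
  move=> g _ /memv_imgP[x xX ->]; rewrite lfunE /= -(wb_rhoE g x).
  exact/memX'/hX.
have X'U : (X' <= lgen (yb lab))%VS.
  by apply/subvP => _ /memv_imgP[x xX ->]; rewrite lfunE /= -spbE subvsP.
have [||X0|XU] := lgen_simple _ _ lX' X'U.
- by apply: SS_unit; [apply: Sr_unit | apply: Ss_unit].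
- by move=> x; apply: ysym2_self; [apply: Sr_unit | apply: Ss_unit].
- left; apply: vspace_eq0P => x /memX'; rewrite X0 memv0 => /eqP x0.
  by apply: val_inj; rewrite /= x0.
right; apply/eqP; rewrite eqEsubv subvf; apply/subvP => y _.
have : vsval y \in X' by rewrite XU -spbE subvsP.
by case/memv_imgP => x xX; rewrite lfunE => /val_inj ->.
Qed.

Lemma th_equivariant (M : fdmod A) lab (f : 'Hom(subvs_of (spb lab), M)) :
  @equivariant k A B (tag lab) _ (wb_rho (lab := lab)) M f ->
  forall x y, th x ** f y = f (vsproj (spb lab) (x * vsval y)).
Proof.
move=> fe x y; move: x; apply: galg_lin => [|a x x' hx hx'|g].
- by rewrite linear0 act0l mul0r !linear0.
- by rewrite th_linear actDl actZl hx hx' mulrDl -scalerAl !linearP.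
rewrite th_delta -[LHS]/(@hh k A B (tag lab) g ** f y) -fe; congr (f _).
apply: subvs_inj; rewrite (wb_rhoE g y) vsprojK // spb_mul // subvsP //.
Qed.

Lemma wb_rho_inj (M : fdmod A) lab lab' (f : 'Hom(subvs_of (spb lab), M))
    (f' : 'Hom(subvs_of (spb lab'), M)) : tag lab = tag lab' ->
  @equivariant k A B (tag lab) _ (wb_rho (lab := lab)) M f ->
  @equivariant k A B (tag lab') _ (wb_rho (lab := lab')) M f' ->
  lker f = 0%VS -> lker f' = 0%VS -> limg f = limg f' -> lab = lab'.
Proof.
case: lab lab' f f' => [j [la mu]] [j' [la' mu']] f f' /= jj.
subst j' => fe fe' f0 f0' ff; pose lb := existT _ j (la, mu) : bipart r s.
pose lb' := existT _ j (la', mu') : bipart r s.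
apply: NNPP => ne.
have [h|h] : (forall z, yb lb * z * yb lb' = 0) \/ (forall z, yb lb' * z * yb lb = 0).
- apply: ysym2_neq; [exact: Sr_unit | exact: Ss_unit|].
  move=> [la_eq mu_eq]; apply: ne.
  by rewrite (partn_inj la_eq) (partn_inj mu_eq).
- have k1 (y : subvs_of (spb lb')) : th (yb lb) ** f' y = 0.
    rewrite (@th_equivariant M lb' f' fe'); have [z zE] := spb_gen y.
    by rewrite zE mulrA h !linear0.
  have k2 (y : subvs_of (spb lb)) : yb lb * vsval y = 0.
    have : f y \in limg f' by rewrite -ff memv_img ?memvf.
    case/memv_imgP => y' _ yE; have := k1 y'; rewrite -yE (@th_equivariant M lb f fe) => /eqP.
    rewrite -memv_ker f0 memv0 => /eqP/(congr1 vsval); rewrite vsprojK ?linear0 //.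
    by rewrite spb_mul // subvsP.
  apply: (@lgen_self _ _ _ (yb lb)).
  + by apply: SS_unit; [apply: Sr_unit | apply: Ss_unit].
  + exact: ysym2_neq0.
  + by move=> x; rewrite -spbE => xU; have := k2 (vsproj _ x); rewrite vsprojK.
have k1 (y : subvs_of (spb lb)) : th (yb lb') ** f y = 0.
  rewrite (@th_equivariant M lb f fe); have [z zE] := spb_gen y.
  by rewrite zE mulrA h !linear0.
have k2 (y : subvs_of (spb lb')) : yb lb' * vsval y = 0.
  have : f' y \in limg f by rewrite ff memv_img ?memvf.
  case/memv_imgP => y' _ yE; have := k1 y'; rewrite -yE (@th_equivariant M lb' f' fe') => /eqP.
  rewrite -memv_ker f0' memv0 => /eqP/(congr1 vsval); rewrite vsprojK ?linear0 //.
  by rewrite spb_mul // subvsP.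
apply: (@lgen_self _ _ _ (yb lb')).
- by apply: SS_unit; [apply: Sr_unit | apply: Ss_unit].
- exact: ysym2_neq0.
- by move=> x; rewrite -spbE => xU; have := k2 (vsproj _ x); rewrite vsprojK.
Qed.

End WalledBrauerLabelling.

Section WalledBrauerLabels.

Variables (k : fieldType) (delta : k) (r s : nat).
Hypothesis r_unit : (r`!%:R : k) != 0.
Hypothesis s_unit : (s`!%:R : k) != 0.
Local Notation N := (minn r s).
Local Notation w := (@mixed_family r s).
Local Notation A := (walled_Brauer_c delta r s).
Local Notation G := (fun l : 'I_N.+1 => ('S_(r - l) * 'S_(s - l))%type).
Local Notation pw := (@perm_diag2 r s _).
Local Notation bb := (@bb k delta _ w _ _).
Local Notation B := (wb_layering delta r_unit s_unit).
Local Notation gr := (@gr k A B).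
Local Notation KK := (@KK k A B).
Local Notation galgG l := (galg k (G l)).
Local Notation th := (@th k delta r s _).
Local Notation rho lab := (@wb_rho k r s lab).
Implicit Types (i j l : 'I_N.+1) (lab : bipart r s).

Lemma yb_neq0 lab : yb k lab != 0. Proof. exact: ysym2_neq0. Qed.

Lemma gr_hel (M : fdmod A) l (x : M) (g : G l) : @hel k delta r s l g ** x \in gr M l.
Proof. exact: (@hh_gr k A B M l g x). Qed.

Lemma th_gr (M : fdmod A) l (y : galgG l) (x : M) : th y ** x \in gr M l.
Proof.
rewrite /th act_suml memv_suml // => g _; rewrite actZl memvZ //.
exact: gr_hel.
Qed.

Lemma th1 l : th (1 : galgG l) = @ide k delta r s l.
Proof. by rewrite -gdelta1 th_delta hel1. Qed.

Lemma th_stable (M : fdmod A) l (W : {vspace M}) (y : galgG l) x :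
  @hstable k A B M l W -> x \in W -> th y ** x \in W.
Proof.
move=> hW xW; rewrite /th act_suml memv_suml // => g _; rewrite actZl memvZ //.
exact: hW.
Qed.

Lemma wb_rho_exists (M : fdmod A) l (W : {vspace M}) :
  (W <= gr M l)%VS -> @hstable k A B M l W -> W <> 0%VS ->
  exists lab (f : 'Hom(subvs_of (spb k lab), M)),
    [/\ tag lab = l, lker f = 0%VS, @equivariant k A B (tag lab) _ (rho lab) M f
      & (limg f <= W)%VS].
Proof.
move=> Wl hW /eqP; rewrite -vpick0; set x := vpick W => x0.
have xW : x \in W by apply: memv_pick.
have xl : @ide k delta r s l ** x = x by apply: (@grP k A B M l x (subvP Wl _ xW)).
have [la [mu [z v0]]] : exists (la : partn (r - l)) (mu : partn (s - l)) (z : galgG l),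
    th (ysym2 k (r - l) (s - l) la mu) ** (th z ** x) != 0.
  apply: NNPP => no; case/eqP: x0; rewrite -xl -th1.
  have lin : linear (fun y : galgG l => th y ** x).
    by move=> a y y'; rewrite th_linear actDl actZl.
  have [h hE] := lfun_of_linear lin.
  suff : (1 : galgG l) \in lker h by rewrite memv_ker hE => /eqP.
  apply: (ysym2_full (Sr_unit r_unit l) (Ss_unit s_unit l)) => la mu y z.
  rewrite memv_ker hE !thM !act_mul; apply/eqP.
  case: (eqVneq (th (ysym2 k (r - l) (s - l) la mu) ** (th z ** x)) 0) => [->|ne].
    by rewrite linear0.
  by case: no; exists la, mu, z.
pose lab : bipart r s := existT _ l (la, mu); pose v := th z ** x.
have lin : linear (fun y : subvs_of (spb k lab) => th (vsval y) ** v).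
  by move=> a y y'; rewrite [vsval _]linearP th_linear actDl actZl.
have [f fE] := lfun_of_linear lin.
have fe : @equivariant k A B (tag lab) _ (rho lab) M f.
  by move=> g y; rewrite !fE wb_rhoE thM th_delta act_mul.
have ker_st (g : G (tag lab)) y : y \in lker f -> rho lab g y \in lker f.
  by rewrite !memv_ker => /eqP y0; rewrite [f _](fe g y) y0 linear0.
exists lab, f; split=> //.
  case: (wb_rho_simple r_unit s_unit ker_st) => // kf.
  case/eqP: v0; have yU := yb_spb k lab.
  have : vsproj (spb k lab) (yb k lab) \in lker f by rewrite kf memvf.
  by rewrite memv_ker fE vsprojK // => /eqP.
apply/subvP => _ /memv_imgP[y _ ->]; rewrite fE; apply: th_stable => //.
exact: th_stable.
Qed.

Lemma th_coef l (y : galgG l) (g : G l) : th y (obb (pw g)) = y g.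
Proof.
rewrite /th sum_ffunE (bigD1 g) //= big1 => [|h hg].
  have E : bb (pw g) (obb (pw g)) = 1 by rewrite bb_coef eqxx.
  by rewrite addr0 ffunE; apply: etrans (congr1 (fun u => y g * u) E) (mulr1 _).
have E : bb (pw h) (obb (pw g)) = 0.
  rewrite bb_coef; case: eqP => // /pw_inj gh.
  by rewrite gh eqxx in hg.
by rewrite ffunE; apply: etrans (congr1 (fun u => y h * u) E) (mulr0 _).
Qed.

Definition nocup_vanish (a : A) := forall i j (d : diag (w i) (w j)), ~~ has_cup d -> a (obb d) = 0.

Lemma cone_nocup c : has_cup (cdg c) = false -> c = cone (csrc c) :> cupdiag r s.
Proof.
elim/cupdiag_ind: c => i j d dP /negbT nd; have /andP[dc _] := dP.
have ij : i = j by apply/family_inj/(nocup_size dc nd).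
subst j; exact: nocup_cone.
Qed.

Lemma bb_nocup_vanish i j i' j' (d : diag (w i) (w j)) (e : diag (w i') (w j')) :
  has_cup e -> nocup_vanish (bb e * bb d).
Proof.
move=> ec a b f nf; have [ij|ij] := eqVneq i' j; last by rewrite bb_mul0 // ffunE.
subst i'; rewrite bb_mul.
have hc : has_cup (comp d e).
  case/existsP: ec => -[x|x] //= ex; case ey: (e (inr x)) ex => [y|y] // _.
  by apply/existsP; exists (inr x); rewrite (comp_cup _ ey).
have E : bb (comp d e) (obb f) = 0.
  apply: etrans (bbE _ _ _) _; case: eqP => // fE; exfalso.
  have : has_cup (tagged (obb f)) = has_cup (tagged (obb (comp d e))) by rewrite fE.
  by rewrite [RHS]hc (negPf nf).
by rewrite ffunE; apply: etrans (congr1 _ E) (mulr0 _).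
Qed.

Lemma KK_nocup (x : reg A) : x \in KK (fullv : {vspace reg A}) -> nocup_vanish x.
Proof.
pose X : {vspace A} := (\bigcap_(z : OBbasis w | ~~ has_cup (tagged z))
  lker (linfun (fun a : A => a z : k^o)))%VS.
have linz (z : OBbasis w) : linear (fun a : A => a z : k^o).
  by move=> c a b; rewrite !ffunE.
have zE z (a : A) : linfun (fun a : A => a z : k^o) a = a z.
  pose h : {linear A -> k^o} := HB.pack (fun a : A => a z : k^o) (GRing.isLinear.Build _ _ _ _ _ (linz z)).
  by rewrite -[linfun _]/(linfun h) lfunE.
have memX (a : A) : reflect (nocup_vanish a) (a \in X).
  rewrite /X; apply: (iffP idP) => [aX i j d nd|h].
    have : a \in lker (linfun (fun a : A => a (obb d) : k^o)).
      by move: a aX; apply/subvP/bigcapv_inf; last exact: subvv.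
    by rewrite memv_ker zE => /eqP.
  have : (<[a]> <= X)%VS.
    apply/subv_bigcapP => -[[i j] d] nd; rewrite -memvE memv_ker zE; apply/eqP/h.
    exact: nd.
  by rewrite -memvE.
move=> xK; apply/memX; move: x xK; apply/subvP; rewrite /KK.
apply/subv_sumP => c cne; apply/subvP => _ /memv_imgP[y _ ->].
have cc : has_cup (cdg c) by apply: contraNT cne => /negPf/cone_nocup/eqP.
have hU (a : A) : a \in (amull (cce delta c) @^-1: X)%VS.
  move: a; apply: bb_span => i j d; rewrite -memv_preim lfunE /=; apply/memX.
  exact: bb_nocup_vanish.
suff : cce delta c * y \in X by rewrite -(regE (cce delta c) y).
by have := hU y; rewrite -memv_preim lfunE.
Qed.

Lemma wb_reg_simple lab : exists f : 'Hom(subvs_of (spb k lab), reg A),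
  [/\ @equivariant k A B (tag lab) _ (rho lab) (reg A) f,
      (limg f <= gr (reg A) (tag lab))%VS &
      forall y, f y \in KK (fullv : {vspace reg A}) -> y = 0].
Proof.
have lin : linear (fun y : subvs_of (spb k lab) => th (vsval y) : reg A).
  by move=> a y y'; rewrite [vsval _]linearP th_linear.
have [f fE] := lfun_of_linear lin; exists f; split.
- by move=> g y; rewrite !fE wb_rhoE thM th_delta; apply: esym (regE _ _).
- apply/subvP => _ /memv_imgP[y _ ->]; rewrite fE.
  have h := @th_gr (reg A) (tag lab) (vsval y) (1 : A).
  by rewrite (regE (th (vsval y)) 1) mulr1 in h.
move=> y; rewrite fE => /KK_nocup h; apply: val_inj; apply/ffunP => g /=.
by rewrite -th_coef h ?ffunE // pw_nocup.
Qed.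

Lemma OBcoef_pw l i j (d : diag (w i) (w j)) (g : G l) :
  OBcoef (bb d) (pw g) = (obb (pw g) == obb d)%:R.
Proof. exact: bbE. Qed.

Lemma cupless_act_linear lab y : linear (fun a : A => @cupless_act k delta r s (tag lab)
  (tagged lab).1 (tagged lab).2 a y).
Proof.
move=> c a b; rewrite /cupless_act -linearP; congr (vsproj _ _).
rewrite scaler_sumr -big_split; apply: eq_bigr => g _.
by rewrite /OBcoef !ffunE scalerDl scalerA.
Qed.

Lemma cupless_act_hel lab (g : G (tag lab)) y :
  @cupless_act k delta r s (tag lab) (tagged lab).1 (tagged lab).2 (@hel k delta r s _ g) y
  = rho lab g y.
Proof.
apply: subvs_inj; rewrite wb_rhoE /cupless_act (bigD1 g) //= big1 => [|h hg].
  rewrite addr0 OBcoef_pw eqxx scale1r.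
  have -> : perm_translate2 g (vsval y) = gdelta k g * vsval y.
    by apply/ffunP => x; rewrite gdeltaMx ffunE.
  by rewrite vsprojK // spb_mul // subvsP.
rewrite OBcoef_pw; case: eqP => [/eqP|]; last by rewrite scale0r.
by rewrite obb_eq => /eqP/pw_inj hE; rewrite hE eqxx in hg.
Qed.

Lemma cupless_act_cst lab c l (g : G l) y : csrc c = l -> c != cone (tag lab) ->
  @cupless_act k delta r s (tag lab) (tagged lab).1 (tagged lab).2
    (@hel k delta r s l g * cst delta c) y = 0.
Proof.
elim/cupdiag_ind: c => i j d dP il; have {}il : i = l := il; subst l => ne.
have E : @hel k delta r s i g * cst delta (exist _ (obb d) dP) = bb (comp (flip d) (pw g)).
  exact: hel_bb.
rewrite E /cupless_act big1 ?linear0 // => h _; rewrite OBcoef_pw.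
case: eqP => [/(congr1 (@tag _ _))/= [jj ii]|]; last by rewrite scale0r.
case/eqP: ne; have /andP[dc _] := dP; move: d dP dc {E}; rewrite -ii -jj => d dP dc.
exact/nocup_cone/(capless_nocup dc).
Qed.

Lemma cupless_mem i j (d : diag (w i) (w j)) : ~~ has_cup d -> bb d \in cupless delta r s.
Proof.
move=> nd; rewrite bb_bz; apply: memv_span; apply/mapP; exists (obb d) => //.
by rewrite mem_filter nd mem_enum.
Qed.

Lemma cupless_hel c l (g : G l) : csrc c = l ->
  @hel k delta r s l g * cst delta c \in cupless delta r s.
Proof.
elim/cupdiag_ind: c => i j d dP il; have {}il : i = l := il; subst l.
have -> : @hel k delta r s i g * cst delta (exist _ (obb d) dP) = bb (comp (flip d) (pw g)).
  exact: hel_bb.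
apply: cupless_mem; apply: nocup_comp; last exact: pw_nocup.
by rewrite nocup_flip; have /andP[] := dP.
Qed.

Lemma cupless_ind (U : {vspace A}) :
  (forall c l (g : G l), csrc c = l -> @hel k delta r s l g * cst delta c \in U) ->
  (cupless delta r s <= U)%VS.
Proof.
move=> h; apply/span_subvP => _ /mapP[[[i j] d] + ->]; rewrite mem_filter => /andP[nd _].
have [c [g [cs _ dE]]] := nocup_cst delta nd.
have -> : [ffun z' => (z' == existT _ (i, j) d)%:R] = bb d by rewrite bb_bz.
by rewrite dE; apply: h.
Qed.

Definition wb_labelling : labelling B.
Proof.
refine (@Labelling k A B (bipart r s) (fun lab => tag lab)
  (fun lab => subvs_of (spb k lab)) (fun lab => rho lab) (cupless delta r s)
  (fun lab => @cupless_act k delta r s (tag lab) (tagged lab).1 (tagged lab).2)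
  _ _ _ _ _ _ _ _ _ _).
- exact: cupless_hel.
- exact: cupless_ind.
- exact: cupless_act_linear.
- exact: cupless_act_hel.
- exact: cupless_act_cst.
- move=> lab h; have : vsproj (spb k lab) (yb k lab) \in (fullv : {vspace subvs_of (spb k lab)}).
    exact: memvf.
  rewrite h memv0 => /eqP/(congr1 vsval); rewrite vsprojK ?yb_spb // linear0 => /eqP.
  by rewrite (negPf (yb_neq0 lab)).
- exact: (wb_rho_simple r_unit s_unit).
- exact: (@wb_rho_inj k delta r s r_unit s_unit).
- exact: wb_rho_exists.
- exact: wb_reg_simple.
Defined.

Lemma bipart_ltP (lab lab' : bipart r s) :
  bipart_lt lab lab' <-> (tag lab < tag lab')%N.
Proof.
rewrite /bipart_lt; case: lab lab' => [j [la mu]] [j' [la' mu']] /=.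
rewrite !partn_sum; have := ltn_ord j; have := ltn_ord j'; lia.
Qed.

End WalledBrauerLabels.

(** * Tensors *)

Record homog_basis (k : fieldType) (V : superspace k) (m n : nat) := HomogBasis {
  vb : nat -> V;
  cb : nat -> 'Hom(V, k^o);
  vb_homog : forall i, (i < m + n)%N -> homog (m <= i)%N (vb i : letter_space V vee);
  cb_homog : forall i, (i < m + n)%N -> homog (m <= i)%N (cb i : letter_space V wedge);
  cb_vb : forall i j, (i < m + n)%N -> (j < m + n)%N -> cb i (vb j) = (i == j)%:R;
  vb_ext : forall (U : vectType k) (f g : 'Hom(V, U)),
    (forall i, (i < m + n)%N -> f (vb i) = g (vb i)) -> f = g;
  hb_dim : dim V = (m + n)%N }.

Lemma homog_basis_exists (k : fieldType) (V : superspace k) m n :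
  has_sdim V m n -> inhabited (homog_basis V m n).
Proof.
move=> [dm dn]; pose X : seq V := vbasis (even_part V) ++ vbasis (odd_part V).
have sX : size X = (m + n)%N by rewrite size_cat !size_tuple dm dn.
have Xb : basis_of (fullv : {vspace V}) X.
  rewrite -(sspace_sum V); apply: cat_basis; try exact: vbasisP.
  by apply/directv_addP; apply: sspace_cap.
have Xe i : (i < m)%N -> X`_i \in even_part V.
  move=> im; rewrite nth_cat size_tuple [X in (_ < X)%N]dm im.
  by apply: vbasis_mem; rewrite mem_nth // size_tuple [X in (_ < X)%N]dm.
have Xo i : (m <= i < m + n)%N -> X`_i \in odd_part V.
  case/andP=> im iD; rewrite nth_cat size_tuple [X in (_ < X)%N]dm ltnNge im /=.
  apply: vbasis_mem; rewrite mem_nth // size_tuple [X in (_ - X)%N]dm [X in (_ < X)%N]dn.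
  by rewrite ltn_subLR.
pose Xt : (m + n).-tuple V := tcast sX (in_tuple X).
have XtE : Xt = X :> seq V by rewrite val_tcast.
have Xb' : basis_of (fullv : {vspace V}) Xt by rewrite XtE.
have cex (i : 'I_(m + n)) : exists c : 'Hom(V, k^o), forall v, c v = coord Xt i v.
  by apply: lfun_of_linear => a u v; rewrite linearP.
have [c cE] := fin_all_exists cex.
pose cb i : 'Hom(V, k^o) := if insub i is Some j then c j else 0.
have cbX i j : (i < m + n)%N -> (j < m + n)%N -> cb i X`_j = (i == j)%:R.
  move=> iD jD; rewrite /cb insubT cE -XtE.
  by have := coord_free (Ordinal jD) (Ordinal iD) (basis_free Xb') => /= ->; rewrite eq_sym.
have ext (U : vectType k) (f g : 'Hom(V, U)) :
    (forall i, (i < m + n)%N -> f X`_i = g X`_i) -> f = g.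
  move=> fg; apply/lfunP => v; rewrite (coord_basis Xb' (memvf v)) !linear_sum.
  by apply: eq_bigr => i _; rewrite !linearZ /= XtE fg.
have vanish (U : {vspace V}) (Y : seq V) i : (forall j, (j < size Y)%N -> cb i Y`_j = 0) ->
    <<Y>>%VS = U -> forall v, v \in U -> cb i v = 0.
  move=> h <- v; have -> : (v \in <<Y>>%VS -> cb i v = 0) <-> True; last by [].
  split=> // _ vY; have /subvP/(_ v vY) : (<<Y>> <= lker (cb i))%VS.
    by apply/span_subvP => y /(nthP 0)[j jY <-]; rewrite memv_ker h.
  by rewrite memv_ker => /eqP.
split; apply: (@HomogBasis k V m n (fun i => X`_i) cb) => //.
- move=> i iD /=; case: leqP => im; first by apply: Xo; rewrite im.
  exact: Xe.
- move=> i iD v; case: leqP => im /=.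
    apply: (vanish _ (vbasis (even_part V))) => [j|]; last exact: span_basis (vbasisP _).
    rewrite size_tuple [X in (_ < X)%N]dm => jm.
    have -> : (vbasis (even_part V))`_j = X`_j by rewrite nth_cat size_tuple [X in (_ < X)%N]dm jm.
    by rewrite cbX ?(leq_trans jm) ?leq_addr // gtn_eqF // (leq_trans jm).
  apply: (vanish _ (vbasis (odd_part V))) => [j|]; last exact: span_basis (vbasisP _).
  rewrite size_tuple [X in (_ < X)%N]dn => jn.
  have -> : (vbasis (odd_part V))`_j = X`_(m + j).
    rewrite nth_cat size_tuple [X in (_ < X)%N]dm [X in (_ - X)%N]dm.
    by rewrite ltnNge leq_addr /= addKn.
  by rewrite cbX ?ltn_add2l // ltn_eqF // (leq_trans im) // leq_addr.
- by rewrite -dimvf -(size_basis Xb') .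
Qed.

Section TensorBasis.

Variables (k : fieldType) (V : superspace k) (m n : nat) (E : homog_basis V m n).
Local Notation D := (m + n)%N.
Local Notation tens := (tens V).
Local Notation vb := (vb E).
Local Notation cb := (cb E).

Definition bas (c : bool) (i : nat) : letter_space V c :=
  match c with true => vb i | false => cb i end.

Lemma bas_homog c i : (i < D)%N -> homog (m <= i)%N (bas c i).
Proof. by case: c; [exact: (vb_homog E) | exact: (cb_homog E)]. Qed.

Lemma bas_pair c i j : (i < D)%N -> (j < D)%N ->
  pairing_space (bas c i) (bas (~~ c) j) = (i == j)%:R.
Proof. by case: c => iD jD /=; rewrite cb_vb // eq_sym. Qed.

Lemma bas_ext c (U : vectType k) (f g : 'Hom(letter_space V c, U)) :
  (forall i, (i < D)%N -> f (bas c i) = g (bas c i)) -> f = g.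
Proof.
case: c f g => f g fg; first exact: (vb_ext fg).
apply/lfunP => al; have -> : al = \sum_(i < D) al (vb i) *: cb i.
  apply: (vb_ext (h := E)) => j jD; rewrite sum_lfunE (bigD1 (Ordinal jD)) //= scale_lfunE cb_vb // eqxx.
  rewrite big1 ?addr0 => [|i ij]; first by rewrite -[RHS]/(_ * _) mulr1.
  rewrite scale_lfunE cb_vb //; case: eqP => [ji|_]; last by rewrite scaler0.
  by case/eqP: ij; apply: val_inj.
by rewrite !linear_sum; apply: eq_bigr => i _; rewrite !linearZ; congr (_ *: _); apply: fg.
Qed.

Fixpoint etens (a : word) (t : seq nat) : tens a :=
  match a with
  | [::] => tunit V
  | c :: a' => tcons (bas c (head 0%N t)) (etens a' (behead t))
  end.

Fixpoint crd (a : word) (t : seq nat) : tens a -> k :=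
  match a with
  | [::] => fun x => x
  | c :: a' => fun f => crd (behead t) ((f : 'Hom(_, tens a')) (bas (~~ c) (head 0%N t)))
  end.

Fixpoint labs (a : word) : seq (seq nat) :=
  if a is c :: a' then [seq i :: t | i <- iota 0 D, t <- labs a'] else [:: [::]].

Lemma labs_cons c a : labs (c :: a) = [seq i :: t | i <- iota 0 D, t <- labs a].
Proof. by []. Qed.

Lemma labsP a t : (t \in labs a) = (size t == size a) && all (ltn^~ D) t.
Proof.
elim: a t => [|c a IHa] t /=; first by case: t.
apply/allpairsP/idP => [[[i u] /= [iD ua ->]]|].
  by move: iD; rewrite mem_iota /= add0n => iD; rewrite eqSS iD -IHa.
case: t => [//|i t] /=; rewrite eqSS => /and3P[st iD tD]; exists (i, t).
by rewrite /= mem_iota IHa st tD.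
Qed.

Lemma labs_uniq a : uniq (labs a).
Proof.
elim: a => [//|c a IHa] /=; apply: allpairs_uniq; rewrite ?iota_uniq //.
by move=> [i t] [j u] _ _ /= [-> ->].
Qed.

Lemma size_labs a : size (labs a) = (D ^ size a)%N.
Proof. by elim: a => [//|c a IHa] /=; rewrite size_allpairs IHa size_iota expnS. Qed.

Lemma dim_tens a : dim (tens a) = (D ^ size a)%N.
Proof.
elim: a => [//|c a IHa]; rewrite -[LHS]/(dim (letter_space V (~~ c)) * dim (tens a))%N IHa expnS.
congr (_ * _)%N; case: c => /=; last exact: (hb_dim E).
by rewrite -[LHS]/(dim V * 1)%N muln1 (hb_dim E).
Qed.

Lemma crd_linear a t : linear (crd t : tens a -> k^o).
Proof.
elim: a t => [//|c a IHa] t z x y /=.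
by rewrite add_lfunE scale_lfunE IHa.
Qed.

Lemma crdZ a t c (x : tens a) : crd t (c *: x) = c * crd t x.
Proof.
have [g gE] := lfun_of_linear (@crd_linear a t).
by rewrite -(gE (c *: x)) -(gE x) linearZ.
Qed.

Lemma crd_sum a t (I : Type) (r : seq I) (P : pred I) (f : I -> tens a) :
  crd t (\sum_(i <- r | P i) f i) = \sum_(i <- r | P i) crd t (f i).
Proof.
have [g gE] := lfun_of_linear (@crd_linear a t).
by rewrite -gE linear_sum; apply: eq_bigr => i _; apply: gE.
Qed.

Lemma crd_etens a t u : t \in labs a -> u \in labs a -> crd u (etens a t) = (t == u)%:R.
Proof.
elim: a t u => [|c a IHa] t u; rewrite !labsP.
  by case: t u => [|//] [|//] _ _.
case: t u => [//|i t] [//|j u] /=; rewrite !eqSS => /and3P[st iD tD] /and3P[su jD uD].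
rewrite tconsE bas_pair // crdZ IHa ?labsP ?st ?su //.
by rewrite -natrM mulnb eqseq_cons.
Qed.

Lemma etens_span a (x : tens a) : x = \sum_(t <- labs a) crd t x *: etens a t.
Proof.
elim: a x => [|c a IHa] x; first by rewrite /= big_seq1 /= -[RHS]/(_ * _) mulr1.
apply: bas_ext => j jD; rewrite sum_lfunE labs_cons big_allpairs_dep.
have jin : j \in iota 0 D by rewrite mem_iota.
rewrite (bigD1_seq j jin (iota_uniq _ _)) /= [X in _ + X]big_seq_cond.
rewrite [X in _ + X]big1 ?addr0; last first.
  move=> i /andP[]; rewrite mem_iota => /= iD ij; rewrite big1 // => t _.
  by rewrite scale_lfunE tconsE bas_pair // (negPf ij) scale0r scaler0.
rewrite [LHS]IHa; apply: eq_bigr => t _.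
by rewrite scale_lfunE tconsE bas_pair // eqxx scale1r.
Qed.

Lemma tens_ext a (x y : tens a) : (forall t, t \in labs a -> crd t x = crd t y) -> x = y.
Proof.
by move=> h; rewrite (etens_span x) (etens_span y) !big_seq; apply: eq_bigr => t /h->.
Qed.

Lemma crd_tcat a b t u (x : tens a) (y : tens b) : size t = size a ->
  crd (t ++ u) (tcat x y) = crd t x * crd u y.
Proof.
elim: a t x => [|c a IHa] t x.
  by case: t => //= _; rewrite crdZ.
by case: t => [//|i t] [st] /=; rewrite tcatE IHa.
Qed.

Lemma labs_cat a b t u : t \in labs a -> u \in labs b -> t ++ u \in labs (a ++ b).
Proof.
by rewrite !labsP !size_cat all_cat => /andP[/eqP-> ->] /andP[/eqP-> ->]; rewrite eqxx.
Qed.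

Lemma labs_split a b t : t \in labs (a ++ b) ->
  exists t1 t2, [/\ t = t1 ++ t2, t1 \in labs a & t2 \in labs b].
Proof.
rewrite labsP size_cat => /andP[/eqP st tD]; exists (take (size a) t), (drop (size a) t).
rewrite cat_take_drop !labsP size_drop st addKn eqxx size_takel ?eqxx ?st ?leq_addr //.
by move: tD; rewrite -{1}(cat_take_drop (size a) t) all_cat => /andP[-> ->].
Qed.

Lemma etens_cat a b t u : t \in labs a -> u \in labs b ->
  etens (a ++ b) (t ++ u) = tcat (etens a t) (etens b u).
Proof.
move=> ta ub; apply: tens_ext => v /labs_split[v1 [v2 [-> v1a v2b]]].
rewrite crd_etens ?labs_cat // crd_tcat; last by move: v1a; rewrite labsP => /andP[/eqP].
rewrite !crd_etens // -natrM mulnb; congr (_%:R); congr nat_of_bool.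
by apply: eqseq_cat; move: ta v1a; rewrite !labsP => /andP[/eqP-> _] /andP[/eqP-> _].
Qed.

(* The labels from m on are the odd ones. *)
Fixpoint eps (a : word) (t : seq nat) : k :=
  if a is c :: a' then (-1) ^+ (~~ c && (m <= head 0%N t)%N) * eps a' (behead t) else 1.

Definition form a (x y : tens a) : k := \sum_(t <- labs a) eps a t * (crd t x * crd t y).

Lemma eps_neq0 a t : eps a t != 0.
Proof. by elim: a t => [|c a IHa] t /=; rewrite ?oner_neq0 // mulf_neq0 // signr_eq0. Qed.

Lemma eps_cat a b t u : size t = size a -> eps (a ++ b) (t ++ u) = eps a t * eps b u.
Proof.
by elim: a t => [|c a IHa] [|i t] //=; rewrite ?mul1r // => -[/IHa->]; rewrite mulrA.
Qed.

Lemma form_C a (x y : tens a) : form x y = form y x.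
Proof. by apply: eq_bigr => t _; rewrite [crd t x * _]mulrC. Qed.

Lemma form_linearr a (x : tens a) : linear (form x : tens a -> k^o).
Proof.
move=> c y z; rewrite /form scaler_sumr -big_split; apply: eq_bigr => t _.
have -> : crd t (c *: y + z) = c * crd t y + crd t z := crd_linear t c y z.
rewrite !mulrDr; congr (_ + _); rewrite -[RHS]/(c * (eps a t * (crd t x * crd t y))).
by rewrite [RHS]mulrCA; congr (_ * _); rewrite mulrCA.
Qed.

Lemma formZr a (x : tens a) c y : form x (c *: y) = c * form x y.
Proof.
have [g gE] := lfun_of_linear (form_linearr x).
by rewrite -(gE (c *: y)) -(gE y) linearZ.
Qed.

Lemma form_sumr a (x : tens a) (I : Type) (r : seq I) (P : pred I) (f : I -> tens a) :
  form x (\sum_(i <- r | P i) f i) = \sum_(i <- r | P i) form x (f i).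
Proof.
have [g gE] := lfun_of_linear (form_linearr x).
by rewrite -gE linear_sum; apply: eq_bigr => i _; apply: gE.
Qed.

Lemma formZl a (y : tens a) c x : form (c *: x) y = c * form x y.
Proof. by rewrite !(form_C _ y) formZr. Qed.

Lemma form_suml a (y : tens a) (I : Type) (r : seq I) (P : pred I) (f : I -> tens a) :
  form (\sum_(i <- r | P i) f i) y = \sum_(i <- r | P i) form (f i) y.
Proof. by rewrite form_C form_sumr; apply: eq_bigr => i _; rewrite form_C. Qed.

Lemma form_etens a (x : tens a) t : t \in labs a -> form x (etens a t) = eps a t * crd t x.
Proof.
move=> ta; rewrite /form (bigD1_seq t) ?labs_uniq //= crd_etens // eqxx mulr1.
rewrite big_seq_cond big1 ?addr0 // => u /andP[ua ut].
by rewrite crd_etens // eq_sym (negPf ut) !mulr0.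
Qed.

Lemma form_nondeg a (x : tens a) : (forall y, form x y = 0) -> x = 0.
Proof.
move=> h; apply: tens_ext => t ta; have /eqP := h (etens a t).
by rewrite form_etens // mulf_eq0 (negPf (eps_neq0 _ _)) /= => /eqP->; have := crdZ t 0 (0 : tens a); rewrite scaler0 mul0r.
Qed.

Lemma form_tcat a b (x x' : tens a) (y y' : tens b) :
  form (tcat x y) (tcat x' y') = form x x' * form y y'.
Proof.
have big_labs (f : seq nat -> k) :
    \sum_(t <- labs (a ++ b)) f t = \sum_(t <- labs a) \sum_(u <- labs b) f (t ++ u).
  elim: a f {x x'} => [|c a IHa] f /=; first by rewrite big_seq1.
  by rewrite !big_allpairs_dep; apply: eq_bigr => i _; rewrite IHa.
rewrite /form big_labs mulr_suml big_seq [RHS]big_seq; apply: eq_bigr => t ta.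
have st : size t = size a by move: ta; rewrite labsP => /andP[/eqP].
rewrite mulr_sumr; apply: eq_bigr => u _; rewrite eps_cat // !crd_tcat //.
by rewrite [RHS]mulrACA; congr (_ * _); rewrite mulrACA.
Qed.

End TensorBasis.

(** * Action of diagrams on labelled tensors *)

Section Functor.

Variables (k : fieldType) (delta : k) (V : superspace k) (m n : nat).
Variables (E : homog_basis V m n) (F : OBfunctor delta V).
Local Notation D := (m + n)%N.
Local Notation labs := (labs m n).
Local Notation etens := (etens E).
Local Notation crd := (crd E).
Local Notation form := (form E).

Definition lbl a b (t u : seq nat) (x : pt a b) : nat :=
  match x with inl i => nth 0%N t i | inr j => nth 0%N u j end.

Definition consistent a b (d : diag a b) (t u : seq nat) :=
  [forall x, lbl t u (d x) == lbl t u x].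

Lemma consistentP a b (d : diag a b) t u :
  reflect (forall x, lbl t u (d x) = lbl t u x) (consistent d t u).
Proof. by apply: (iffP forallP) => h x; apply/eqP/(h x). Qed.

(* The braiding introduces signs in the matrix of F d; only its support is
   recorded, together with the fact that mirror images act by adjoints. *)
Definition regular a b (d : diag a b) : Prop :=
  (forall t u, t \in labs a -> u \in labs b ->
     (crd u (obF F d (etens a t)) != 0) = consistent d t u) /\
  (forall x y, form (obF F d x) y = form x (obF F (flip d) y)).

Lemma regular_flip a b (d : diag a b) x y : regular d ->
  form (obF F (flip d) x) y = form x (obF F d y).
Proof. by case=> _ h; rewrite form_C -h form_C. Qed.

Lemma obF_comp0 a b c (d : diag a b) (e : diag b c) x : loops d e = 0%N ->
  obF F (comp d e) x = obF F e (obF F d x).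
Proof.
move=> l0; have /lfunP/(_ x) := obF_comp F d e.
by rewrite l0 expr0 scale1r comp_lfunE.
Qed.

Lemma obF1 a x : obF F (diag1 a) x = x.
Proof. by rewrite obF_id id_lfunE. Qed.

Lemma lbl_eq (a : word) (t u : seq nat) : size t = size a -> size u = size a ->
  (forall i : 'I_(size a), nth 0%N t i = nth 0%N u i) -> t = u.
Proof.
move=> st su h; apply: (@eq_from_nth _ 0%N); rewrite ?st ?su // => i ia.
exact: (h (Ordinal ia)).
Qed.

Lemma labs_size (a : word) t : t \in labs a -> size t = size a.
Proof. by rewrite labsP => /andP[/eqP]. Qed.

Lemma regular1 a : regular (diag1 a).
Proof.
split=> [t u ta ua|x y]; last by rewrite flip1 !obF1.
rewrite obF1 crd_etens //; have [->|tu] := eqVneq t u.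
  by rewrite oner_eq0; apply/esym/consistentP => -[] i; rewrite ffunE.
rewrite eqxx; apply/esym/negP => /consistentP h; case/eqP: tu; apply: (lbl_eq (labs_size ta) (labs_size ua)) => i.
by have := h (inl i); rewrite ffunE.
Qed.

Lemma consistent_comp a b c (d : diag a b) (e : diag b c) t u v :
  consistent d t v -> consistent e v u -> consistent (comp d e) t u.
Proof.
move=> /consistentP hd /consistentP he; apply/consistentP => x.
pose lq (q : pt a b + pt b c) := match q with inl y => lbl t v y | inr y => lbl v u y end.
have lo y : lq (outer b y) = lbl t u y by case: y.
rewrite -!lo; have := comp_same d e x.
apply: (zigzag_ind (P := fun q => lq q = lq (outer b x))) => // q <-.
  by case: q => y /=; rewrite ?hd ?he.
by case: q => [] [].
Qed.

Lemma consistent_factor a b c (d : diag a b) (e : diag b c) t u :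
  t \in labs a -> u \in labs c -> capless e ->
  exists2 v, v \in labs b & forall v', v' \in labs b ->
     (consistent d t v' && consistent e v' u) = (v' == v) && consistent (comp d e) t u.
Proof.
move=> ta ua ec; have /caplessP/fin_all_exists[f fP] := ec.
pose v := [seq nth 0%N u (f j) | j : 'I_(size b)].
have sv : size v = size b by rewrite size_map -cardE card_ord.
have vE (j : 'I_(size b)) : nth 0%N v j = nth 0%N u (f j).
  by rewrite (nth_map j) ?nth_ord_enum // size_enum_ord.
have vb : v \in labs b.
  rewrite labsP sv eqxx; apply/allP => _ /mapP[j _ ->].
  have := ua; rewrite labsP => /andP[/eqP su /allP]; apply; apply: mem_nth.
  by rewrite su.
exists v => // v' v'b; apply/andP/andP => [[hd he]|[/eqP-> /consistentP h]].
  split; last exact: consistent_comp hd he.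
  apply/eqP/(lbl_eq (labs_size v'b) sv) => j; rewrite vE.
  by have /consistentP/(_ (inl j)) := he; rewrite fP.
split; apply/consistentP.
  case=> i.
    case di: (d (inl i)) => [i'|j]; first by have := h (inl i); rewrite (comp_cap e di).
    by rewrite /= vE; have := h (inl i); rewrite (comp_through di (fP j)).
  case di: (d (inr i)) => [i'|j].
    by rewrite /= vE; have := h (inr (f i)); rewrite (comp_through' (diag_inv (fP i)) di).
  rewrite /= !vE; have := h (inr (f i)).
  by rewrite (comp_pull (diag_inv (fP i)) di (fP j)).
case=> i; first by rewrite fP /= vE.
case ei: (e (inr i)) => [j|j]; last by have := h (inr i); rewrite (comp_cup d ei).
by have := fP j; rewrite (diag_inv ei) /= vE => -[->].
Qed.

Lemma crd_obF a b (e : diag a b) x u :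
  crd u (obF F e x) = \sum_(v <- labs a) crd v x * crd u (obF F e (etens a v)).
Proof.
rewrite [in LHS](etens_span E x) linear_sum crd_sum; apply: eq_bigr => v _.
by rewrite linearZ crdZ.
Qed.

Lemma regular_comp a b c (d : diag a b) (e : diag b c) : capless e ->
  regular d -> regular e -> regular (comp d e).
Proof.
move=> ec [cd ad] [ce ae]; have l0 : loops d e = 0%N by apply: loops_capless.
split=> [t u ta ua|x y]; last first.
  by rewrite flip_comp !obF_comp0 ?loops_flip // ae ad.
rewrite obF_comp0 // crd_obF; have [v vb vP] := consistent_factor d ta ua ec.
rewrite (bigD1_seq v) ?labs_uniq //= big_seq_cond big1 ?addr0 => [|v' /andP[v'b v'v]].
  by rewrite mulf_eq0 negb_or cd // ce // vP // eqxx.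
apply/eqP; rewrite -[_ == 0]negbK mulf_eq0 negb_or cd // ce // vP // (negPf v'v).
by [].
Qed.

Lemma lbl_join (a b a' b' : word) t t' u u' (x : pt a b + pt a' b') : size t = size a -> size u = size b ->
  lbl (t ++ t') (u ++ u') (pt_join x) =
  match x with inl y => lbl t u y | inr y => lbl t' u' y end.
Proof.
by move=> st su; case: x => [] [] i /=; rewrite nth_cat ?st ?su ?ltn_ord // ltnNge leq_addr /= addKn.
Qed.

Lemma juxt_join a b a' b' (d : diag a b) (d' : diag a' b') x :
  juxt d d' (pt_join x) = pt_join match x with inl y => inl (d y) | inr y => inr (d' y) end.
Proof. by rewrite ffunE /juxt_fun pt_joinK. Qed.

Lemma flip_juxt a b a' b' (d : diag a b) (d' : diag a' b') :
  flip (juxt d d') = juxt (flip d) (flip d').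
Proof.
apply: diag_ext => x; rewrite -[x]pt_splitK; set y := pt_split x.
have jf a1 b1 a2 b2 (z : pt a1 b1 + pt a2 b2) : pt_flip (pt_join z) =
    pt_join match z with inl y => inl (pt_flip y) | inr y => inr (pt_flip y) end.
  by case: z => [] [].
rewrite flipE jf !juxt_join jf; congr pt_join.
by case: y => y; rewrite flipE.
Qed.

Lemma consistent_juxt a b a' b' (d : diag a b) (d' : diag a' b') t t' u u' :
  size t = size a -> size u = size b ->
  consistent (juxt d d') (t ++ t') (u ++ u') = consistent d t u && consistent d' t' u'.
Proof.
move=> st su; apply/consistentP/andP => [h|[/consistentP h /consistentP h'] x].
  split; apply/consistentP => x.
    by have := h (pt_join (inl x)); rewrite juxt_join !lbl_join.
  by have := h (pt_join (inr x)); rewrite juxt_join !lbl_join.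
by rewrite -[x]pt_splitK juxt_join !lbl_join //; case: (pt_split x).
Qed.

Lemma form_ext a b (f : 'Hom(tens V a, tens V b)) (g : 'Hom(tens V b, tens V a)) :
  (forall t u, t \in labs a -> u \in labs b -> form (f (etens a t)) (etens b u) = form (etens a t) (g (etens b u))) ->
  forall x y, form (f x) y = form x (g y).
Proof.
move=> h x y; rewrite (etens_span E x) (etens_span E y) !linear_sum !form_suml.
rewrite big_seq [RHS]big_seq; apply: eq_bigr => t ta.
rewrite !form_sumr big_seq [RHS]big_seq; apply: eq_bigr => u ub.
by rewrite /= !linearZ /= !formZl !formZr h.
Qed.

Lemma regular_juxt a b a' b' (d : diag a b) (d' : diag a' b') :
  regular d -> regular d' -> regular (juxt d d').
Proof.
move=> [cd ad] [cd' ad']; split=> [t u|x y].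
  move=> /labs_split[t1 [t2 [-> t1a t2b]]] /labs_split[u1 [u2 [-> u1a u2b]]].
  rewrite etens_cat // obF_juxt crd_tcat ?(labs_size u1a) // mulf_eq0 negb_or cd // cd' //.
  by rewrite consistent_juxt // ?(labs_size t1a) ?(labs_size u1a).
move: x y; apply: form_ext => t u /labs_split[t1 [t2 [-> t1a t2b]]] /labs_split[u1 [u2 [-> u1a u2b]]].
by rewrite !etens_cat // flip_juxt !obF_juxt !form_tcat ad ad'.
Qed.

Lemma regular_cross c : regular (cross c c).
Proof.
have crossE i j : (i < D)%N -> (j < D)%N ->
    obF F (cross c c) (etens [:: c; c] [:: i; j]) =
    (-1) ^+ ((m <= i) && (m <= j))%N *: etens [:: c; c] [:: j; i].
  by move=> iD jD; apply: obF_cross; apply: bas_homog.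
have pair t : t \in labs [:: c; c] -> exists i j, [/\ t = [:: i; j], (i < D)%N & (j < D)%N].
  by rewrite labsP; case: t => [|i [|j [|]]] //= /and3P[iD jD _]; exists i, j.
have fc : flip (cross c c) = cross c c.
  by apply: diag_ext => -[] i; rewrite flipE !ffunE.
split=> [t u /pair[i [j [-> iD jD]]] /pair[i' [j' [-> iD' jD']]]|x y].
  rewrite crossE // crdZ crd_etens ?labsP /= ?iD ?jD ?iD' ?jD' //.
  rewrite mulf_eq0 signr_eq0 /=.
  rewrite eqseq_cons eqseq_cons andbT; apply/idP/consistentP => [|h].
    case: andP => [[/eqP-> /eqP->] _|_]; last by rewrite eqxx.
    by case=> -[[|[|]] //= ltx]; rewrite ffunE.
  have h0 := h (inl ord0); have h1 := h (inl ord_max); rewrite !ffunE /= in h0 h1.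
  by rewrite h0 h1 !eqxx oner_eq0.
rewrite fc; apply: (form_ext (f := obF F (cross c c)) (g := obF F (cross c c))) => t u.
move=> /pair[i [j [-> iD jD]]] /pair[i' [j' [-> iD' jD']]]; rewrite !crossE //.
have mem2 i1 i2 : (i1 < D)%N -> (i2 < D)%N -> [:: i1; i2] \in labs [:: c; c].
  by move=> D1 D2; rewrite labsP /= D1 D2.
rewrite formZl formZr !form_etens ?mem2 // !crd_etens ?mem2 //=.
rewrite !eqseq_cons !andbT [(j == i') && _]andbC.
case: (i =P j') => [->|_]; last by rewrite !mulr0.
case: (j =P i') => [->|_]; last by rewrite !mulr0.
rewrite [(m <= j')%N && _]andbC; congr (_ * _); congr (_ * _); exact: mulrCA.
Qed.

End Functor.

Section JuxtaposePoints.

Definition pnum a b (x : pt a b) : nat := match x with inl i => i | inr j => j end.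

Lemma pt_eq a b (x y : pt a b) : is_lower x = is_lower y -> pnum x = pnum y -> x = y.
Proof. by case: x y => i [] j //= _ ij; [congr inl | congr inr]; apply: val_inj. Qed.

Variables (a b a' b' : word) (d : diag a b) (d' : diag a' b').

Lemma juxt_at_l x1 (x y : pt (a ++ a') (b ++ b')) :
  is_lower x = is_lower x1 -> pnum x = pnum x1 ->
  is_lower y = is_lower (d x1) -> pnum y = pnum (d x1) -> juxt d d' x = y.
Proof.
move=> lx px ly py; have -> : x = pt_join (inl x1) by apply: pt_eq; case: x1 {ly py} lx px => i.
by rewrite juxt_join; apply/esym/pt_eq; case: (d x1) ly py => i.
Qed.

Lemma juxt_at_r x1 (x y : pt (a ++ a') (b ++ b')) :
  is_lower x = is_lower x1 -> pnum x = ((if is_lower x1 then size a else size b) + pnum x1)%N ->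
  is_lower y = is_lower (d' x1) ->
  pnum y = ((if is_lower (d' x1) then size a else size b) + pnum (d' x1))%N -> juxt d d' x = y.
Proof.
move=> lx px ly py; have -> : x = pt_join (inr x1) by apply: pt_eq; case: x1 {ly py} lx px => i.
by rewrite juxt_join; apply/esym/pt_eq; case: (d' x1) ly py => i.
Qed.

Lemma juxt_val x :
  (exists x1, [/\ is_lower x = is_lower x1, pnum x = pnum x1,
     is_lower (juxt d d' x) = is_lower (d x1) & pnum (juxt d d' x) = pnum (d x1)]) \/
  (exists x1, [/\ is_lower x = is_lower x1,
     pnum x = ((if is_lower x1 then size a else size b) + pnum x1)%N,
     is_lower (juxt d d' x) = is_lower (d' x1) &
     pnum (juxt d d' x) = ((if is_lower (d' x1) then size a else size b) + pnum (d' x1))%N]).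
Proof.
rewrite -[x]pt_splitK; case: (pt_split x) => y; [left | right]; exists y; rewrite juxt_join.
  by case: y => i; split=> //; case: (d _).
by case: y => i; split=> //; case: (d' _).
Qed.

Lemma juxt_capless : capless d -> capless d' -> capless (juxt d d').
Proof.
move=> /caplessP dc /caplessP dc'; apply/caplessP => i.
suff : ~~ is_lower (juxt d d' (inl i)) by case: (juxt _ _ _) => // j _; exists j.
case: (juxt_val (inl i)) => -[x1 [l1 _ -> _]]; case: x1 l1 => // i1 _.
  by have [j ->] := dc i1.
by have [j ->] := dc' i1.
Qed.

End JuxtaposePoints.

Lemma diag1_capless' a : capless (diag1 a).
Proof. by apply/caplessP => i; exists i; rewrite ffunE. Qed.

Lemma nseq_wall a b :
  nseq a.+1 vee ++ nseq b.+1 wedge = nseq a vee ++ [:: vee; wedge] ++ nseq b wedge.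
Proof. by rewrite -addn1 nseqD -catA. Qed.

Definition cup_fun (x : pt [::] [:: vee; wedge]) : pt [::] [:: vee; wedge] :=
  match x with inl i => inl i | inr j => inr (rev_ord j) end.

Lemma cup_funK : involutive cup_fun.
Proof. by case=> i //=; rewrite rev_ordK. Qed.

Lemma cup_fun_sgn x : sgn (cup_fun x) = ~~ sgn x.
Proof. by case: x => [] [[|[|[]]] //= _]. Qed.

Definition cup : diag [::] [:: vee; wedge] := mk_diag cup_funK cup_fun_sgn.

Definition wall_diag a b : diag (mixed a b) (nseq a vee ++ [:: vee; wedge] ++ nseq b wedge) :=
  juxt (diag1 (nseq a vee)) (juxt cup (diag1 (nseq b wedge))).

Lemma wall_cup a b (w : word) : w = nseq a vee ++ [:: vee; wedge] ++ nseq b wedge ->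
  exists d : diag (mixed a b) w, [/\ capless d,
    forall x y, d (inr x) = inr y -> (x = a :> nat /\ y = a.+1 :> nat) \/ (x = a.+1 :> nat /\ y = a :> nat) &
    forall P : (forall w1 w2, diag w1 w2 -> Prop), P _ _ (wall_diag a b) -> P _ _ d].
Proof.
move=> ->; pose d := wall_diag a b; exists d; split=> //.
- apply: (@juxt_capless _ _ _ _ (diag1 (nseq a vee)) (juxt cup (diag1 (nseq b wedge)))).
    exact: diag1_capless'.
  apply: (@juxt_capless _ _ _ _ cup (diag1 (nseq b wedge))); last exact: diag1_capless'.
  by apply/caplessP => -[].
move=> x y dxy; have ly : is_lower (d (inr x)) = false by rewrite dxy.
have -> : nat_of_ord y = pnum (d (inr x)) by rewrite dxy.
rewrite -[nat_of_ord x]/(pnum (inr x : pt (mixed a b) (nseq a vee ++ [:: vee; wedge] ++ nseq b wedge))).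
case: (juxt_val (diag1 (nseq a vee)) (juxt cup (diag1 (nseq b wedge))) (inr x)) => -[x1 [l0 p1 l1 q1]].
  have ll : is_lower (d (inr x)) = is_lower (diag1 (nseq a vee) x1) by [].
  by case: x1 l0 ll {p1 q1 l1} => // i _; rewrite ly ffunE.
have ly1 : is_lower (juxt cup (diag1 (nseq b wedge)) x1) = false by rewrite -l1 -ly.
case: x1 l0 p1 l1 q1 ly1 => // i _ p1 l1 q1 ly1.
have -> : pnum (d (inr x)) = (size (nseq a vee) + pnum (juxt cup (diag1 (nseq b wedge)) (inr i)))%N.
  by rewrite [LHS]q1 ly1.
rewrite p1.
case: (juxt_val cup (diag1 (nseq b wedge)) (inr i)) => -[x2 [l2 -> l3 ->]].
  case: x2 l2 {l3} => // t _; rewrite ffunE /= !size_nseq; case: t => [[|[|//]] ?] /=;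
    rewrite ?addn0 ?addn1; by [left | right].
by case: x2 l2 l3 => // t _ l3; move: ly1; rewrite l3 ffunE.
Qed.

Section Generators.

Variables (k : fieldType) (delta : k) (V : superspace k) (m n : nat).
Variables (E : homog_basis V m n) (F : OBfunctor delta V).
Local Notation D := (m + n)%N.
Local Notation labs := (labs m n).
Local Notation etens := (etens E).
Local Notation crd := (crd E).
Local Notation form := (form E).
Local Notation regular := (regular E F).

Lemma diag_vee_unique (d d' : diag [:: vee] [:: vee]) : d = d'.
Proof.
have h (e : diag [:: vee] [:: vee]) x : e x = swap_line x.
  have := diag_neq e x; case: x => i; case: (e _) => j; rewrite ?(ord1 i) ?(ord1 j) ?eqxx //.
by apply: diag_ext => x; rewrite !h.
Qed.

Lemma diag_cap_unique (d d' : diag [:: vee; wedge] [::]) : d = d'.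
Proof.
have h (e : diag [:: vee; wedge] [::]) x : exists2 i : 'I_2, x = inl i & e x = inl (rev_ord i).
  have := diag_neq e x; case: x => i; last by case: i.
  exists i => //; case: (e _) H => j ne; last by case: j ne.
  congr inl; apply: val_inj; move: ne; rewrite (inj_eq (@inl_inj _ _)) -val_eqE /=.
  by case: i j => [[|[|//]] ?] [[|[|//]] ?].
by apply: diag_ext => x; have [i -> ->] := h d x; have [j [->] ->] := h d' (inl i).
Qed.

Let z1 : diag [:: vee] [:: vee; wedge; vee] := juxt cup (diag1 [:: vee]).
Let z2 : diag [:: vee; wedge; vee] [:: vee] := juxt (diag1 [:: vee]) cap.
Let o0 : 'I_(size [:: vee; wedge; vee]) := @Ordinal 3 0 isT.
Let o1 : 'I_(size [:: vee; wedge; vee]) := @Ordinal 3 1 isT.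
Let o2 : 'I_(size [:: vee; wedge; vee]) := @Ordinal 3 2 isT.

Let z1_2 : z1 (inr o2) = inl (ord0 : 'I_(size [:: vee])).
Proof.
by apply: (@juxt_at_r [::] [:: vee; wedge] [:: vee] [:: vee] cup (diag1 [:: vee])
  (inr (ord0 : 'I_(size [:: vee])))); rewrite ?ffunE.
Qed.

Let z1_1 : z1 (inr o1) = inr o0.
Proof.
by apply: (@juxt_at_l [::] [:: vee; wedge] [:: vee] [:: vee] cup (diag1 [:: vee])
  (inr (ord_max : 'I_(size [:: vee; wedge])))); rewrite ?ffunE.
Qed.

Let z2_0 : z2 (inl o0) = inr (ord0 : 'I_(size [:: vee])).
Proof.
by apply: (@juxt_at_l [:: vee] [:: vee] [:: wedge; vee] [::] (diag1 [:: vee]) cap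
  (inl (ord0 : 'I_(size [:: vee])))); rewrite ?ffunE.
Qed.

Let z2_1 : z2 (inl o1) = inl o2.
Proof.
by apply: (@juxt_at_r [:: vee] [:: vee] [:: wedge; vee] [::] (diag1 [:: vee]) cap
  (inl (ord0 : 'I_(size [:: wedge; vee])))); rewrite ?ffunE.
Qed.

Lemma zigzag_loops : loops z1 z2 = 0%N.
Proof.
pose S := same_strand z1 z2.
have s1 x y : z1 x = y -> S (inl x) (inl y) by move=> <-; apply: (same_strand_s z1 z2 (inl x)).
have s2 x y : z2 x = y -> S (inr x) (inr y) by move=> <-; apply: (same_strand_s z1 z2 (inr x)).
have g1 j : S (inl (inr j)) (inr (inl j)) by apply: (same_strand_g z1 z2 (inl (inr j))).
have g2 j : S (inr (inl j)) (inl (inr j)) by apply: (same_strand_g z1 z2 (inr (inl j))).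
have a2 : S (inl (inr o2)) (outer _ (inl (ord0 : 'I_(size [:: vee])))) := s1 _ _ z1_2.
have b0 : S (inr (inl o0)) (outer _ (inr (ord0 : 'I_(size [:: vee])))) := s2 _ _ z2_0.
have a0 := same_trans (g1 o0) b0; have b2 := same_trans (g2 o2) a2.
have a1 := same_trans (s1 _ _ z1_1) a0; have b1 := same_trans (s2 _ _ z2_1) b2.
have c3 (j : 'I_(size [:: vee; wedge; vee])) : [\/ j = o0, j = o1 | j = o2].
  by case: j => [[|[|[|//]]] ?]; [apply: Or31 | apply: Or32 | apply: Or33]; apply: val_inj.
apply: loops0 => -[] [] j.
- by exists (inl j); apply: connect0.
- by case: (c3 j) => ->; eexists; eassumption.
- by case: (c3 j) => ->; eexists; eassumption.
- by exists (inr j); apply: connect0.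
Qed.

Lemma labs_vwv t : t \in labs [:: vee; wedge; vee] ->
  exists a b c, [/\ t = [:: a; b; c], (a < D)%N, (b < D)%N & (c < D)%N].
Proof.
by rewrite labsP; case: t => [|a [|b [|c [|]]]] //= /and4P[aD bD cD _]; exists a, b, c.
Qed.

Lemma cup_crd i j : (i < D)%N -> (j < D)%N ->
  crd [:: i; j] (obF F cup (tunit V)) = (i == j)%:R.
Proof.
move=> iD jD; set x := obF F cup (tunit V).
have vl l : (l < D)%N -> [:: l] \in labs [:: vee] by move=> lD; rewrite labsP /= lD.
have H : obF F z2 (obF F z1 (etens [:: vee] [:: j])) = etens [:: vee] [:: j].
  rewrite -obF_comp0 ?zigzag_loops // (diag_vee_unique (comp z1 z2) (diag1 _)).
  exact: obF1.
have z1E : obF F z1 (etens [:: vee] [:: j]) = tcat x (etens [:: vee] [:: j]).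
  have -> : etens [:: vee] [:: j] = tcat (tunit V) (etens [:: vee] [:: j]).
    by rewrite /= scale1r.
  rewrite (obF_juxt F cup (diag1 [:: vee]) (tunit V) (etens [:: vee] [:: j])) obF1.
  by rewrite /= scale1r.
have := congr1 (crd [:: i]) H; rewrite z1E crd_obF crd_etens ?vl // eqseq_cons andbT eq_sym => <-.
have lin : [:: i; j; j] \in labs [:: vee; wedge; vee] by rewrite labsP /= iD jD.
have term v : v \in labs [:: vee; wedge; vee] ->
    crd v (tcat x (etens [:: vee] [:: j])) * crd [:: i] (obF F z2 (etens [:: vee; wedge; vee] v)) =
    if v == [:: i; j; j] then crd [:: i; j] x else 0.
  move=> /labs_vwv[a [b [c [-> aD bD cD]]]].
  rewrite (@crd_tcat _ _ _ _ E [:: vee; wedge] [:: vee] [:: a; b] [:: c]) //.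
  rewrite crd_etens ?vl //.
  have -> : etens [:: vee; wedge; vee] [:: a; b; c] =
      tcat (etens [:: vee] [:: a]) (etens [:: wedge; vee] [:: b; c]).
    by apply: (@etens_cat _ _ _ _ E [:: vee] [:: wedge; vee] [:: a]); rewrite labsP /= ?aD ?bD ?cD.
  rewrite (obF_juxt F (diag1 [:: vee]) cap) obF1.
  rewrite (@crd_tcat _ _ _ _ E [:: vee] [::] [:: i] [::]) // crd_etens ?vl //.
  rewrite [etens [:: wedge; vee] _]/= (obF_cap F (cb E b) (vb E c)) /= cb_vb //.
  rewrite !eqseq_cons !andbT; case: (a =P i) => [->|_] /=; last by rewrite mul0r mulr0.
  case: (j =P c) => [<-|jc]; last first.
    have -> : (c == j) = false by apply/eqP => cj; apply: jc.
    by rewrite andbF mulr0 mul0r.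
  by rewrite eqxx andbT; case: eqP => [->|]; rewrite ?mulr1 ?mulr0 // mul1r.
rewrite big_seq (eq_bigr _ (fun v => term v)) -big_seq (bigD1_seq _ lin) ?labs_uniq //= eqxx.
by rewrite big1 ?addr0 // => v /negPf->.
Qed.

Lemma labs_vw t : t \in labs [:: vee; wedge] -> exists i j, [/\ t = [:: i; j], (i < D)%N & (j < D)%N].
Proof. by rewrite labsP; case: t => [|i [|j [|]]] //= /and3P[iD jD _]; exists i, j. Qed.

Lemma regular_cup : regular cup.
Proof.
split=> [t u|].
  rewrite [t \in _]inE => /eqP-> /labs_vw[i [j [-> iD jD]]].
  rewrite [etens _ _]/= cup_crd //; apply/idP/consistentP => [|h].
    have [->|_] := eqVneq i j; last by rewrite eqxx.
    by move=> _ [[]//|[[|[|]] //= ltx]]; rewrite ffunE.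
  by have := h (inr ord0); rewrite ffunE /= => ->; rewrite eqxx oner_neq0.
have fc : flip cup = comp (cross vee wedge) cap by apply: diag_cap_unique.
have l0 : loops (cross vee wedge) cap = 0%N.
  by apply: loops_nocup; apply/nocupP => j; exists (rev_ord j); rewrite ffunE.
apply: form_ext => t u; rewrite [t \in _]inE => /eqP-> /labs_vw[i [j [-> iD jD]]].
have mem : [:: i; j] \in labs [:: vee; wedge] by rewrite labsP /= iD jD.
rewrite (form_etens E _ mem) [etens [::] [::]]/(tunit V) cup_crd // fc obF_comp0 //.
have X : obF F (cross vee wedge) (etens [:: vee; wedge] [:: i; j]) =
    (-1) ^+ ((m <= i)%N && (m <= j)%N) *: tcons (cb E j : letter_space V wedge)
      (tcons (vb E i : letter_space V vee) (tunit V)).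
  exact: (@obF_cross _ _ _ F vee wedge _ _ _ _ (vb_homog E iD) (cb_homog E jD)).
have Y : obF F cap (tcons (cb E j : letter_space V wedge)
      (tcons (vb E i : letter_space V vee) (tunit V))) = ((j == i)%:R : k^o).
  exact: etrans (obF_cap F (cb E j) (vb E i)) (cb_vb E jD iD).
have Z : obF F cap (obF F (cross vee wedge) (etens [:: vee; wedge] [:: i; j])) =
    (-1) ^+ ((m <= i)%N && (m <= j)%N) *: ((j == i)%:R : k^o).
  by rewrite X linearZ; congr (_ *: _); exact: Y.
rewrite Z formZr /form /= big_seq1 !mul1r mulr1 [j == i]eq_sym.
by case: (i =P j) => [->|_]; rewrite ?mulr0 // andbb.
Qed.

Section PermDiagrams.

Variable (c : bool) (N : nat).
Implicit Types g h : 'S_N.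

Lemma perm_diag_inl g (i : 'I_(size (nseq N c))) :
  perm_diag c g (inl i) = inr (cast_ord (esym (size_nseq N c)) (g (cast_ord (size_nseq N c) i))).
Proof. by rewrite ffunE. Qed.

Lemma perm_diag_capless g : capless (perm_diag c g).
Proof. by apply/caplessP => i; rewrite perm_diag_inl; eexists. Qed.

Lemma perm_diag_comp g h : comp (perm_diag c g) (perm_diag c h) = perm_diag c (g * h)%g.
Proof.
apply: nocup_ext => [|i]; first exact: capless_nocup (perm_diag_capless _) erefl.
rewrite perm_diag_inl; apply: comp_through (perm_diag_inl _ _) _.
by rewrite perm_diag_inl cast_ordKV permM.
Qed.

Lemma perm_diag_1 : perm_diag c (1%g : 'S_N) = diag1 (nseq N c).
Proof.
apply: nocup_ext => [|i]; last by rewrite perm_diag_inl perm1 cast_ordK ffunE.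
by apply: capless_nocup => //; apply/caplessP => i; exists i; rewrite ffunE.
Qed.

Definition swapn i x := if x == i then i.+1 else if x == i.+1 then i else x.

Lemma regular_swap (w p q : word) (d : diag w w) : w = p ++ [:: c; c] ++ q ->
  (forall x, exists2 y : 'I_(size w), d (inl x) = inr y & nat_of_ord y = swapn (size p) x) ->
  regular d.
Proof.
move=> wE; subst w => dE.
have -> : d = juxt (diag1 p) (juxt (cross c c) (diag1 q)); last first.
  by apply: regular_juxt; [exact: regular1 | apply: regular_juxt; [exact: regular_cross | exact: regular1]].
pose J := juxt (diag1 p) (juxt (cross c c) (diag1 q)).
have Jc : capless J.
  apply: juxt_capless; first exact: diag1_capless'.
  apply: juxt_capless; last exact: diag1_capless'.
  by apply/caplessP => x; exists (rev_ord x); rewrite ffunE.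
have JE x : exists2 y, J (inl x) = inr y & nat_of_ord y = swapn (size p) x.
  have /caplessP/(_ x)[y yE] := Jc; exists y => //.
  have -> : nat_of_ord y = pnum (J (inl x)) by rewrite yE.
  rewrite -[nat_of_ord x]/(pnum (inl x : pt (p ++ [:: c; c] ++ q) (p ++ [:: c; c] ++ q))) /swapn /J.
  case: (juxt_val (diag1 p) (juxt (cross c c) (diag1 q)) (inl x)) => -[x1 [l1 -> _ ->]].
    case: x1 l1 => // i _; rewrite ffunE /=; have := ltn_ord i.
    by case: eqP => [?|_]; [lia | case: eqP; lia].
  case: x1 l1 => // i _.
  case: (juxt_val (cross c c) (diag1 q) (inl i)) => -[x2 [l2 p2 -> ->]]; rewrite [pnum (inl i)]/(nat_of_ord i) in p2;
    rewrite [pnum (inl i)]/(nat_of_ord i) p2; case: x2 l2 {p2} => // t _; rewrite ffunE /=.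
    by case: t => [[|[|//]] ?] /=; rewrite ?addn0 ?addn1 ?eqxx // gtn_eqF // eqxx.
  by case: eqP => [|_]; [lia | case: eqP => //; lia].
apply: nocup_ext => [|x].
  exact: capless_nocup Jc erefl.
have [y -> yE] := dE x; have [z zE zE'] := JE x; rewrite [RHS]zE; congr inr.
by apply: val_inj; rewrite /= yE zE'.
Qed.

Lemma regular_adjacent (i j : 'I_N) : j = i.+1 :> nat -> regular (perm_diag c (tperm i j)).
Proof.
move=> ji; apply: (@regular_swap _ (nseq i c) (nseq (N - i.+2) c)).
  by rewrite -[[:: c; c]]/(nseq 2 c) !cat_nseq /ncons -!iterD -/(ncons _ _ _); congr nseq; have := ltn_ord j; lia.
move=> x; eexists; first exact: perm_diag_inl.
rewrite /= [size (nseq i c)]size_nseq /swapn; case: tpermP => [xi|xj|].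
- have xE : nat_of_ord x = i by rewrite -xi.
  by rewrite xE eqxx ji.
- have xE : nat_of_ord x = j by rewrite -xj.
  by rewrite xE ji gtn_eqF // eqxx.
move=> ni nj; case: eqP => [e|_]; first by case: ni; apply: val_inj.
by case: eqP => // e; case: nj; apply: val_inj; rewrite /= e ji.
Qed.

Lemma regular_permM g h : regular (perm_diag c g) -> regular (perm_diag c h) ->
  regular (perm_diag c (g * h)%g).
Proof. by move=> rg rh; rewrite -perm_diag_comp; apply: regular_comp => //; apply: perm_diag_capless. Qed.

Lemma regular_tperm (i j : 'I_N) : (i < j)%N -> regular (perm_diag c (tperm i j)).
Proof.
have [q] := ubnP (j - i); elim: q j => // q IHq j lt ij.
have [ji|ji] := eqVneq (nat_of_ord j) i.+1; first exact: regular_adjacent.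
have lt' : (j.-1 < N)%N by rewrite (leq_ltn_trans (leq_pred j)).
pose j' := Ordinal lt'; have jj' : j = j'.+1 :> nat by rewrite /= prednK // (leq_ltn_trans _ ij).
have rj : regular (perm_diag c (tperm j' j)) by apply: regular_adjacent.
have -> : tperm i j = ((tperm j' j) * (tperm i j' * tperm j' j))%g.
  rewrite -{1}(tpermV j' j) -conjgE tpermJ tpermL tpermD // -val_eqE /=; lia.
apply: regular_permM => //; apply: regular_permM => //; apply: IHq => /=; lia.
Qed.

Lemma regular_perm_diag g : regular (perm_diag c g).
Proof.
have [ts -> ds] := prod_tpermP g; elim: ts ds => [_|[i j] ts IHts /= /andP[ij ds]].
  by rewrite big_nil perm_diag_1; apply: regular1.
rewrite big_cons; apply: regular_permM; last exact: IHts.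
have [lt|lt|/val_inj ij'] := ltngtP (i : nat) j; first exact: regular_tperm.
  by rewrite tpermC; apply: regular_tperm.
by rewrite /= ij' tperm1 perm_diag_1; apply: regular1.
Qed.

End PermDiagrams.

Lemma regular_pd a b (st : 'S_a * 'S_b) : regular (pd st).
Proof. by apply: regular_juxt; apply: regular_perm_diag. Qed.

Variables r s : nat.
Local Notation N := (minn r s).
Local Notation w := (@mixed_family r s).
Implicit Types (i j l : 'I_N.+1).

Lemma regular_wall a b : regular (wall_diag a b).
Proof.
apply: (@regular_juxt _ _ _ _ _ E F _ _ _ _ (diag1 (nseq a vee)) (juxt cup (diag1 (nseq b wedge)))).
  exact: regular1.
exact: (@regular_juxt _ _ _ _ _ E F _ _ _ _ cup (diag1 (nseq b wedge)) regular_cup (regular1 E F _)).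
Qed.

Lemma regular_capless l j (c : diag (w l) (w j)) : capless c -> regular c.
Proof.
have [q] := ubnP (l - j); elim: q l j c => // q IHq l j c lt cc.
have [ncup|] := boolP (~~ has_cup c).
  have lj : l = j by apply/family_inj/(nocup_size cc ncup).
  by subst l; have [g ->] := capless_pw cc; apply: regular_pd.
rewrite negbK => /existsP[[i|x0] //= dx0].
have [x [y [cxy xv yw]]] : exists x y, [/\ c (inr x) = inr y,
    nth wedge (w j) x = vee & nth wedge (w j) y = wedge].
  case cx: (c (inr x0)) dx0 => [i|y0] // _.
  have := diag_sgn c (inr x0); rewrite cx /= => /negb_inj ll.
  case xv: (nth wedge (w j) x0); last by exists y0, x0; rewrite (diag_inv cx) ll xv.
  by exists x0, y0; rewrite cx ll xv.
have [a aE] := letter_mv xv; have [b bE] := letter_mw yw.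
have jl : (j < l)%N.
  have := capless_size cc => /family_le; rewrite leq_eqVlt => /orP[/eqP/val_inj jl|//].
  subst l; have /nocupP/(_ x)[z] := capless_nocup cc erefl; by rewrite cxy.
have lt1 : (j.+1 < N.+1)%N := leq_ltn_trans jl (ltn_ord l).
pose l1 : 'I_N.+1 := Ordinal lt1.
have rj : (r - j = (r - j.+1).+1)%N by have := ltn_ord j; lia.
have sj : (s - j = (s - j.+1).+1)%N by have := ltn_ord j; lia.
have wE : w j = nseq (r - j.+1) vee ++ [:: vee; wedge] ++ nseq (s - j.+1) wedge.
  rewrite [LHS]/(nseq (r - j) vee ++ nseq (s - j) wedge) rj sj; exact: nseq_wall.
have [kap [kr kc kE]] : exists d : diag (w l1) (w j), [/\ regular d, capless d &
    forall x y, d (inr x) = inr y -> (x = (r - j.+1)%N :> nat /\ y = (r - j.+1).+1 :> nat)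
      \/ (x = (r - j.+1).+1 :> nat /\ y = (r - j.+1)%N :> nat)].
  have [d [dc dE dP]] := wall_cup wE; exists d; split=> //.
  exact: (dP (fun w1 w2 e => regular e) (@regular_wall _ _)).
have lta : (r - j.+1 < r - j)%N by rewrite rj.
have ltb : (0 < s - j)%N by rewrite sj.
pose a1 := Ordinal lta; pose b1 := Ordinal ltb.
pose g : 'S_(r - j) * 'S_(s - j) := (tperm a a1, tperm b b1).
have gE : comp c (perm_diag2 g) (inr (mv _ a1)) = inr (mw _ b1).
  apply: (@comp_pull _ _ _ c _ _ _ (mv _ a) (mw _ b)).
  - by apply: diag_inv; rewrite [LHS](pd_mv g a) /= tpermL.
  - by rewrite -aE cxy bE.
  - by rewrite [LHS](pd_mw g b) /= tpermL.
have cgc : capless (comp c (perm_diag2 g)) by apply: capless_comp => //; apply: pw_capless.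
have ab : comp (comp (comp c (perm_diag2 g)) (flip kap)) kap = comp c (perm_diag2 g).
  apply: comp_absorb => // x1 y1 /kE[] [xE yE].
    have -> : x1 = mv _ a1 by apply: val_inj.
    by rewrite gE; congr inr; apply: val_inj; rewrite /= yE rj addn0.
  have -> : x1 = mw _ b1 by apply: val_inj; rewrite /= xE rj addn0.
  by rewrite (diag_inv gE); congr inr; apply: val_inj.
have c1c : capless (comp (comp c (perm_diag2 g)) (flip kap)).
  apply/caplessP => z; case fz: (comp _ (flip kap) _) => [z'|z']; last by exists z'.
  have /caplessP/(_ z)[z''] := cgc; by rewrite -ab (comp_cap _ fz).
have rg : regular (comp c (perm_diag2 g)).
  rewrite -ab; apply: regular_comp => //; apply: IHq => //=.
  by move: lt; rewrite /= ltnS; lia.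
have -> : c = comp (comp c (perm_diag2 g)) (perm_diag2 g^-1%g).
  by rewrite compA pw_comp mulgV pw1 compd1.
apply: regular_comp => //; first exact: pw_capless.
exact: regular_pd.
Qed.

End Generators.

(** * The module of mixed tensors *)

Section TensorModule.

Variables (k : fieldType) (delta : k) (V : superspace k) (F : OBfunctor delta V).
Variables (N : nat) (w : 'I_N.+1 -> word).
Local Notation A := (OBalg delta w).
Local Notation T := (OBmod F w).
Local Notation tn := (fun i => tens V (w i)).

Definition tin i (x : tens V (w i)) : T := dsum_of (fun j =>
  match i =P j with
  | ReflectT e => eq_rect i (fun j => tens V (w j) : Type) x j e
  | ReflectF _ => 0
  end).

Lemma tin_same i (x : tens V (w i)) : (tin x : dsum tn) i = x.
Proof.
rewrite dsumE; case: eqP => // e.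
by rewrite (eq_axiomK e).
Qed.

Lemma tin_neq i j (x : tens V (w i)) : i != j -> (tin x : dsum tn) j = 0.
Proof. by rewrite dsumE; case: eqP. Qed.

Lemma T_ext (x y : T) : (forall i, (x : dsum tn) i = (y : dsum tn) i) -> x = y.
Proof. exact: dsumP. Qed.

Lemma tin_linear i : linear (@tin i).
Proof.
move=> a x y; apply: T_ext => j; rewrite dsum_addE dsum_scaleE.
have [ij|ij] := eqVneq i j; last by rewrite !tin_neq // scaler0 addr0.
by subst j; rewrite !tin_same.
Qed.

Lemma T_sum (x : T) : x = \sum_i tin ((x : dsum tn) i).
Proof.
apply: T_ext => j.
have comp_sum (I : finType) (f : I -> dsum tn) : (\sum_i f i) j = \sum_i (f i) j.
  apply: (big_morph (fun z : dsum tn => z j)) => [z z'|]; first exact: dsum_addE.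
  by have := dsum_scaleE 0 (0 : dsum tn) j; rewrite !scale0r.
rewrite [RHS]comp_sum (bigD1 j) //= tin_same big1 ?addr0 // => i ij.
exact: tin_neq.
Qed.

Lemma act_bb i j (d : diag (w i) (w j)) (x : T) :
  act T (bb delta d) x = tin (obF F d ((x : dsum tn) i)).
Proof.
apply: T_ext => j'; apply: etrans (OBactE F (bb delta d) x j') _.
have term i' (d' : diag (w i') (w j')) : (obb d' = obb d -> False) ->
    (bb delta d (obb d')) *: obF F d' ((x : dsum tn) i') = 0.
  move=> h; have H := bbE delta d (obb d').
  have H0 : bb delta d (obb d') = 0.
    by apply: etrans H _; case: (obb d' =P obb d) => // e; case: h.
  exact: etrans (congr1 (fun z => z *: _) H0) (scale0r _).
have [jj|jj] := eqVneq j j'; last first.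
  rewrite tin_neq // big1 // => i' _; rewrite big1 // => d' _; apply: term.
  by move=> /(congr1 (@tag _ _))/= [_ e]; rewrite e eqxx in jj.
subst j'; rewrite tin_same (bigD1 i) //= [X in _ + X]big1 ?addr0 => [|i' ii]; last first.
  rewrite big1 // => d' _; apply: term => /(congr1 (@tag _ _))/= [e].
  by rewrite e eqxx in ii.
rewrite (bigD1 d) //= [X in _ + X]big1 ?addr0 => [|d' dd]; last first.
  by apply: term => /eqP; rewrite obb_eq => /eqP e; rewrite e eqxx in dd.
have H1 : bb delta d (obb d) = 1 by rewrite bb_coef eqxx.
exact: etrans (congr1 (fun z => z *: _) H1) (scale1r _).
Qed.

Lemma act_bb_tin i j (d : diag (w i) (w j)) (x : tens V (w i)) :
  act T (bb delta d) (tin x) = tin (obF F d x).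
Proof. by rewrite act_bb tin_same. Qed.

End TensorModule.

Section Kappa.

Variables r s : nat.
Local Notation N := (minn r s).
Local Notation w := (@mixed_family r s).
Implicit Types (i j l : 'I_N.+1).

Lemma kappa_exists j (a : 'I_(r - j)) (b : 'I_(s - j)) :
  exists l (d : diag (w l) (w j)), [/\ capless d, l = j.+1 :> nat,
    d (inr (mv (s - j) a)) = inr (mw (r - j) b) &
    forall x y, d (inr x) = inr y -> (x = mv _ a /\ y = mw _ b) \/ (x = mw _ b /\ y = mv _ a)].
Proof.
have lt1 : (j.+1 < N.+1)%N by have := ltn_ord a; have := ltn_ord b; have := ltn_ord j; lia.
have rj : (r - j = (r - j.+1).+1)%N by have := ltn_ord a; lia.
have sj : (s - j = (s - j.+1).+1)%N by have := ltn_ord b; lia.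
have dex : exists2 d : diag (w (Ordinal lt1)) (w j), capless d &
    forall x y, d (inr x) = inr y -> (x = (r - j.+1)%N :> nat /\ y = (r - j.+1).+1 :> nat)
      \/ (x = (r - j.+1).+1 :> nat /\ y = (r - j.+1)%N :> nat).
  have wE : w j = nseq (r - j.+1) vee ++ [:: vee; wedge] ++ nseq (s - j.+1) wedge.
    by rewrite [LHS]/(nseq (r - j) vee ++ nseq (s - j) wedge) rj sj; exact: nseq_wall.
  by have [d [dc dE _]] := wall_cup wE; exists d.
have [d dc dE] := dex.
have lta : (r - j.+1 < r - j)%N by rewrite rj.
have ltb : (0 < s - j)%N by rewrite sj.
pose a1 := Ordinal lta; pose b1 := Ordinal ltb.
have a1E x : (x : 'I_(size (w j))) = (r - j.+1)%N :> nat -> x = mv _ a1 by move=> xE; apply: val_inj.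
have b1E x : (x : 'I_(size (w j))) = (r - j.+1).+1 :> nat -> x = mw _ b1.
  by move=> xE; apply: val_inj; rewrite /= xE addn0 -rj.
have dE' x y : d (inr x) = inr y -> (x = mv _ a1 /\ y = mw _ b1) \/ (x = mw _ b1 /\ y = mv _ a1).
  by move=> /dE[] [h1 h2]; [left | right]; split; by [apply: a1E | apply: b1E].
pose g : 'S_(r - j) * 'S_(s - j) := (tperm a1 a, tperm b1 b).
have ga : perm_diag2 g (inl (mv _ a1)) = inr (mv _ a) by rewrite [LHS](pd_mv g a1) /= tpermL.
have gb : perm_diag2 g (inl (mw _ b1)) = inr (mw _ b) by rewrite [LHS](pd_mw g b1) /= tpermL.
have ncup : has_cup d.
  case: (boolP (has_cup d)) => // nc; have := nocup_size dc nc; rewrite !size_family /=.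
  by rewrite rj sj; lia.
have dab : d (inr (mv _ a1)) = inr (mw _ b1).
  case/existsP: ncup => -[//|x] /= dx; case dxE: (d (inr x)) dx => [//|y] _.
  by case: (dE' _ _ dxE) => -[xE yE]; rewrite xE yE in dxE; [|apply: diag_inv].
exists (Ordinal lt1), (comp d (perm_diag2 g)); split=> //.
- by apply: capless_comp => //; apply: pw_capless.
- exact: comp_pull (diag_inv ga) dab gb.
move=> x y cxy; case gx: (perm_diag2 g (inr x)) => [x1|x1]; last first.
  by have /nocupP/(_ x)[z] := pw_nocup g; rewrite gx.
case dx: (d (inr x1)) => [z|y1]; first by rewrite (comp_through' gx dx) in cxy.
have [y2 gy] : exists y2, perm_diag2 g (inl y1) = inr y2 by have /caplessP := pw_capless g.
move: cxy; rewrite (comp_pull gx dx gy) => -[<-].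
case: (dE' _ _ dx) => -[xE yE]; rewrite xE in gx; rewrite yE in gy; [left|right].
  by split; [have := diag_inv gx; rewrite ga => -[] | move: gy; rewrite gb => -[]].
by split; [have := diag_inv gx; rewrite gb => -[] | move: gy; rewrite ga => -[]].
Qed.

End Kappa.

Section MixedTensorModule.

Variables (k : fieldType) (delta : k) (V : superspace k) (m n : nat).
Variables (E : homog_basis V m n) (F : OBfunctor delta V) (r s : nat).
Hypothesis r_unit : (r`!%:R : k) != 0.
Hypothesis s_unit : (s`!%:R : k) != 0.
Hypothesis m_large : (r + s <= m)%N.
Local Notation D := (m + n)%N.
Local Notation labs := (labs m n).
Local Notation etens := (etens E).
Local Notation crd := (crd E).
Local Notation form := (form E).
Local Notation N := (minn r s).
Local Notation w := (@mixed_family r s).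
Local Notation A := (walled_Brauer_c delta r s).
Local Notation B := (wb_layering delta r_unit s_unit).
Local Notation T := (mixed_tensors_c F r s).
Local Notation tin i := (@tin k delta V F _ w i).
Local Notation gr := (@gr k A B).
Local Notation G := (fun l : 'I_N.+1 => ('S_(r - l) * 'S_(s - l))%type).
Implicit Types (i j l : 'I_N.+1) (c : cupdiag r s).

Let regc l j (d : diag (w l) (w j)) (dc : capless d) := regular_capless E F dc.

Definition tproj i (x : T) : tens V (w i) := (x : dsum (fun i => tens V (w i))) i.

Lemma tproj_tin i x : tproj i (tin i x) = x. Proof. exact: tin_same. Qed.

Lemma tin_inj i : injective (tin i).
Proof. by move=> x y xy; rewrite -(tproj_tin x) xy tproj_tin. Qed.

Lemma ide_tin i (x : T) : @ide k delta r s i ** x = tin i (tproj i x).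
Proof. by rewrite [LHS](@act_bb k delta V F N w i i (diag1 (w i)) x) obF1. Qed.

Lemma cce_tin c (x : T) : cce delta c ** x = tin (ctgt c) (obF F (cdg c) (tproj _ x)).
Proof. exact: act_bb. Qed.

Lemma cst_tin c (x : T) : cst delta c ** x = tin (csrc c) (obF F (flip (cdg c)) (tproj _ x)).
Proof. exact: act_bb. Qed.

Lemma mem_gr_tin l (x : T) : reflect (exists y, x = tin l y) (x \in gr T l).
Proof.
rewrite (@mem_gr k A B T l x) [@le k A B l ** x](ide_tin l x); apply: (iffP eqP) => [<-|[y ->]].
  by exists (tproj l x).
by rewrite tproj_tin.
Qed.

Definition tinl l : 'Hom(tens V (w l), T) := linfun (tin l).

Lemma tinlE l x : tinl l x = tin l x.
Proof.
pose f : {linear _ -> _} := HB.pack (tin l) (GRing.isLinear.Build _ _ _ _ _ (@tin_linear k delta V F _ w l)).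
by rewrite -[tinl l]/(linfun f) lfunE.
Qed.

Lemma tinl_ker l : lker (tinl l) = 0%VS.
Proof.
apply: vspace_eq0P => x; rewrite memv_ker tinlE => /eqP x0.
by apply: (@tin_inj l); rewrite x0 -tinlE linear0.
Qed.

Lemma gr_tinl l : gr T l = limg (tinl l).
Proof.
apply/vspaceP => x; apply/mem_gr_tin/memv_imgP => [[y ->]|[y _ ->]]; exists y; rewrite ?memvf // tinlE //.
Qed.

(* The part of V^(r-l) W^(s-l) coming from the layers above l. *)
Definition Kt l : {vspace tens V (w l)} := (tinl l @^-1: @KK k A B T fullv)%VS.

Lemma Kt_cup l j (d : diag (w l) (w j)) x : capless d -> (j < l)%N -> obF F d x \in Kt j.
Proof.
move=> dc jl; rewrite -memv_preim tinlE.
have [c [g [cl cj dE]]] := capless_cce delta dc.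
have -> : tin j (obF F d x) = cce delta c ** (@hel k delta r s l g ** tin l x).
  by rewrite -act_mul -dE; apply/esym/act_bb_tin.
apply: (@mem_KK k A B T fullv c); last exact: memvf.
apply: contraTneq jl => ce; rewrite -cl -cj [in ctgt _]ce.
by rewrite [ctgt _]/(csrc c) ltnn.
Qed.

Lemma Kt_ind l (X : {vspace tens V (w l)}) :
  (forall j (d : diag (w j) (w l)) x, capless d -> (l < j)%N -> obF F d x \in X) -> (Kt l <= X)%VS.
Proof.
move=> h; pose p : 'Hom(T, tens V (w l)) := linfun (tproj l).
have pE x : p x = tproj l x.
  have pl : linear (tproj l) by move=> c x1 y1; rewrite /tproj dsum_addE dsum_scaleE.
  pose f : {linear _ -> _} := HB.pack (tproj l) (GRing.isLinear.Build _ _ _ _ _ pl).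
  by rewrite -[p]/(linfun f) lfunE.
have /subvP sub : (@KK k A B T fullv <= p @^-1: X)%VS.
  apply: KK_le => c x cu _; rewrite -memv_preim pE [cc c ** x](cce_tin c x).
  have lt := ctgt_lt cu; have [e|ne] := eqVneq (ctgt c) l; last by rewrite /tproj tin_neq ?mem0v.
  by subst l; rewrite tproj_tin; apply: h (cdg_capless c) lt.
apply/subvP => x; rewrite -memv_preim tinlE => /sub; rewrite -memv_preim pE tproj_tin //.
Qed.

Definition inj_lab l (u : seq nat) := forall i j : 'I_(size (w l)), nth 0%N u i = nth 0%N u j -> i = j.

Lemma cup_inj_lab l j (d : diag (w j) (w l)) u x : capless d -> (l < j)%N ->
  u \in labs (w l) -> inj_lab l u -> crd u (obF F d x) = 0.
Proof.
move=> dc lj ul uinj; rewrite crd_obF big_seq big1 // => v vj.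
apply/eqP; rewrite mulf_eq0 -[X in _ || X]negbK (regc dc).1 //; apply/orP; right.
apply/negP => /consistentP h.
have : has_cup d.
  case: (boolP (has_cup d)) => // nc; have /family_inj lj' := nocup_size dc nc.
  by rewrite lj' ltnn in lj.
case/existsP => -[//|y] /=; case dy: (d (inr y)) => [//|z] _.
have := h (inr y); rewrite dy /= => /uinj zy.
by have := diag_neq d (inr y); rewrite dy zy eqxx.
Qed.

(* The cups (x, y) that the labels of a basis tensor would allow a diagram to
   have, if a cup between the positions x and y were to carry the label x + y. *)
Definition matched j (t : seq nat) (x : 'I_(r - j)) (y : 'I_(s - j)) :=
  (nth 0%N t (mv (s - j) x) == x + y)%N && (nth 0%N t (mw (r - j) y) == x + y)%N.

Definition good i j (d : diag (w i) (w j)) (t : seq nat) :=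
  [forall x : 'I_(r - j), forall y : 'I_(s - j), matched t x y == (d (inr (mv (s - j) x)) == inr (mw (r - j) y))].

Lemma good_unique c c' t : ctgt c = ctgt c' -> good (cdg c) t -> good (cdg c') t -> c = c'.
Proof.
move=> cc gc gc'; apply: cupdiag_eq => //; move: gc gc'.
rewrite /good; move: (cdg c) (cdg c'); move: cc; rewrite -/(ctgt c').
move: (ctgt c) (ctgt c') => j j' jj; subst j' => d d' /forallP gd /forallP gd'.
have dd a (e : diag a (w j)) x y : e (inr x) = inr y ->
    exists u v, (x = mv _ u /\ y = mw _ v) \/ (x = mw _ v /\ y = mv _ u).
  move=> exy; have := diag_sgn e (inr x); rewrite exy /= => /negb_inj.
  case: (mixed_cases x) => -[u ->]; rewrite ?nth_mv ?nth_mw => yl.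
    by have [v ->] := @letter_mw (r - j) (s - j) y yl; exists u, v; left.
  by have [v ->] := @letter_mv (r - j) (s - j) y yl; exists v, u; right.
have key u v : (d (inr (mv _ u)) == inr (mw _ v)) = (d' (inr (mv _ u)) == inr (mw _ v)).
  have /forallP/(_ v)/eqP <- := gd u; have /forallP/(_ v)/eqP <- := gd' u.
  by [].
apply/cupseqP => x y; split=> exy; have [u [v [] [xE yE]]] := dd _ _ _ _ exy; subst x y.
- by apply/eqP; rewrite -key exy.
- by apply: diag_inv; apply/eqP; rewrite -key; apply/eqP/diag_inv.
- by apply/eqP; rewrite key exy.
- by apply: diag_inv; apply/eqP; rewrite key; apply/eqP/diag_inv.
Qed.

Lemma sum_good : (\sum_c count (good (cdg c)) (labs (w (ctgt c))) <= \sum_j dim (tens V (w j)))%N.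
Proof.
rewrite (partition_big (@ctgt r s) xpredT) //=; apply: leq_sum => j _.
rewrite (dim_tens E) -(size_labs m n) -sum1_size.
rewrite (eq_bigr (fun c => \sum_(t <- labs (w j)) good (cdg c) t)%N) => [|c /eqP <-]; last first.
  by rewrite -sum1_count big_mkcond; apply: eq_bigr => t _; case: (good _ t).
rewrite exchange_big /=; apply: leq_sum => t _.
have [[c /andP[cj ct]]|no] := classic (exists c, (ctgt c == j) && good (cdg c) t).
  rewrite (bigD1 c) //= ct big1 // => c' /andP[cj' ne].
  apply/eqP; rewrite eqb0; apply: contra ne => ct'; apply/eqP.
  by apply: good_unique ct' ct; rewrite (eqP cj) (eqP cj').
rewrite big1 // => c cj; apply/eqP; rewrite eqb0; apply/negP => ct; apply: no.
by exists c; rewrite cj.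
Qed.

(* The sum of qcost a and qcost b at i exceeds that at a + b by 2 (i - a - b)^2. *)
Definition qcost a (i : nat) := (i * i + 4 * a * (D - i))%N.

Lemma qcost_lt a b (i : nat) : (i < D)%N -> (a + b < D)%N -> i != (a + b)%N ->
  (qcost a (a + b) + qcost b (a + b) < qcost a i + qcost b i)%N.
Proof.
move=> iD abD /eqP ne; rewrite /qcost.
have [e eE] : exists e, D = (a + b + e)%N by exists (D - (a + b))%N; rewrite subnKC // ltnW.
have [f fE] : exists f, D = (i + f)%N by exists (D - i)%N; rewrite subnKC // ltnW.
have -> : (D - (a + b) = e)%N by lia.
have -> : (D - i = f)%N by lia.
have [lt|le] := ltnP i (a + b); nia.
Qed.

Lemma lt_ab j (a : 'I_(r - j)) (b : 'I_(s - j)) : (a + b < D)%N.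
Proof. by have := ltn_ord a; have := ltn_ord b; lia. Qed.

Lemma bound_step (b c c' q : nat) : (b - c < q.+1)%N -> (c < c')%N -> (c' <= b)%N -> (b - c' < q)%N.
Proof. lia. Qed.

(* Modulo Kt, a basis tensor with an unwanted match (x, y) is a combination of
   basis tensors whose labels at x and y are equal but not x + y. *)
Lemma good_span l j (d : diag (w l) (w j)) : capless d -> exists S : seq (seq nat),
  [/\ (size S <= count (good d) (labs (w j)))%N,
      {subset S <= labs (w l)} &
      forall t, t \in labs (w l) ->
        etens (w l) t \in (Kt l + <<[seq etens (w l) u | u <- S]>>)%VS].
Proof.
move=> dc; have /caplessP/fin_all_exists[f fP] := dc.
pose bpos (y : 'I_(size (w j))) : nat := if (y < r - j)%N then y : nat else (y - (r - j))%N.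
have bv x : bpos (mv _ x) = x by rewrite /bpos /= ltn_ord.
have bw y : bpos (mw _ y) = y by rewrite /bpos /= ltnNge leq_addr /= addKn.
pose lab (t : seq nat) (y : 'I_(size (w j))) : nat :=
  match d (inr y) with inl i => nth 0%N t i | inr z => (bpos y + bpos z)%N end.
pose ext (t : seq nat) := [seq lab t y | y : 'I_(size (w j))].
have sext t : size (ext t) = size (w j) by rewrite size_map -cardE card_ord.
have extE t (y : 'I_(size (w j))) : nth 0%N (ext t) y = lab t y.
  by rewrite (nth_map y) ?nth_ord_enum // size_enum_ord.
have bpD (y z : 'I_(size (w j))) : d (inr y) = inr z -> (bpos y + bpos z < D)%N.
  move=> yz; have := diag_sgn d (inr y); rewrite yz /= => /negb_inj.
  case: (mixed_cases y) => -[u ->]; rewrite ?nth_mv ?nth_mw => zl.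
    have [v ->] := @letter_mw (r - j) (s - j) z zl; rewrite bv bw.
    exact: lt_ab.
  have [v ->] := @letter_mv (r - j) (s - j) z zl; rewrite bv bw.
  by rewrite addnC; exact: lt_ab.
have ext_labs t : t \in labs (w l) -> ext t \in labs (w j).
  move=> tl; rewrite labsP sext eqxx; apply/allP => _ /mapP[y _ ->]; rewrite /lab.
  case dy: (d (inr y)) => [i|z]; last exact: bpD.
  by move: tl; rewrite labsP => /andP[/eqP st /allP]; apply; apply: mem_nth; rewrite st.
have ext_f t (i : 'I_(size (w l))) : nth 0%N (ext t) (f i) = nth 0%N t i.
  by rewrite extE /lab (diag_inv (fP i)).
have ext_inj t u : t \in labs (w l) -> u \in labs (w l) -> ext t = ext u -> t = u.
  move=> tl ul tu; apply: (lbl_eq (labs_size tl) (labs_size ul)) => i.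
  by rewrite -!ext_f tu.
exists [seq t <- labs (w l) | good d (ext t)]; split.
- rewrite size_filter -!size_filter -(size_map ext); apply: uniq_leq_size.
    rewrite map_inj_in_uniq ?filter_uniq ?labs_uniq // => t u.
    by rewrite !mem_filter => /andP[_ tl] /andP[_ ul]; apply: ext_inj.
  move=> _ /mapP[t + ->]; rewrite !mem_filter => /andP[-> tl].
  exact: ext_labs.
- by move=> t; rewrite mem_filter => /andP[].
set X := (_ + _)%VS.
pose cost (t : seq nat) := (\sum_(i < size (w l)) qcost (bpos (f i)) (nth 0 t i))%N.
pose bnd := (size (w l) * (D * D + 4 * size (w j) * D))%N.
have cost_le t : t \in labs (w l) -> (cost t <= bnd)%N.
  move=> tl; rewrite /cost /bnd -[X in (X * _)%N]card_ord -sum_nat_const; apply: leq_sum => i _.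
  have tD : (nth 0 t i < D)%N.
    by move: tl; rewrite labsP => /andP[/eqP st /allP]; apply; apply: mem_nth; rewrite st.
  have fj : (bpos (f i) <= size (w j))%N.
    by rewrite /bpos; have := ltn_ord (f i); case: ifP => _; lia.
  rewrite /qcost leq_add //; first by rewrite leq_mul // ltnW.
  by rewrite leq_mul // ?leq_subr // leq_mul.
move=> t; have [q] := ubnP (bnd - cost t); elim: q t => // q IHq t lt tl.
have [gt|] := boolP (good d (ext t)).
  apply: (subvP (addvSr _ _)); apply/memv_span/map_f; by rewrite mem_filter gt.
case/forallPn => a /forallPn[b] => mb.
have dV : (d (inr (mv (s - j) a)) == inr (mw (r - j) b)) -> matched (ext t) a b.
  move=> /eqP ab; rewrite /matched !extE /lab ab (diag_inv ab) !bv !bw.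
  by rewrite eqxx addnC eqxx.
have [mab nab] : matched (ext t) a b /\ ~~ (d (inr (mv _ a)) == inr (mw _ b)).
  move: mb dV;  case: (matched _ _ _); case: (_ == inr _) => // _ h.
  by have := h isT.
have /andP[/eqP ta /eqP tb] := mab.
have [i1 di1] : exists i1 : 'I_(size (w l)), d (inr (mv _ a)) = inl i1.
  case da: (d (inr (mv _ a))) => [i1|z]; first by exists i1.
  have := diag_sgn d (inr (mv _ a)); rewrite da /= nth_mv => /negb_inj zl.
  have [b' zE] := @letter_mw (r - j) (s - j) z zl.
  move: ta; rewrite extE /lab da zE bv bw => /addnI bb'.
  by case/eqP: nab; rewrite da zE; congr (inr (mw _ _)); apply: val_inj.
have [i2 di2] : exists i2 : 'I_(size (w l)), d (inr (mw _ b)) = inl i2.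
  case db: (d (inr (mw _ b))) => [i2|z]; first by exists i2.
  have := diag_sgn d (inr (mw _ b)); rewrite db /= nth_mw => /negb_inj zl.
  have [a' zE] := @letter_mv (r - j) (s - j) z zl.
  move: tb; rewrite extE /lab db zE bv bw addnC => /addIn aa'.
  have aE : a' = a by apply: val_inj.
  by case/eqP: nab; rewrite -aE -zE; apply: diag_inv.
have f1 : f i1 = mv _ a by have := fP i1; rewrite (diag_inv di1) => -[].
have f2 : f i2 = mw _ b by have := fP i2; rewrite (diag_inv di2) => -[].
have [x1 x1E] : exists x1, i1 = mv (s - l) x1.
  by apply: (@letter_mv (r - l) (s - l)); have := diag_sgn d (inr (mv _ a)); rewrite di1 /= negbK nth_mv.
have [y2 y2E] : exists y2, i2 = mw (r - l) y2.
  by apply: (@letter_mw (r - l) (s - l)); have := diag_sgn d (inr (mw _ b)); rewrite di2 /= negbK nth_mw.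
have t1 : nth 0%N t i1 = (a + b)%N by rewrite -ext_f f1.
have t2 : nth 0%N t i2 = (a + b)%N by rewrite -ext_f f2.
have [l' [kap [kc l'E k12 kE]]] := kappa_exists x1 y2.
have ll' : (l < l')%N by rewrite l'E.
rewrite -x1E -y2E in k12 kE.
have /caplessP/fin_all_exists[g gP] := kc.
pose t' := [seq nth 0%N t (g i) | i : 'I_(size (w l'))].
have t'E (i : 'I_(size (w l'))) : nth 0%N t' i = nth 0%N t (g i).
  by rewrite (nth_map i) ?nth_ord_enum // size_enum_ord.
have t'l : t' \in labs (w l').
  rewrite labsP size_map -cardE card_ord eqxx; apply/allP => _ /mapP[i _ ->].
  by move: tl; rewrite labsP => /andP[/eqP st /allP]; apply; apply: mem_nth; rewrite st.
have kt : consistent kap t' t.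
  apply/consistentP => -[i|y]; first by rewrite gP /= t'E.
  case ky: (kap (inr y)) => [i|z]; first by have := gP i; rewrite (diag_inv ky) /= t'E => -[->].
  by case: (kE _ _ ky) => -[-> ->] /=; rewrite t1 t2.
have ck : crd t (obF F kap (etens (w l') t')) != 0 by rewrite (regc kc).1.
have Kx : obF F kap (etens (w l') t') \in X.
  by apply: (subvP (addvSl _ _)); apply: Kt_cup.
have : crd t (obF F kap (etens (w l') t')) *: etens (w l) t \in X.
  have := Kx; rewrite {1}(etens_span E (obF F kap (etens (w l') t'))).
  rewrite (bigD1_seq t) ?labs_uniq //= rpredDr //.
  rewrite big_seq_cond memv_suml // => u /andP[ul ut].
  have [->|cu] := eqVneq (crd u (obF F kap (etens (w l') t'))) 0; first by rewrite scale0r mem0v.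
  apply: memvZ; apply: IHq => //; rewrite (regc kc).1 // in cu.
  have /consistentP hu := cu.
  have uo (y : 'I_(size (w l))) : y != i1 -> y != i2 -> nth 0%N u y = nth 0%N t y.
    move=> y1 y2'; case ky: (kap (inr y)) => [i|z]; last first.
      by case: (kE _ _ ky) => -[yE _]; rewrite yE eqxx in y1 y2'.
    have := hu (inr y); rewrite ky /= => <-; rewrite t'E.
    by have := gP i; rewrite (diag_inv ky) => -[<-].
  have u12 : nth 0%N u i2 = nth 0%N u i1.
    by have := hu (inr i1); rewrite k12.
  have i12 : i2 != i1.
    by apply/eqP => e; have := diag_neq kap (inr i1); rewrite k12 e eqxx.
  have u1 : nth 0%N u i1 != (a + b)%N.
    apply: contra ut => /eqP u1; apply/eqP/(lbl_eq (labs_size ul) (labs_size tl)) => y.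
    have [->|y1] := eqVneq y i1; first by rewrite u1 t1.
    have [->|y2'] := eqVneq y i2; first by rewrite u12 u1 t2.
    exact: uo.
  have uD : (nth 0%N u i1 < D)%N.
    by move: ul; rewrite labsP => /andP[/eqP su /allP]; apply; apply: mem_nth; rewrite su.
  have abD := lt_ab a b.
  have : (cost t < cost u)%N.
    rewrite /cost (bigD1 i1) // (bigD1 i2) //= [X in (_ < X)%N](bigD1 i1) // [X in (_ < _ + X)%N](bigD1 i2) //=.
    rewrite !addnA f1 f2 bv bw t1 t2 u12.
    rewrite (eq_bigr (fun i : 'I_(size (w l)) => qcost (bpos (f i)) (nth 0 u i))) => [|i /andP[h1 h2]]; last by rewrite uo.
    by rewrite ltn_add2r -[X in (X < _)%N]addnA -[X in (_ < X)%N]addnA; apply: (qcost_lt uD abD u1).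
  by move/(bound_step lt); apply; apply: cost_le.
by move/(memvZ (crd t (obF F kap (etens (w l') t')))^-1); rewrite scalerA mulVf // scale1r.
Qed.

End MixedTensorModule.

Section MixedTensorTilting.

Variables (k : fieldType) (delta : k) (V : superspace k) (m n : nat).
Variables (E : homog_basis V m n) (F : OBfunctor delta V) (r s : nat).
Hypothesis r_unit : (r`!%:R : k) != 0.
Hypothesis s_unit : (s`!%:R : k) != 0.
Hypothesis m_large : (r + s <= m)%N.
Local Notation D := (m + n)%N.
Local Notation labs := (labs m n).
Local Notation etens := (etens E).
Local Notation crd := (crd E).
Local Notation form := (form E).
Local Notation N := (minn r s).
Local Notation w := (@mixed_family r s).
Local Notation A := (walled_Brauer_c delta r s).
Local Notation B := (wb_layering delta r_unit s_unit).
Local Notation Y := (wb_labelling delta r_unit s_unit).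
Local Notation T := (mixed_tensors_c F r s).
Local Notation tin i := (@tin k delta V F N w i).
Local Notation tinl l := (@tinl k delta V F r s l).
Local Notation gr := (@gr k A B T).
Local Notation KK := (@KK k A B T).
Local Notation ZZ := (@ZZ k A B T).
Local Notation Kt l := (@Kt k delta V F r s r_unit s_unit l).
Local Notation G := (fun l : 'I_N.+1 => ('S_(r - l) * 'S_(s - l))%type).
Local Notation pw := (@perm_diag2 r s _).
Implicit Types (i j l : 'I_N.+1) (c : cupdiag r s).

Let regc l j (d : diag (w l) (w j)) (dc : capless d) := regular_capless E F dc.

Lemma dim_tinl l (X : {vspace tens V (w l)}) : \dim (tinl l @: X) = \dim X.
Proof. by rewrite dim_limg_inj // tinl_ker capv0. Qed.

Lemma dim_cap_gr l (X : {vspace T}) : \dim (X :&: gr l) = \dim (tinl l @^-1: X).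
Proof. by rewrite gr_tinl -(dim_tinl (tinl l @^-1: X)%VS) -lpreim_cap_limg lpreimK // capvSr. Qed.

Lemma top_good c :
  (@top k A B T (csrc c) 0 fullv <= count (good (cdg c)) (labs (w (ctgt c))))%N.
Proof.
have [S [sS _ hS]] := good_span E F r_unit s_unit m_large (cdg_capless c).
apply: leq_trans sS; rewrite /top addv0 !dim_cap_gr -/(Kt (csrc c)) leq_subLR.
have -> : (tinl (csrc c) @^-1: fullv = Kt (csrc c) + <<[seq etens (w (csrc c)) u | u <- S]>>)%VS.
  apply/eqP; rewrite eqEsubv; apply/andP; split; apply/subvP => x _; last by rewrite -memv_preim memvf.
  rewrite (etens_span E x) big_seq memv_suml // => t tl; rewrite memvZ //; exact: hS.
apply: leq_trans (dimv_add_leqif _ _) _; rewrite leq_add2l.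
by apply: leq_trans (dim_span _) _; rewrite size_map.
Qed.

Lemma mixed_tensors_free : free_over B 0 (fullv : {vspace T}).
Proof.
rewrite /free_over /tops dimv0 subn0 -(@sum_csize k A B (fun l => @top k A B T l 0 fullv)).
rewrite dimvf; apply: leq_trans (sum_good E r s); apply: leq_sum => c _; exact: top_good.
Qed.

Lemma flip_ZZ l j (d : diag (w j) (w l)) (y : tens V (w l)) : capless d -> (l < j)%N ->
  tin l y \in ZZ 0 fullv -> obF F (flip d) y = 0.
Proof.
move=> dc lj /mem_ZZ[_ h]; have nc : ~~ has_cup (flip d) by rewrite -capless_flip flipK.
have [c [g [cj cl dE]]] := nocup_cst delta nc.
apply: (@tin_inj k delta V F r s j).
apply: etrans (esym (@act_bb_tin k delta V F N w l j (flip d) y)) _.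
apply: etrans (congr1 (fun a => a ** tin l y) dE) _; rewrite act_mul.
have h0 : cst delta c ** tin l y = 0.
  apply/eqP; rewrite -memv0; apply: h.
  by apply: contraTneq lj => ce; rewrite -cl -cj [in ctgt _]ce [ctgt _]/(csrc c) ltnn.
apply: etrans (congr1 (fun z => hel delta g ** z) h0) _; rewrite linear0.
by rewrite -tinlE linear0.
Qed.

Lemma perp_Kt l y x : tin l y \in ZZ 0 fullv -> x \in Kt l -> form y x = 0.
Proof.
move=> yZ; have [g gE] := lfun_of_linear (form_linearr E y).
have /subvP sub : (Kt l <= lker g)%VS.
  apply: Kt_ind => j d z dc lj; rewrite memv_ker gE -(regular_flip _ _ (regc dc)).
  by rewrite (flip_ZZ dc lj yZ) form_C; have := formZr E z 0 0; rewrite scaler0 mul0r => ->.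
by move=> /sub; rewrite memv_ker gE => /eqP.
Qed.

Lemma soc_good c :
  (@soc k A B T (csrc c) 0 fullv <= count (good (cdg c)) (labs (w (ctgt c))))%N.
Proof.
set l := csrc c.
have [S [sS Sl hS]] := good_span E F r_unit s_unit m_large (cdg_capless c).
apply: leq_trans sS; rewrite /soc dim_cap_gr; apply: leq_trans (leq_subr _ _) _.
set Z := (_ @^-1: _)%VS.
have ql : linear (fun y : tens V (w l) => \sum_(t <- undup S) crd t y *: etens (w l) t).
  move=> a x y; rewrite scaler_sumr -big_split; apply: eq_bigr => t _.
  by rewrite crd_linear scalerDl scalerA.
have [q qE] := lfun_of_linear ql.
have Zq : (Z :&: lker q)%VS = 0%VS.
  apply: vspace_eq0P => y; rewrite memv_cap -memv_preim tinlE memv_ker => /andP[yZ /eqP y0].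
  apply: (@form_nondeg _ _ _ _ E) => x.
  have : x \in (Kt l + <<[seq etens (w l) u | u <- S]>>)%VS.
    rewrite (etens_span E x) big_seq memv_suml // => t tl; rewrite memvZ //; exact: hS.
  case/memv_addP => x1 /(perp_Kt yZ) yx1 [x2 x2S ->].
  have [g gE] := lfun_of_linear (form_linearr E y).
  have fD : form y (x1 + x2) = form y x1 + form y x2.
    by have := form_linearr E y 1 x1 x2; rewrite !scale1r.
  rewrite fD yx1 add0r.
  have /subvP/(_ _ x2S) : (<<[seq etens (w l) u | u <- S]>> <= lker g)%VS.
    apply/span_subvP => _ /mapP[u uS ->]; rewrite memv_ker gE form_etens ?Sl //.
    have [p pE] := lfun_of_linear (@crd_linear k V m n E (w l) u).
    have cu : crd u y = p (q y).
      rewrite pE qE crd_sum (bigD1_seq u) ?undup_uniq ?mem_undup //=.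
      rewrite (crdZ E u (crd u y) (etens (w l) u)) (crd_etens E (Sl _ uS) (Sl _ uS)) eqxx mulr1.
      rewrite big_seq_cond big1 ?addr0 // => t /andP[]; rewrite mem_undup => tS tu.
      by rewrite (crdZ E u (crd t y) (etens (w l) t)) (crd_etens E (Sl _ tS) (Sl _ uS)) (negPf tu) mulr0.
    by rewrite cu y0 linear0 mulr0.
  by rewrite memv_ker gE => /eqP.
rewrite -(dim_limg_inj Zq).
apply: (@leq_trans (\dim <<[seq etens (w l) u | u <- S]>>)).
  apply: dimvS; apply/subvP => _ /memv_imgP[y _ ->]; rewrite qE big_seq memv_suml // => t tS.
  by rewrite memvZ // memv_span // map_f // -mem_undup.
by apply: leq_trans (dim_span _) _; rewrite size_map.
Qed.

Lemma mixed_tensors_cofree : cofree_over B 0 (fullv : {vspace T}).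
Proof.
rewrite /cofree_over /socs dimv0 subn0 -(@sum_csize k A B (fun l => @soc k A B T l 0 fullv)).
rewrite dimvf; apply: leq_trans (sum_good E r s); apply: leq_sum => c _; exact: soc_good.
Qed.

Section Label.

Variable l : 'I_N.+1.
Local Notation v := (etens (w l) (iota 0 (size (w l)))).
Local Notation galgG := (galg k (G l)).

Lemma size_w_le : (size (w l) <= D)%N.
Proof. by rewrite size_family; lia. Qed.

Lemma iota_labs : iota 0 (size (w l)) \in labs (w l).
Proof.
rewrite labsP size_iota eqxx; apply/allP => i; rewrite mem_iota => /andP[_ il].
exact: leq_trans il size_w_le.
Qed.

Lemma iota_inj : inj_lab l (iota 0 (size (w l))).
Proof. by move=> i j; rewrite !nth_iota ?ltn_ord // => /val_inj. Qed.

(* The labels carried to the upper line by the permutation diagram of h when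
   the lower line is labelled 0, 1, 2, and so on. *)
Lemma pw_labels (h : G l) : exists u, [/\ u \in labs (w l), inj_lab l u,
  consistent (pw h) (iota 0 (size (w l))) u &
  forall g : G l, consistent (pw g) (iota 0 (size (w l))) u -> g = h].
Proof.
have /nocupP/fin_all_exists[f fP] := pw_nocup h.
have finj : injective f.
  by move=> x y fxy; have := diag_inv (fP x); rewrite fxy (diag_inv (fP y)) => -[].
exists [seq (f x : nat) | x : 'I_(size (w l))].
have uE (x : 'I_(size (w l))) : nth 0%N [seq (f x : nat) | x : 'I_(size (w l))] x = f x.
  by rewrite (nth_map x) ?nth_ord_enum // size_enum_ord.
have nI (i : 'I_(size (w l))) : nth 0%N (iota 0 (size (w l))) i = i by rewrite nth_iota.
split.
- rewrite labsP size_map -cardE card_ord eqxx; apply/allP => _ /mapP[x _ ->].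
  exact: leq_trans (ltn_ord (f x)) size_w_le.
- by move=> x y; rewrite !uE => /val_inj/finj.
- apply/consistentP => -[i|y]; last by rewrite fP /= uE nI.
  have /caplessP/(_ i)[y hi] := pw_capless h; rewrite hi /= uE nI.
  by have := fP y; rewrite (diag_inv hi) => -[->].
move=> g /consistentP cg; apply: (@pw_inj r s l).
have gf y : pw g (inr y) = inl (f y).
  have /nocupP/(_ y)[i gi] := pw_nocup g; have := cg (inr y).
  by rewrite gi /= uE nI => /val_inj->.
apply: diag_ext => -[i|y]; last by rewrite gf fP.
have /caplessP/(_ i)[y gi] := pw_capless g; rewrite gi.
have := gf y; rewrite (diag_inv gi) => -[->].
by rewrite (diag_inv (fP y)).
Qed.

Definition twist (x : galgG) : tens V (w l) := \sum_(g : G l) x g *: obF F (pw g) v.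

Lemma th_tin (x : galgG) : th delta x ** tin l v = tin l (twist x).
Proof.
rewrite /th act_suml /twist -[RHS]tinlE linear_sum; apply: eq_bigr => g _.
by rewrite actZl linearZ /= tinlE; congr (_ *: _); apply: act_bb_tin.
Qed.

Lemma flip_twist j (d : diag (w j) (w l)) (x : galgG) : capless d -> (l < j)%N ->
  obF F (flip d) (twist x) = 0.
Proof.
move=> dc lj; apply: (@form_nondeg _ _ _ _ E) => z; rewrite (regular_flip _ _ (regc dc)).
rewrite form_suml big1 // => g _; rewrite formZl.
rewrite (regc (pw_capless g)).2 pw_flip -obF_comp0; last exact: loops_capless (pw_capless _).
rewrite form_C form_etens ?iota_labs // cup_inj_lab ?mulr0 //; last exact: iota_inj.
- exact: capless_comp (pw_capless _).
- exact: iota_labs.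
Qed.

Lemma cst_twist c (x : galgG) : c != cone l -> cst delta c ** tin l (twist x) = 0.
Proof.
move=> cl; rewrite (cst_tin c); have [e|ne] := eqVneq (ctgt c) l; last first.
  by rewrite /tproj tin_neq 1?eq_sym // linear0 -tinlE linear0.
have cs : c != cone (csrc c).
  apply: contra cl => /eqP ce; have ct : ctgt c = csrc c by rewrite {1}ce.
  by rewrite -e ct; apply/eqP.
move: (ctgt_lt cs) (@flip_twist (csrc c)) => lt ft.
move: (cdg c) (cdg_capless c) => d dc; move: lt d dc; rewrite e => lt d dc.
by rewrite tproj_tin ft // -tinlE linear0.
Qed.

Lemma twist_Kt (x : galgG) : twist x \in Kt l -> x = 0.
Proof.
move=> xK; apply/ffunP => h; rewrite ffunE.
have [u [ul uinj uh ug]] := pw_labels h.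
have [q qE] := lfun_of_linear (@crd_linear k V m n E (w l) u).
have /subvP/(_ _ xK) : (Kt l <= lker q)%VS.
  by apply: Kt_ind => j d z dc lj; rewrite memv_ker qE (cup_inj_lab E F z dc lj ul uinj).
rewrite memv_ker qE /twist crd_sum (bigD1 h) //= big1 ?addr0 => [|g gh]; last first.
  rewrite crdZ; apply/eqP; rewrite mulf_eq0 -[X in _ || X]negbK (regc (pw_capless g)).1 ?iota_labs //.
  by apply/orP; right; apply: contra gh => /ug->.
rewrite crdZ mulf_eq0 => /orP[/eqP //|].
by rewrite -[_ == 0]negbK (regc (pw_capless h)).1 ?iota_labs // uh.
Qed.

End Label.

Lemma mixed_tensors_label (lab : Lab Y) : exists f : 'Hom(@Sp k A B Y lab, T),
  [/\ equivariant (@rho k A B Y lab) f, killed f & forall y, f y \in KK fullv -> y = 0].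
Proof.
have fl : linear (fun y : subvs_of (spb k lab) => tin (tag lab) (twist (vsval y))).
  move=> a x y; rewrite -!th_tin.
  have e : th delta (vsval (a *: x + y)) = a *: th delta (vsval x) + th delta (vsval y).
    exact: etrans (congr1 (@th k delta r s (tag lab)) (linearP (@vsval _ _ (spb k lab)) a x y)) (th_linear _ _ _ _).
  by apply: etrans (congr1 (fun z => z ** _) e) _; rewrite actDl actZl.
have [f fE] := lfun_of_linear fl; exists f; split.
- move=> g y; apply: etrans (fE _) _; rewrite (fE y) -!th_tin.
  rewrite (wb_rhoE g y) thM th_delta act_mul //.
- by move=> c y cu; rewrite (fE y); apply: cst_twist.
move=> y; rewrite (fE y) => yK; apply: val_inj; rewrite [RHS]linear0.
by apply: twist_Kt; rewrite -memv_preim tinlE.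
Qed.

Lemma mixed_tensors_tilting :
  is_complete_tilting (@bipart_lt r s) (@is_standard k delta r s) T.
Proof.
apply: (@complete_tilting_of k A B Y (@bipart_lt r s)).
- exact: (bipart_ltP r_unit s_unit).
- exact: mixed_tensors_free.
- exact: mixed_tensors_cofree.
exact: mixed_tensors_label.
Qed.

End MixedTensorTilting.

(** * Endomorphisms *)

Section Blocks.

Variables (k : fieldType) (delta : k) (V : superspace k) (F : OBfunctor delta V).
Variables (N : nat) (w : 'I_N.+1 -> word).
Local Notation A := (OBalg delta w).
Local Notation T := (OBmod F w).
Local Notation tn := (fun i => tens V (w i)).
Local Notation tin i := (@tin k delta V F N w i).
Implicit Types (f : 'End(T)).

Definition comp_at i (x : T) : tens V (w i) := (x : dsum tn) i.

Lemma comp_at_linear i : linear (comp_at i).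
Proof. by move=> a x y; rewrite /comp_at dsum_addE dsum_scaleE. Qed.

HB.instance Definition _ i := GRing.isLinear.Build k T (tens V (w i)) _ (comp_at i) (@comp_at_linear i).
HB.instance Definition _ i :=
  GRing.isLinear.Build k (tens V (w i)) T _ (tin i) (@tin_linear k delta V F N w i).

Lemma comp_at_tin i x : comp_at i (tin i x) = x. Proof. exact: tin_same. Qed.

Definition block i (f : 'End(T)) : 'End(tens V (w i)) :=
  linfun (comp_at i \o f \o tin i).

Lemma blockE i f x : block i f x = comp_at i (f (tin i x)).
Proof. by rewrite lfunE. Qed.

Lemma block_linear i : linear (block i).
Proof.
move=> a f g; apply/lfunP => x.
by rewrite add_lfunE scale_lfunE !blockE add_lfunE scale_lfunE linearP.
Qed.

Definition glue_fun (g : forall i, 'End(tens V (w i))) (x : T) : T :=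
  \sum_i tin i (g i (comp_at i x)).

Lemma glue_linear g : linear (glue_fun g).
Proof.
move=> a x y; rewrite /glue_fun scaler_sumr -big_split; apply: eq_bigr => i _.
by rewrite !linearP.
Qed.

HB.instance Definition _ g := GRing.isLinear.Build k T T _ (glue_fun g) (glue_linear g).

Definition blocks g : 'End(T) := linfun (glue_fun g).

Lemma blocksE g x : blocks g x = \sum_i tin i (g i (comp_at i x)).
Proof. by rewrite lfunE. Qed.

Lemma blocks_tin g i x : blocks g (tin i x) = tin i (g i x).
Proof.
rewrite blocksE (bigD1 i) //= comp_at_tin big1 ?addr0 // => j ji.
by rewrite /comp_at tin_neq 1?eq_sym // !linear0.
Qed.

Lemma block_blocks g i : block i (blocks g) = g i.
Proof. by apply/lfunP => x; rewrite blockE blocks_tin comp_at_tin. Qed.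

Lemma block_hom f : is_hom f -> forall i x, f (tin i x) = tin i (block i f x).
Proof.
move=> fh i x; have h := fh (bb delta (diag1 (w i))) (tin i x).
rewrite (@act_bb_tin k delta V F N w) obF1 in h; rewrite h.
by apply: etrans (@act_bb k delta V F N w i i (diag1 (w i)) _) _; rewrite obF1 blockE.
Qed.

Lemma block_natural f : is_hom f ->
  forall i j (d : diag (w i) (w j)) x, block j f (obF F d x) = obF F d (block i f x).
Proof.
move=> fh i j d x; have h := fh (bb delta d) (tin i x).
rewrite (@act_bb_tin k delta V F N w) !(block_hom fh) in h.
have h' := etrans h (@act_bb_tin k delta V F N w i j d _).
by have := congr1 (comp_at j) h'; rewrite !comp_at_tin.
Qed.

Lemma end_ext f f' : (forall i x, f (tin i x) = f' (tin i x)) -> f = f'.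
Proof.
move=> h; apply/lfunP => x; rewrite (T_sum x) !linear_sum; apply: eq_bigr => i _; exact: h.
Qed.

Lemma hom_ext f f' : is_hom f -> is_hom f' -> (forall i, block i f = block i f') -> f = f'.
Proof. by move=> fh fh' h; apply: end_ext => i x; rewrite !block_hom // h. Qed.

Lemma blocks_hom (g : forall i, 'End(tens V (w i))) : (forall i j (d : diag (w i) (w j)) x, g j (obF F d x) = obF F d (g i x)) ->
  is_hom (blocks g).
Proof.
move=> h a x; pose c (b : A) : 'End(T) := ((blocks g \o act T b) - (act T b \o blocks g))%VF.
have cE b v : c b v = blocks g (act T b v) - act T b (blocks g v).
  by rewrite /c add_lfunE opp_lfunE !comp_lfunE.
clearbody c; have cl : linear c.
  move=> b y z; apply/lfunP => v; rewrite add_lfunE scale_lfunE !cE.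
  by rewrite !actDl !actZl linearP scalerBr opprD addrACA.
have [C CE] := lfun_of_linear cl.
have : a \in lker C.
  apply: (@bb_span k delta N w (lker C)) => i j d; rewrite memv_ker CE; apply/eqP.
  apply: end_ext => l v; rewrite zero_lfunE cE; apply/eqP; rewrite subr_eq0; apply/eqP.
  apply: etrans (congr1 (blocks g) (@act_bb k delta V F N w i j d _)) _.
  rewrite blocks_tin h; apply/esym/(etrans (@act_bb k delta V F N w i j d _)).
  congr (tin j (obF F d _)); rewrite blocks_tin.
  have [<-|il] := eqVneq l i; first by rewrite -!/(comp_at _ _) !comp_at_tin.
  by rewrite !tin_neq // linear0.
rewrite memv_ker CE => /eqP/lfunP/(_ x); rewrite zero_lfunE cE => /eqP.
by rewrite subr_eq0 => /eqP.
Qed.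

End Blocks.

Section Adjoint.

Variables (k : fieldType) (V : superspace k) (m n : nat) (E : homog_basis V m n).
Local Notation labs := (labs m n).
Local Notation etens := (etens E).
Local Notation crd := (crd E).
Local Notation form := (form E).

Definition adj_fun a b (g : 'Hom(tens V a, tens V b)) (y : tens V b) : tens V a :=
  \sum_(t <- labs a) ((eps k m a t)^-1 * form (g (etens a t)) y) *: etens a t.

Lemma adj_fun_linear a b (g : 'Hom(tens V a, tens V b)) : linear (adj_fun g).
Proof.
move=> c x y; rewrite /adj_fun scaler_sumr -big_split; apply: eq_bigr => t _.
have -> : form (g (etens a t)) (c *: x + y) = c * form (g (etens a t)) x + form (g (etens a t)) y.
  exact: form_linearr.
by rewrite mulrDr scalerDl scalerA mulrCA.
Qed.

HB.instance Definition _ a b (g : 'Hom(tens V a, tens V b)) :=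
  GRing.isLinear.Build k (tens V b) (tens V a) _ (adj_fun g) (adj_fun_linear g).

Definition adj a b (g : 'Hom(tens V a, tens V b)) : 'Hom(tens V b, tens V a) :=
  linfun (adj_fun g).

Lemma form_adj a b (g : 'Hom(tens V a, tens V b)) x y : form x (adj g y) = form (g x) y.
Proof.
have formb t : t \in labs a -> form (etens a t) (adj g y) = form (g (etens a t)) y.
  move=> ta; rewrite form_C form_etens // lfunE /= crd_sum (bigD1_seq t) ?labs_uniq //=.
  rewrite (crdZ E t _ (etens a t)) (crd_etens E ta ta) eqxx mulr1 big_seq_cond big1 ?addr0.
    by rewrite mulVKf // eps_neq0.
  by move=> u /andP[ua ut]; rewrite (crdZ E t _ (etens a u)) (crd_etens E ua ta) (negPf ut) mulr0.
rewrite (etens_span E x) linear_sum !form_suml big_seq [RHS]big_seq; apply: eq_bigr => t ta.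
by rewrite linearZ !formZl formb.
Qed.

Lemma form_extl a (x x' : tens V a) : (forall y, form x y = form x' y) -> x = x'.
Proof.
move=> h; apply/eqP; rewrite -subr_eq0; apply/eqP/(@form_nondeg _ _ _ _ E) => y.
rewrite form_C; have -> : form y (x - x') = form y x - form y x'.
  by have := form_linearr E y (-1) x' x; rewrite !scaleN1r [- x' + x]addrC [- form y x' + _]addrC.
by rewrite !(form_C E y) h subrr.
Qed.

Lemma form_extr a (x x' : tens V a) : (forall y, form y x = form y x') -> x = x'.
Proof. by move=> h; apply: form_extl => y; rewrite !(form_C E _ y). Qed.

Lemma adjK a b (g : 'Hom(tens V a, tens V b)) : adj (adj g) = g.
Proof. by apply/lfunP => x; apply: form_extl => y; rewrite -[LHS]form_C form_adj form_C form_adj. Qed.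

Lemma adj_linear a b : linear (@adj a b).
Proof.
move=> c f g; apply/lfunP => y; apply: form_extr => x.
rewrite add_lfunE scale_lfunE form_adj add_lfunE scale_lfunE.
have -> : form x (c *: adj f y + adj g y) = c * form x (adj f y) + form x (adj g y).
  exact: form_linearr.
rewrite !form_adj !(form_C E _ y); exact: form_linearr.
Qed.

Lemma adj1 a : adj (\1%VF : 'End(tens V a)) = \1%VF.
Proof. by apply/lfunP => y; apply: form_extr => x; rewrite form_adj !id_lfunE. Qed.

Lemma adjM a b c (f : 'Hom(tens V b, tens V c)) (g : 'Hom(tens V a, tens V b)) :
  adj (f \o g)%VF = (adj g \o adj f)%VF.
Proof. by apply/lfunP => y; apply: form_extr => x; rewrite comp_lfunE !form_adj comp_lfunE. Qed.

End Adjoint.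

Section RingelDual.

Variables (k : fieldType) (delta : k) (V : superspace k) (m n : nat).
Variables (E : homog_basis V m n) (F : OBfunctor delta V) (r s : nat).
Hypothesis m_large : (r + s <= m)%N.
Local Notation D := (m + n)%N.
Local Notation labs := (labs m n).
Local Notation etens := (etens E).
Local Notation crd := (crd E).
Local Notation form := (form E).
Local Notation N := (minn r s).
Local Notation w := (@mixed_family r s).
Local Notation A := (walled_Brauer_c delta r s).
Local Notation T := (mixed_tensors_c F r s).
Implicit Types (i j l : 'I_N.+1).

Lemma cups_exist j : exists c : diag (w j) (w ord0), capless c.
Proof.
case: j => q; elim: q => [|q IHq] qN.
  have -> : Ordinal qN = ord0 by apply: val_inj.
  by exists (diag1 (w ord0)); apply: diag1_capless.
have qN' : (q < N.+1)%N by apply: ltnW.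
have [c cc] := IHq qN'.
have ra : (0 < r - q)%N by lia.
have sb : (0 < s - q)%N by lia.
have [l [d [dc lE _ _]]] := @kappa_exists r s (Ordinal qN') (Ordinal ra) (Ordinal sb).
have le : l = Ordinal qN by apply: val_inj.
by subst l; exists (comp d c); apply: capless_comp.
Qed.

Lemma obF_adjoint i j (d : diag (w i) (w j)) x y :
  form (obF F d x) y = form x (obF F (flip d) y).
Proof.
have [l [c [cc cE]]] := capless_cups d.
have dE : comp (comp d (flip c)) c = d.
  by apply: comp_absorb => // u v; apply: cupseq_cup.
have fc : ~~ has_cup (comp d (flip c)) by apply: nocup_rest.
move: (comp d (flip c)) dE fc => e dE fc.
have -> : obF F d x = obF F c (obF F e x).
  by rewrite -obF_comp0 ?dE // loops_capless.
have -> : obF F (flip d) y = obF F (flip e) (obF F (flip c) y).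
  by rewrite -obF_comp0 -?flip_comp ?dE // loops_flip.
rewrite (regular_capless E F cc).2.
have ec : capless (flip e) by rewrite capless_flip.
by rewrite -{1}[e]flipK (regular_flip _ _ (regular_capless E F ec)).
Qed.

Lemma capless_injective j (c : diag (w j) (w ord0)) : capless c -> injective (obF F c).
Proof.
move=> cc; have [f fP] := fin_all_exists (caplessP _ cc).
have D0 (x : 'I_(size (w ord0))) : (0 < D)%N.
  by have := leq_ltn_trans (leq0n x) (ltn_ord x); rewrite size_family /=; lia.
suff key (x : tens V (w j)) : obF F c x = 0 -> x = (0 : tens V (w j)).
  move=> x y xy; apply/eqP; rewrite -subr_eq0; apply/eqP/key; rewrite linearB /= xy subrr //.
move=> x0; apply: (@tens_ext k V m n E (w j) x 0) => v vj.
have [p pE] := lfun_of_linear (@crd_linear k V m n E (w j) v); rewrite -[RHS]pE linear0.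
pose u := [seq (if c (inr y) is inl i then nth 0%N v i else 0%N) | y : 'I_(size (w ord0))].
have uE (y : 'I_(size (w ord0))) :
    nth 0%N u y = if c (inr y) is inl i then nth 0%N v i else 0%N.
  by rewrite (nth_map y) ?nth_ord_enum // size_enum_ord.
have ul : u \in labs (w ord0).
  rewrite labsP size_map -cardE card_ord eqxx; apply/allP => _ /mapP[y _ ->].
  case: (c (inr y)) => [i|_]; last exact: D0 y.
  by move: vj; rewrite labsP => /andP[/eqP sv /allP]; apply; apply: mem_nth; rewrite sv.
have cons v' : v' \in labs (w j) -> consistent c v' u = (v' == v).
  move=> v'j; apply/consistentP/eqP => [h|->].
    apply: (lbl_eq (labs_size v'j) (labs_size vj)) => i.
    by have := h (inl i); rewrite fP /= uE (diag_inv (fP i)).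
  move=> -[i|y]; first by rewrite fP /= uE (diag_inv (fP i)).
  case cy: (c (inr y)) => [i|z] /=; rewrite !uE cy //.
  by rewrite (diag_inv cy).
have [p' pE'] := lfun_of_linear (@crd_linear k V m n E (w ord0) u).
have := crd_obF E F c x u; rewrite -[LHS]pE' x0 linear0.
rewrite (bigD1_seq v) ?labs_uniq //= big_seq_cond big1 ?addr0 => [|v' /andP[v'j vv]]; last first.
  apply/eqP; rewrite mulf_eq0 -[X in _ || X]negbK (regular_capless E F cc).1 // cons // vv.
  by rewrite orbT.
move/esym/eqP; rewrite mulf_eq0 -[X in _ || X]negbK (regular_capless E F cc).1 // cons // eqxx.
by rewrite orbF => /eqP.
Qed.

Lemma flip_surjective j (c : diag (w j) (w ord0)) y : capless c ->
  exists x, y = obF F (flip c) x.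
Proof.
move=> cc; have ker : (lker (obF F c) <= lker (\1%VF : 'End(tens V (w j))))%VS.
  apply/subvP => x; rewrite !memv_ker => /eqP x0; apply/eqP.
  by rewrite id_lfunE; apply: (capless_injective cc); rewrite x0 linear0.
have [L LE] := lfun_factor ker; exists (adj E L y).
apply: (form_extr (E := E)) => z; rewrite -obF_adjoint form_adj LE id_lfunE //.
Qed.

Lemma natural_extend (h : 'End(tens V (w ord0))) :
  (forall (d : diag (w ord0) (w ord0)) x, h (obF F d x) = obF F d (h x)) ->
  exists g : forall j, 'End(tens V (w j)), g ord0 = h /\
    forall i j (d : diag (w i) (w j)) x, g j (obF F d x) = obF F d (g i x).
Proof.
move=> hn; have [c cc] := fin_all_exists cups_exist.
have cfc j z : obF F (c j) (obF F (flip (c j)) z) = obF F (comp (flip (c j)) (c j)) z.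
  by rewrite obF_comp0 // loops_capless.
have gex j : exists g : 'End(tens V (w j)), forall x, g (obF F (flip (c j)) x) = obF F (flip (c j)) (h x).
  have ker : (lker (obF F (flip (c j))) <= lker (obF F (flip (c j)) \o h))%VS.
    apply/subvP => x; rewrite !memv_ker => /eqP x0; apply/eqP.
    rewrite comp_lfunE; apply: (capless_injective (cc j)).
    by rewrite linear0 cfc -hn -cfc x0 !linear0.
  by have [g gE] := lfun_factor ker; exists g => x; rewrite gE comp_lfunE.
have [g gE] := fin_all_exists gex; exists g; split.
  apply/lfunP => y; have [x ->] := flip_surjective y (cc ord0).
  by rewrite gE hn.
have gc j y : obF F (c j) (g j y) = h (obF F (c j) y).
  have [x ->] := flip_surjective y (cc j).
  by rewrite gE !cfc hn.
move=> i j d y; have [x ->] := flip_surjective y (cc i).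
apply: (capless_injective (cc j)); rewrite gc gE.
have lf : loops (flip (c i)) (comp d (c j)) = 0%N by apply: loops_nocup; rewrite nocup_flip.
have fE z : obF F (c j) (obF F d (obF F (flip (c i)) z)) =
    obF F (comp (flip (c i)) (comp d (c j))) z.
  by rewrite (obF_comp0 F z lf) obF_comp0 // loops_capless.
by rewrite !fE hn.
Qed.

Lemma ringel_dual_word (a : word) : a = w ord0 -> End_op_iso T (OBmod F (fun _ : 'I_1 => a)).
Proof.
move=> ->; set w0 := fun _ : 'I_1 => w ord0; set N0 := OBmod F w0.
have phil : linear (fun f : 'End(T) =>
    @blocks k delta V F 0 w0 (fun _ => adj E (block ord0 f))).
  move=> c f g; apply: end_ext => i x; rewrite add_lfunE scale_lfunE !blocks_tin.
  by rewrite block_linear adj_linear add_lfunE scale_lfunE linearP.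
have [Phi PhiE] := lfun_of_linear phil.
have nat0 (f : 'End(T)) (d : diag (w ord0) (w ord0)) x : is_hom f ->
    adj E (block ord0 f) (obF F d x) = obF F d (adj E (block ord0 f) x).
  move=> fh; apply: (form_extr (E := E)) => z; rewrite form_adj.
  rewrite -[d in RHS]flipK -obF_adjoint form_adj.
  by rewrite block_natural // obF_adjoint flipK.
have inj0 (f f' : 'End(T)) : is_hom f -> is_hom f' -> block ord0 f = block ord0 f' -> f = f'.
  move=> fh fh' ff; apply: hom_ext => // j; apply/lfunP => x; have [c cc] := cups_exist j.
  by apply: (capless_injective cc); rewrite -!block_natural // ff.
exists Phi; split.
- by move=> f fh; rewrite PhiE; apply: blocks_hom => i j d x; apply: nat0.
- move=> g gh; pose h := adj E (@block k delta V F 0 w0 ord0 g).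
  have hn (d : diag (w ord0) (w ord0)) x : h (obF F d x) = obF F d (h x).
    apply: (form_extr (E := E)) => z; rewrite form_adj.
    rewrite -[d in RHS]flipK -obF_adjoint form_adj.
    by rewrite (@block_natural k delta V F 0 w0 g gh ord0 ord0) obF_adjoint flipK.
  have [b [b0 bn]] := natural_extend hn.
  have PhiP f : Phi f = g -> block ord0 f = h.
    by move=> fE; rewrite /h -fE PhiE (@block_blocks k delta V F 0 w0) adjK.
  exists (blocks F b); split; first split.
  + exact: blocks_hom.
  + rewrite PhiE block_blocks b0 /h adjK; apply: hom_ext => // [|i].
      by apply: blocks_hom => i j d x; exact: (@block_natural k delta V F 0 w0 g gh ord0 ord0 d x).
    by rewrite block_blocks (ord1 i).
  + move=> f [fh /PhiP fE]; apply: inj0 => //; first exact: blocks_hom.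
    by rewrite block_blocks b0 fE.
- rewrite PhiE; apply: end_ext => i x; rewrite blocks_tin id_lfunE.
  have -> : @block k delta V F N w ord0 \1%VF = \1%VF.
    by apply/lfunP => y; rewrite blockE !id_lfunE comp_at_tin.
  by rewrite adj1 id_lfunE.
move=> f g fh gh; rewrite !PhiE; apply: end_ext => i x; rewrite comp_lfunE !blocks_tin.
have -> : block ord0 (f \o g)%VF = (block ord0 f \o block ord0 g)%VF.
  by apply/lfunP => y; rewrite blockE !comp_lfunE (block_hom gh) -blockE.
by rewrite adjM comp_lfunE.
Qed.

Lemma ringel_dual_mixed : End_op_iso T (mixed_tensors F r s).
Proof. by apply: ringel_dual_word; rewrite /mixed_family !subn0. Qed.

End RingelDual.

Lemma fact_neq0 (k : fieldType) (p q r : nat) : has_characteristic k p ->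
  ~~ (2 <= p <= q)%N -> (r <= q)%N -> (r`!%:R : k) != 0.
Proof.
move=> chk pq; elim: r => [|r IHr] rq; first by rewrite oner_neq0.
rewrite factS natrM mulf_neq0 ?IHr ?(ltnW rq) // natf_neq0_pchar.
apply/pnatP => // x xp xr; rewrite inE; apply/negP => xk.
case: p chk pq => [h _|p pk]; first by have := h x; rewrite xk.
move: xk; rewrite (pcharf_eq pk) inE => /eqP xE; rewrite -xE prime_gt1 //=.
by rewrite (leq_trans (dvdn_leq _ xr) rq).
Qed.

Theorem theorem5p2p1 (k : closedFieldType) (p r s m n : nat)
    (V : superspace k) (F : OBfunctor (superdim k m n) V)
    (char_k : has_characteristic k p) (sdim_V : has_sdim V m n)
    (p_good : ~~ (2 <= p <= maxn r s)%N)
    (m_large : (r + s <= m)%N) (n_large : (maxn r s <= n)%N) :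
  [/\ quasi_hereditary (walled_Brauer_c (superdim k m n) r s)
        (@bipart_lt r s) (@is_standard k (superdim k m n) r s),
      is_complete_tilting (@bipart_lt r s) (@is_standard k (superdim k m n) r s)
        (mixed_tensors_c F r s) &
      is_ringel_dual (@bipart_lt r s) (@is_standard k (superdim k m n) r s)
        (mixed_tensors_c F r s) (mixed_tensors F r s)].
Proof.
have [E] := homog_basis_exists sdim_V.
have r_unit : (r`!%:R : k) != 0 := fact_neq0 char_k p_good (leq_maxl r s).
have s_unit : (s`!%:R : k) != 0 := fact_neq0 char_k p_good (leq_maxr r s).
have tilting := mixed_tensors_tilting E F r_unit s_unit m_large.
split=> //.
  exact: (@layering_quasi_hereditary _ _ _ (wb_labelling (superdim k m n) r_unit s_unit)
    _ (bipart_ltP r_unit s_unit)).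
by split=> //; apply: (ringel_dual_mixed E F).
Qed.
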